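(* In the setting and notation of the context, assume: (i) $b_r(0)=b_r(L)=0$; (ii) $a_r(0)=0$ and $c_r(0)=0$; (iii) for every compact $K\subset\overline{\Pi}$, the functions $f$ and $\nabla_u f$ are bounded on $K\times\mathbb{R}$; (iv) for all $i\le k$, $j\le l$, $q\le m$ and all $s$ with $t_s^*<t_l$, one has $\tilde\omega(0;x_i,t_j)\neq t_s^*$ and $\omega(0;x_i,t_j)\neq x_q^*$ (that is, neither the points $(0,t_s^* )$ and $(x_i,t_j)$ nor the points $(x_q^*,0)$ and $(x_i,t_j)$ lie on a common characteristic); (v) $(0,0)\notin I_-$. For $0<\varepsilon\le\varepsilon_0$ let $u^{\varepsilon}$ be the continuous solution on $\overline\Pi$ of problem (U), and let $w^{\varepsilon}$, $v^{\varepsilon}$ be the continuous solutions on $\overline\Pi$ of the coupled problems (W) and (V). Then there exist a function $w$ on $\Pi$ and a distribution $v\in\mathcal{D}'(\Pi)$ such that $$u^{\varepsilon}\to w+v\quad\text{in }\mathcal{D}'(\Pi)\text{ as }\varepsilon\to0,$$ where - for every $T>0$, with $\Pi^T=\{(x,t)\in\Pi : t<T\}$, the restriction of $w$ to $\Pi^T$ is the limit of $w^{\varepsilon}$ in $C(\Pi^T)$ (i.e. uniformly on $\Pi^T$) as $\varepsilon\to0$; - $v=\lim_{\varepsilon\to0}v^{\varepsilon}$ in $\mathcal{D}'(\Pi)$, and the restriction of $v$ to $\Pi\setminus I_+$ is identically equal to $0$.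
   Context: **Domain and data.** Let $L>0$ and $\Pi=\{(x,t)\in\mathbb{R}^2 : 0<x<L,\ t>0\}$. The real functions $p(x,t)$ and $\lambda(x,t)$ on $\overline\Pi$, $f(x,t,u)$ on $\overline\Pi\times\mathbb{R}$, $a_r(x)$ and $b_r(x)$ on $[0,L]$, $c_r(t)$ on $[0,\infty)$ are given; $p,f,a_r,b_r,c_r$ are continuous, $\lambda$ is continuously differentiable in all its arguments, $f$ is continuously differentiable with respect to $u$ (its $u$-derivative is denoted $\nabla_u f$), and $\lambda(x,t)>0$ for all $(x,t)\in\overline\Pi$. Further $$a_s=\sum_{i=1}^m\delta(x-x_i^* ),\quad b_s=\sum_{i=1}^k\delta(x-x_i),\quad c_s=\sum_{j=1}^l\delta(t-t_j)$$ are finite sums of Dirac delta functions with $0<x_1^*<\dots<x_m^*<L$, $0<x_1<\dots<x_k<L$, $0<t_1<\dots<t_l$. **Characteristics.** For $(x,t)\in\overline\Pi$ let $\xi=\omega(\tau;x,t)$ be the solution (as long as it stays in $\overline\Pi$) of $\frac{d\xi}{d\tau}=\lambda(\xi(\tau),\tau)$, $\xi(t)=x$, and let $\tau=\tilde\omega(\xi;x,t)$ be its inverse function (the time at which the characteristic through $(x,t)$ passes the position $\xi$). The characteristic through $(x,t)$ is the curve $\{(\omega(\tau;x,t),\tau)\}$ in $\overline\Pi$. Let $\theta(x,t)$ be the smallest $\tau\ge0$ such that $(\omega(\tau;x,t),\tau)\in\partial\Pi$. **The sets $I_-$, $I_+$ and their neighborhoods.** $I_-$ is the union of the characteristics through the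 points $(x_i,t_j)$, $i\le k$, $j\le l$; $I_-^{\varepsilon}$ is the union over $i\le k$, $j\le l$ of the sets $\{(\omega(\tau;x_i,t),\tau) : \tilde\omega(x_i;x_i+\varepsilon,t_j-\varepsilon)<t<\tilde\omega(x_i;x_i-\varepsilon,t_j+\varepsilon)\}$. Set $I_+=\bigcup_{n\ge0}I_+[n]$ and $I_+^\varepsilon=\bigcup_{n\ge0}I_+^{\varepsilon}[n]$, defined inductively: - $I_+[0]$ is the union of the characteristics through $(x_i^*,0)$, $i\le m$, and through $(0,t_j)$, $j\le l$; $I_+^\varepsilon[0]$ is the union of the sets $\{(\omega(\tau;x,0),\tau): x_i^*-\varepsilon<x<x_i^*+\varepsilon\}$ and $\{(\omega(\tau;0,t),\tau): t_j-\varepsilon<t<t_j+\varepsilon\}$. - For $n\ge1$: whenever $I_+[n-1]$ includes a characteristic passing through a point $(x_i,\tilde t)$ with $i\le k$, $I_+[n]$ includes the characteristic through $(0,\tilde t)$ (and $I_+[n]$ is the union of these); whenever $I_+^\varepsilon[n-1]$ includes a neighborhood $\{(\omega(\tau;x_i,t),\tau): \tilde t-\varepsilon^-<t<\tilde t+\varepsilon^+\}$, $I_+^{\varepsilon}[n]$ includes the neighborhood $\{(\omega(\tau;0,t),\tau): \tilde\omega(x_i-\varepsilon;x_i,\tilde t-\varepsilon^-)<t<\tilde\omega(x_i+\varepsilon;x_i,\tilde t+\varepsilon^+)\}$. Let $t_1^*<t_2^*<\dots$ be the $t$-coordinates of the intersection points with the axis $x=0$ of the characteristics contributing to $I_+$.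 **Choice of $\varepsilon_0$.** $\varepsilon_0>0$ is fixed so small that the expressions above are defined, $x_1^*-\varepsilon_0>0$, $t_1-\varepsilon_0>0$, $I_-^\varepsilon\cap I_+^\varepsilon=\emptyset$ for all $0<\varepsilon\le\varepsilon_0$, and $(0,0)\notin I_-^{\varepsilon_0}\cup I_+^{\varepsilon_0}$. Throughout $0<\varepsilon\le\varepsilon_0$. **Regularization.** Fix $\varphi\in\mathcal{D}(\mathbb{R})$ with $\int\varphi\,dx=1$ and $\operatorname{supp}\varphi\subset[-1,1]$; put $\varphi_\varepsilon(x)=\frac1\varepsilon\varphi(\frac x\varepsilon)$ and $a_s^\varepsilon=a_s*\varphi_\varepsilon$, $b_s^\varepsilon=b_s*\varphi_\varepsilon$, $c_s^\varepsilon=c_s*\varphi_\varepsilon$. **Problems.** (U): $(\partial_t+\lambda\partial_x)u^\varepsilon=p\,u^\varepsilon+f(x,t,u^\varepsilon)$ in $\Pi$; $u^\varepsilon|_{t=0}=a_s^\varepsilon+a_r$; $u^\varepsilon|_{x=0}=(c_s^\varepsilon+c_r)(t)\int_0^L(b_s^\varepsilon+b_r)u^\varepsilon\,dx$. (W): $(\partial_t+\lambda\partial_x)w^\varepsilon=p\,w^\varepsilon+f(x,t,w^\varepsilon)$ in $\Pi$; $w^\varepsilon|_{t=0}=a_r$; $w^\varepsilon|_{x=0}=c_r(t)\int_0^L[(b_s^\varepsilon+b_r)w^\varepsilon+b_rv^\varepsilon]\,dx$. (V): $(\partial_t+\lambda\partial_x)v^\varepsilon=p\,v^\varepsilon$ in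 $\Pi$; $v^\varepsilon|_{t=0}=a_s^\varepsilon$; $v^\varepsilon|_{x=0}=c_s^\varepsilon(t)\int_0^L[(b_s^\varepsilon+b_r)w^\varepsilon+b_rv^\varepsilon]\,dx+c_r(t)\int_0^Lb_s^\varepsilon v^\varepsilon\,dx$. A continuous solution $z\in C(\overline\Pi)$ of a problem $(\partial_t+\lambda\partial_x)z=g(x,t,z)$, $z|_{t=0}=z_0(x)$, $z|_{x=0}=h(t)$ is understood via the equivalent integral equation $z(x,t)=(Rz)(x,t)+\int_{\theta(x,t)}^t g(\xi,\tau,z(\xi,\tau))|_{\xi=\omega(\tau;x,t)}\,d\tau$, where $(Rz)(x,t)=z_0(\omega(0;x,t))$ if $\theta(x,t)=0$ and $(Rz)(x,t)=h(\theta(x,t))$ if $\theta(x,t)>0$. *)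

(* Defs.v *)
From HB Require Import structures.
From mathcomp Require Import all_boot all_order all_algebra.
From mathcomp Require Import all_classical all_reals all_analysis.

Set Implicit Arguments.
Unset Strict Implicit.
Unset Printing Implicit Defensive.

Import Order.TTheory GRing.Theory Num.Theory.
Import numFieldNormedType.Exports.

Local Open Scope classical_set_scope.
Local Open Scope ring_scope.

Section Distributions.
Variables (R : realType) (V : normedModType R).
Implicit Types (Omega : set V) (psi : V -> R) (T : (V -> R) -> R).

Definition iter_derive (s : seq V) psi : V -> R :=
  foldr (fun v (g : V -> R) x => 'D_v g x) psi s.

(* On a finite-dimensional V this is C^oo. *)
Definition smooth psi : Prop :=
  forall s : seq V, continuous (iter_derive s psi) /\
    forall v x, derivable (iter_derive s psi) x v.

Definition supp psi : set V := closure [set x | psi x != 0].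

Definition test_function Omega psi : Prop :=
  [/\ smooth psi, compact (supp psi) & supp psi `<=` Omega].

(* T is a total function on V -> R, but only its values on D(Omega) matter.
   The last clause is the usual seminorm estimate: S lists the derivatives
   whose suprema control T on the test functions supported in K. *)
Definition is_distribution Omega T : Prop :=
  [/\ forall psi1 psi2, test_function Omega psi1 -> test_function Omega psi2 ->
        T (psi1 \+ psi2) = T psi1 + T psi2,
      forall (a : R) psi, test_function Omega psi ->
        T (fun x => a * psi x) = a * T psi &
      forall K, compact K -> K `<=` Omega ->
        exists (C : R) (S : seq (seq V)), forall psi (M : R),
          test_function Omega psi -> supp psi `<=` K -> 0 <= M ->
          (forall s x, s \in S -> `|iter_derive s psi x| <= M) ->
          `|T psi| <= C * M].

Definition distr_cvg Omega (T_ : R -> (V -> R) -> R) T : Prop :=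
  forall psi, test_function Omega psi ->
    T_ eps psi @[eps --> 0^'+] --> T psi.

Definition vanishes_on Omega T : Prop :=
  forall psi, test_function Omega psi -> T psi = 0.

End Distributions.

Section Regularization.
Variable R : realType.

Definition dirac_sum (s : seq R) : (R -> R) -> R :=
  fun psi => \sum_(y <- s) psi y.

Definition conv_distr (T : (R -> R) -> R) (psi : R -> R) : R -> R :=
  fun x => T (fun y => psi (x - y)).

Definition mollifier (phi : R -> R) : Prop :=
  [/\ test_function setT phi, supp phi `<=` `[-1, 1] &
      \int[lebesgue_measure]_(x in setT) phi x = 1].

Definition scaled (phi : R -> R) (eps : R) : R -> R :=
  fun x => eps^-1 * phi (x / eps).

Definition reg (s : seq R) (phi : R -> R) (eps : R) : R -> R :=
  conv_distr (dirac_sum s) (scaled phi eps).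

End Regularization.

Section Domain.
Variables (R : realType) (L : R).

(* Points of the plane are pairs (x, t). *)
Definition Pidom : set (R * R) := [set q | 0 < q.1 < L /\ 0 < q.2].
Definition Pibar : set (R * R) := [set q | 0 <= q.1 <= L /\ 0 <= q.2].
Definition PiT (T : R) : set (R * R) := [set q | Pidom q /\ q.2 < T].

Definition regular_distr (z : R * R -> R) : (R * R -> R) -> R :=
  fun psi => \int[(lebesgue_measure \x lebesgue_measure)%E]_(q in Pidom)
               (z q * psi q).

(* l is the derivative of g at x along A (one-sided at an end point of an
   interval A). *)
Definition derive_within (A : set R) (g : R -> R) (x l : R) : Prop :=
  (g y - g x) / (y - x) @[y --> within A x^'] --> l.

Definition C1_Pibar (lam : R * R -> R) : Prop :=
  {within Pibar, continuous lam} /\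
  exists lamx lamt : R * R -> R,
    [/\ {within Pibar, continuous lamx}, {within Pibar, continuous lamt} &
        forall x t, Pibar (x, t) ->
          derive_within `[0, L] (fun y => lam (y, t)) x (lamx (x, t)) /\
          derive_within `[0, +oo[ (fun s => lam (x, s)) t (lamt (x, t))].

Definition C1_in_u (f : R * R * R -> R) : Prop :=
  forall q, Pibar q ->
    (forall y, derivable (fun y => f (q, y)) y 1) /\
    continuous (derive1 (fun y => f (q, y))).

Definition bounded_on_compacts (f : R * R * R -> R) : Prop :=
  forall K : set (R * R), compact K -> K `<=` Pibar ->
    exists M : R, forall q y, K q ->
      `|f (q, y)| <= M /\ `|derive1 (fun y => f (q, y)) y| <= M.

End Domain.

Section Characteristics.
Variables (R : realType) (L : R) (lam : R * R -> R).

(* The solution of c' = lam (c, tau) with c q.2 = q.1 exists and stays in the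
   closed domain between the times q.2 and q'.2, and c q'.2 = q'.1. *)
Definition on_char (q q' : R * R) : Prop :=
  exists c : R -> R,
    let J := `[Num.min q.2 q'.2, Num.max q.2 q'.2]%classic in
    [/\ c q.2 = q.1, c q'.2 = q'.1 &
        forall s, J s ->
          Pibar L (c s, s) /\ derive_within J c s (lam (c s, s))].

Definition char_curve (q : R * R) : set (R * R) := [set q' | on_char q q'].

(* omega and omegat are partial: their values are meaningful only under the
   corresponding definedness predicate. *)
Definition omega_def (tau : R) (q : R * R) : Prop :=
  exists xi, on_char q (xi, tau).
Definition omega (tau : R) (q : R * R) : R :=
  get [set xi | on_char q (xi, tau)].

Definition omegat_def (xi : R) (q : R * R) : Prop :=
  exists tau, on_char q (xi, tau).
Definition omegat (xi : R) (q : R * R) : R :=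
  get [set tau | on_char q (xi, tau)].

(* For q in the closed domain the infimum is attained. *)
Definition theta (q : R * R) : R :=
  inf [set tau | [/\ 0 <= tau, omega_def tau q &
                     (Pibar L `\` Pidom L) (omega tau q, tau)]].

Definition bc_term (z0 h : R -> R) (q : R * R) : R :=
  if theta q == 0 then z0 (omega 0 q) else h (theta q).

(* Continuous solution of (d_t + lam d_x) z = g(x, t, z), z(x, 0) = z0(x),
   z(0, t) = h(t). *)
Definition is_solution (g : R * R * R -> R) (z0 h : R -> R)
    (z : R * R -> R) : Prop :=
  {within Pibar L, continuous z} /\
  forall q, Pibar L q ->
    z q = bc_term z0 h q +
      \int[lebesgue_measure]_(tau in `[theta q, q.2])
        g (omega tau q, tau, z (omega tau q, tau)).

(* Union of the characteristics that cross the line x = xi at a time in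
   ]alpha, beta[. *)
Definition tube (xi alpha beta : R) : set (R * R) :=
  [set q | exists2 t, alpha < t < beta & char_curve (xi, t) q].

Section Singularities.
(* Supports of a_s, b_s and c_s. *)
Variables (xa xb tc : seq R).

Definition Iminus : set (R * R) :=
  [set q | exists xi tj, [/\ xi \in xb, tj \in tc &
                             char_curve (xi, tj) q]].

Definition Iminus_nbhd (eps : R) : set (R * R) :=
  [set q | exists xi tj, [/\ xi \in xb, tj \in tc &
     tube xi (omegat xi (xi + eps, tj - eps))
             (omegat xi (xi - eps, tj + eps)) q]].

Fixpoint Iplus_gen (n : nat) : set (R * R) :=
  if n is n'.+1 then
    [set q | exists xi t, [/\ xi \in xb, Iplus_gen n' (xi, t) &
                              char_curve (0, t) q]]
  else
    [set q | (exists2 x, x \in xa & char_curve (x, 0) q) \/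
             (exists2 t, t \in tc & char_curve (0, t) q)].

Definition Iplus : set (R * R) := \bigcup_n Iplus_gen n.

(* ]alpha, beta[ = ]t~ - eps^-, t~ + eps^+[ ranges over all time intervals
   whose tube at xi is contained in the previous generation. *)
Fixpoint Iplus_nbhd_gen (eps : R) (n : nat) : set (R * R) :=
  if n is n'.+1 then
    [set q | exists xi alpha beta,
       [/\ xi \in xb, 0 <= alpha < beta,
           tube xi alpha beta `<=` Iplus_nbhd_gen eps n' &
           tube 0 (omegat (xi - eps) (xi, alpha))
                  (omegat (xi + eps) (xi, beta)) q]]
  else
    [set q | (exists x x0, [/\ x0 \in xa, x0 - eps < x < x0 + eps &
                               char_curve (x, 0) q]) \/
             (exists2 tj, tj \in tc & tube 0 (tj - eps) (tj + eps) q)].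

Definition Iplus_nbhd (eps : R) : set (R * R) :=
  \bigcup_n Iplus_nbhd_gen eps n.

(* The set of the numbers t_s^*. *)
Definition tstar : set R := [set t | Iplus (0, t)].

(* All points and all values of omega and omegat occurring in Iminus_nbhd and
   Iplus_nbhd exist. *)
Definition nbhds_defined (eps : R) : Prop :=
  [/\ forall xi tj, xi \in xb -> tj \in tc ->
        omegat_def xi (xi + eps, tj - eps) /\
        omegat_def xi (xi - eps, tj + eps),
      forall x x0, x0 \in xa -> x0 - eps < x < x0 + eps -> Pibar L (x, 0),
      forall t tj, tj \in tc -> tj - eps < t < tj + eps -> Pibar L (0, t) &
      forall n xi alpha beta, xi \in xb -> 0 <= alpha < beta ->
        tube xi alpha beta `<=` Iplus_nbhd_gen eps n ->
        omegat_def (xi - eps) (xi, alpha) /\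
        omegat_def (xi + eps) (xi, beta)].

Definition admissible_eps0 (eps0 : R) : Prop :=
  [/\ 0 < eps0,
      forall eps, 0 < eps <= eps0 ->
        nbhds_defined eps /\ Iminus_nbhd eps `&` Iplus_nbhd eps = set0,
      forall x0, x0 \in xa -> 0 < x0 - eps0,
      forall tj, tj \in tc -> 0 < tj - eps0 &
      ~ (Iminus_nbhd eps0 `|` Iplus_nbhd eps0) (0, 0)].

End Singularities.

End Characteristics.

Section Problems.
Variables (R : realType) (L : R) (lam p : R * R -> R) (f : R * R * R -> R).
Variables (ar br cr : R -> R).
(* Regularizations of a_s, b_s and c_s. *)
Variables (ase bse cse : R -> R).

Local Notation "\int0L_ x F" := (\int[lebesgue_measure]_(x in `[0, L]) F)
  (at level 36, x name, F at level 36).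

Definition solves_U (u : R * R -> R) : Prop :=
  is_solution L lam (fun y => p y.1 * y.2 + f y)
    (fun x => ase x + ar x)
    (fun t => (cse t + cr t) *
              \int0L_x ((bse x + br x) * u (x, t)))
    u.

Definition solves_W (w v : R * R -> R) : Prop :=
  is_solution L lam (fun y => p y.1 * y.2 + f y)
    ar
    (fun t => cr t *
              \int0L_x ((bse x + br x) * w (x, t) + br x * v (x, t)))
    w.

Definition solves_V (w v : R * R -> R) : Prop :=
  is_solution L lam (fun y => p y.1 * y.2)
    ase
    (fun t => cse t *
              \int0L_x ((bse x + br x) * w (x, t) + br x * v (x, t)) +
              cr t * \int0L_x (bse x * v (x, t)))
    v.

End Problems.

(* Main.v *)
(** Parametrize the points where characteristics enter the domain by one real
    variable [s]: the point [(0, s)] for [s >= 0] and a point of the initial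
    line for [s < 0]; [X t s] is the position at time [t] of the characteristic
    entering at [s], and [foot] is its inverse in [s]. Since [v^eps] solves a
    linear equation, it is the transport of its boundary values [bdv v s]:
    [Int F(x) v(x,t) dx = Int F(X t s) Y(t,s) bdv v s ds] for a continuous
    density [Y]. So everything is governed by the functions [bdv v^eps] and by
    the boundary integrals [B = Int (b_s + b_r) w + b_r v].

    The points [x_i] are away from the boundary, so a singularity produced on
    [x = 0] needs a fixed positive time before it can act on [x = 0] again.
    With weights [expR (- G t)], [G] large, this delay makes the boundary
    equations contractive. One gets uniform bounds on [w] and on the mass of
    [bdv v], and: if the functions [B] are Cauchy and equicontinuous up to [m]
    as [eps -> 0], then they are so up to [eta + m / 2] for every [eta > 0].
    Hence [w^eps] converges uniformly, and [bdv v^eps] converges when it is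
    tested against continuous kernels, because such a kernel can be transported
    backwards through finitely many reflections.

    [bdv v^eps] concentrates at finitely many parameters, whose characteristics
    belong to [I_+]; so [v = 0] outside [I_+], and the assumption on [(x_i, t_j)]
    gives [c_s Int b_s v = 0] for small [eps]. Finally, for [u - w - v] the
    nonlinearity contributes [f(w + v) - f(w) = O(min(1, |v|))], whose integral
    tends to [0] because [v] concentrates; this and a Gronwall argument show that
    [u - w - v] tends to [0]. *)

Require Import Defs.
From HB Require Import structures.
From mathcomp Require Import all_boot all_order all_algebra.
From mathcomp Require Import all_classical all_reals all_analysis.
From mathcomp Require Import ring lra.
Set Implicit Arguments.
Unset Strict Implicit.
Unset Printing Implicit Defensive.
Import Order.TTheory GRing.Theory Num.Theory.
Import numFieldNormedType.Exports.
Local Open Scope classical_set_scope.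
Local Open Scope ring_scope.

(** Only the mass of [bdv v] stays bounded as [eps -> 0], so the one way to pass to the limit in [v]
    is to pair it with continuous kernels. Convergence of [B] at each fixed time would not give the
    limit of [c_s B]: the mollified delta samples [B] at scale [eps] while [B] itself depends on
    [eps]. This is why [closeB] compares different times and different [eps] at once. No
    subsequences are extracted: a crude bound on the defect is halved repeatedly.

    For the remainder, [c_s] times the integral of [b_s (u - w - v)] is a product of two kernels of
    size [1 / eps], and estimates of mass alone do not control it. Here the assumption on the points
    [(x_i, t_j)] acts a second time: near [t_j] the kernel [b_s] sees only parameters near the foot
    of [(x_i, t_j)], where [v] vanishes and the boundary values of the remainder are bounded
    pointwise by a multiple of the quantity [ysum]. Its own mass enters there with a small factor,
    so the estimate closes.

    Everything takes place on a box [[0, L] x [0, T]], with the data extended by clamping and [T]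
    beyond all [t_j] and beyond the times in the support of the test function. *)

Ltac clear_props := repeat match goal with
  | H : is_true _ |- _ => clear H
  | H : _ = _ |- _ => clear H
  | H : forall _, _ |- _ => match type of H with ?P => match type of P with Prop => clear H end end
  | H : _ /\ _ |- _ => clear H
  end.
Ltac flra := clear_props; lra.

(** * Derivatives and integrals of continuous functions *)

Section Calculus.
Variable R : realType.
Implicit Types (F G : R -> R) (a b c x y : R).
Local Notation mu := (@lebesgue_measure R).

Lemma cts_integrable F a b : continuous F -> mu.-integrable `[a, b] (EFin \o F).
Proof.
move=> cF; apply: continuous_compact_integrable; first exact: segment_compact.
exact: continuous_subspaceT.
Qed.

Lemma cts_within F (A : set R) : continuous F -> {within A, continuous F}.
Proof. exact: continuous_subspaceT. Qed.

Definition has_deriv F x l : Prop := is_derive x 1 F l.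

Lemma derive_cts F (f : R -> R) : (forall x, has_deriv F x (f x)) -> continuous F.
Proof. by move=> d x; have [dx _] := d x; apply/differentiable_continuous/derivable1_diffP. Qed.

Lemma cts_dist F x (e : R) : continuous F -> 0 < e ->
  exists2 d : R, 0 < d & forall y : R, `|y - x| < d -> `|F y - F x| < e.
Proof.
move=> cF e0; have /cvgrPdist_lt/(_ _ e0) := cF x.
move=> /nbhs_ballP[d /= d0 H]; exists d => // y yx.
by rewrite distrC; apply: H; rewrite /ball /= distrC.
Qed.

Lemma cts_distP F : (forall x (e : R), 0 < e ->
  exists2 d : R, 0 < d & forall y : R, `|y - x| < d -> `|F y - F x| <= e) -> continuous F.
Proof.
move=> H x; apply/cvgrPdist_le => e e0; have [d d0 Hd] := H x e e0.
apply/nbhs_ballP; exists d => //= y; rewrite /ball /= => yx.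
by rewrite distrC; apply: Hd; rewrite distrC.
Qed.

Lemma is_derive_dist F x l : (forall e : R, 0 < e -> exists2 d : R, 0 < d &
  forall y : R, y != x -> `|y - x| < d -> `|F y - F x - l * (y - x)| <= e * `|y - x|) ->
  has_deriv F x l.
Proof.
move=> H.
have C : h^-1 *: ((F \o shift x) h%:A - F x) @[h --> 0^'] --> l.
  apply/cvgrPdist_le => e e0; have [d d0 Hd] := H e e0.
  rewrite near_withinE; apply/nbhs_ballP; exists d => //= h; rewrite /ball /= sub0r normrN => hd h0.
  have := Hd (h + x); rewrite addrK /= [_ *: 1]mulr1 => /(_ _ hd).
  have -> : h + x != x by rewrite -subr_eq0 addrK.
  move=> /(_ isT) K.
  have hp : 0 < `|h| by rewrite normr_gt0.
  rewrite -(ler_pM2r hp); apply: le_trans K.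
  have -> : h^-1 *: (F (h + x) - F x) = h^-1 * (F (h + x) - F x) by [].
  rewrite -normrM -[X in X <= _]normrN le_eqVlt; apply/orP; left; apply/eqP; congr (`| _ |).
  by field.
apply: DeriveDef; first by apply/cvg_ex; exists l.
by apply: cvg_lim => //; exact: C.
Qed.

Lemma derive_mvt F (f : R -> R) a b : a <= b -> continuous F ->
  (forall x, a < x < b -> has_deriv F x (f x)) ->
  exists2 c : R, a <= c <= b & F b - F a = f c * (b - a).
Proof.
move=> ab cF dF; have [x|c cab E] := @MVT_segment R F f a b ab _ (cts_within cF).
- by rewrite in_itv; exact: dF.
- by exists c => //; move: cab; rewrite in_itv.
Qed.

Lemma derive_mvt_oo F (f : R -> R) a b : a < b -> continuous F ->
  (forall x, a < x < b -> has_deriv F x (f x)) ->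
  exists2 c : R, a < c < b & F b - F a = f c * (b - a).
Proof.
move=> ab cF dF; have [x|c cab E] := @MVT R F f a b ab _ (cts_within cF).
- by rewrite in_itv; exact: dF.
- by exists c => //; move: cab; rewrite in_itv.
Qed.

Lemma derive_le F (f : R -> R) a b : a <= b -> continuous F ->
  (forall x, a < x < b -> has_deriv F x (f x)) ->
  (forall x, a < x < b -> f x <= 0) -> F b <= F a.
Proof.
rewrite le_eqVlt => /predU1P[-> //|ab] cF dF f0.
have [c cab E] := derive_mvt_oo ab cF dF.
by rewrite -subr_le0 E mulr_le0_ge0 ?f0 // subr_ge0 ltW.
Qed.

Lemma derive_eq0 F a b : a <= b -> continuous F ->
  (forall x, a < x < b -> has_deriv F x 0) -> F b = F a.
Proof.
rewrite le_eqVlt => /predU1P[-> //|ab] cF dF.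
have [c cab E] := derive_mvt_oo ab cF dF.
by apply/eqP; rewrite -subr_eq0 E mul0r.
Qed.

(** The Lebesgue integral from [a] gives a primitive only to the right of [a]. The normalized
    integral [g a x] does not depend on [a] as long as [a] lies below [x] and [0], so the base point
    may move with [x]; near a given point all choices agree with one fixed base point. *)
Lemma exists_primitive F : continuous F ->
  exists G, forall x, has_deriv G x (F x).
Proof.
move=> cF.
pose g (a x : R) : R := \int[mu]_(t in `[a, x]) F t - \int[mu]_(t in `[a, 0]) F t.
have gE a b x : a <= b -> b <= x -> b <= 0 -> g a x = g b x.
  move=> ab bx b0.
  have H z : b <= z -> \int[mu]_(t in `[a, z]) F t =
      \int[mu]_(t in `[a, b]) F t + \int[mu]_(t in `[b, z]) F t.
    move=> bz; have := @Rintegral_itvB R F (BLeft a) (BRight z) b.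
    rewrite Rintegral_itv_obnd_cbnd; last first.
      apply: integrableS (@cts_integrable F b z cF) => //.
      by apply: subset_itvr; rewrite bnd_simp.
    by rewrite !bnd_simp => <- //; [ring|exact: cts_integrable].
  by rewrite /g (H x) // (H 0) // opprD addrACA subrr add0r.
exists (fun x => g (- `|x| - 1) x) => x.
pose a : R := - `|x| - 2.
have nx : x <= `|x| by exact: ler_norm.
have nx' : - x <= `|x| by rewrite -normrN; exact: ler_norm.
have n0 : 0 <= `|x| by [].
have x1 : x < x + 1 by rewrite ltrDl.
have ax : a < x by rewrite /a; lra.
have [D E] := continuous_FTC1_closed x1 (@cts_integrable F a (x + 1) cF) ax (cF x).
have dga : is_derive x 1 (g a) (F x).
  rewrite -[F x]subr0; apply: is_deriveB.
  by rewrite -E derive1E; exact: derivableP.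
apply: near_eq_is_derive dga => //.
apply/nbhs_ballP; exists 1 => //= y; rewrite /ball /= => xy.
apply: gE.
- rewrite /a; have := ler_normB x (x - y); rewrite subKr; lra.
- have : - y <= `|y| by rewrite -normrN; exact: ler_norm.
  lra.
- have : 0 <= `|y| by []. lra.
Qed.

Definition prim F : R -> R := get [set G | forall x, has_deriv G x (F x)].

Lemma prim_derive F x : continuous F -> has_deriv (prim F) x (F x).
Proof.
by move=> cF; have [G HG] := exists_primitive cF; have := getPex (ex_intro _ G HG : [set G | forall x, has_deriv G x (F x)] !=set0); exact.
Qed.

Lemma prim_cts F : continuous F -> continuous (prim F).
Proof. by move=> cF; apply: (@derive_cts _ F) => x; exact: prim_derive. Qed.

(** Oriented integral of a continuous function. Being a difference of values of one primitive, it is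
    additive for bounds in any order; [Int_Rintegral] identifies it with the Lebesgue integral when
    [a <= b]. *)
Definition Int F a b : R := prim F b - prim F a.

Lemma Int_chasles F a b c : Int F a b + Int F b c = Int F a c.
Proof. by rewrite /Int; ring. Qed.

Lemma Int_refl F a : Int F a a = 0. Proof. exact: subrr. Qed.

Lemma Int_opp F a b : Int F b a = - Int F a b. Proof. by rewrite /Int opprB. Qed.

Lemma Int_derive F a x : continuous F -> has_deriv (Int F a) x (F x).
Proof.
move=> cF; rewrite -[F x]subr0; apply: is_deriveB; exact: prim_derive.
Qed.

Lemma Int_cts F a : continuous F -> continuous (Int F a).
Proof. by move=> cF; apply: (@derive_cts _ F) => x; exact: Int_derive. Qed.

(** Derivatives are required in the open interval only, because many integrands and substitutions
    are given by a formula that is valid just between two break points. *)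
Lemma Int_ftc_oo F G a b : a <= b -> continuous F -> continuous G ->
  (forall x, a < x < b -> has_deriv G x (F x)) -> Int F a b = G b - G a.
Proof.
move=> ab cF cG dG.
have /(_ ab) := @derive_eq0 (fun x => prim F x - G x) a b.
rewrite /Int => H; suff : prim F b - G b = prim F a - G a by lra.
apply: H.
  move=> x; apply: cvgB; [exact: prim_cts|exact: cG].
move=> x xab; rewrite -(subrr (F x)); apply: is_deriveB; [exact: prim_derive|exact: dG].
Qed.

Lemma Int_ftc F G a b : continuous F ->
  (forall x, has_deriv G x (F x)) -> Int F a b = G b - G a.
Proof.
move=> cF dG; have cG := derive_cts dG.
case: (leP a b) => [ab|/ltW ab]; first exact: Int_ftc_oo.
rewrite Int_opp (@Int_ftc_oo F G) //; first by ring.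
Qed.

Lemma Int_mvt F a b : a <= b -> continuous F ->
  exists2 c : R, a <= c <= b & Int F a b = F c * (b - a).
Proof.
move=> ab cF; apply: derive_mvt => //; first exact: prim_cts.
by move=> x _; exact: prim_derive.
Qed.

Lemma Int_ext F G a b : a <= b -> continuous F -> continuous G ->
  (forall x, a < x < b -> F x = G x) -> Int F a b = Int G a b.
Proof.
move=> ab cF cG FG; apply: Int_ftc_oo => //; first exact: prim_cts.
by move=> x xab; rewrite FG //; exact: prim_derive.
Qed.

Lemma IntD F G a b : continuous F -> continuous G ->
  Int (fun x => F x + G x) a b = Int F a b + Int G a b.
Proof.
move=> cF cG; rewrite (@Int_ftc _ (fun x => prim F x + prim G x)).
- by rewrite /Int; ring.
- by move=> x; apply: cvgD; [exact: cF|exact: cG].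
- by move=> x; apply: is_deriveD; exact: prim_derive.
Qed.

Lemma IntN F a b : continuous F ->
  Int (fun x => - F x) a b = - Int F a b.
Proof.
move=> cF; rewrite (@Int_ftc _ (fun x => - prim F x)).
- by rewrite /Int; ring.
- by move=> x; apply: cvgN; exact: cF.
- by move=> x; apply: is_deriveN; exact: prim_derive.
Qed.

Lemma IntB F G a b : continuous F -> continuous G ->
  Int (fun x => F x - G x) a b = Int F a b - Int G a b.
Proof.
by move=> cF cG; rewrite IntD ?IntN //; move=> x; apply: cvgN; exact: cG.
Qed.

Lemma IntZ F c a b : continuous F ->
  Int (fun x => c * F x) a b = c * Int F a b.
Proof.
move=> cF; rewrite (@Int_ftc _ (fun x => c * prim F x)).
- by rewrite /Int; ring.
- by move=> x; apply: cvgM; [exact: cvg_cst|exact: cF].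
- move=> x; apply: is_deriveZ; exact: prim_derive.
Qed.

Lemma Int_cst c a b : Int (fun=> c) a b = c * (b - a).
Proof.
rewrite (@Int_ftc _ (fun x => c * x)); first by ring.
- exact: cst_continuous.
- by move=> x; have := @is_deriveZ R R R id c x 1 1 (is_derive_id _ _); rewrite [c *: 1]mulr1.
Qed.

Lemma Int_ge0 F a b : a <= b -> continuous F ->
  (forall x, a <= x <= b -> 0 <= F x) -> 0 <= Int F a b.
Proof.
move=> ab cF F0; have [c cab ->] := Int_mvt ab cF.
by rewrite mulr_ge0 ?F0 // subr_ge0.
Qed.

Lemma Int_le F G a b : a <= b -> continuous F -> continuous G ->
  (forall x, a <= x <= b -> F x <= G x) -> Int F a b <= Int G a b.
Proof.
move=> ab cF cG FG; rewrite -subr_ge0 -IntB //; apply: Int_ge0 => //.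
- by move=> x; apply: cvgB; [exact: cG|exact: cF].
- by move=> x xab; rewrite subr_ge0 FG.
Qed.

Lemma Int_norm F G a b : a <= b -> continuous F -> continuous G ->
  (forall x, a <= x <= b -> `|F x| <= G x) -> `|Int F a b| <= Int G a b.
Proof.
move=> ab cF cG FG; rewrite ler_norml; apply/andP; split.
  rewrite lerNl -IntN //; apply: Int_le => //.
  - by move=> x; apply: cvgN; exact: cF.
  - by move=> x /FG; rewrite ler_norml lerNl => /andP[].
by apply: Int_le => // x /FG; rewrite ler_norml => /andP[].
Qed.

Lemma Int_bound F c a b : a <= b -> continuous F ->
  (forall x, a <= x <= b -> `|F x| <= c) -> `|Int F a b| <= c * (b - a).
Proof.
move=> ab cF Fc; rewrite -Int_cst; apply: Int_norm => //; exact: cst_continuous.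
Qed.

Lemma Int_bound_abs F c a b : continuous F ->
  (forall x, `|F x| <= c) -> `|Int F a b| <= c * `|b - a|.
Proof.
move=> cF Fc; case: (leP a b) => [ab|/ltW ab].
  by rewrite (ger0_norm (x := b - a)) ?subr_ge0 //; apply: Int_bound.
by rewrite Int_opp normrN (distrC b) (ger0_norm (x := a - b)) ?subr_ge0 //; apply: Int_bound.
Qed.

Lemma Int_Rintegral F (H : R -> R) a b : a <= b -> continuous F ->
  (forall x, a <= x <= b -> H x = F x) ->
  \int[mu]_(x in `[a, b]) H x = Int F a b.
Proof.
move=> ab cF HF.
transitivity (\int[mu]_(x in `[a, b]) F x).
  by apply: eq_Rintegral => x; rewrite inE /= in_itv; exact: HF.
move: ab; rewrite le_eqVlt => /predU1P[->|ab].
  by rewrite Int_refl set_itv1 Rintegral_set1.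
rewrite /Rintegral (@continuous_FTC2 R F (prim F)) //.
- exact: cts_within.
- split.
  + by move=> x _; have [] := prim_derive x cF.
  + apply: cvg_at_right_filter; exact: prim_cts.
  + apply: cvg_at_left_filter; exact: prim_cts.
- by move=> x _; rewrite derive1E; apply: derive_val; exact: prim_derive.
Qed.

End Calculus.

(** * Uniform continuity and boundedness on compact sets *)

Section Compactness.
Variable R : realType.

Lemma near0_ex (P : R -> Prop) : (\forall d \near 0^'+, P d) ->
  exists2 d0 : R, 0 < d0 & forall d, 0 < d < d0 -> P d.
Proof.
rewrite near_withinE => /nbhs_ballP[d /= d0 H]; exists d => // x /andP[x0 xd].
by apply: H => //; rewrite /ball /= sub0r normrN gtr0_norm.
Qed.

Lemma near0_of (P : R -> Prop) (d0 : R) : 0 < d0 -> (forall d, 0 < d < d0 -> P d) ->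
  \forall d \near 0^'+, P d.
Proof.
move=> d0p H; rewrite near_withinE; apply/nbhs_ballP; exists d0 => //= x.
rewrite /ball /= sub0r normrN => xd x0; apply: H; rewrite x0 /=.
by rewrite gtr0_norm in xd.
Qed.

Lemma heine (V : normedModType R) (K : set V) (F : V -> R) (e : R) :
  compact K -> {within K, continuous F} -> 0 < e ->
  exists2 d : R, 0 < d & forall q q', K q -> K q' -> `|q - q'| < d -> `|F q - F q'| < e.
Proof.
move=> cK cF e0.
have /compact_near_coveringP nK := cK.
pose P (d : R) (q : V) := K q -> forall q', K q' -> `|q - q'| < d -> `|F q - F q'| < e.
have : \forall d \near 0^'+, K `<=` P d.
  apply: nK => q Kq.
  have /subspace_continuousP/(_ _ Kq)/cvgrPdist_lt/(_ (e / 2)) := cF.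
  rewrite divr_gt0 // => /(_ isT); rewrite near_withinE => /nbhs_ballP[r /= r0 Hr].
  exists (ball q (r / 2), [set d | 0 < d < r / 2]); first split => /=.
  - by apply: nbhsx_ballx; rewrite divr_gt0.
  - by apply: (near0_of (d0 := r / 2)); rewrite ?divr_gt0.
  - move=> [x d] [/=]; rewrite -ball_normE /ball_ /= => xq /andP[_ dr] Kx q' Kq' xq'.
    have H1 := Hr x; rewrite -ball_normE /ball_ /= in H1.
    have H2 := Hr q'; rewrite -ball_normE /ball_ /= in H2.
    have {}H1 : `|F q - F x| < e / 2 by apply: H1 => //; lra.
    have {}H2 : `|F q - F q'| < e / 2.
      by apply: H2 => //; have := ler_distD x q q'; lra.
    by have := ler_distD (F q) (F x) (F q'); rewrite (distrC (F x) (F q)) => ?; lra.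
move=> /near0_ex[d0 d0p H]; exists (d0 / 2); first by rewrite divr_gt0.
move=> q q' Kq Kq' qq'; apply: (H (d0 / 2) _ q Kq Kq q' Kq' qq').
by apply/andP; split; lra.
Qed.

Lemma within_bounded (V : normedModType R) (K : set V) (F : V -> R) :
  compact K -> {within K, continuous F} ->
  exists2 M : R, 0 <= M & forall q, K q -> `|F q| <= M.
Proof.
move=> cK cF; have cFK : compact [set F q | q in K] by exact: continuous_compact.
have [M [Mr HM]] := compact_bounded cFK.
exists (`|M| + 1); first by rewrite addr_ge0.
move=> q Kq; apply: (HM (`|M| + 1)); last by exists q.
by rewrite (le_lt_trans (ler_norm M)) // ltrDl.
Qed.

Lemma within_comp (U V : topologicalType) (A : set V) (F : V -> R) (g : U -> V) :
  {within A, continuous F} -> continuous g -> (forall u, A (g u)) ->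
  continuous (F \o g).
Proof.
move=> cF cg gA u; have /subspace_continuousP/(_ _ (gA u)) H := cF.
apply: cvg_comp H => B; rewrite /within /= => nB.
have := cg u _ nB; rewrite /nbhs /=; apply: filterS => x; apply; exact: gA.
Qed.

End Compactness.

(** * Closure properties of continuity *)

Section Continuity.
Variables (R : realType) (U : topologicalType).
Implicit Types f g : U -> R.

Lemma ctsD f g : continuous f -> continuous g -> continuous (fun x => f x + g x).
Proof. by move=> cf cg x; apply: cvgD; [exact: cf|exact: cg]. Qed.
Lemma ctsN f : continuous f -> continuous (fun x => - f x).
Proof. by move=> cf x; apply: cvgN; exact: cf. Qed.
Lemma ctsB f g : continuous f -> continuous g -> continuous (fun x => f x - g x).
Proof. by move=> cf cg; apply: ctsD => //; exact: ctsN. Qed.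
Lemma ctsM f g : continuous f -> continuous g -> continuous (fun x => f x * g x).
Proof. by move=> cf cg x; apply: cvgM; [exact: cf|exact: cg]. Qed.
Lemma cts_norm f : continuous f -> continuous (fun x => `|f x|).
Proof. by move=> cf x; apply: cvg_norm; exact: cf. Qed.
Lemma cts_pair f g : continuous f -> continuous g -> continuous (fun x => (f x, g x)).
Proof. by move=> cf cg x; exact: (cvg_pair (cf x) (cg x)). Qed.
Lemma cts_pair3 f g (h : U -> R) : continuous f -> continuous g -> continuous h ->
  continuous (fun x => (f x, g x, h x)).
Proof.
by move=> cf cg ch x; exact: (cvg_pair (cvg_pair (cf x) (cg x)) (ch x)).
Qed.
Lemma cts_app (W : topologicalType) (h : U -> W) (F : W -> R) :
  continuous F -> continuous h -> continuous (fun x => F (h x)).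
Proof. by move=> cF ch x; apply: (continuous_comp (ch x)); exact: cF. Qed.
Lemma cts_max f g : continuous f -> continuous g -> continuous (fun x => Num.max (f x) (g x)).
Proof.
move=> cf cg; apply: (@cts_app _ (fun x => (f x, g x)) (fun q : R * R => Num.max q.1 q.2)).
  exact: max_continuous.
exact: cts_pair.
Qed.
Lemma cts_min f g : continuous f -> continuous g -> continuous (fun x => Num.min (f x) (g x)).
Proof.
move=> cf cg; apply: (@cts_app _ (fun x => (f x, g x)) (fun q : R * R => Num.min q.1 q.2)).
  exact: min_continuous.
exact: cts_pair.
Qed.
Lemma cts_exp f : continuous f -> continuous (fun x => expR (f x)).
Proof. by move=> cf; apply: (@cts_app _ f expR) => //; exact: continuous_expR. Qed.
Lemma cts_inv f : continuous f -> (forall x, f x != 0) -> continuous (fun x => (f x)^-1).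
Proof. by move=> cf f0 x; apply: cvgV => //; exact: cf. Qed.
Lemma cts_sum (I : Type) (r : seq I) (F : I -> U -> R) :
  (forall i, continuous (F i)) -> continuous (fun x => \sum_(i <- r) F i x).
Proof.
move=> cF; elim: r => [|i r IH].
  under eq_fun do rewrite big_nil; exact: cst_continuous.
by under eq_fun do rewrite big_cons; apply: ctsD.
Qed.

Definition cts2 (F : R -> R -> R) := continuous (fun q : R * R => F q.1 q.2).

Lemma cts2_app (F : R -> R -> R) f g : cts2 F -> continuous f -> continuous g ->
  continuous (fun x => F (f x) (g x)).
Proof.
by move=> cF cf cg; apply: (@cts_app _ (fun x => (f x, g x)) (fun q => F q.1 q.2)) => //; exact: cts_pair.
Qed.

End Continuity.

Lemma cts_fst (R : realType) : continuous (fun q : R * R => q.1).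
Proof. by move=> q; exact: cvg_fst. Qed.
Lemma cts_snd (R : realType) : continuous (fun q : R * R => q.2).
Proof. by move=> q; exact: cvg_snd. Qed.
Lemma cts_id (U : topologicalType) : continuous (fun x : U => x).
Proof. by move=> x; exact: cvg_id. Qed.
Lemma cts_cst (U V : topologicalType) (c : V) : continuous (fun _ : U => c).
Proof. exact: cst_continuous. Qed.

Ltac cts := repeat first
  [ assumption | exact: cts_cst | exact: cts_id | exact: cts_fst | exact: cts_snd
  | apply: ctsB | apply: ctsD | apply: ctsN | apply: ctsM | apply: cts_max | apply: cts_min
  | apply: cts_exp | apply: cts_norm ].

Lemma exp_affine_cts (R : realType) (k s : R) : continuous (fun x : R => expR (k * (x - s))).
Proof.
apply: cts_exp; apply: ctsM; first exact: cts_cst.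
by apply: ctsB; [exact: cts_id|exact: cts_cst].
Qed.

(** * Integrals depending on a parameter, exchange of integrals, Gronwall's inequality *)

Section ParametricIntegrals.
Variable R : realType.
Implicit Types (F : R -> R -> R) (a b c d e x y : R).

Lemma cts2_distP F : (forall x y e, 0 < e -> exists2 d : R, 0 < d &
    forall x' y' : R, `|x' - x| < d -> `|y' - y| < d -> `|F x' y' - F x y| <= e) -> cts2 F.
Proof.
move=> H [x y]; apply/cvgrPdist_le => e e0; have [d d0 Hd] := H x y e e0.
exists (ball x d, ball y d) => /=; first by split; exact: nbhsx_ballx.
move=> [x' y'] [/=]; rewrite -!ball_normE /ball_ /= => xx yy.
by rewrite distrC; apply: Hd; rewrite distrC.
Qed.

Lemma cts2_unif F (M e : R) : cts2 F -> 0 < e -> exists2 d : R, 0 < d &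
  forall x x' y y' : R, `|x| <= M -> `|x'| <= M -> `|y| <= M -> `|y'| <= M ->
    `|x - x'| < d -> `|y - y'| < d -> `|F x y - F x' y'| < e.
Proof.
move=> cF e0.
have cK : compact (`[- M, M] `*` `[- M, M] : set (R * R)).
  by apply: compact_setX; exact: segment_compact.
have [d d0 H] := heine cK (continuous_subspaceT cF) e0.
have I z : `|z| <= M -> z \in `[- M, M] by rewrite in_itv /= ler_norml.
exists d => // x x' y y' Hx Hx' Hy Hy' xx yy.
apply: (H (x, y) (x', y')); [split; exact: I|split; exact: I|].
by rewrite prod_normE /= gt_max xx yy.
Qed.

Lemma cts2_bounded F (M : R) : cts2 F -> exists2 B : R, 0 <= B &
  forall x y, `|x| <= M -> `|y| <= M -> `|F x y| <= B.
Proof.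
move=> cF.
have cK : compact (`[- M, M] `*` `[- M, M] : set (R * R)).
  by apply: compact_setX; exact: segment_compact.
have [B B0 H] := within_bounded cK (continuous_subspaceT cF).
have I z : `|z| <= M -> z \in `[- M, M] by rewrite in_itv /= ler_norml.
by exists B => // x y Hx Hy; apply: (H (x, y)); split; exact: I.
Qed.

Lemma cts2_l F y : cts2 F -> continuous (F^~ y).
Proof. by move=> cF; apply: (cts2_app cF) => //; cts. Qed.

Lemma cts2_r F x : cts2 F -> continuous (F x).
Proof. by move=> cF; apply: (cts2_app cF) => //; cts. Qed.

Lemma cts2_flip F : cts2 F -> cts2 (fun x y => F y x).
Proof. by move=> cF; apply: (cts2_app cF) => //; cts. Qed.

(** The increment splits into a change of the integrand, small by uniform continuity on a square
    containing all the points involved, and a change of the end point for the fixed integrand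
    [F y0]. *)
Lemma Int_param_cts2 F a : cts2 F -> cts2 (fun y b => Int (F y) a b).
Proof.
move=> cF; apply: cts2_distP => y0 b0 e e0.
have c0 : continuous (F y0) by exact: cts2_r.
pose M : R := `|y0| + `|b0| + `|a| + 1.
have n1 : 0 <= `|y0| by []. have n2 : 0 <= `|b0| by []. have n3 : 0 <= `|a| by [].
have M0 : 0 < 4 * M by rewrite /M; lra.
have [d d0 Hd] := cts2_unif M cF (divr_gt0 e0 M0).
have e20 : 0 < e / 2 by rewrite divr_gt0.
have [d' d'0 Hd'] := cts_dist b0 (@Int_cts _ _ a c0) e20.
exists (Num.min 1 (Num.min d d')); first by rewrite !lt_min ltr01 d0.
move=> y b; rewrite !lt_min => /and3P[y1 yd _] /and3P[b1 _ bd].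
have -> : Int (F y) a b - Int (F y0) a b0 =
    Int (fun x => F y x - F y0 x) a b + (Int (F y0) a b - Int (F y0) a b0).
  by rewrite IntB //; [ring|exact: cts2_r].
have yM : `|y| <= M by have := ler_normD (y - y0) y0; rewrite subrK /M; move: y1 n1 n2 n3; flra.
have bM : `|b| <= M by have := ler_normD (b - b0) b0; rewrite subrK /M; move: b1 n1 n2 n3; flra.
have y0M : `|y0| <= M by rewrite /M; move: n1 n2 n3; flra.
have aM : `|a| <= M by rewrite /M; move: n1 n2 n3; flra.
have H1 : `|Int (fun x => F y x - F y0 x) a b| <= e / (4 * M) * `|b - a|.
  have cd : continuous (fun x => F y x - F y0 x) by apply: ctsB => //; exact: cts2_r.
  have K x : `|x| <= M -> `|F y x - F y0 x| <= e / (4 * M).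
    by move=> xM; apply: ltW; apply: Hd => //; rewrite subrr normr0.
  case: (leP a b) => [ab|/ltW ab].
    rewrite (ger0_norm (x := b - a)) ?subr_ge0 //; apply: Int_bound => // x /andP[ax xb].
    by apply: K; move: aM bM ax xb; clear_props; rewrite !ler_norml => /andP[? ?] /andP[? ?] ? ?; apply/andP; split; lra.
  rewrite Int_opp normrN (distrC b) (ger0_norm (x := a - b)) ?subr_ge0 //; apply: Int_bound => // x /andP[ax xb].
  by apply: K; move: aM bM ax xb; clear_props; rewrite !ler_norml => /andP[? ?] /andP[? ?] ? ?; apply/andP; split; lra.
have H2 := Hd' _ bd.
have H3 : e / (4 * M) * `|b - a| <= e / 2.
  have : `|b - a| <= 2 * M by have := ler_normB b a; move: aM bM; flra.
  move=> /(ler_wpM2l (ltW (divr_gt0 e0 M0))) /le_trans; apply.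
  by have -> : e / (4 * M) * (2 * M) = e / 2 by field; rewrite gt_eqF //; move: M0; flra.
have := ler_normD (Int (fun x => F y x - F y0 x) a b) (Int (F y0) a b - Int (F y0) a b0).
by move: H1 H2 H3; flra.
Qed.

Lemma Int_param_cts F a b : cts2 F -> continuous (fun y => Int (F y) a b).
Proof.
by move=> /(@Int_param_cts2 _ a) H; apply: (cts2_app H); cts.
Qed.

(** Both sides vanish for [b = a], so it suffices that the right side, as a function [G] of its
    upper bound, has derivative [Int (F x) c d]. This derivative is taken under the integral sign by
    uniform continuity. *)
Lemma Int_swap F a b c d : cts2 F ->
  Int (fun x => Int (F x) c d) a b = Int (fun y => Int (F^~ y) a b) c d.
Proof.
move=> cF; wlog cd : c d / c <= d.
  move=> H; case: (leP c d) => [|/ltW dc]; first exact: H.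
  rewrite [RHS]Int_opp -H // -IntN; last by apply: Int_param_cts.
  by congr (Int _ _ _); apply/funext => x; rewrite Int_opp.
pose G b := Int (fun y => Int (F^~ y) a b) c d.
have cI b' : continuous (fun y => Int (F^~ y) a b').
  by apply: (@Int_param_cts (fun y x => F x y)); exact: cts2_flip.
have G0 : G a = 0.
  rewrite /G (_ : (fun y => _) = (fun=> 0)) ?Int_cst ?mul0r //.
  by apply/funext => y; rewrite Int_refl.
rewrite -[RHS]/(G b) -[RHS]subr0 -G0; apply: Int_ftc.
  exact: Int_param_cts.
move=> x; apply: is_derive_dist => e e0.
pose M : R := `|x| + `|c| + `|d| + 1.
have n1 : 0 <= `|x| by []. have n2 : 0 <= `|c| by []. have n3 : 0 <= `|d| by [].
have dc0 : 0 < d - c + 1 by lra.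
have [r r0 Hr] := cts2_unif M cF (divr_gt0 e0 dc0).
exists (Num.min 1 r); first by rewrite lt_min ltr01.
move=> y _; rewrite lt_min => /andP[y1 yr].
have E : G y - G x - Int (F x) c d * (y - x) =
    Int (fun z => Int (fun s => F s z - F x z) x y) c d.
  rewrite /G -IntB // (mulrC _ (y - x)) -IntZ; last exact: cts2_r.
  rewrite -IntB; first last.
  - by apply: ctsM; [cts|exact: cts2_r].
  - by apply: ctsB.
  congr (Int _ _ _); apply/funext => z.
  by rewrite IntB; [rewrite Int_cst /Int; ring|exact: cts2_l|cts].
have cc : cts2 (fun z s => F s z - F x z).
  by apply: ctsB; [apply: (cts2_app cF); cts|apply: (cts2_app cF); cts].
rewrite E; apply: le_trans (_ : e / (d - c + 1) * `|y - x| * (d - c) <= _).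
  apply: Int_bound => //; first exact: (@Int_param_cts (fun z s => F s z - F x z)).
  move=> z /andP[cz zd].
  have zM : `|z| <= M.
    rewrite ler_norml /M; have := ler_norm c; have := ler_norm (- c); have := ler_norm d; have := ler_norm (- d).
    by rewrite !normrN; move: cz zd n1; clear_props; move=> *; apply/andP; split; lra.
  have K s : `|s - x| <= `|y - x| -> `|F s z - F x z| <= e / (d - c + 1).
    move=> sx; apply/ltW/Hr => //.
    - by have := ler_normD (s - x) x; rewrite subrK /M; move: sx y1 n2 n3; flra.
    - by rewrite /M; move: n2 n3; flra.
    - by move: sx yr; flra.
    - by rewrite subrr normr0.
  have cz' : continuous (fun s => F s z - F x z) by exact: (@cts2_r _ z cc).
  case: (leP x y) => [xy|/ltW xy].
    rewrite (ger0_norm (x := y - x)) ?subr_ge0 //; apply: Int_bound => // s /andP[xs sy].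
    by apply: K; rewrite !ger0_norm ?subr_ge0 //; move: sy; flra.
  rewrite Int_opp normrN (distrC y) (ger0_norm (x := x - y)) ?subr_ge0 //; apply: Int_bound => // s /andP[xs sy].
  by apply: K; rewrite distrC (distrC y) !ger0_norm ?subr_ge0 //; move: xs; flra.
have -> : e / (d - c + 1) * `|y - x| * (d - c) = (d - c) / (d - c + 1) * (e * `|y - x|).
  by field; rewrite gt_eqF.
by apply: ler_piMl; [rewrite mulr_ge0 // ltW|rewrite ler_pdivrMr // mul1r; clear_props; lra].
Qed.

Lemma comp_deriv (F G : R -> R) x f g : has_deriv F (G x) f -> has_deriv G x g ->
  has_deriv (fun y => F (G y)) x (f * g).
Proof. by move=> dF dG; exact: is_derive1_comp. Qed.

Lemma Int_subst (F G g H : R -> R) a b : a <= b -> continuous F -> continuous G ->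
  continuous H -> (forall x, a < x < b -> has_deriv G x (g x)) ->
  (forall x, a < x < b -> H x = F (G x) * g x) ->
  Int H a b = Int F (G a) (G b).
Proof.
move=> ab cF cG cH dG HE.
rewrite (@Int_ftc_oo _ H (fun x => prim F (G x))) //.
  exact/(cts_app (prim_cts cF) cG).
move=> x xab; rewrite HE //; apply: comp_deriv; [exact: prim_derive|exact: dG].
Qed.

Lemma exp_deriv (G : R -> R) x g : has_deriv G x g ->
  has_deriv (fun y => expR (G y)) x (expR (G x) * g).
Proof. move=> dG; apply: comp_deriv => //; exact: is_derive_expR. Qed.

Lemma derivM (F G : R -> R) x f g : has_deriv F x f -> has_deriv G x g ->
  has_deriv (fun y => F y * G y) x (f * G x + F x * g).
Proof.
move=> dF dG; have := is_deriveM dF dG; rewrite addrC.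
by move=> H; apply: (is_derive_eq H); rewrite [_ *: _]/(G x * f) [_ *: _]/(F x * g) mulrC.
Qed.

Lemma derivZ c (F : R -> R) x f : has_deriv F x f -> has_deriv (fun y => c * F y) x (c * f).
Proof. exact: is_deriveZ. Qed.

Lemma derivD (F G : R -> R) x f g : has_deriv F x f -> has_deriv G x g ->
  has_deriv (fun y => F y + G y) x (f + g).
Proof. exact: is_deriveD. Qed.

Lemma derivB (F G : R -> R) x f g : has_deriv F x f -> has_deriv G x g ->
  has_deriv (fun y => F y - G y) x (f - g).
Proof. exact: is_deriveB. Qed.

Lemma deriv_id x : has_deriv id x (1 : R).
Proof. exact: is_derive_id. Qed.

Lemma deriv_cst (c x : R) : has_deriv (fun=> c) x 0.
Proof. exact: is_derive_cst. Qed.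

Lemma deriv_eq (F : R -> R) x f g : has_deriv F x f -> f = g -> has_deriv F x g.
Proof. by move=> dF <-. Qed.

(** [phi] need not be differentiable, but the right side [psi] of the hypothesis is, and
    [psi t * expR (- K * (t - a))] does not increase. *)
Lemma gronwall (phi : R -> R) (a b c K : R) : 0 <= K -> continuous phi ->
  (forall t, a <= t <= b -> phi t <= c + K * Int phi a t) ->
  forall t, a <= t <= b -> phi t <= c * expR (K * (t - a)).
Proof.
move=> K0 cphi H t /andP[at_ tb].
pose psi t := c + K * Int phi a t.
pose W t := psi t * expR (- K * (t - a)).
have dpsi s : has_deriv psi s (K * phi s).
  rewrite -[K * _]add0r; apply: derivD; first exact: deriv_cst.
  by apply: derivZ; exact: Int_derive.
have dexp s : has_deriv (fun t => expR (- K * (t - a))) s (expR (- K * (s - a)) * (- K)).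
  apply: exp_deriv; apply: deriv_eq (derivZ _ (derivB (deriv_id s) (deriv_cst a s))) _.
  by rewrite subr0 mulr1.
have dW s := derivM (dpsi s) (dexp s).
have WW : W t <= W a.
  apply: (derive_le at_ (derive_cts dW) (fun x _ => dW x)) => s /andP[/ltW as_ /ltW st].
  have -> : K * phi s * expR (- K * (s - a)) + psi s * (expR (- K * (s - a)) * - K) =
    K * expR (- K * (s - a)) * (phi s - psi s) by ring.
  rewrite mulr_ge0_le0 // ?mulr_ge0 ?expR_ge0 // subr_le0; apply: H.
  by rewrite as_ (le_trans st).
have : phi t <= psi t by apply: H; rewrite at_ tb.
move=> /le_trans; apply.
have -> : c = W a by rewrite /W /psi Int_refl subrr !mulr0 addr0 expR0 mulr1.
have -> : psi t = W t * expR (K * (t - a)).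
  by rewrite /W -mulrA -expRD mulNr addNr expR0 mulr1.
by rewrite ler_wpM2r ?expR_ge0.
Qed.

End ParametricIntegrals.

(** * Ordinary differential equations *)

Section Flow.
Variable R : realType.

Lemma expR_ge1 (x : R) : 0 <= x -> 1 <= expR x.
Proof. by move=> x0; rewrite -[X in X <= _](expR0 R) ler_expR. Qed.

Lemma le0_geometric (x C : R) : (forall n, x <= C / 2 ^+ n) -> x <= 0.
Proof.
move=> H; rewrite leNgt; apply/negP => x0.
have [n Hn] : exists n, C < x * n%:R.
  exists (Num.bound `|C / x|); rewrite mulrC -ltr_pdivrMr //.
  exact: le_lt_trans (ler_norm _) (archi_boundP (normr_ge0 _)).
have := H n; rewrite ler_pdivlMr ?exprn_gt0 // leNgt => /negP; apply.
apply: (lt_le_trans Hn); rewrite ler_pM2l //.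
by rewrite -natrX ler_nat ltnW // ltn_expl.
Qed.

(** The limit is taken as the supremum of the lower bounds [u n - 2 * B / 2 ^+ n]; every
    [u n + 2 * B / 2 ^+ n] bounds these from above. *)
Lemma geometric_limit (u : nat -> R) (B : R) :
  (forall n, `|u n.+1 - u n| <= B / 2 ^+ n) ->
  exists l, forall n, `|u n - l| <= 2 * B / 2 ^+ n.
Proof.
move=> H.
have step n m : `|u (n + m)%N - u n| <= 2 * B / 2 ^+ n - 2 * B / 2 ^+ (n + m).
  elim: m => [|m IH]; first by rewrite addn0 !subrr normr0.
  have := ler_normD (u (n + m)%N.+1 - u (n + m)%N) (u (n + m)%N - u n).
  rewrite addrA subrK addnS => /le_trans; apply.
  apply: le_trans (lerD (H _) IH) _; rewrite exprS invfM.
  by rewrite le_eqVlt; apply/orP; left; apply/eqP; field; rewrite !expf_neq0.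
have B0 : 0 <= B by have := le_trans (normr_ge0 _) (H 0%N); rewrite expr0 divr1.
have pos n : 0 <= 2 * B / 2 ^+ n by rewrite divr_ge0 ?mulr_ge0 // exprn_ge0.
have near n m : `|u m - u n| <= 2 * B / 2 ^+ n + 2 * B / 2 ^+ m.
  have Pn := pos n; have Pm := pos m.
  case: (leqP n m) => [/subnKC E|/ltnW /subnKC E].
    by have := step n (m - n)%N; rewrite E => /le_trans; apply; lra.
  by have := step m (n - m)%N; rewrite E distrC => /le_trans; apply; lra.
pose A := [set u n - 2 * B / 2 ^+ n | n in [set: nat]].
have ub n : ubound A (u n + 2 * B / 2 ^+ n).
  move=> _ [m _ <-]; have := near n m; rewrite ler_norml => /andP[_]; lra.
have A0 : A !=set0 by exists (u 0%N - 2 * B / 2 ^+ 0); exists 0%N.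
exists (sup A) => n; rewrite ler_norml; apply/andP; split.
  by have := ge_sup A0 (ub n); lra.
have : u n - 2 * B / 2 ^+ n <= sup A.
  by apply: ub_le_sup; [exists (u 0%N + 2 * B / 2 ^+ 0); exact: ub|exists n].
lra.
Qed.

Variables (h : R -> R -> R) (K l1 : R).
Hypotheses (ch : cts2 h) (K0 : 0 < K)
  (hK : forall x y t, `|h x t - h y t| <= K * `|x - y|)
  (hl1 : forall x t, `|h x t| <= l1).

Definition ode_sol (c : R -> R) := forall t, has_deriv c t (h (c t) t).

(** The square of the difference [D] replaces its absolute value, which need not be differentiable.
    [D * D * expR (- 2 * K * t)] does not increase and [D * D * expR (2 * K * t)] does not decrease;
    this gives the estimate in both directions of time. *)
Lemma ode_stab (c1 c2 : R -> R) (a b : R) : a <= b -> continuous c1 -> continuous c2 ->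
  (forall t, a < t < b -> has_deriv c1 t (h (c1 t) t)) ->
  (forall t, a < t < b -> has_deriv c2 t (h (c2 t) t)) ->
  `|c1 b - c2 b| <= `|c1 a - c2 a| * expR (K * (b - a)) /\
  `|c1 a - c2 a| <= `|c1 b - c2 b| * expR (K * (b - a)).
Proof.
move=> ab k1 k2 d1 d2.
pose D t := c1 t - c2 t.
pose m t := h (c1 t) t - h (c2 t) t.
have cD : continuous D by apply: ctsB.
have dD t : a < t < b -> has_deriv D t (m t) by move=> tab; apply: derivB; [exact: d1|exact: d2].
have mD t : `|m t * D t| <= K * (D t * D t).
  rewrite normrM (_ : D t * D t = `|D t| * `|D t|); last by rewrite -normrM ger0_norm // -expr2 sqr_ge0.
  by rewrite mulrA ler_wpM2r //; exact: hK.
have dW k t : a < t < b -> has_deriv (fun t => D t * D t * expR (k * (t - a))) t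
   ((m t * D t + D t * m t) * expR (k * (t - a)) + D t * D t * (expR (k * (t - a)) * k)).
  move=> tab; apply: derivM; first by apply: derivM; exact: dD.
  apply: exp_deriv; apply: deriv_eq (derivZ _ (derivB (deriv_id t) (deriv_cst a t))) _.
  by rewrite subr0 mulr1.
have cW k : continuous (fun t => D t * D t * expR (k * (t - a))).
  apply: ctsM; first exact: ctsM.
  exact: exp_affine_cts.
have E0 k : D a * D a * expR (k * (a - a)) = D a * D a by rewrite subrr mulr0 expR0 mulr1.
have sq (x y : R) : x * x <= y * y * expR (2 * K * (b - a)) -> `|x| <= `|y| * expR (K * (b - a)).
  move=> H; rewrite -ler_sqr ?nnegrE ?mulr_ge0 ?expR_ge0 //.
  rewrite !expr2 -!normrM mulrACA -normrM -expRD -mulrDr ger0_norm -?expr2 ?sqr_ge0 //.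
  rewrite ger0_norm ?sqr_ge0 // !expr2; apply: le_trans H _.
  by rewrite le_eqVlt; apply/orP; left; apply/eqP; congr (_ * expR _); ring.
split; apply: sq.
  have : D b * D b * expR (- (2 * K) * (b - a)) <= D a * D a.
    rewrite -(E0 (- (2 * K))); apply: (derive_le ab (cW _) (dW _)) => t tab.
    have := mD t; rewrite ler_norml => /andP[_ H]; have := expR_gt0 (- (2 * K) * (t - a)).
    nra.
  move=> H; have := ler_wpM2r (expR_ge0 (2 * K * (b - a))) H.
  by rewrite -(mulrA (D b * D b)) -expRD mulNr addNr expR0 mulr1.
have : - (D b * D b * expR (2 * K * (b - a))) <= - (D a * D a).
  rewrite -(E0 (2 * K)); apply: (derive_le ab (ctsN (cW (2 * K))) (fun t tab => is_deriveN (dW (2 * K) t tab))) => t tab.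
  have := mD t; rewrite ler_norml => /andP[H _]; have := expR_gt0 (2 * K * (t - a)).
  nra.
by rewrite lerN2.
Qed.

Lemma ode_sol_cts c : ode_sol c -> continuous c.
Proof. exact: derive_cts. Qed.

Lemma ode_sol_stab c1 c2 s t : ode_sol c1 -> ode_sol c2 ->
  `|c1 t - c2 t| <= `|c1 s - c2 s| * expR (K * `|t - s|).
Proof.
move=> s1 s2; have k1 := ode_sol_cts s1; have k2 := ode_sol_cts s2.
case: (leP s t) => [st|/ltW ts].
  by rewrite (ger0_norm (x := t - s)) ?subr_ge0 //; exact: (ode_stab st k1 k2 (fun x _ => s1 x) (fun x _ => s2 x)).1.
rewrite (distrC t) (ger0_norm (x := s - t)) ?subr_ge0 //.
exact: (ode_stab ts k1 k2 (fun x _ => s1 x) (fun x _ => s2 x)).2.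
Qed.

Lemma ode_sol_uniq c1 c2 s : ode_sol c1 -> ode_sol c2 -> c1 s = c2 s -> c1 = c2.
Proof.
move=> s1 s2 E; apply/funext => t; have := ode_sol_stab s t s1 s2.
by rewrite E subrr normr0 mul0r normr_le0 subr_eq0 => /eqP.
Qed.

(** In the norm weighted by [expR (- k * |t - s|)], integration from [s] is an operator of norm at
    most [1 / k]. *)
Lemma exp_weight_Int (phi : R -> R) (a k s t : R) : 0 < k -> 0 <= a -> continuous phi ->
  (forall x, `|phi x| <= a * expR (k * `|x - s|)) ->
  `|Int phi s t| <= a / k * expR (k * `|t - s|).
Proof.
move=> k0 a0 cphi H.
have dE u v x : has_deriv (fun y => v * expR (u * (y - s))) x (v * (expR (u * (x - s)) * u)).
  apply: derivZ; apply: exp_deriv.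
  by apply: deriv_eq (derivZ _ (derivB (deriv_id x) (deriv_cst s x))) _; rewrite subr0 mulr1.
have cE u v : continuous (fun y => v * expR (u * (y - s))) by apply: ctsM; [exact: cts_cst|exact: exp_affine_cts].
case: (leP s t) => [st|/ltW ts].
  have G : `|Int phi s t| <= Int (fun y => a * expR (k * (y - s))) s t.
    apply: Int_norm => // x /andP[sx xt]; apply: le_trans (H x) _.
    by rewrite ger0_norm ?subr_ge0.
  apply: le_trans G _.
  rewrite (@Int_ftc _ _ (fun y => a / k * expR (k * (y - s)))) //; last first.
    by move=> x; apply: deriv_eq (dE _ _ _) _; field; rewrite gt_eqF.
  rewrite subrr mulr0 expR0 mulr1 ger0_norm ?subr_ge0 //.
  by have := divr_ge0 a0 (ltW k0); lra.
rewrite Int_opp normrN.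
have G : `|Int phi t s| <= Int (fun y => a * expR (- k * (y - s))) t s.
  apply: Int_norm => // x /andP[tx xs]; apply: le_trans (H x) _.
  by rewrite distrC ger0_norm ?subr_ge0 // mulNr -mulrN opprB.
apply: le_trans G _.
rewrite (@Int_ftc _ _ (fun y => - (a / k) * expR (- k * (y - s)))) //; last first.
  by move=> x; apply: deriv_eq (dE _ _ _) _; field; rewrite gt_eqF.
rewrite subrr mulr0 expR0 mulr1 distrC ger0_norm ?subr_ge0 //.
have -> : - k * (t - s) = k * (s - t) by ring.
by have := divr_ge0 a0 (ltW k0); lra.
Qed.

Fixpoint picard (s y : R) (n : nat) (t : R) : R :=
  if n is n'.+1 then y + Int (fun r => h (picard s y n' r) r) s t else y.

(** With the weight [k = 2 * K] every Picard step halves the weighted distance of successive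
    iterates, so the iteration converges on the whole line at once and no continuation of local
    solutions is required. *)
Lemma ode_exists s y : exists2 c, c s = y & ode_sol c.
Proof.
have cp n : continuous (picard s y n).
  elim: n => [|n IH] /=; first exact: cts_cst.
  apply: ctsD; first exact: cts_cst.
  by apply: Int_cts; apply: (cts2_app ch) => //; exact: cts_id.
have chp n : continuous (fun r => h (picard s y n r) r).
  by apply: (cts2_app ch) => //; exact: cts_id.
have l0 : 0 <= l1 by apply: le_trans (hl1 0 0).
have k0 : 0 < 2 * K by rewrite mulr_gt0.
pose A := l1 / (2 * K).
have A0 : 0 <= A by rewrite divr_ge0 // ltW.
have est n t : `|picard s y n.+1 t - picard s y n t| <= A / 2 ^+ n * expR (2 * K * `|t - s|).
  elim: n t => [|n IH] t.
    rewrite expr0 divr1 /= [y + _]addrC addrK.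
    apply: exp_weight_Int => //; first exact: cts2_r.
    move=> x; apply: le_trans (hl1 _ _) _; by rewrite ler_peMr // expR_ge1 // mulr_ge0 // ltW.
  rewrite [picard s y n.+2 t]/= [picard s y n.+1 t]/= opprD addrACA subrr add0r.
  rewrite -IntB; [|exact: (chp n.+1)|exact: chp].
  have -> : A / 2 ^+ n.+1 = K * (A / 2 ^+ n) / (2 * K).
    by rewrite exprS; field; rewrite gt_eqF //= expf_neq0.
  apply: exp_weight_Int => //.
  - by rewrite mulr_ge0 ?(ltW K0) // divr_ge0 // exprn_ge0.
  - exact: (ctsB (chp n.+1) (chp n)).
  - move=> x; apply: le_trans (hK _ _ _) _; rewrite -mulrA ler_wpM2l ?(ltW K0) //; exact: IH.
have lim t : exists l, forall n, `|picard s y n t - l| <= 2 * (A * expR (2 * K * `|t - s|)) / 2 ^+ n.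
  by apply: geometric_limit => n; rewrite mulrAC; exact: est.
have [c Hc] := choice lim.
have cc : continuous c.
  apply: cts_distP => x e e0.
  (* [W] bounds the weight for all points at distance less than 1 from [x], so the iterates converge
     uniformly there and the limit is continuous at [x]. *)
  pose W := 2 * (A * expR (2 * K * (`|x - s| + 1))).
  have W0 : 0 <= W by rewrite mulr_ge0 // mulr_ge0 ?expR_ge0.
  have [n Hn] : exists n, W / 2 ^+ n < e / 3.
    apply: contrapT => /forallNP N.
    have : e / 3 <= 0 by apply: (@le0_geometric _ W) => n; rewrite leNgt; apply/negP/N.
    lra.
  have [d d0 Hd] := cts_dist x (cp n) (divr_gt0 e0 (ltr0n R 3)).
  exists (Num.min 1 d); first by rewrite lt_min ltr01.
  move=> z; rewrite lt_min => /andP[z1 zd].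
  have bd z' : `|z' - x| < 1 -> `|picard s y n z' - c z'| < e / 3.
    move=> z'1; apply: le_lt_trans (Hc z' n) _; apply: le_lt_trans Hn.
    rewrite ler_wpM2r ?invr_ge0 ?exprn_ge0 // ler_wpM2l // ler_wpM2l // ler_expR.
    by rewrite ler_wpM2l ?(ltW k0) //; have := ler_distD x z' s; lra.
  have H1 := bd z z1; have H2 := bd x; rewrite subrr normr0 in H2.
  have {}H2 := H2 ltr01; have H3 := Hd z zd.
  have := ler_distD (picard s y n z) (c z) (c x).
  have := ler_distD (picard s y n x) (picard s y n z) (c x).
  by rewrite (distrC (c z) (picard s y n z)); move: H1 H2 H3; flra.
have chc : continuous (fun r => h (c r) r) by apply: (cts2_app ch) => //; exact: cts_id.
have fix_c t : c t = y + Int (fun r => h (c r) r) s t.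
  apply/eqP; rewrite -subr_eq0 -normr_le0.
  pose W := 2 * (A * expR (2 * K * `|t - s|)).
  have W0 : 0 <= W by rewrite mulr_ge0 // mulr_ge0 ?expR_ge0.
  apply: (@le0_geometric _ (W + W)) => n.
  have -> : c t - (y + Int (fun r => h (c r) r) s t) =
    (c t - picard s y n.+1 t) + (Int (fun r => h (picard s y n r) r) s t - Int (fun r => h (c r) r) s t).
    by rewrite /=; ring.
  apply: le_trans (ler_normD _ _) _; rewrite mulrDl; apply: lerD.
    rewrite distrC; apply: le_trans (Hc t n.+1) _; rewrite -/W exprS invfM.
    have : 0 <= W / 2 ^+ n by rewrite divr_ge0 // exprn_ge0.
    by rewrite mulrCA; move: (W / 2 ^+ n) => w; lra.
  rewrite -IntB //.
  have := @exp_weight_Int (fun r => h (picard s y n r) r - h (c r) r) (K * (2 * A / 2 ^+ n)) (2 * K) s t k0.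
  have q0 : 0 <= A / 2 ^+ n by rewrite divr_ge0 // exprn_ge0.
  rewrite mulr_ge0 ?(ltW K0) //; last by rewrite -mulrA mulr_ge0.
  move=> /(_ isT (ctsB (chp n) chc)) H; apply: le_trans (H _) _.
    move=> x; apply: le_trans (hK _ _ _) _; rewrite -mulrA ler_wpM2l ?(ltW K0) //.
    by apply: le_trans (Hc x n) _; rewrite le_eqVlt; apply/orP; left; apply/eqP; ring.
  rewrite /W.
  have -> : K * (2 * A / 2 ^+ n) / (2 * K) = A / 2 ^+ n.
    by rewrite -(mulrA 2 A); move: (A / 2 ^+ n) => q; field; rewrite gt_eqF.
  have : 0 <= A / 2 ^+ n * expR (2 * K * `|t - s|) by rewrite mulr_ge0 ?expR_ge0.
  have -> : 2 * (A * expR (2 * K * `|t - s|)) / 2 ^+ n = 2 * (A / 2 ^+ n * expR (2 * K * `|t - s|)) by ring.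
  lra.
exists c; first by rewrite fix_c Int_refl addr0.
move=> t; have -> : c = (fun t => y + Int (fun r => h (c r) r) s t) by apply/funext => r; exact: fix_c.
rewrite -[h _ _]add0r -fix_c; apply: derivD; first exact: deriv_cst.
exact: Int_derive.
Qed.

Definition Phi (s y : R) : R -> R := get [set c | c s = y /\ ode_sol c].

Lemma PhiP s y : Phi s y s = y /\ ode_sol (Phi s y).
Proof.
have [c cs cO] := ode_exists s y.
exact: (getPex (ex_intro [set c | c s = y /\ ode_sol c] c (conj cs cO))).
Qed.

(** If the order were reversed at [t], the two curves would meet somewhere between [s] and [t] and
    would coincide by uniqueness. *)
Lemma ode_sol_lt c1 c2 s t : ode_sol c1 -> ode_sol c2 -> c1 s < c2 s -> c1 t < c2 t.
Proof.
move=> s1 s2 lt_s; rewrite ltNge; apply/negP => le_t.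
have cD : continuous (fun r => c2 r - c1 r) by apply: ctsB; exact: ode_sol_cts.
have [r Hr] : exists r, c2 r - c1 r = 0.
  case: (leP s t) => [st|/ltW ts].
    have [||r _ Hr] := @IVT R (fun r => c2 r - c1 r) s t 0 st; last by exists r.
      exact: cts_within.
    by rewrite ge_min le_max; apply/andP; split; apply/orP; [right|left]; lra.
  have [||r _ Hr] := @IVT R (fun r => c2 r - c1 r) t s 0 ts; last by exists r.
    exact: cts_within.
  by rewrite ge_min le_max; apply/andP; split; apply/orP; [left|right]; lra.
have E : c1 = c2 by apply: (@ode_sol_uniq _ _ r) => //; lra.
by move: lt_s; rewrite E ltxx.
Qed.

End Flow.

(** * The flow of the characteristics *)

Section BoundaryFlow.
Variable R : realType.

Lemma cts2_dist (F : R -> R -> R) (x y e : R) : cts2 F -> 0 < e ->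
  exists2 d : R, 0 < d & forall x' y' : R, `|x' - x| < d -> `|y' - y| < d -> `|F x' y' - F x y| < e.
Proof.
move=> cF e0; pose M : R := `|x| + `|y| + 1.
have n1 : 0 <= `|x| by []. have n2 : 0 <= `|y| by [].
have [d d0 Hd] := cts2_unif M cF e0.
exists (Num.min 1 d); first by rewrite lt_min ltr01.
move=> x' y'; rewrite !lt_min => /andP[x1 xd] /andP[y1 yd]; apply: Hd => //.
- by have := ler_normD (x' - x) x; rewrite subrK /M; lra.
- by rewrite /M; lra.
- by have := ler_normD (y' - y) y; rewrite subrK /M; lra.
- by rewrite /M; lra.
Qed.

(** The bounds are required on the whole plane: [h] will be [lam] composed with the projection onto
    a box, so that characteristics are defined for all times and no question of leaving the domain
    arises. *)
Record speed_field (h : R -> R -> R) (K l0 l1 : R) : Prop := SpeedField {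
  sf_cts : cts2 h;
  sf_K0 : 0 < K;
  sf_lip : forall x y t, `|h x t - h y t| <= K * `|x - y|;
  sf_l0 : 0 < l0;
  sf_ge : forall x t, l0 <= h x t;
  sf_le : forall x t, h x t <= l1 }.

Variables (h : R -> R -> R) (K l0 l1 : R).
Hypothesis sf : speed_field h K l0 l1.

Let ch := sf_cts sf.
Let K0 := sf_K0 sf.
Let hK := sf_lip sf.
Let l00 := sf_l0 sf.
Let hl0 := sf_ge sf.
Let hl1 := sf_le sf.

Let hl1' x t : `|h x t| <= l1.
Proof. by rewrite ger0_norm ?hl1 // (le_trans _ (hl0 x t)) // ltW. Qed.

Let l01 : l0 <= l1. Proof. exact: le_trans (hl0 0 0) (hl1 0 0). Qed.

(* The characteristic entering at the boundary point of parameter s: the point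
   (0, s) if s >= 0, and the point (- h 0 0 * s, 0) if s < 0. The factor h 0 0
   makes the Jacobian below continuous at s = 0. *)
Definition bstart (s : R) : R := - h 0 0 * Num.min s 0.
Definition flow (t s : R) : R := Phi h (Num.max s 0) (bstart s) t.
Local Notation X := flow.

Lemma X_sol s : ode_sol h (X^~ s).
Proof. exact: (PhiP ch K0 hK hl1' _ _).2. Qed.

Lemma X_start s : X (Num.max s 0) s = bstart s.
Proof. exact: (PhiP ch K0 hK hl1' _ _).1. Qed.

Lemma X_diag s : 0 <= s -> X s s = 0.
Proof.
move=> s0; have := X_start s; rewrite /bstart max_l // min_r // mulr0; exact.
Qed.

Lemma X_0 s : s <= 0 -> X 0 s = - h 0 0 * s.
Proof.
by move=> s0; have := X_start s; rewrite /bstart max_r // min_l.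
Qed.

Lemma sol_speed c s t : ode_sol h c -> s <= t ->
  l0 * (t - s) <= c t - c s <= l1 * (t - s).
Proof.
move=> cO st; have [r _ ->] := derive_mvt st (ode_sol_cts cO) (fun x _ => cO x).
by rewrite !ler_wpM2r ?subr_ge0 ?hl0 ?hl1.
Qed.

Lemma X_speed s t t' : t <= t' -> l0 * (t' - t) <= X t' s - X t s <= l1 * (t' - t).
Proof. by move=> tt; exact: (sol_speed (X_sol s) tt). Qed.

Lemma X_le s t t' : t <= t' -> X t s <= X t' s.
Proof.
move=> tt; have /andP[H _] := X_speed s tt; rewrite -subr_ge0; apply: le_trans H.
by rewrite mulr_ge0 ?subr_ge0 // ltW.
Qed.

Lemma X_lip_t s t t' : `|X t s - X t' s| <= l1 * `|t - t'|.
Proof.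
case: (leP t t') => [tt|/ltW tt]; have /andP[_ H] := X_speed s tt; have := X_le s tt.
  by move=> ?; rewrite distrC ger0_norm ?subr_ge0 // distrC ger0_norm ?subr_ge0.
by move=> ?; rewrite ger0_norm ?subr_ge0 // ger0_norm ?subr_ge0.
Qed.

Lemma max_lip (s s' c : R) : `|Num.max s c - Num.max s' c| <= `|s - s'|.
Proof.
rewrite ler_norml /Num.max; have := ler_norm (s - s'); have := ler_norm (s' - s).
rewrite (distrC s'); case: ltP => ?; case: ltP => ?; move=> *; apply/andP; split; lra.
Qed.

Lemma min_lip (s s' c : R) : `|Num.min s c - Num.min s' c| <= `|s - s'|.
Proof.
rewrite ler_norml /Num.min; have := ler_norm (s - s'); have := ler_norm (s' - s).
rewrite (distrC s'); case: ltP => ?; case: ltP => ?; move=> *; apply/andP; split; lra.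
Qed.

(** The curves are compared at the entry time of [s']. The entry points differ by at most
    [l1 * |s - s'|], and the curve of [s] moves by at most as much between the two entry times;
    hence the factor 2. *)
Lemma X_lip_s t s s' :
  `|X t s - X t s'| <= 2 * l1 * `|s - s'| * expR (K * `|t - Num.max s' 0|).
Proof.
apply: le_trans (ode_sol_stab hK (Num.max s' 0) t (X_sol s) (X_sol s')) _.
rewrite ler_wpM2r ?expR_ge0 // X_start.
have -> : X (Num.max s' 0) s - bstart s' =
  (X (Num.max s' 0) s - X (Num.max s 0) s) + (bstart s - bstart s') by rewrite X_start; ring.
apply: le_trans (ler_normD _ _) _.
have H1 := X_lip_t s (Num.max s' 0) (Num.max s 0).
have H2 : `|bstart s - bstart s'| <= l1 * `|s - s'|.
  rewrite /bstart -mulrBr normrM normrN.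
  by apply: ler_pM => //; exact: min_lip.
have H3 : l1 * `|Num.max s' 0 - Num.max s 0| <= l1 * `|s - s'|.
  rewrite ler_wpM2l //; first by rewrite (le_trans (ltW l00)).
  by rewrite (distrC s); exact: max_lip.
lra.
Qed.

(** On the initial line the gap is [h 0 0] per unit of parameter, and on the axis it is the distance
    covered at speed at least [l0] between the two entry times. Both rates are at least [l0], also
    when the parameters have different signs. *)
Lemma X_gap_start s1 s2 : s1 <= s2 ->
  l0 * (s2 - s1) <= X (Num.max s2 0) s1 - X (Num.max s2 0) s2.
Proof.
move=> s12; rewrite X_start.
have M : Num.max s1 0 <= Num.max s2 0 by rewrite ge_max !le_max s12 lexx orbT.
have /andP[H _] := X_speed s1 M; rewrite X_start in H.
have h00 := hl0 0 0; move: H M; rewrite /bstart /Num.max /Num.min.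
by case: ltP => a1; case: ltP => a2; move=> *; nra.
Qed.

Lemma X_gap t s1 s2 : s1 <= s2 ->
  l0 * (s2 - s1) <= (X t s1 - X t s2) * expR (K * `|t - Num.max s2 0|).
Proof.
move=> s12.
have nn t' : 0 <= X t' s1 - X t' s2.
  move: s12; rewrite le_eqVlt => /predU1P[->|s12]; first by rewrite subrr.
  rewrite subr_ge0 ltW //; apply: (ode_sol_lt hK t' (X_sol s2) (X_sol s1) (s := Num.max s2 0)).
  by have := X_gap_start (ltW s12); have : 0 < l0 * (s2 - s1); [rewrite mulr_gt0 // subr_gt0|lra].
apply: le_trans (X_gap_start s12) _.
have := ode_sol_stab hK t (Num.max s2 0) (X_sol s1) (X_sol s2).
by rewrite (distrC (Num.max s2 0)) (ger0_norm (nn t)) (ger0_norm (nn (Num.max s2 0))).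
Qed.

Lemma X_lt t s1 s2 : s1 < s2 -> X t s2 < X t s1.
Proof.
move=> s12; apply: (ode_sol_lt hK t (X_sol s2) (X_sol s1) (s := Num.max s2 0)).
by have := X_gap_start (ltW s12); have : 0 < l0 * (s2 - s1); [rewrite mulr_gt0 // subr_gt0|lra].
Qed.

Lemma X_leE t s1 s2 : (X t s2 <= X t s1) = (s1 <= s2).
Proof.
case: (ltgtP s1 s2) => [/(X_lt t)/ltW //|/(X_lt t) H|->]; last exact: lexx.
by apply/negbTE; rewrite -ltNge.
Qed.

Lemma X_ltE t s1 s2 : (X t s2 < X t s1) = (s1 < s2).
Proof. by rewrite !ltNge X_leE. Qed.

Lemma X_inj t : injective (X t).
Proof. by move=> s1 s2 E; apply/eqP; rewrite eq_le -(X_leE t s1) -(X_leE t s2) E lexx. Qed.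

Lemma X_cts2 : cts2 X.
Proof.
apply: cts2_distP => t s e e0.
pose W := 2 * l1 * expR (K * `|t - Num.max s 0|).
have l1p : 0 < l1 by apply: lt_le_trans l00 l01.
have W0 : 0 < W by rewrite /W !mulr_gt0 ?expR_gt0.
exists (Num.min (e / 2 / l1) (e / 2 / W)); first by rewrite lt_min !divr_gt0.
move=> t' s'; rewrite !lt_min => /andP[tt _] /andP[_ ss].
have := ler_distD (X t s') (X t' s') (X t s).
have := X_lip_t s' t' t; have := X_lip_s t s' s.
rewrite ltr_pdivlMr // in tt; rewrite ltr_pdivlMr // in ss.
rewrite (_ : 2 * l1 * `|s' - s| * expR (K * `|t - Num.max s 0|) = `|s' - s| * W); last by rewrite /W; ring.
lra.
Qed.

Lemma foot_exists x t : exists s, X t s = x.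
Proof.
have l1p : 0 < l1 by apply: lt_le_trans l00 l01.
have h0 : 0 < h 0 0 by apply: lt_le_trans l00 _.
(* The curve of [a] starts so far to the right at time 0 that it is still to the right of [x] at
   time [t]. The curve of [b] enters at least [|x| / l0] after time [t]; traced back to [t] it lies
   to the left of [x]. *)
pose a := - ((`|x| + l1 * `|t|) / h 0 0); pose b := `|t| + `|x| / l0.
have a0 : a <= 0 by rewrite oppr_le0 divr_ge0 ?addr_ge0 ?mulr_ge0 // ltW.
have b0 : 0 <= b by rewrite addr_ge0 // divr_ge0 // ltW.
have Xa : x <= X t a.
  have H := X_lip_t a 0 t; have := ler_norm (X 0 a - X t a).
  rewrite X_0 // in H *; rewrite sub0r normrN in H.
  have -> : - h 0 0 * a = `|x| + l1 * `|t| by rewrite /a mulrNN mulrC divfK // gt_eqF.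
  by have := ler_norm x; move: H; rewrite /a mulrNN mulrC divfK ?gt_eqF //; lra.
have tb : t <= b by rewrite /b; have := ler_norm t; have := divr_ge0 (normr_ge0 x) (ltW l00); lra.
have Xb : X t b <= x.
  have /andP[H _] := X_speed b tb; rewrite X_diag // in H.
  have : `|x| <= l0 * (b - t).
    rewrite mulrC -ler_pdivrMr // /b; have := ler_norm t; lra.
  by have := ler_norm (- x); rewrite normrN; lra.
have [|||s _ E] := @IVT R (X t) a b x; last by exists s.
- exact: le_trans b0.
- exact/cts_within/cts2_r/X_cts2.
- by rewrite ge_min le_max Xa Xb orbT.
Qed.

Definition foot (x t : R) : R := get [set s | X t s = x].

Lemma X_foot x t : X t (foot x t) = x.
Proof. by have [s E] := foot_exists x t; exact: (getPex (ex_intro [set s | X t s = x] s E)). Qed.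

Lemma foot_X t s : foot (X t s) t = s.
Proof. by apply: (@X_inj t); rewrite X_foot. Qed.

Lemma foot_0 t : 0 <= t -> foot 0 t = t.
Proof. by move=> t0; rewrite -(X_diag t0) foot_X. Qed.

Lemma foot_le x t : 0 <= x -> 0 <= t -> foot x t <= t.
Proof. by move=> x0 t0; rewrite -(X_leE t) X_foot X_diag. Qed.

(** [X_gap] bounds the inverse of [X t] from above; [expR (K * T)] is the cost of carrying the gap
    from the entry time to [t]. A change of time is first traded for a change of position along a
    characteristic. *)
Lemma foot_lip (T x t x' t' : R) : 0 <= t <= T -> 0 <= t' <= T -> 0 <= x -> 0 <= x' ->
  `|foot x t - foot x' t'| <= expR (K * T) / l0 * (`|x - x'| + l1 * `|t - t'|).
Proof.
move=> /andP[t0 tT] /andP[t'0 t'T] x0 x'0.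
have key s1 s2 : s1 <= s2 -> s2 <= T -> s2 - s1 <= expR (K * T) / l0 * (X t s1 - X t s2).
  move=> s12 s2T; rewrite mulrAC ler_pdivlMr // mulrC.
  apply: le_trans (X_gap t s12) _; rewrite mulrC; apply: ler_wpM2r.
    by rewrite subr_ge0 X_leE.
  rewrite ler_expR ler_wpM2l ?(ltW K0) // ler_norml.
  by rewrite /Num.max; case: ltP => ?; apply/andP; split; lra.
have fT y r : 0 <= r -> r <= T -> 0 <= y -> foot y r <= T.
  by move=> r0 rT y0; apply: le_trans (foot_le y0 r0) rT.
have E : `|X t (foot x t) - X t (foot x' t')| <= `|x - x'| + l1 * `|t - t'|.
  rewrite X_foot; have := X_lip_t (foot x' t') t t'; rewrite X_foot distrC => H.
  by have := ler_distD x' x (X t (foot x' t')); lra.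
have C0 : 0 <= expR (K * T) / l0 by rewrite divr_ge0 ?expR_ge0 // ltW.
apply: le_trans (ler_wpM2l C0 E).
case: (leP (foot x t) (foot x' t')) => [|/ltW] s12.
  rewrite distrC ger0_norm ?subr_ge0 // ger0_norm ?subr_ge0 ?X_leE //.
  by apply: key => //; exact: fT.
rewrite ger0_norm ?subr_ge0 // distrC ger0_norm ?subr_ge0 ?X_leE //.
by apply: key => //; exact: fT.
Qed.

Lemma tau_exists x s : exists t, X t s = x.
Proof.
pose d := `|x - X 0 s| / l0.
have d0 : 0 <= d by rewrite divr_ge0 // ltW.
have E : l0 * d = `|x - X 0 s| by rewrite /d mulrC divfK // gt_eqF.
have n0 : - d <= 0 by rewrite oppr_le0.
have /andP[H1 _] := X_speed s d0; have /andP[H2 _] := X_speed s n0.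
have := ler_norm (x - X 0 s); have := ler_norm (- (x - X 0 s)); rewrite normrN => I1 I2.
have [|||t _ Et] := @IVT R (X^~ s) (- d) d x; last by exists t.
- by rewrite ge0_cp.
- exact/cts_within/(cts2_l X_cts2).
- rewrite ge_min le_max; apply/andP; split; apply/orP; [left|right]; lra.
Qed.

Definition tau (x s : R) : R := get [set t | X t s = x].

Lemma X_tau x s : X (tau x s) s = x.
Proof. by have [t E] := tau_exists x s; exact: (getPex (ex_intro [set t | X t s = x] t E)). Qed.

Lemma X_strict s t t' : t < t' -> X t s < X t' s.
Proof.
move=> tt; have /andP[H _] := X_speed s (ltW tt).
by have : 0 < l0 * (t' - t); [rewrite mulr_gt0 // subr_gt0|lra].
Qed.

Lemma tau_X t s : tau (X t s) s = t.
Proof.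
have E := X_tau (X t s) s.
by case: (ltgtP (tau (X t s) s) t) => // /(X_strict s); rewrite E ltxx.
Qed.

Lemma tau_dist x s t : l0 * `|tau x s - t| <= `|x - X t s|.
Proof.
rewrite -[X in _ <= `|X - _|](X_tau x s); case: (leP t (tau x s)) => [tt|/ltW tt]; have /andP[H _] := X_speed s tt; have := X_le s tt.
  by move=> ?; rewrite ger0_norm ?subr_ge0 // ger0_norm ?subr_ge0.
by move=> ?; rewrite distrC ger0_norm ?subr_ge0 // distrC ger0_norm ?subr_ge0.
Qed.

Lemma tau_cts2 : cts2 tau.
Proof.
apply: cts2_distP => x s e e0.
have e1 : 0 < l0 * e / 2 by rewrite divr_gt0 // mulr_gt0.
have [d d0 Hd] := cts_dist s (@cts2_r _ _ (tau x s) X_cts2) e1.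
exists (Num.min (l0 * e / 2) d); first by rewrite lt_min e1.
move=> x' s'; rewrite !lt_min => /andP[xx _] /andP[_ /Hd ss].
rewrite -(ler_pM2l l00); apply: le_trans (tau_dist _ _ _) _.
rewrite X_tau in ss.
by have := ler_distD x x' (X (tau x s) s'); rewrite (distrC x (X _ _)); lra.
Qed.

Lemma tau_ge x s : 0 <= s -> 0 <= x -> s + x / l1 <= tau x s.
Proof.
move=> s0 x0; have l1p : 0 < l1 by apply: lt_le_trans l00 l01.
have st : s <= tau x s.
  rewrite leNgt; apply/negP => /(X_strict s); rewrite X_tau X_diag //; lra.
have /andP[_] := X_speed s st; rewrite X_tau X_diag // subr0 => H.
by rewrite -lerBrDl ler_pdivrMr // mulrC.
Qed.

(** At speed at most [l1] the way from the axis to [x] takes time at least [x / l1]. All delays used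
    later come from this. *)
Lemma foot_travel x t : 0 <= x -> 0 <= t -> 0 <= foot x t -> foot x t <= t - x / l1.
Proof.
move=> x0 t0 f0; have := tau_ge f0 x0; rewrite -[X in tau X _](X_foot x t) tau_X; lra.
Qed.

Lemma X_ge0 s t : Num.max s 0 <= t -> 0 <= X t s.
Proof.
move=> st; apply: le_trans (X_le s st); rewrite X_start /bstart mulNr oppr_ge0.
by rewrite mulr_ge0_le0 // ?ge_min ?lexx ?orbT // (le_trans (ltW l00)).
Qed.

End BoundaryFlow.

(** * Derivative of the flow in the parameter and the change of variables it gives *)

Section Jacobian.
Variables (R : realType) (h hx : R -> R -> R) (K l0 l1 L : R).

(** The clamped speed may have a kink in [x] at [0] and [L]. Its derivative is therefore recorded
    through the mean value property between points of [[0, L]], with a function [hx] that is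
    continuous on the whole plane. *)
Record C1_speed_field : Prop := C1SpeedField {
  cf_sf : speed_field h K l0 l1;
  cf_L0 : 0 < L;
  cf_hx : cts2 hx;
  cf_mv : forall t x y, 0 <= x -> x <= y -> y <= L ->
    exists2 z, x <= z <= y & h y t - h x t = hx z t * (y - x) }.

Hypothesis cf : C1_speed_field.
Let sf := cf_sf cf.
Let L0 := cf_L0 cf.
Let l00 := sf_l0 sf.
Let hl0 := sf_ge sf.
Let hl1 := sf_le sf.
Local Notation X := (flow h).

(** Solution of the linearized equation along the characteristic, starting at the entry time from
    [h 0 (Num.max s 0)]. This is minus the derivative in [s] of the entry position, on the initial
    line as well as on the axis. *)
Definition Jac (t s : R) : R :=
  h 0 (Num.max s 0) * expR (Int (fun r => hx (X r s) r) (Num.max s 0) t).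

Lemma along_cts2 (g : R -> R -> R) : cts2 g -> cts2 (fun s r => g (X r s) r).
Proof.
move=> cg; apply: (cts2_app cg); last exact: cts_snd.
by apply: (cts2_app (X_cts2 sf)); cts.
Qed.

Lemma along_Int_cts2 (g : R -> R -> R) : cts2 g ->
  cts2 (fun t s => Int (fun r => g (X r s) r) (Num.max s 0) t).
Proof.
move=> cg; have H := Int_param_cts2 (a := 0) (along_cts2 cg).
have -> : (fun t s => Int (fun r => g (X r s) r) (Num.max s 0) t) =
  (fun t s => Int (fun r => g (X r s) r) 0 t - Int (fun r => g (X r s) r) 0 (Num.max s 0)).
  by apply/funext => t; apply/funext => s; rewrite /Int; ring.
apply: ctsB; first by apply: (cts2_app H); [exact: cts_snd|exact: cts_fst].
by apply: (cts2_app H); [exact: cts_snd|apply: cts_max; [exact: cts_snd|exact: cts_cst]].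
Qed.

Lemma Jac_cts2 : cts2 Jac.
Proof.
apply: ctsM; first by apply: (cts2_app (sf_cts sf)); [exact: cts_cst|apply: cts_max; [exact: cts_snd|exact: cts_cst]].
by apply: cts_exp; exact: along_Int_cts2 (cf_hx cf).
Qed.

Lemma Jac_gt0 t s : 0 < Jac t s.
Proof. by rewrite mulr_gt0 ?expR_gt0 // (lt_le_trans l00). Qed.

(** Finite form of the variational equation: the difference [D] of two characteristics solves
    [D' = m D], where [m] is the difference quotient of the speed and hence a value of [hx] between
    the two curves. *)
Lemma X_diff_exp t a b : Num.max b 0 <= t -> a < b -> X t a <= L ->
  exists2 m : R -> R, continuous m /\
     (forall r, Num.max b 0 <= r <= t ->
        exists2 z, X r b <= z <= X r a & m r = hx z r) &
     X t a - X t b = (X (Num.max b 0) a - X (Num.max b 0) b) * expR (Int m (Num.max b 0) t).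
Proof.
move=> bt ab XL; set s := Num.max b 0 in bt *.
pose D r := X r a - X r b.
have D0 r : 0 < D r by rewrite subr_gt0; exact: (X_lt sf).
have cD : continuous D by apply: ctsB; exact: (cts2_l (X_cts2 sf)).
pose m r := (h (X r a) r - h (X r b) r) / D r.
have ca s' : continuous (fun r => h (X r s') r).
  by apply: (cts2_app (sf_cts sf)); [exact: (cts2_l (X_cts2 sf))|exact: cts_id].
have cm : continuous m.
  apply: ctsM; first exact: ctsB.
  by apply: cts_inv => // r; rewrite gt_eqF.
exists m; first split => //.
  move=> r /andP[sr rt].
  have Xb : 0 <= X r b by apply: (X_ge0 sf).
  have Xa : X r a <= L by apply: le_trans (X_le sf a rt) XL.
  have Xab : X r b <= X r a by rewrite -subr_ge0 ltW // D0.
  have [z zab E] := cf_mv cf r Xb Xab Xa.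
  by exists z => //; rewrite /m E mulfK // gt_eqF // D0.
pose E r := D r * expR (- Int m s r).
have dE r : has_deriv E r 0.
  have dD : has_deriv D r (m r * D r).
    rewrite /m divfK ?gt_eqF //; apply: derivB; exact: (X_sol sf).
  have dx : has_deriv (fun r => expR (- Int m s r)) r (expR (- Int m s r) * - m r).
    by apply: exp_deriv; apply: is_deriveN; exact: Int_derive.
  by apply: deriv_eq (derivM dD dx) _; ring.
have : E t = E s by apply: derive_eq0 => //; exact: (@derive_cts _ E (fun=> 0) dE).
rewrite /E Int_refl oppr0 expR0 mulr1 -/(D t) -/(D s) => <-.
by rewrite -mulrA -expRD addNr expR0 mulr1.
Qed.

End Jacobian.

(** First order expansion of the gap at the later entry time. The interval [[a, b]] may contain 0;
    then its negative part is covered at rate [h 0 0], its positive part at the actual speed near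
    the corner, and the two rates agree in the limit. *)
Lemma X_start_diff (R : realType) (h hx : R -> R -> R) (K l0 l1 L : R) (cf : C1_speed_field h hx K l0 l1 L) (s0 e : R) :
  0 < e -> exists2 d : R, 0 < d & forall a b, a <= b ->
  a <= s0 <= b -> b - a < d ->
  `|flow h (Num.max b 0) a - flow h (Num.max b 0) b - h 0 (Num.max s0 0) * (b - a)| <= e * (b - a).
Proof.
have sf := cf_sf cf; have L0 := cf_L0 cf; have l00 := sf_l0 sf; have hl0 := sf_ge sf; have hl1 := sf_le sf.
move=> e0.
have [d d0 Hd] := cts2_dist 0 (Num.max s0 0) (sf_cts sf) e0.
have l1p : 0 < l1 by apply: lt_le_trans l00 (le_trans (hl0 0 0) (hl1 0 0)).
exists (Num.min d (d / (2 * l1))); first by rewrite lt_min d0 divr_gt0 // mulr_gt0.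
move=> a b ab /andP[as0 s0b]; rewrite lt_min => /andP[bad]; rewrite ltr_pdivlMr ?mulr_gt0 // => bad'.
rewrite (X_start sf b).
case: (leP b 0) => [b0|b0].
  have a0 : a <= 0 by apply: le_trans b0.
  rewrite (X_0 sf) // /bstart min_l // (max_r (le_trans s0b b0)).
  rewrite (_ : _ - _ - _ = 0); last by ring.
  by rewrite normr0 mulr_ge0 ?subr_ge0 // ltW.
rewrite /bstart (min_r (ltW b0)) mulr0 subr0.
set sa := Num.max a 0.
have sab : sa <= b by rewrite /sa ge_max ab ltW.
have [c /andP[c1 c2] Ec] := derive_mvt sab (ode_sol_cts (X_sol sf a)) (fun r _ => X_sol sf a r).
have Xsa : flow h sa a = h 0 0 * (sa - a).
  rewrite (X_start sf) /bstart /sa /Num.max /Num.min.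
  by case: ltP => ?; ring.
have aa : a <= sa by rewrite /sa le_max lexx.
have -> : flow h b a - h 0 (Num.max s0 0) * (b - a) =
   (h 0 0 - h 0 (Num.max s0 0)) * (sa - a) + (h (flow h c a) c - h 0 (Num.max s0 0)) * (b - sa).
  rewrite -[flow h b a](subrK (flow h sa a)) Ec Xsa; ring.
have l1b : 2 * l1 * (b - a) < d by rewrite mulrC.
have H1 : `|(h 0 0 - h 0 (Num.max s0 0)) * (sa - a)| <= e * (sa - a).
  rewrite normrM (ger0_norm (x := sa - a)) ?subr_ge0 //.
  case: (leP 0 a) => a0; first by rewrite (_ : sa = a) ?subrr ?mulr0 // /sa max_l.
  rewrite ler_wpM2r ?subr_ge0 // ltW //; apply: Hd; first by rewrite subrr normr0.
  have m0 : 0 <= Num.max s0 0 by rewrite le_max lexx orbT.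
  by rewrite sub0r normrN (ger0_norm m0) gt_max d0 andbT; move: as0 s0b bad a0; flra.
have H2 : `|(h (flow h c a) c - h 0 (Num.max s0 0)) * (b - sa)| <= e * (b - sa).
  rewrite normrM (ger0_norm (x := b - sa)) ?subr_ge0 //.
  rewrite ler_wpM2r ?subr_ge0 // ltW //; apply: Hd.
    have X0 : 0 <= flow h c a by exact: (X_ge0 sf).
    rewrite subr0 ger0_norm //; apply: le_lt_trans l1b.
    have /andP[_ H] := X_speed sf a c1; rewrite Xsa in H.
    have := ler_wpM2r (_ : 0 <= sa - a) (hl1 0 0); rewrite subr_ge0 => /(_ aa) H'.
    have H'' : l1 * (c - sa) <= l1 * (b - a) by rewrite ler_wpM2l ?(ltW l1p) //; move: c2 aa; flra.
    have H3 : l1 * (sa - a) <= l1 * (b - a) by rewrite ler_wpM2l ?(ltW l1p) //; move: sab; flra.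
    by move: H H' H'' H3; flra.
  move: c1 c2 sab; rewrite /sa /Num.max; case: (ltP a 0) => a0; case: (ltP s0 0) => s00 c1 c2 sab; rewrite ltr_norml; move: as0 s0b bad a0 s00 c1 c2 sab b0; clear => *; apply/andP; split; lra.
have := ler_normD ((h 0 0 - h 0 (Num.max s0 0)) * (sa - a)) ((h (flow h c a) c - h 0 (Num.max s0 0)) * (b - sa)).
by move: H1 H2; flra.
Qed.

(** The difference quotient is the product of the gap at entry, controlled by [X_start_diff], and
    the exponential factor of [X_diff_exp]. Both factors converge, and multiplication with the
    exponential is jointly continuous. *)
Lemma X_deriv_s (R : realType) (h hx : R -> R -> R) (K l0 l1 L : R) (cf : C1_speed_field h hx K l0 l1 L) t s0 :
  0 <= t -> s0 < t -> flow h t s0 < L -> has_deriv (flow h t) s0 (- Jac h hx t s0).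
Proof.
have sf := cf_sf cf; have L0 := cf_L0 cf; have l00 := sf_l0 sf; have hl0 := sf_ge sf; have hl1 := sf_le sf.
move=> t0 s0t XL; apply: is_derive_dist => e e0.
set S0 := Num.max s0 0.
have S0t : S0 <= t by rewrite ge_max t0 ltW.
pose I0 := Int (fun r => hx (flow h r s0) r) S0 t.
have cprod : cts2 (fun u v : R => u * expR v).
  by apply: ctsM; [exact: cts_fst|apply: cts_exp; exact: cts_snd].
have [e1 e1p He1] := cts2_dist (h 0 S0) I0 cprod e0.
have e12 : 0 < e1 / 2 by rewrite divr_gt0.
have [d1 d1p Hd1] := X_start_diff cf s0 e12.
(* r ranges over [S0, t] and z over [0, L] below *)
pose M := L + t.
have cX0 : cts2 (fun z r => hx z r) by exact: (cf_hx cf).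
have e3p : 0 < e1 / 4 / (t + 1) by rewrite !divr_gt0 // ltr_wpDl.
have [d2 d2p Hd2] := cts2_unif M cX0 e3p.
have [B B0 HB] := cts2_bounded M cX0.
have l1p : 0 < l1 by apply: lt_le_trans l00 (le_trans (hl0 0 0) (hl1 0 0)).
pose C := 2 * l1 * expR (K * t).
have Cp : 0 < C by rewrite /C !mulr_gt0 ?expR_gt0.
have LX : 0 < L - flow h t s0 by rewrite subr_gt0.
have [d3 d3p Hd3] := cts_dist s0 (@cts2_r _ _ t (X_cts2 sf)) LX.
have d4p : 0 < e1 / 8 / (B + 1) by rewrite !divr_gt0 // ltr_wpDl.
exists (Num.min (Num.min d1 (d2 / (2 * C))) (Num.min (Num.min d3 (t - s0)) (e1 / 8 / (B + 1)))).
  by rewrite !lt_min d1p d3p d4p subr_gt0 s0t !divr_gt0 // mulr_gt0.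
move=> s sne; rewrite !lt_min => /andP[/andP[sd1 sd2] /andP[/andP[sd3 st] sd4]].
have XsL : flow h t s < L.
  by rewrite -(ltrD2r (- flow h t s0)); exact: le_lt_trans (ler_norm _) (Hd3 s sd3).
have sst : s < t by rewrite -(ltrD2r (- s0)); exact: le_lt_trans (ler_norm _) st.
(* [a, b] is the interval between s and s0 *)
have main a b : a < b -> a <= s0 <= b -> b < t -> flow h t a < L -> b - a = `|s - s0| ->
    `|flow h t a - flow h t b - Jac h hx t s0 * (b - a)| <= e * (b - a).
  move=> ab /andP[as0 s0b] bt XaL Eba.
  set S := Num.max b 0.
  have S0S : S0 <= S by rewrite /S0 /S ge_max !le_max s0b lexx orbT.
  have St : S <= t by rewrite ge_max t0 ltW.
  have SS : S - S0 <= b - a.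
    have := le_trans (ler_norm _) (max_lip b s0 0).
    rewrite -/S -/S0 (ger0_norm (x := b - s0)) ?subr_ge0 // => /le_trans; apply.
    by rewrite lerD2l lerN2.
  have Sn : 0 <= S0 by rewrite le_max lexx orbT.
  have [m [cm Hm] E] := X_diff_exp cf St ab (ltW XaL).
  have H1 := Hd1 a b (ltW ab) _ _; rewrite as0 s0b Eba in H1; have {}H1 := H1 isT sd1.
  have ba0 : 0 < b - a by rewrite subr_gt0.
  pose u := (flow h S a - flow h S b) / (b - a).
  have uE : flow h S a - flow h S b = u * (b - a) by rewrite divfK // gt_eqF.
  have Hu : `|u - h 0 S0| < e1.
    rewrite -(ltr_pM2r ba0) -{1}(ger0_norm (ltW ba0)) -normrM mulrBl -uE.
    rewrite -Eba in H1; apply: le_lt_trans H1 _; rewrite ltr_pM2r //; move: e1p; clear; lra.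
  have ch0 : continuous (fun r => hx (flow h r s0) r) by exact: (@cts2_r _ _ s0 (along_cts2 cf (cf_hx cf))).
  have inM r : S0 <= r <= t -> `|r| <= M.
    by move=> /andP[r1 r2]; rewrite ger0_norm /M ?(le_trans Sn) //; move: L0 r2; clear; lra.
  have X0L r : S0 <= r <= t -> 0 <= flow h r s0 <= L.
    move=> /andP[r1 r2]; rewrite (X_ge0 sf) //=.
    by apply: le_trans (X_le sf s0 r2) (ltW XL).
  have inL z : 0 <= z <= L -> `|z| <= M by move=> /andP[zz1 zz2]; rewrite ger0_norm /M //; move: t0 zz2; clear; lra.
  (* [m r] is a value of [hx] between the curves of [a] and [b], which enclose the curve of [s0] and
     are close together. The two integrals start at [S] and [S0]; the missing piece has length at
     most [b - a]. *)
  have Hv : `|Int m S t - I0| < e1.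
    rewrite /I0 -(Int_chasles _ S0 S t).
    have -> : Int m S t - (Int (fun r => hx (flow h r s0) r) S0 S + Int (fun r => hx (flow h r s0) r) S t) =
       Int (fun r => m r - hx (flow h r s0) r) S t - Int (fun r => hx (flow h r s0) r) S0 S.
      by rewrite IntB //; ring.
    apply: le_lt_trans (ler_normB _ _) _.
    have H2 : `|Int (fun r => m r - hx (flow h r s0) r) S t| <= e1 / 4 / (t + 1) * (t - S).
      apply: Int_bound => //; first exact: ctsB.
      move=> r /andP[Sr rt]; have rM : S0 <= r <= t by rewrite rt (le_trans S0S).
      have [z /andP[z1 z2] ->] := Hm r (introT andP (conj Sr rt)).
      apply/ltW/Hd2; [apply: inL|apply: inL|exact: inM|exact: inM| |by rewrite subrr normr0].
      - apply/andP; split; first by apply: le_trans z1; exact: (X_ge0 sf).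
        by apply: le_trans z2 _; apply: le_trans (X_le sf a rt) (ltW XaL).
      - exact: X0L.
      have Xa0 : flow h r s0 <= flow h r a by rewrite (X_leE sf).
      have X0b : flow h r b <= flow h r s0 by rewrite (X_leE sf).
      have Xab : `|flow h r a - flow h r b| < d2.
        apply: le_lt_trans (X_lip_s sf r a b) _; rewrite -/S.
        have -> : `|a - b| = `|s - s0| by rewrite distrC ger0_norm ?subr_ge0 // ltW.
        have C2 : 0 < 2 * C by rewrite mulr_gt0.
        rewrite ltr_pdivlMr // in sd2.
        have : expR (K * `|r - S|) <= expR (K * t).
          rewrite ler_expR ler_wpM2l ?(ltW (sf_K0 sf)) // ger0_norm ?subr_ge0 //.
          by move: rt Sr S0S Sn; clear; lra.
        have p0 : 0 <= 2 * l1 * `|s - s0| by rewrite mulr_ge0 // mulr_ge0 // ltW.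
        have p1 : 0 <= `|s - s0| * C by rewrite mulr_ge0 // ltW.
        move=> /(ler_wpM2l p0).
        have -> : 2 * l1 * `|s - s0| * expR (K * t) = `|s - s0| * C by rewrite /C; ring.
        by move: sd2 p1; clear; lra.
      have {}Xab := le_lt_trans (ler_norm _) Xab.
      by rewrite ltr_norml; move: Xab Xa0 X0b z1 z2; clear => *; apply/andP; split; lra.
    have H3 : `|Int (fun r => hx (flow h r s0) r) S0 S| <= B * (S - S0).
      apply: Int_bound => // r /andP[r1 r2]; apply: HB.
        by apply/inL/X0L; rewrite r1 (le_trans r2).
      by apply: inM; rewrite r1 (le_trans r2).
    have H4 : e1 / 4 / (t + 1) * (t - S) <= e1 / 4.
      rewrite mulrAC ler_pdivrMr; last by move: t0; clear; lra.
      by rewrite ler_wpM2l //; [rewrite divr_ge0 // ltW|move: Sn S0S; clear; lra].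
    have H5 : B * (S - S0) <= e1 / 8.
      apply: le_trans (_ : (B + 1) * (S - S0) <= _); first by rewrite ler_wpM2r ?subr_ge0 // lerDl.
      rewrite mulrC -ler_pdivlMr; last by move: B0; clear; lra.
      by apply: le_trans SS _; rewrite Eba ltW.
    by move: H2 H3 H4 H5 e1p; clear; lra.
  have := He1 u (Int m S t) Hu Hv.
  have -> : flow h t a - flow h t b - Jac h hx t s0 * (b - a) = (u * expR (Int m S t) - h 0 S0 * expR I0) * (b - a).
    by rewrite E -/S uE /Jac -/S0 -/I0; ring.
  rewrite normrM (ger0_norm (ltW ba0)) => /ltW H.
  by rewrite ler_wpM2r // ltW.
case: (ltgtP s s0) sne => // ss _.
  have := main s s0 ss _ s0t XsL; rewrite lexx (ltW ss) => /(_ isT).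
  rewrite distrC ger0_norm ?subr_ge0 ?(ltW ss) // => /(_ erefl).
  congr (_ <= _); congr (`| _ |); ring.
have := main s0 s ss _ sst XL; rewrite lexx (ltW ss) => /(_ isT).
rewrite ger0_norm ?subr_ge0 ?(ltW ss) // => /(_ erefl).
rewrite -normrN; congr (_ <= _); congr (`| _ |); ring.
Qed.

(** Substitution [x = X t s]. The parameters in [[- A, foot L t]] lie to the right of [L] and those
    in [[t, T]] to the left of 0, where [F] vanishes, so one fixed range of parameters serves for
    all times [t]. *)
Lemma Int_flow_subst (R : realType) (h hx : R -> R -> R) (K l0 l1 L : R) (cf : C1_speed_field h hx K l0 l1 L)
  (F : R -> R) (t A T : R) : continuous F ->
  (forall x, x <= 0 -> F x = 0) -> (forall x, L <= x -> F x = 0) ->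
  0 <= t <= T -> L <= h 0 0 * A ->
  Int F 0 L = Int (fun s => F (flow h t s) * Jac h hx t s) (- A) T.
Proof.
have sf := cf_sf cf; have L0 := cf_L0 cf; have l00 := sf_l0 sf; have hl0 := sf_ge sf; have hl1 := sf_le sf.

move=> cF F0 FL /andP[t0 tT] LA.
have h0 : 0 < h 0 0 by apply: lt_le_trans l00 _.
have A0 : 0 <= A by rewrite -(ler_pM2l h0) mulr0 (le_trans (ltW L0)).
have cX : continuous (flow h t) by exact: (@cts2_r _ _ t (X_cts2 sf)).
have cG : continuous (fun s => F (flow h t s) * Jac h hx t s).
  by apply: ctsM; [exact: (cts_app cF)|exact: (@cts2_r _ _ t (Jac_cts2 cf))].
pose sL := foot h L t.
have XsL : flow h t sL = L by exact: (X_foot sf).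
have AsL : - A <= sL.
  rewrite -(X_leE sf t) XsL; apply: le_trans (X_le sf (- A) t0).
  by rewrite (X_0 sf) ?oppr_le0 // mulrNN.
have sLt : sL < t by rewrite -(X_ltE sf t) XsL (X_diag sf).
rewrite -(Int_chasles _ (- A) sL T) -(Int_chasles _ sL t T).
have z1 : Int (fun s => F (flow h t s) * Jac h hx t s) (- A) sL = 0.
  rewrite (@Int_ext _ _ (fun=> 0)) // ?Int_cst ?mul0r //; first exact: cts_cst.
  by move=> s /andP[_ /ltW ss]; rewrite FL ?mul0r // -XsL (X_leE sf).
have z2 : Int (fun s => F (flow h t s) * Jac h hx t s) t T = 0.
  rewrite (@Int_ext _ _ (fun=> 0)) // ?Int_cst ?mul0r //; first exact: cts_cst.
  by move=> s /andP[/ltW ss _]; rewrite F0 ?mul0r // -(X_diag sf t0) (X_leE sf).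
rewrite z1 z2 add0r addr0.
rewrite (@Int_subst _ (fun x => - F x) (flow h t) (fun s => - Jac h hx t s) (fun s => F (flow h t s) * Jac h hx t s) sL t) //.
- by rewrite XsL (X_diag sf) // IntN // (Int_opp F 0 L) opprK.
- exact: ltW.
- exact: ctsN.
- by move=> s /andP[s1 s2]; apply: (X_deriv_s cf) => //; rewrite -XsL (X_ltE sf).
- by move=> s _; rewrite mulrNN.
Qed.

(** * Characteristics and solutions in terms of the flow *)

Section OneSidedDerivatives.
Variable R : realType.
Implicit Types (A : set R) (g : R -> R) (x l : R).

Lemma derive_within_dist A g x l : derive_within A g x l -> forall e : R, 0 < e ->
  exists2 d : R, 0 < d & forall y, A y -> y != x -> `|y - x| < d ->
    `|g y - g x - l * (y - x)| <= e * `|y - x|.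
Proof.
move=> /cvgrPdist_le H e e0; have := H e e0.
rewrite !near_withinE => /nbhs_ballP[d /= d0 Hd]; exists d => // y Ay yx yd.
have := Hd y; rewrite /ball /= distrC => /(_ yd yx Ay).
have yx0 : 0 < `|y - x| by rewrite normr_gt0 subr_eq0.
by rewrite -(ler_pM2r yx0) -normrM mulrBl divfK ?subr_eq0 // (distrC (l * _)).
Qed.

Lemma dist_derive_within A g x l : (forall e : R, 0 < e ->
  exists2 d : R, 0 < d & forall y, A y -> y != x -> `|y - x| < d ->
    `|g y - g x - l * (y - x)| <= e * `|y - x|) -> derive_within A g x l.
Proof.
move=> H; apply/cvgrPdist_le => e e0; have [d d0 Hd] := H e e0.
rewrite !near_withinE; apply/nbhs_ballP; exists d => //= y; rewrite /ball /= distrC => yd yx Ay.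
have yx0 : 0 < `|y - x| by rewrite normr_gt0 subr_eq0.
by rewrite -(ler_pM2r yx0) -normrM mulrBl divfK ?subr_eq0 // (distrC (l * _)) Hd.
Qed.

Lemma has_deriv_dist g x l : has_deriv g x l -> forall e : R, 0 < e ->
  exists2 d : R, 0 < d & forall y, `|y - x| < d ->
    `|g y - g x - l * (y - x)| <= e * `|y - x|.
Proof.
move=> dg e e0; have [D E] := dg.
have : h^-1 *: ((g \o shift x) h%:A - g x) @[h --> 0^'] --> l by rewrite -E; exact: D.
move=> /cvgrPdist_le /(_ e e0); rewrite near_withinE => /nbhs_ballP[d /= d0 Hd].
exists d => // y yd; case: (eqVneq y x) => [->|yx]; first by rewrite !subrr mulr0 subrr normr0 mulr0.
have yx0 : 0 < `|y - x| by rewrite normr_gt0 subr_eq0.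
have := Hd (y - x); rewrite /ball /= sub0r normrN => /(_ yd); rewrite subr_eq0 => /(_ yx).
rewrite [_ *: 1]mulr1 subrK => H.
have {}H : `|l - (y - x)^-1 * (g y - g x)| <= e by [].
rewrite -(ler_pM2r yx0) -normrM mulrBl mulrAC mulVf ?mul1r ?subr_eq0 // in H.
by rewrite distrC.
Qed.

Lemma derive_within_itv (g g' : R -> R) (a b x l : R) : a < x < b ->
  (forall y, a <= y <= b -> g' y = g y) -> derive_within `[a, b] g x l -> has_deriv g' x l.
Proof.
move=> /andP[ax xb] E H; apply: is_derive_dist => e e0.
have [d d0 Hd] := derive_within_dist H e0.
exists (Num.min d (Num.min (x - a) (b - x))); first by rewrite !lt_min d0 !subr_gt0 ax.
move=> y yx; rewrite !lt_min => /and3P[yd ya yb].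
have ay : a <= y by have := ler_norm (x - y); rewrite (distrC x); lra.
have yb' : y <= b by have := ler_norm (y - x); lra.
rewrite !E ?ay //; last by rewrite !ltW.
by apply: Hd => //=; rewrite in_itv /= ay.
Qed.

Definition clamp (a b x : R) : R := Num.min (Num.max x a) b.

Lemma clamp_itv a b x : a <= b -> a <= clamp a b x <= b.
Proof. by move=> ab; rewrite /clamp le_min le_max lexx orbT ab ge_min lexx orbT. Qed.

Lemma clamp_id a b x : a <= x <= b -> clamp a b x = x.
Proof. by move=> /andP[ax xb]; rewrite /clamp max_l // min_l. Qed.

Lemma clamp_cts a b : continuous (clamp a b).
Proof. by apply: cts_min; [apply: cts_max; cts|cts]. Qed.

Lemma clamp_dist a b x y : `|clamp a b x - clamp a b y| <= `|x - y|.
Proof. exact: le_trans (min_lip _ _ _) (max_lip _ _ _). Qed.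

(** A curve known only on [[a, b]], with one-sided derivatives at the ends, becomes a continuous
    function on the line after clamping its argument; results stated for functions on the line then
    apply to it. *)
Lemma derive_within_cts (g : R -> R) (a b : R) : a <= b ->
  (forall x, a <= x <= b -> exists l, derive_within `[a, b] g x l) ->
  continuous (g \o clamp a b).
Proof.
move=> ab H; apply: cts_distP => x e e0.
have cI := clamp_itv x ab; have [l Hl] := H _ cI.
have [d d0 Hd] := derive_within_dist Hl ltr01.
have L1 : 0 < `|l| + 1 by rewrite ltr_wpDl.
exists (Num.min d (e / (`|l| + 1))); first by rewrite lt_min d0 divr_gt0.
move=> y; rewrite lt_min ltr_pdivlMr // => /andP[yd ye] /=.
set u := clamp a b y; set v := clamp a b x.
have uv : `|u - v| <= `|y - x| by exact: clamp_dist.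
case: (eqVneq u v) => [->|uv']; first by rewrite subrr normr0 ltW.
have := Hd u _ uv' (le_lt_trans uv yd); rewrite /= in_itv /= clamp_itv // => /(_ isT).
have := ler_normD (g u - g v - l * (u - v)) (l * (u - v)); rewrite subrK normrM.
have := ler_wpM2l (ltW L1) uv; have := normr_ge0 (u - v); have := normr_ge0 l.
by move: ye; clear; nra.
Qed.

End OneSidedDerivatives.

(** * Extension of functions from the box to the plane *)

Section ClampedSpeed.
Variables (R : realType) (L T : R) (lam : R * R -> R).
Hypotheses (L0 : 0 < L) (T0 : 0 < T).

Definition cbox (x t : R) : R * R := (clamp 0 L x, clamp 0 T t).
(** Composition with the projection onto the compact box: a function continuous on the closed strip
    becomes bounded and continuous on the whole plane, unchanged on the box. *)
Definition ext (z : R * R -> R) (x t : R) : R := z (cbox x t).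

Lemma cbox_Pibar x t : Pibar L (cbox x t).
Proof.
have /andP[x0 xL] := clamp_itv x (ltW L0); have /andP[t0 tT] := clamp_itv t (ltW T0).
by split; rewrite /= ?x0.
Qed.

Lemma cbox_cts : continuous (fun q : R * R => cbox q.1 q.2).
Proof.
apply: (@cts_pair R _ (fun q => clamp 0 L q.1) (fun q => clamp 0 T q.2)).
  exact: (@cts_app R _ _ (fun q : R * R => q.1) _ (@clamp_cts _ 0 L) (@cts_fst R)).
exact: (@cts_app R _ _ (fun q : R * R => q.2) _ (@clamp_cts _ 0 T) (@cts_snd R)).
Qed.

Lemma ext_cts2 z : {within Pibar L, continuous z} -> cts2 (ext z).
Proof.
move=> cz; apply: (@within_comp _ _ _ (Pibar L) z (fun q : R * R => cbox q.1 q.2)) => //.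
  exact: cbox_cts.
by move=> q; exact: cbox_Pibar.
Qed.

Lemma ext_id z x t : 0 <= x <= L -> 0 <= t <= T -> ext z x t = z (x, t).
Proof. by move=> xL tT; rewrite /ext /cbox !clamp_id. Qed.

Lemma ext_ext z x t : ext z (clamp 0 L x) (clamp 0 T t) = ext z x t.
Proof. by rewrite /ext /cbox !(clamp_id (clamp_itv _ (ltW L0))) !(clamp_id (clamp_itv _ (ltW T0))). Qed.

Lemma ext_bounded z : {within Pibar L, continuous z} ->
  exists2 B : R, 0 <= B & forall x t, `|ext z x t| <= B.
Proof.
move=> /ext_cts2/(cts2_bounded (L + T))[B B0 HB]; exists B => // x t.
rewrite -ext_ext; apply: HB.
  by have /andP[c0 c1] := clamp_itv x (ltW L0); rewrite ger0_norm // (le_trans c1) // ?lerDl ?lerDr ltW.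
by have /andP[c0 c1] := clamp_itv t (ltW T0); rewrite ger0_norm // (le_trans c1) // ?lerDl ?lerDr ltW.
Qed.

(** The Lipschitz constant comes from the bound on [lamx] over the box, the lower bound on the speed
    from a bound [M] on [1 / lam], which is continuous there. Adding 1 makes both constants
    positive. *)
Lemma C1_Pibar_speed_field : C1_Pibar L lam -> (forall q, Pibar L q -> 0 < lam q) ->
  exists (hx : R -> R -> R) (K l0 l1 : R), C1_speed_field (ext lam) hx K l0 l1 L.
Proof.
move=> [cl [lamx [lamt [clx _ dl]]]] lp.
have ch := ext_cts2 cl; have chx := ext_cts2 clx.
have hp x t : 0 < ext lam x t by apply: lp; exact: cbox_Pibar.
have [l1 l1p Hl1] := ext_bounded cl.
have [B B0 HB] := ext_bounded clx.
have ci : cts2 (fun x t => (ext lam x t)^-1).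
  by apply: cts_inv => // q; rewrite gt_eqF.
have [M M0 HM] := cts2_bounded (L + T) ci.
have mv t x y : 0 <= x -> x <= y -> y <= L ->
    exists2 z, x <= z <= y & ext lam y t - ext lam x t = ext lamx z t * (y - x).
  move=> x0 xy yL; apply: (@derive_mvt _ (fun y => ext lam y t) (fun z => ext lamx z t)) => //; first exact: cts2_l.
  move=> z /andP[xz zy].
  have zI : 0 < z < L by rewrite (le_lt_trans x0 xz) (lt_le_trans zy yL).
  have Pz : Pibar L (z, clamp 0 T t).
    by case/andP: zI => ? ?; have /andP[? ?] := clamp_itv t (ltW T0); split; rewrite //= !ltW.
  have [D _] := dl _ _ Pz.
  have -> : ext lamx z t = lamx (z, clamp 0 T t).
    by rewrite /ext /cbox clamp_id //; case/andP: zI => ? ?; rewrite !ltW.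
  apply: derive_within_itv zI _ D => w wL.
  by rewrite /ext /cbox clamp_id.
exists (ext lamx), (B + 1), (M + 1)^-1, l1; split => //; split => //.
- by rewrite ltr_wpDl.
- move=> x y t; rewrite -(ext_ext lam x) -(ext_ext lam y).
  set u := clamp 0 L x; set v := clamp 0 L y; set s := clamp 0 T t.
  have uv : `|u - v| <= `|x - y| by exact: clamp_dist.
  have key a b : 0 <= a -> a <= b -> b <= L -> `|ext lam b s - ext lam a s| <= (B + 1) * (b - a).
    move=> a0 ab bL; have [z _ ->] := mv s a b a0 ab bL.
    rewrite normrM (ger0_norm (x := b - a)) ?subr_ge0 // ler_wpM2r ?subr_ge0 //.
    by apply: le_trans (HB _ _) _; rewrite lerDl.
  have B1 : 0 <= B + 1 by rewrite addr_ge0.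
  apply: le_trans (ler_wpM2l B1 uv).
  have /andP[u0 uL] := clamp_itv x (ltW L0); have /andP[v0 vL] := clamp_itv y (ltW L0).
  case: (leP u v) => [le_uv|/ltW le_vu].
    by rewrite distrC (distrC u) (ger0_norm (x := v - u)) ?subr_ge0 //; exact: key.
  by rewrite (ger0_norm (x := u - v)) ?subr_ge0 //; exact: key.
- by rewrite invr_gt0 ltr_wpDl.
- move=> x t; rewrite -ext_ext; set u := clamp 0 L x; set s := clamp 0 T t.
  have := HM u s.
  have -> : `|u| <= L + T by have /andP[c0 c1] := clamp_itv x (ltW L0); rewrite ger0_norm // (le_trans c1) // ?lerDl ?lerDr ltW.
  have -> : `|s| <= L + T by have /andP[c0 c1] := clamp_itv t (ltW T0); rewrite ger0_norm // (le_trans c1) // ?lerDl ?lerDr ltW.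
  move=> /(_ isT isT); rewrite ger0_norm ?invr_ge0 ?(ltW (hp _ _)) // => H.
  rewrite -[X in _ <= X]invrK lef_pV2 ?posrE ?invr_gt0 ?hp //; last by rewrite ltr_wpDl.
  by apply: le_trans H _; rewrite lerDl.
- by move=> x t; apply: le_trans (ler_norm _) (Hl1 _ _).
Qed.

End ClampedSpeed.

(** * Characteristics, [theta], [omega] and solutions expressed through the flow *)

Section CharacteristicsOfFlow.
Variables (R : realType) (L T K l0 l1 : R) (lam : R * R -> R).
Hypotheses (L0 : 0 < L) (T0 : 0 < T).
Local Notation h := (ext L T lam).
Hypothesis sf : speed_field h K l0 l1.
Local Notation X := (flow h).
Local Notation foot := (foot h).

(** This translates every statement about characteristics into one about parameters. A curve
    witnessing [on_char] solves the equation of the flow after clamping its argument, so it is a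
    flow line by [ode_stab]. *)
Lemma on_char_foot q q' : q.2 <= T -> q'.2 <= T ->
  on_char L lam q q' <-> [/\ Pibar L q, Pibar L q' & foot q.1 q.2 = foot q'.1 q'.2].
Proof.
case: q => x t; case: q' => x' t' /= tT t'T.
have hlam y s : Pibar L (y, s) -> s <= T -> h y s = lam (y, s).
  by move=> [/= yL s0] sT; rewrite ext_id // s0.
set a := Num.min t t'; set b := Num.max t t'.
have ab : a <= b by rewrite /a /b /Num.min /Num.max; case: ltP => // /ltW.
have aE : a = t \/ a = t' by rewrite /a /Num.min; case: ltP; [left|right].
have ta : a <= t <= b by rewrite /a /b ge_min le_max !lexx.
have ta' : a <= t' <= b by rewrite /a /b ge_min le_max !lexx !orbT.
have bT : b <= T by rewrite ge_max tT t'T.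
split.
  move=> [c [/= ct ct' Hc]].
  have Jin s : a <= s <= b -> Pibar L (c s, s) /\ derive_within `[a, b] c s (lam (c s, s)).
    by move=> sab; apply: Hc; rewrite /= in_itv.
  have Pq : Pibar L (x, t) by rewrite -ct; exact: (Jin t ta).1.
  have Pq' : Pibar L (x', t') by rewrite -ct'; exact: (Jin t' ta').1.
  split => //; pose c' := c \o clamp a b.
  have c'E s : a <= s <= b -> c' s = c s by move=> sab; rewrite /c' /= clamp_id.
  have cc' : continuous c'.
    apply: derive_within_cts ab _ => s sab; exists (lam (c s, s)); exact: (Jin s sab).2.
  have dc' s : a < s < b -> has_deriv c' s (h (c' s) s).
    move=> sab; have sab' : a <= s <= b by case/andP: sab => ? ?; rewrite !ltW.
    have [Ps Ds] := Jin s sab'.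
    rewrite (c'E _ sab') hlam //; last by case/andP: sab' => _ /le_trans; apply.
    exact: derive_within_itv sab _ Ds.
  have sX := X_sol sf (foot x t).
  have [H1 H2] := ode_stab (sf_lip sf) ab cc' (ode_sol_cts sX) dc' (fun s _ => sX s).
  have Xt : X t (foot x t) = x by exact: (X_foot sf).
  suff : c' t' = X t' (foot x t).
    by rewrite c'E // ct' => ->; rewrite (foot_X sf).
  have z (u v : R) : u = v -> `|u - v| = 0 by move=> ->; rewrite subrr normr0.
  have z' (u v k : R) : `|u - v| <= 0 * k -> u = v.
    by rewrite mul0r normr_le0 subr_eq0 => /eqP.
  have ctX : c' t = X t (foot x t) by rewrite c'E // ct.
  move: ta ta' H1 H2 ctX; rewrite /a /b /Num.min /Num.max; case: ltP => tt' _ _ H1 H2 E.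
    by apply: (z' _ _ (expR (K * (t' - t)))); rewrite -(z _ _ E).
  by apply: (z' _ _ (expR (K * (t - t')))); rewrite -(z _ _ E).
(* The flow line itself is the required curve. It increases in time, so it stays in the closed strip
   between its two end points, which lie there. *)
move=> [Pq Pq' E]; exists (X^~ (foot x t)).
have Xt : X t (foot x t) = x by exact: (X_foot sf).
have Xt' : X t' (foot x t) = x' by rewrite E (X_foot sf).
split => //= s; rewrite in_itv /= -/a -/b => /andP[as_ sb].
have Pa : 0 <= X a (foot x t) /\ 0 <= a.
  by case: Pq Pq' => /= /andP[? ?] ? [/= /andP[? ?] ?]; case: aE => ->; rewrite ?Xt ?Xt'.
have Pb : X b (foot x t) <= L.
  rewrite /b /Num.max; case: Pq Pq' => /= /andP[? ?] ? [/= /andP[? ?] ?].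
  by case: ltP => _; rewrite ?Xt ?Xt'.
have Ps : Pibar L (X s (foot x t), s).
  split => /=; last by apply: le_trans as_; exact: Pa.2.
  by rewrite (le_trans Pa.1 (X_le sf _ as_)) (le_trans (X_le sf _ sb)).
split => //; apply: dist_derive_within => e e0.
have := X_sol sf (foot x t) s; rewrite hlam // ?(le_trans sb) // => /has_deriv_dist/(_ e e0)[d d0 Hd].
by exists d => // y _ _; exact: Hd.
Qed.

(** At the entry time the curve is on the boundary. A point of it at an earlier nonnegative time
    would lie to the left of the axis, hence outside the closed strip. *)
Lemma theta_foot x t : 0 <= x <= L -> 0 <= t <= T -> theta L lam (x, t) = Num.max (foot x t) 0.
Proof.
move=> /andP[x0 xL] /andP[t0 tT]; set s := foot x t.
have st : Num.max s 0 <= t by rewrite ge_max t0 andbT; exact: (foot_le sf).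
have s0 : 0 <= Num.max s 0 by rewrite le_max lexx orbT.
have Pq : Pibar L (x, t) by split; rewrite //= x0.
have Xs : X t s = x by exact: (X_foot sf).
have P0 : Pibar L (X (Num.max s 0) s, Num.max s 0).
  split => //=; rewrite (X_ge0 sf) //=.
  by apply: le_trans (X_le sf _ st) _; rewrite Xs.
have oc r y : 0 <= r -> r <= t -> on_char L lam (x, t) (y, r) -> y = X r s.
  move=> r0 rt /on_char_foot[] //=; first exact: le_trans tT.
  by move=> _ _ E; rewrite /s E (X_foot sf).
rewrite /theta; set S := [set _ | _].
have Smem : S (Num.max s 0).
  have o : on_char L lam (x, t) (X (Num.max s 0) s, Num.max s 0).
    by apply/on_char_foot => //=; [exact: le_trans tT|split => //; rewrite (foot_X sf)].
  have E : omega L lam (Num.max s 0) (x, t) = X (Num.max s 0) s.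
    apply: oc => //; rewrite /omega; exact: (getPex (ex_intro [set xi | on_char L lam (x, t) (xi, Num.max s 0)] _ o)).
  split => //; first by exists (X (Num.max s 0) s).
  rewrite E; split => //; case=> /= /andP[H _] H'.
  move: H H'; rewrite (X_start sf) /bstart; case: (leP s 0) => ss; first by rewrite ltxx.
  by rewrite mulr0 ltxx.
have Slb r : S r -> Num.max s 0 <= r.
  move=> [r0 [y o] _]; case: (leP r t) => [rt|/ltW]; last exact: le_trans.
  have yE := oc _ _ r0 rt o.
  have : Pibar L (y, r) by have /on_char_foot[] := o => //=; exact: le_trans tT.
  case=> /= /andP[y0 _] _; rewrite ge_max r0 andbT leNgt; apply/negP => rs.
  have sp : 0 <= s by rewrite (le_trans r0) // ltW.
  by have := X_strict sf s rs; rewrite (X_diag sf) // -yE ltNge y0.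
apply/eqP; rewrite eq_le; apply/andP; split.
  by apply: ge_inf => //; exists (Num.max s 0) => r /Slb.
by apply: lb_le_inf; [exists (Num.max s 0)|move=> r /Slb].
Qed.

Lemma omega_flow x t r : 0 <= x <= L -> 0 <= t <= T -> Num.max (foot x t) 0 <= r <= t ->
  omega L lam r (x, t) = X r (foot x t).
Proof.
move=> /andP[x0 xL] /andP[t0 tT] /andP[sr rt].
have r0 : 0 <= r by apply: le_trans sr; rewrite le_max lexx orbT.
have o : on_char L lam (x, t) (X r (foot x t), r).
  apply/on_char_foot => //=; first exact: le_trans tT.
  split; [by split; rewrite //= x0| |by rewrite (foot_X sf)].
  split => //=; rewrite (X_ge0 sf) //=; apply: le_trans (X_le sf _ rt) _.
  by rewrite (X_foot sf).
have : on_char L lam (x, t) (omega L lam r (x, t), r).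
  exact: (getPex (ex_intro [set xi | on_char L lam (x, t) (xi, r)] _ o)).
move=> /on_char_foot[] //=; first exact: le_trans tT.
by move=> _ _ ->; rewrite (X_foot sf).
Qed.

(** The integral equation read along one fixed characteristic. The parameter 0 goes with the initial
    data, in agreement with the test [theta q == 0] in [bc_term]. *)
Lemma solution_flow (g : R * R * R -> R) (z0 hb : R -> R) (z : R * R -> R) :
  is_solution L lam g z0 hb z -> forall t s (G : R -> R), continuous G ->
  (forall r, Num.max s 0 <= r <= t -> G r = g (X r s, r, z (X r s, r))) ->
  Num.max s 0 <= t -> t <= T -> X t s <= L ->
  ext L T z (X t s) t = (if s <= 0 then z0 (bstart h s) else hb s) + Int G (Num.max s 0) t.
Proof.
move=> [_ Hz] t s G cG GE st tT XL.
have t0 : 0 <= t by apply: le_trans st; rewrite le_max lexx orbT.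
have XI : 0 <= X t s <= L by rewrite (X_ge0 sf).
have tI : 0 <= t <= T by rewrite t0.
have PX : Pibar L (X t s, t) by split.
rewrite ext_id // Hz // /bc_term theta_foot // (foot_X sf); congr (_ + _).
  have -> : (Num.max s 0 == 0) = (s <= 0).
    by rewrite eq_le le_max lexx orbT andbT ge_max lexx andbT.
  case: ifP => s0; last by rewrite max_l // leNgt; apply/negP => /ltW; rewrite s0.
  rewrite omega_flow // (foot_X sf) ?(max_r s0) ?lexx //.
  by have := X_start sf s; rewrite (max_r s0) => ->.
apply: Int_Rintegral => // r rI.
by rewrite omega_flow // (foot_X sf) // GE.
Qed.

Lemma solution_initial (g : R * R * R -> R) (z0 hb : R -> R) (z : R * R -> R) y :
  is_solution L lam g z0 hb z -> 0 <= y <= L -> z (y, 0) = z0 y.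
Proof.
move=> [_ Hz] yL.
have h0 : 0 < h 0 0 by apply: lt_le_trans (sf_l0 sf) (sf_ge sf _ _).
have T0' : (0 : R) <= 0 <= T by rewrite lexx ltW.
have fs : foot y 0 <= 0 by apply: (foot_le sf) => //; case/andP: yL.
have PY : Pibar L (y, 0) by split => /=.
rewrite Hz // /bc_term theta_foot // max_r // eqxx omega_flow //; last by rewrite max_r // lexx.
rewrite (X_foot sf) set_itv1 Rintegral_set1 addr0 //.
Qed.

Lemma solution_boundary (g : R * R * R -> R) (z0 hb : R -> R) (z : R * R -> R) s :
  is_solution L lam g z0 hb z -> 0 < s <= T -> z (0, s) = hb s.
Proof.
move=> [_ Hz] /andP[s0 sT].
have L0' : (0 : R) <= 0 <= L by rewrite lexx ltW.
have sI : 0 <= s <= T by rewrite ltW.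
have PY : Pibar L (0, s) by split => //=; rewrite ltW.
rewrite Hz // /bc_term theta_foot // (foot_0 sf) ?(ltW s0) // max_l ?(ltW s0) // gt_eqF //.
by rewrite set_itv1 Rintegral_set1 addr0.
Qed.

End CharacteristicsOfFlow.

(** * Mollifiers *)

Section Mollifiers.
Variables (R : realType) (phi : R -> R).

Record bump_profile : Prop := BumpProfile {
  bp_cts : continuous phi;
  bp_supp : forall x, 1 < `|x| -> phi x = 0;
  bp_int : Int phi (- 1) 1 = 1 }.

Lemma mollifier_profile : mollifier phi -> bump_profile.
Proof.
move=> [[sm _ _] sp int1]; have cphi : continuous phi by exact: (sm [::]).1.
have z x : 1 < `|x| -> phi x = 0.
  move=> x1; apply/eqP; apply: contraTT x1 => px; rewrite -leNgt.
  have : supp phi x by exact: subset_closure.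
  by move=> /sp; rewrite /= in_itv /= -ler_norml.
split => //; etransitivity; last exact: int1.
rewrite -(@Int_Rintegral _ phi phi (- 1) 1) //.
rewrite [LHS]Rintegral_mkcond [RHS]Rintegral_mkcond; congr (Rintegral _ _ _); apply/funext => x.
rewrite /patch; case: ifPn => [_|xn]; first by rewrite in_setT.
rewrite in_setT z // ltNge; apply: contra xn; rewrite ler_norml => xI.
by rewrite mem_set //= in_itv.
Qed.

Definition bump (e y x : R) : R := e^-1 * phi ((x - y) / e).
(** The profile may change sign, so its L1 norm is only known to be at least 1, and all estimates of
    mollified deltas carry it. *)
Definition mass : R := Int (fun x => `|phi x|) (- 1) 1.

Lemma reg_bump s e x : reg s phi e x = \sum_(y <- s) bump e y x.
Proof. by []. Qed.

Lemma Int_sum (I : Type) (s : seq I) (F : I -> R -> R) a b : (forall i, continuous (F i)) ->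
  Int (fun x => \sum_(i <- s) F i x) a b = \sum_(i <- s) Int (F i) a b.
Proof.
move=> cF; elim: s => [|i s IH].
  rewrite big_nil (_ : (fun x => _) = (fun=> 0)) ?Int_cst ?mul0r //.
  by apply/funext => x; rewrite big_nil.
rewrite big_cons -IH -IntD //; last exact: cts_sum.
by congr (Int _ a b); apply/funext => x; rewrite big_cons.
Qed.

Lemma sum_const_le (s : seq R) (F : R -> R) (C : R) : (forall y, y \in s -> F y <= C) ->
  \sum_(y <- s) F y <= (size s)%:R * C.
Proof.
move=> H; apply: le_trans (_ : \sum_(y <- s) C <= _).
  by rewrite big_seq [X in _ <= X]big_seq; apply: ler_sum => y ys; exact: H.
by rewrite big_const_seq count_predT iter_addr_0 mulr_natl.
Qed.

Hypothesis bp : bump_profile.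

Lemma bump_cts e y : continuous (bump e y).
Proof.
apply: ctsM; first exact: cts_cst.
apply: (cts_app (bp_cts bp)); apply: ctsM; [cts|exact: cts_cst].
Qed.

Lemma reg_cts s e : continuous (reg s phi e).
Proof. apply: cts_sum => y; exact: bump_cts. Qed.

Lemma bump_eq0 e y x : 0 < e -> e < `|x - y| -> bump e y x = 0.
Proof.
move=> e0 H; rewrite /bump (bp_supp bp) ?mulr0 //.
by rewrite normrM normfV (gtr0_norm e0) ltr_pdivlMr // mul1r.
Qed.

Lemma reg_eq0 s e x : 0 < e -> (forall y, y \in s -> e < `|x - y|) -> reg s phi e x = 0.
Proof.
move=> e0 H; rewrite reg_bump big_seq big1 // => y ys; apply: bump_eq0 => //; exact: H.
Qed.

Let cabs : continuous (fun x => `|phi x|).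
Proof. apply: cts_norm; exact: (bp_cts bp). Qed.

Lemma phi_abs_Int u v : u <= v -> Int (fun x => `|phi x|) u v <= mass.
Proof.
move=> uv; pose u' := Num.min u (- 1); pose v' := Num.max v 1.
have u'u : u' <= u by rewrite ge_min lexx.
have u'1 : u' <= -1 by rewrite ge_min lexx orbT.
have vv' : v <= v' by rewrite le_max lexx.
have v'1 : 1 <= v' by rewrite le_max lexx orbT.
have z a b : a <= b -> (b <= -1) || (1 <= a) -> Int (fun x => `|phi x|) a b = 0.
  move=> ab H; rewrite (@Int_ext _ _ (fun=> 0)) // ?Int_cst ?mul0r //; first exact: cts_cst.
  move=> x /andP[ax xb]; rewrite (bp_supp bp) ?normr0 //.
  case/orP: H => H; first by rewrite ltr0_norm; lra.
  by rewrite gtr0_norm; lra.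
have E : Int (fun x => `|phi x|) u' v' = mass.
  by rewrite -(Int_chasles _ u' (-1) v') -(Int_chasles _ (-1) 1 v') (z u' (-1)) ?lexx // (z 1 v') ?lexx ?orbT // add0r addr0.
rewrite -E -(Int_chasles _ u' u v') -(Int_chasles _ u v v').
have P a b : a <= b -> 0 <= Int (fun x => `|phi x|) a b by move=> ab; apply: Int_ge0.
by have := P _ _ u'u; have := P _ _ vv'; flra.
Qed.

Lemma mass_ge1 : 1 <= mass.
Proof.
have m11 : (-1 : R) <= 1 by lra.
have := Int_norm m11 (bp_cts bp) cabs (fun x _ => lexx _).
by rewrite (bp_int bp) normr1.
Qed.

Lemma phi_Int_cover u v : u <= -1 -> 1 <= v -> Int phi u v = 1.
Proof.
move=> u1 v1.
have z a b : a <= b -> (b <= -1) || (1 <= a) -> Int phi a b = 0.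
  move=> ab H; rewrite (@Int_ext _ _ (fun=> 0)) // ?Int_cst ?mul0r //; [exact: (bp_cts bp)|exact: cts_cst|].
  move=> x /andP[ax xb]; rewrite (bp_supp bp) //.
  case/orP: H => H; first by rewrite ltr0_norm; lra.
  by rewrite gtr0_norm; lra.
by rewrite -(Int_chasles _ u (-1) v) -(Int_chasles _ (-1) 1 v) (z u (-1)) ?lexx // (z 1 v) ?lexx ?orbT // add0r addr0 (bp_int bp).
Qed.

(** * Mollified deltas composed with an increasing function *)

Section Pullback.
Variables (G g : R -> R) (g0 : R).
Hypotheses (dG : forall x, has_deriv G x (g x)) (cg : continuous g)
  (g0p : 0 < g0) (g0g : forall x, g0 <= g x).

Let cG : continuous G. Proof. exact: derive_cts dG. Qed.

Lemma bump_pullback_Int (psi : R -> R) e y a b : continuous psi -> 0 < e -> a <= b ->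
  Int (fun r => e^-1 * psi ((G r - y) / e) * g r) a b = Int psi ((G a - y) / e) ((G b - y) / e).
Proof.
move=> cpsi e0 ab.
have cG' : continuous (fun r => (G r - y) / e) by apply: ctsM; [cts|exact: cts_cst].
rewrite (@Int_subst _ psi (fun r => (G r - y) / e) (fun r => g r / e)) //.
- apply: ctsM => //; apply: ctsM; first exact: cts_cst.
  exact: (cts_app cpsi cG').
- move=> x _; have := derivZ e^-1 (derivB (dG x) (deriv_cst y x)); rewrite subr0 mulrC.
  by rewrite (_ : (fun r => (G r - y) / e) = (fun r => e^-1 * (G r - y))) //; apply/funext => r; rewrite mulrC.
- by move=> x _; ring.
Qed.

(** The factor [g r / g0 >= 1] is inserted to complete the substitution [x = G r]. In the
    applications [G] is the position on a characteristic as a function of time, and [g0] the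
    smallest speed. *)
Lemma bump_pullback_abs e y a b (U : R -> R) (C : R) : 0 < e -> a <= b -> 0 <= C -> continuous U ->
  (forall r, a <= r <= b -> `|G r - y| <= e -> `|U r| <= C) ->
  Int (fun r => `|bump e y (G r) * U r|) a b <= C / g0 * mass.
Proof.
move=> e0 ab C0 cU H.
have cb : continuous (fun r => bump e y (G r)) by exact: (cts_app (@bump_cts e y) cG).
have cpg : continuous (fun r => e^-1 * `|phi ((G r - y) / e)| * g r).
  apply: ctsM => //; apply: ctsM; first exact: cts_cst.
  apply: (cts_app cabs); apply: ctsM; [cts|exact: cts_cst].
apply: le_trans (_ : Int (fun r => C / g0 * (e^-1 * `|phi ((G r - y) / e)| * g r)) a b <= _).
  apply: Int_le => //.
  - by apply: cts_norm; apply: ctsM.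
  - by apply: ctsM => //; exact: cts_cst.
  move=> r rI; rewrite normrM.
  case: (leP `|G r - y| e) => [Gy|Gy]; last first.
    by rewrite bump_eq0 // normr0 mul0r !mulr_ge0 ?invr_ge0 ?(ltW e0) ?(ltW g0p) // (le_trans (ltW g0p)).
  rewrite /bump normrM normfV (gtr0_norm e0).
  have := H r rI Gy; set q := e^-1 * `|_|.
  have q0 : 0 <= q by rewrite mulr_ge0 ?invr_ge0 // ltW.
  move=> UC; apply: le_trans (ler_wpM2l q0 UC) _.
  have -> : C / g0 * (q * g r) = q * C * (g r / g0) by ring.
  by apply: ler_peMr; [exact: mulr_ge0|rewrite ler_pdivlMr // mul1r].
rewrite IntZ // ler_wpM2l ?divr_ge0 // ?(ltW g0p) // (@bump_pullback_Int (fun x => `|phi x|)) //.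
apply: phi_abs_Int; rewrite ler_pM2r ?invr_gt0 // lerD2r.
case: (ltgtP a b) ab => // [ab _|-> //].
have [c _ E] := derive_mvt (ltW ab) cG (fun x _ => dG x).
by rewrite -subr_ge0 E mulr_ge0 ?subr_ge0 ?(ltW ab) // (le_trans (ltW g0p)).
Qed.

Lemma reg_pullback_abs s e a b (U : R -> R) (C : R) : 0 < e -> a <= b -> 0 <= C -> continuous U ->
  (forall r y, y \in s -> a <= r <= b -> `|G r - y| <= e -> `|U r| <= C) ->
  Int (fun r => `|reg s phi e (G r) * U r|) a b <= (size s)%:R * (C / g0 * mass).
Proof.
move=> e0 ab C0 cU H.
have cb y : continuous (fun r => bump e y (G r)) by exact: (cts_app (@bump_cts e y) cG).
have cbU y : continuous (fun r => `|bump e y (G r) * U r|) by apply: cts_norm; apply: ctsM.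
apply: le_trans (_ : Int (fun r => \sum_(y <- s) `|bump e y (G r) * U r|) a b <= _).
  apply: Int_le => //.
  - by apply: cts_norm; apply: ctsM => //; exact: (cts_app (@reg_cts s e) cG).
  - exact: cts_sum.
  by move=> r _; rewrite reg_bump mulr_suml; exact: ler_norm_sum.
rewrite Int_sum //; apply: sum_const_le => y ys.
apply: bump_pullback_abs => // r rI; exact: H.
Qed.

(** In the limit [delta (G r - y) * g r] is the delta at the time when [G] reaches [y]. That time
    enters as [ty y], through the oscillation of [V] over the support of the bump; the bounds on
    [G a] and [G b] ensure that the whole bump is crossed and integrates to 1. *)
Lemma reg_pullback_lim s e a b (V : R -> R) (ty : R -> R) (eta : R) : 0 < e -> a <= b ->
  continuous V -> 0 <= eta ->
  (forall y, y \in s -> G a <= y - e /\ y + e <= G b) ->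
  (forall r y, y \in s -> a <= r <= b -> `|G r - y| <= e -> `|V r - V (ty y)| <= eta) ->
  `|Int (fun r => reg s phi e (G r) * (V r * g r)) a b - \sum_(y <- s) V (ty y)| <=
    (size s)%:R * (eta * mass).
Proof.
move=> e0 ab cV eta0 Hs H.
have cb y : continuous (fun r => bump e y (G r)) by exact: (cts_app (@bump_cts e y) cG).
have cbg y : continuous (fun r => bump e y (G r) * g r) by apply: ctsM.
have cbV y : continuous (fun r => bump e y (G r) * (V r * g r)) by apply: ctsM => //; apply: ctsM.
have -> : Int (fun r => reg s phi e (G r) * (V r * g r)) a b =
    \sum_(y <- s) Int (fun r => bump e y (G r) * (V r * g r)) a b.
  rewrite -Int_sum //; congr (Int _ a b); apply/funext => r; by rewrite reg_bump mulr_suml.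
rewrite -sumrB; apply: le_trans (ler_norm_sum _ _ _) _; apply: sum_const_le => y ys.
have [Ga Gb] := Hs y ys.
have I1 : Int (fun r => bump e y (G r) * g r) a b = 1.
  rewrite /bump bump_pullback_Int //; last exact: (bp_cts bp).
  apply: phi_Int_cover; last by rewrite ler_pdivlMr // mul1r; lra.
  by rewrite ler_pdivrMr // mulN1r; lra.
rewrite -[V (ty y)]mulr1 -I1 -IntZ // -IntB //; last by apply: ctsM => //; exact: cts_cst.
have cpg : continuous (fun r => e^-1 * `|phi ((G r - y) / e)| * g r).
  apply: ctsM => //; apply: ctsM; first exact: cts_cst.
  apply: (cts_app cabs); apply: ctsM; [cts|exact: cts_cst].
apply: le_trans (_ : Int (fun r => eta * (e^-1 * `|phi ((G r - y) / e)| * g r)) a b <= _).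
  apply: Int_norm => //.
  - by apply: ctsB => //; apply: ctsM => //; exact: cts_cst.
  - by apply: ctsM => //; exact: cts_cst.
  move=> r rI.
  have -> : bump e y (G r) * (V r * g r) - V (ty y) * (bump e y (G r) * g r) =
    (V r - V (ty y)) * (bump e y (G r) * g r) by ring.
  have gr : 0 <= g r by apply: le_trans (ltW g0p) _.
  rewrite normrM (normrM (bump _ _ _)) (ger0_norm gr).
  case: (leP `|G r - y| e) => [Gy|Gy]; last first.
    by rewrite bump_eq0 // normr0 mul0r mulr0 !mulr_ge0 ?invr_ge0 ?(ltW e0).
  have -> : `|bump e y (G r)| = e^-1 * `|phi ((G r - y) / e)|.
    by rewrite /bump normrM normfV (gtr0_norm e0).
  by rewrite ler_wpM2r ?mulr_ge0 ?invr_ge0 ?(ltW e0) //; exact: H.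
rewrite IntZ // ler_wpM2l // (@bump_pullback_Int (fun x => `|phi x|)) //.
apply: phi_abs_Int; rewrite ler_pM2r ?invr_gt0 // lerD2r; lra.
Qed.

End Pullback.
End Mollifiers.

Lemma char_stab (R : realType) (Delta D : R -> R) (a b d k m : R) : a <= b ->
  continuous Delta -> continuous D -> 0 <= k -> 0 <= m ->
  (forall r, a <= r <= b -> Delta r = d + Int D a r) ->
  (forall r, a <= r <= b -> `|D r| <= k * `|Delta r| + m) ->
  forall r, a <= r <= b -> `|Delta r| <= (`|d| + m * (b - a)) * expR (k * (b - a)).
Proof.
move=> ab cDe cD k0 m0 E H r rI.
have cn : continuous (fun r => `|Delta r|) by exact: cts_norm.
have G : `|Delta r| <= (`|d| + m * (b - a)) * expR (k * (r - a)).
  apply: (gronwall k0 cn _ rI) => t /andP[at_ tb].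
  rewrite E ?at_ //; apply: le_trans (ler_normD _ _) _; rewrite -addrA lerD2l.
  have : `|Int D a t| <= Int (fun r => k * `|Delta r| + m) a t.
    apply: Int_norm => //.
      by apply: ctsD; [apply: ctsM => //; exact: cts_cst|exact: cts_cst].
    by move=> q /andP[aq qt]; apply: H; rewrite aq (le_trans qt).
  move=> /le_trans; apply; rewrite IntD; [|by apply: ctsM => //; exact: cts_cst|exact: cts_cst].
  have -> : Int (fun x => k * `|Delta x|) a t + Int (fun=> m) a t =
      m * (t - a) + k * Int (fun x => `|Delta x|) a t by rewrite IntZ // Int_cst addrC.
  by apply: lerD => //; rewrite ler_wpM2l // lerD2r.
apply: le_trans G _; apply: ler_wpM2l.
  by rewrite addr_ge0 // mulr_ge0 // subr_ge0.
by rewrite ler_expR ler_wpM2l //; case/andP: rI => _; flra.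
Qed.

(** * The problems in boundary coordinates *)

Section Setup.
Variables (R : realType) (L T : R) (h hx p : R -> R -> R) (f : R -> R -> R -> R)
  (ar br cr : R -> R) (xa xb tc : seq R) (phi : R -> R) (K l0 l1 C xm : R).

Local Notation X := (flow h).
Local Notation foot := (foot h).
Local Notation bs := (reg xb phi).
Local Notation cs := (reg tc phi).
Local Notation as_ := (reg xa phi).
Local Notation J := (Jac h hx).

(* Along a characteristic [v (X t s) t = E t s * bdv v s]; [J] is minus the derivative of [X t] and
   [Y] the density of the transported boundary values. *)
Definition E (t s : R) : R := expR (Int (fun r => p (X r s) r) (Num.max s 0) t).
Definition Y (t s : R) : R := J t s * E t s.
(** [- A] is the parameter of the corner [(L, 0)], so [[- A, T]] parametrizes all entry points of
    the box. *)
Definition A : R := L / h 0 0.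
(** Gronwall factor over the time [T]: one [C] in the rate bounds [p], the other is the Lipschitz
    constant of [f]. *)
Definition CW : R := expR (2 * C * T).
(** Trace on the initial line and on the axis as a function of the single entry parameter. *)
Definition bdv (z : R -> R -> R) (s : R) : R := z (bstart h s) (Num.max s 0).

(* [C] dominates every bound on the data that is used; [xm] is smaller than the distance between any
   support point of a delta function and the ends of its interval. *)
Record setup : Prop := Setup {
  st_T : 0 < T;
  st_cf : C1_speed_field h hx K l0 l1 L;
  st_p : cts2 p;
  st_f : continuous (fun q : R * R * R => f q.1.1 q.1.2 q.2);
  st_ar : continuous ar;
  st_br : continuous br;
  st_cr : continuous cr;
  st_ar0 : ar 0 = 0;
  st_br0 : forall x, x <= 0 -> br x = 0;
  st_brL : forall x, L <= x -> br x = 0;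
  st_cr0 : cr 0 = 0;
  st_phi : bump_profile phi;
  st_xm : 0 < xm;
  st_xa : forall y, y \in xa -> 2 * xm <= y <= L - 2 * xm;
  st_xb : forall y, y \in xb -> 2 * xm <= y <= L - 2 * xm;
  st_tc : forall y, y \in tc -> 2 * xm <= y <= T - 2 * xm;
  st_C1 : 1 <= C;
  st_pC : forall x t, `|p x t| <= C;
  st_fC : forall x t u, `|f x t u| <= C;
  st_fL : forall x t u u', `|f x t u - f x t u'| <= C * `|u - u'|;
  st_arC : forall x, `|ar x| <= C;
  st_brC : forall x, `|br x| <= C;
  st_crC : forall x, `|cr x| <= C;
  st_JC : forall t s, 0 <= t <= T -> - A <= s <= T -> J t s <= C;
  st_EC : forall t s, 0 <= t <= T -> - A <= s <= T -> E t s <= C;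
  st_massC : mass phi <= C;
  st_szC : [/\ (size xa)%:R <= C, (size xb)%:R <= C & (size tc)%:R <= C];
  st_l0C : l0^-1 <= C;
  st_l1C : l1 <= C;
  st_LC : L <= C;
  st_TC : T <= C }.

Definition Bf (e : R) (w v : R -> R -> R) (t : R) : R :=
  Int (fun x => (bs e x + br x) * w x t + br x * v x t) 0 L.
Definition Qf (e : R) (v : R -> R -> R) (t : R) : R :=
  Int (fun x => bs e x * v x t) 0 L.

(** Problems (W) and (V) along characteristics. Since the support points keep distance [2 * xm] from
    the ends of their intervals, [e < xm] leaves a margin [xm] for the mollified deltas. *)
Record wvsol (e : R) (w v : R -> R -> R) : Prop := WVSol {
  so_e : 0 < e < xm;
  so_w : cts2 w;
  so_v : cts2 v;
  so_wX : forall t s, Num.max s 0 <= t -> t <= T -> X t s <= L ->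
    w (X t s) t = bdv w s +
      Int (fun r => p (X r s) r * w (X r s) r + f (X r s) r (w (X r s) r)) (Num.max s 0) t;
  so_w0 : forall y, 0 <= y <= L -> w y 0 = ar y;
  so_wb : forall s, 0 < s <= T -> w 0 s = cr s * Bf e w v s;
  so_vX : forall t s, Num.max s 0 <= t -> t <= T -> X t s <= L ->
    v (X t s) t = bdv v s + Int (fun r => p (X r s) r * v (X r s) r) (Num.max s 0) t;
  so_v0 : forall y, 0 <= y <= L -> v y 0 = as_ e y;
  so_vb : forall s, 0 < s <= T -> v 0 s = cs e s * Bf e w v s + cr s * Qf e v s }.

Section Facts.
Hypothesis S : setup.

Lemma st_sf : speed_field h K l0 l1. Proof. exact: cf_sf (st_cf S). Qed.
Lemma st_L : 0 < L. Proof. exact: cf_L0 (st_cf S). Qed.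
Lemma st_h0 : 0 < h 0 0. Proof. by apply: lt_le_trans (sf_l0 st_sf) (sf_ge st_sf _ _). Qed.
Lemma st_A : 0 < A. Proof. by rewrite divr_gt0 ?st_L ?st_h0. Qed.
Lemma st_hA : h 0 0 * A = L. Proof. by rewrite /A mulrC divfK // gt_eqF // st_h0. Qed.
Lemma st_C0 : 0 < C. Proof. exact: lt_le_trans ltr01 (st_C1 S). Qed.
Lemma st_l1 : 0 < l1. Proof. apply: lt_le_trans (sf_l0 st_sf) _; exact: le_trans (sf_ge st_sf 0 0) (sf_le st_sf 0 0). Qed.
Lemma CW_ge1 : 1 <= CW.
Proof. by apply: expR_ge1; rewrite !mulr_ge0 // ltW ?(st_C0) ?(st_T S). Qed.

Lemma bstart_neg s : - A <= s <= 0 -> [/\ bstart h s = - h 0 0 * s, 0 <= bstart h s <= L & Num.max s 0 = 0].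
Proof.
move=> /andP[As s0]; rewrite /bstart (max_r s0) (min_l s0); split => //.
have h0 := st_h0; rewrite mulNr oppr_ge0 pmulr_rle0 // s0 /=.
by rewrite -st_hA -mulrN ler_pM2l // lerNl.
Qed.

Lemma bstart_pos s : 0 <= s -> bstart h s = 0 /\ Num.max s 0 = s.
Proof. by move=> s0; rewrite /bstart (max_l s0) (min_r s0) mulr0. Qed.

Lemma foot_in x t : 0 <= x <= L -> 0 <= t <= T ->
  [/\ - A <= foot x t, foot x t <= t & Num.max (foot x t) 0 <= t].
Proof.
move=> /andP[x0 xL] /andP[t0 tT].
have ft : foot x t <= t by exact: (foot_le st_sf).
split => //; last by rewrite ge_max ft.
rewrite -(X_leE st_sf t) (X_foot st_sf); apply: le_trans (X_le st_sf _ t0).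
by rewrite (X_0 st_sf) ?oppr_le0 ?(ltW st_A) // mulrNN st_hA.
Qed.

Lemma E_cts2 : cts2 E.
Proof. by apply: cts_exp; exact: (along_Int_cts2 (st_cf S) (st_p S)). Qed.

Lemma Y_cts2 : cts2 Y.
Proof. by apply: ctsM; [exact: (Jac_cts2 (st_cf S))|exact: E_cts2]. Qed.

Lemma E_gt0 t s : 0 < E t s. Proof. exact: expR_gt0. Qed.
Lemma J_gt0 t s : 0 < J t s. Proof. exact: (Jac_gt0 (st_cf S)). Qed.
Lemma Y_gt0 t s : 0 < Y t s. Proof. by rewrite mulr_gt0 ?E_gt0 ?J_gt0. Qed.

Lemma Y_le t s : 0 <= t <= T -> - A <= s <= T -> Y t s <= C * C.
Proof.
by move=> tI sI; apply: ler_pM; rewrite ?(ltW (J_gt0 _ _)) ?(ltW (E_gt0 _ _)) ?(st_JC S) ?(st_EC S).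
Qed.

Lemma bdv_cts z : cts2 z -> continuous (bdv z).
Proof.
move=> cz; apply: (cts2_app cz); last by apply: cts_max; [exact: cts_id|exact: cts_cst].
by apply: ctsM; [exact: cts_cst|apply: cts_min; [exact: cts_id|exact: cts_cst]].
Qed.

Lemma along_cts z s : cts2 z -> continuous (fun r => z (X r s) r).
Proof. by move=> cz; exact: (@cts2_r _ _ s (along_cts2 (st_cf S) cz)). Qed.

Lemma flow_pairing (F z : R -> R) t : continuous F -> continuous z ->
  (forall x, x <= 0 -> F x = 0) -> (forall x, L <= x -> F x = 0) -> 0 <= t <= T ->
  Int (fun x => F x * z x) 0 L = Int (fun s => F (X t s) * z (X t s) * J t s) (- A) T.
Proof.
move=> cF cz F0 FL tI; apply: (Int_flow_subst (st_cf S) (F := fun x => F x * z x)) => //.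
- exact: ctsM.
- by move=> x /F0 ->; rewrite mul0r.
- by move=> x /FL ->; rewrite mul0r.
- by rewrite st_hA.
Qed.

(** Multiplying by the integrating factor [expR (- Int p)] gives a function with zero derivative
    along the characteristic. *)
Lemma v_formula e w v t s : wvsol e w v -> Num.max s 0 <= t -> t <= T -> X t s <= L ->
  v (X t s) t = bdv v s * E t s.
Proof.
move=> so st tT XL; set a := Num.max s 0 in st *.
have cp : continuous (fun r => p (X r s) r) by apply: along_cts; exact: (st_p S).
have cpv : continuous (fun r => p (X r s) r * v (X r s) r).
  by apply: ctsM => //; apply: along_cts; exact: (so_v so).
pose Psi r := bdv v s + Int (fun r => p (X r s) r * v (X r s) r) a r.
have PE r : a <= r <= t -> v (X r s) r = Psi r.
  move=> /andP[ar_ rt]; apply: (so_vX so) => //; first exact: le_trans tT.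
  exact: le_trans (X_le st_sf s rt) XL.
have dPsi r : has_deriv Psi r (p (X r s) r * v (X r s) r).
  rewrite -[p _ _ * _]add0r; apply: derivD; first exact: deriv_cst.
  exact: Int_derive.
have dE r : has_deriv (fun r => expR (- Int (fun r => p (X r s) r) a r)) r
    (expR (- Int (fun r => p (X r s) r) a r) * - p (X r s) r).
  by apply: exp_deriv; apply: is_deriveN; exact: Int_derive.
have dD r := derivM (dPsi r) (dE r).
have H : Psi t * expR (- Int (fun r => p (X r s) r) a t) = Psi a * expR (- Int (fun r => p (X r s) r) a a).
  apply: (derive_eq0 st (derive_cts dD)) => r /andP[ar_ rt].
  by apply: deriv_eq (dD r) _; rewrite PE ?ltW //; ring.
rewrite PE ?lexx ?st // /E -/a.
rewrite -[LHS]mulr1 -(expR0 R) -(addNr (Int (fun r => p (X r s) r) a t)) expRD mulrA H.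
by rewrite Int_refl oppr0 expR0 mulr1 /Psi Int_refl addr0.
Qed.

Lemma v_pairing e w v (F : R -> R) t : wvsol e w v -> continuous F ->
  (forall x, x <= 0 -> F x = 0) -> (forall x, L <= x -> F x = 0) -> 0 <= t <= T ->
  Int (fun x => F x * v x t) 0 L = Int (fun s => F (X t s) * Y t s * bdv v s) (- A) T.
Proof.
move=> so cF F0 FL /andP[t0 tT].
rewrite (flow_pairing (F := F) (z := v^~ t) (t := t)) //; [|exact: (cts2_l (so_v so))|by rewrite t0].
have cX : continuous (X t) by exact: (@cts2_r _ _ t (X_cts2 st_sf)).
apply: Int_ext.
- by have := st_A; have := st_T S; lra.
- apply: ctsM; last exact: (@cts2_r _ _ t (Jac_cts2 (st_cf S))).
  by apply: ctsM; [exact: (cts_app cF)|exact: (cts_app (cts2_l (so_v so)) cX)].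
- apply: ctsM; last exact: (bdv_cts (so_v so)).
  by apply: ctsM; [exact: (cts_app cF)|exact: (@cts2_r _ _ t Y_cts2)].
move=> s /andP[As sT].
case: (leP (X t s) 0) => [/F0 ->|X0]; first by rewrite !mul0r.
case: (leP L (X t s)) => [/FL ->|XL]; first by rewrite !mul0r.
rewrite (v_formula so) ?(ltW XL) //; first by rewrite /Y; ring.
by rewrite ge_max t0 andbT ltW // -(X_ltE st_sf t) (X_diag st_sf).
Qed.

Lemma bs_supp e x : 0 < e < xm -> (x <= xm) || (L - xm <= x) -> bs e x = 0.
Proof.
move=> /andP[e0 ex] H; apply: (reg_eq0 (st_phi S) e0) => y /(st_xb S)/andP[y1 y2].
case/orP: H => H; last by apply: lt_le_trans (ler_norm _); lra.
by rewrite distrC; apply: lt_le_trans (ler_norm _); lra.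
Qed.

Lemma Q_pairing e w v t : wvsol e w v -> 0 <= t <= T ->
  Qf e v t = Int (fun s => bs e (X t s) * Y t s * bdv v s) (- A) T.
Proof.
move=> so tI; have xm0 := st_xm S; apply: (v_pairing so) => //; first exact: (reg_cts (st_phi S)).
  by move=> x x0; apply: bs_supp (so_e so) _; rewrite (le_trans x0 (ltW xm0)).
by move=> x x0; apply: bs_supp (so_e so) _; apply/orP; right; lra.
Qed.

(** The support of the mollified delta at [y] lies to the right of [xm], so a characteristic meeting
    it has been inside the domain for time at least [xm / l1]. This separates successive
    reflections. *)
Lemma delay e x t y : 0 < e < xm -> y \in xb -> `|x - y| <= e -> 0 <= t -> 0 <= foot x t ->
  foot x t <= t - xm / l1.
Proof.
move=> /andP[e0 ex] yb xy t0 f0; have /andP[y1 y2] := st_xb S yb.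
have xx : xm <= x by move: xy; rewrite ler_norml => /andP[]; lra.
have x0 : 0 <= x by apply: le_trans xx; rewrite ltW // (st_xm S).
apply: le_trans (foot_travel st_sf x0 t0 f0) _; rewrite lerD2l lerN2.
by rewrite ler_pM2r // invr_gt0 st_l1.
Qed.

Lemma near_in e x y : 0 < e < xm -> y \in xb -> `|x - y| <= e -> 0 <= x <= L.
Proof.
move=> /andP[e0 ex] yb xy; have /andP[y1 y2] := st_xb S yb; have := st_xm S.
by move: xy; rewrite ler_norml => /andP[? ?] ?; apply/andP; split; lra.
Qed.

Lemma bdw_neg e w v s : wvsol e w v -> - A <= s <= 0 -> bdv w s = ar (bstart h s).
Proof. by move=> so sI; have [_ bI m0] := bstart_neg sI; rewrite /bdv m0 (so_w0 so). Qed.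

Lemma bdw_pos e w v s : wvsol e w v -> 0 < s <= T -> bdv w s = cr s * Bf e w v s.
Proof.
move=> so /andP[s0 sT]; have [b0 m0] := bstart_pos (ltW s0).
by rewrite /bdv b0 m0 (so_wb so) // s0.
Qed.

Lemma bdv_neg e w v s : wvsol e w v -> - A <= s <= 0 -> bdv v s = as_ e (- h 0 0 * s).
Proof. by move=> so sI; have [<- bI m0] := bstart_neg sI; rewrite /bdv m0 (so_v0 so). Qed.

Lemma bdv_pos e w v s : wvsol e w v -> 0 < s <= T -> bdv v s = cs e s * Bf e w v s + cr s * Qf e v s.
Proof.
move=> so /andP[s0 sT]; have [b0 m0] := bstart_pos (ltW s0).
by rewrite /bdv b0 m0 (so_vb so) // s0.
Qed.

Lemma gap_margin e b y : 0 <= e <= xm -> 2 * xm <= y <= b - 2 * xm -> 0 <= y - e /\ y + e <= b.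
Proof. by move=> /andP[e0 ex] /andP[y1 y2]; split; move: e0 ex y1 y2; flra. Qed.

Lemma gap_in b y : 2 * xm <= y <= b - 2 * xm -> 0 <= y <= b.
Proof.
have xm0 : 0 <= (0 : R) <= xm by rewrite lexx ltW // (st_xm S).
by move=> /(gap_margin xm0); rewrite subr0 addr0 => -[-> ->].
Qed.

Lemma CW_le a b : 0 <= a -> a <= b -> b <= T -> expR (2 * C * (b - a)) <= CW.
Proof.
move=> a0 ab bT; rewrite ler_expR ler_wpM2l ?mulr_ge0 ?(ltW st_C0) //; lra.
Qed.

Lemma w_diff e w v e' w' v' t s : wvsol e w v -> wvsol e' w' v' ->
  Num.max s 0 <= t -> t <= T -> X t s <= L ->
  `|w (X t s) t - w' (X t s) t| <= CW * `|bdv w s - bdv w' s|.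
Proof.
move=> so so' st tT XL; set a := Num.max s 0 in st *.
have a0 : 0 <= a by rewrite le_max lexx orbT.
pose g (w : R -> R -> R) r := p (X r s) r * w (X r s) r + f (X r s) r (w (X r s) r).
have cw z : cts2 z -> continuous (g z).
  move=> cz; apply: ctsD; first by apply: ctsM; apply: along_cts => //; exact: (st_p S).
  apply: (@cts_app _ _ _ (fun r => (X r s, r, z (X r s) r)) (fun q => f q.1.1 q.1.2 q.2) (st_f S)).
  apply: cts_pair3; [|exact: cts_id|exact: along_cts].
  exact: (cts2_l (X_cts2 st_sf)).
have := @char_stab R (fun r => w (X r s) r - w' (X r s) r) (fun r => g w r - g w' r) a t
   (bdv w s - bdv w' s) (2 * C) 0 st.
have C0 := st_C0.
have cd : continuous (fun r => w (X r s) r - w' (X r s) r).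
  by apply: ctsB; apply: along_cts; [exact: (so_w so)|exact: (so_w so')].
have cg : continuous (fun r => g w r - g w' r).
  by apply: ctsB; apply: cw; [exact: (so_w so)|exact: (so_w so')].
move=> /(_ cd cg) H.
have {}H := H (mulr_ge0 (ler0n _ _) (ltW C0)) (lexx 0).
have H1 r : a <= r <= t -> w (X r s) r - w' (X r s) r = bdv w s - bdv w' s + Int (fun r => g w r - g w' r) a r.
  move=> /andP[ar_ rt]; have rT := le_trans rt tT.
  have XrL := le_trans (X_le st_sf s rt) XL.
  rewrite (so_wX so) // (so_wX so') // IntB; [|by apply: cw; exact: (so_w so)|by apply: cw; exact: (so_w so')].
  by rewrite /g -/a; ring.
have H2 r : a <= r <= t -> `|g w r - g w' r| <= 2 * C * `|w (X r s) r - w' (X r s) r| + 0.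
  move=> _; rewrite addr0 /g; set u := w _ _; set u' := w' _ _.
  have -> : p (X r s) r * u + f (X r s) r u - (p (X r s) r * u' + f (X r s) r u') =
    p (X r s) r * (u - u') + (f (X r s) r u - f (X r s) r u') by ring.
  apply: le_trans (ler_normD _ _) _; rewrite normrM.
  have := st_fL S (X r s) r u u'; have := ler_wpM2r (normr_ge0 (u - u')) (st_pC S (X r s) r); flra.
have := H H1 H2 t; rewrite lexx st mul0r addr0 => /(_ isT) /le_trans; apply.
by rewrite mulrC ler_wpM2r // CW_le.
Qed.

Lemma w_bound e w v t s : wvsol e w v -> Num.max s 0 <= t -> t <= T -> X t s <= L ->
  `|w (X t s) t| <= CW * (`|bdv w s| + C * T).
Proof.
move=> so st tT XL; set a := Num.max s 0 in st *.
have a0 : 0 <= a by rewrite le_max lexx orbT.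
have C0 := st_C0.
pose g r := p (X r s) r * w (X r s) r + f (X r s) r (w (X r s) r).
have cw := so_w so.
have cg : continuous g.
  apply: ctsD; first by apply: ctsM; apply: along_cts => //; exact: (st_p S).
  apply: (@cts_app _ _ _ (fun r => (X r s, r, w (X r s) r)) (fun q => f q.1.1 q.1.2 q.2) (st_f S)).
  apply: cts_pair3; [|exact: cts_id|exact: along_cts].
  exact: (cts2_l (X_cts2 st_sf)).
have C2 : 0 <= 2 * C by rewrite mulr_ge0 // ltW.
have H1 r : a <= r <= t -> w (X r s) r = bdv w s + Int g a r.
  move=> /andP[ar_ rt]; apply: (so_wX so) => //; first exact: le_trans rt tT.
  exact: le_trans (X_le st_sf s rt) XL.
have H2 r : a <= r <= t -> `|g r| <= 2 * C * `|w (X r s) r| + C.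
  move=> _; rewrite /g; set u := w _ _; apply: le_trans (ler_normD _ _) _; rewrite normrM.
  have := st_fC S (X r s) r u; have := ler_wpM2r (normr_ge0 u) (st_pC S (X r s) r).
  by have := mulr_ge0 (ltW C0) (normr_ge0 u); flra.
have := char_stab st (@along_cts w s cw) cg C2 (ltW C0) H1 H2; move=> /(_ t).
rewrite lexx st => /(_ isT) /le_trans; apply; rewrite mulrC.
apply: ler_pM; rewrite ?expR_ge0 ?addr_ge0 ?mulr_ge0 ?subr_ge0 ?(ltW C0) ?CW_le //.
by rewrite lerD2l ler_wpM2l ?(ltW C0) //; lra.
Qed.

End Facts.

(** Kernel through which the regular factor [br] acts on the boundary values of [v]. It vanishes for
    [s >= t], continuously because [br 0 = 0]. *)
Definition kappa (t s : R) : R := br (X t s) * Y t s.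
Local Notation d0 := (xm / l1).

Lemma exp_small (a eta : R) : 0 < a -> 0 < eta ->
  exists2 G0 : R, 0 < G0 & forall G, G0 <= G -> expR (- (G * a)) <= eta.
Proof.
move=> a0 e0; exists (eta^-1 / a); first by rewrite divr_gt0 ?invr_gt0.
move=> G; rewrite ler_pdivrMr // => HG.
rewrite expRN -[eta]invrK lef_pV2 ?posrE ?expR_gt0 ?invr_gt0 //.
by apply: le_trans HG _; apply: le_trans (expR_ge1Dx _); rewrite lerDr.
Qed.

Lemma st_d0 : setup -> 0 < d0.
Proof. by move=> S; rewrite divr_gt0 ?(st_xm S) ?(st_l1 S). Qed.

Lemma kappa_cts2 : setup -> cts2 kappa.
Proof.
move=> S; apply: ctsM; last exact: (Y_cts2 S).
exact: (cts_app (st_br S) (X_cts2 (st_sf S))).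
Qed.

Lemma kappa_eq0 t s : setup -> 0 <= t -> t <= s -> kappa t s = 0.
Proof.
by move=> S t0 ts; rewrite /kappa (st_br0 S) ?mul0r // -(X_diag (st_sf S) t0) (X_leE (st_sf S)).
Qed.

Lemma kappa_bound t s : setup -> 0 <= t <= T -> - A <= s <= T -> `|kappa t s| <= C * (C * C).
Proof.
move=> S tI sI; rewrite normrM (ger0_norm (ltW (Y_gt0 S _ _))).
apply: ler_pM => //; [exact: (ltW (Y_gt0 S _ _))|exact: (st_brC S)|exact: (Y_le S)].
Qed.

(** The action of [br] on [v] has no delay. Near the diagonal [kappa] is small by uniform
    continuity, since it vanishes at [s = t]; at distance [d] from it the weights differ by at least
    the factor [expR (G * d)]. Contractivity here rests on [br 0 = 0]. *)
Lemma kappa_small (eta : R) : setup -> 0 < eta -> exists2 G0 : R, 0 < G0 &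
  forall G t s, G0 <= G -> 0 <= t <= T -> 0 <= s <= T -> `|kappa t s| * expR (G * s) <= eta * expR (G * t).
Proof.
move=> S e0; have [d dp Hd] := cts2_unif T (kappa_cts2 S) e0.
have C0 := st_C0 S; have C3 : 0 < C * (C * C) by rewrite !mulr_gt0.
have [G0 G0p HG] := exp_small dp (divr_gt0 e0 C3).
exists G0 => // G t s GG tI sI; have /andP[t0 tT] := tI; have /andP[s0 sT] := sI.
have nT z : 0 <= z <= T -> `|z| <= T by move=> /andP[z0 zT]; rewrite ger0_norm.
case: (leP t s) => [ts|st].
  by rewrite kappa_eq0 // normr0 mul0r mulr_ge0 ?expR_ge0 // ltW.
have sI' : - A <= s <= T by rewrite sT andbT; apply: le_trans s0; rewrite oppr_le0 ltW // (st_A S).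
case: (ltP (t - s) d) => ds.
  apply: ler_pM; rewrite ?expR_ge0 //; last first.
    by rewrite ler_expR ler_pM2l ?(lt_le_trans G0p GG) // ltW.
  have := Hd t t s t (nT _ tI) (nT _ tI) (nT _ sI) (nT _ tI).
  rewrite subrr normr0 => /(_ dp); rewrite distrC gtr0_norm ?subr_gt0 // => /(_ ds).
  by rewrite (kappa_eq0 S t0 (lexx t)) subr0 => /ltW.
have -> : expR (G * s) = expR (- (G * (t - s))) * expR (G * t) by rewrite -expRD; congr expR; ring.
rewrite mulrA; apply: ler_wpM2r; first exact: expR_ge0.
have H1 : expR (- (G * (t - s))) <= eta / (C * (C * C)).
  apply: le_trans (HG G GG); rewrite ler_expR lerN2 ler_pM2l //; exact: lt_le_trans GG.
apply: le_trans (ler_pM (normr_ge0 _) (expR_ge0 _) (kappa_bound S tI sI') H1) _.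
by rewrite mulrC divfK // gt_eqF.
Qed.

(** Along a characteristic [w] is Lipschitz, and across characteristics Gronwall transports the
    difference of the boundary values. The modulus of continuity is thus independent of [e], except
    for the oscillation of [bdv w], which stays explicit. *)
Lemma w_modulus (Mw eta : R) : setup -> 0 < eta -> 0 <= Mw -> exists2 d : R, 0 < d &
  forall e w v, wvsol e w v -> (forall x t, 0 <= x <= L -> 0 <= t <= T -> `|w x t| <= Mw) ->
  forall x t x' t', 0 <= x <= L -> 0 <= t <= T -> 0 <= x' <= L -> 0 <= t' <= T ->
  `|x - x'| < d -> `|t - t'| < d ->
  `|w x t - w x' t'| <= CW * `|bdv w (foot x t) - bdv w (foot x' t')| + eta.
Proof.
move=> S eta0 Mw0; have C0 := st_C0 S; have sf := st_sf S; have T0 := st_T S; have L0 := st_L S.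
have l1p := st_l1 S; have CW1 := CW_ge1 S; have CW0 : 0 < CW by apply: lt_le_trans CW1.
pose G := C * Mw + C; have G0 : 0 < G by rewrite ltr_wpDl // mulr_ge0 // ltW.
(* Tolerance for the variation of [p] and [f]: multiplied by [Mw + 1], integrated over time at most
   [T] and amplified by [CW], it contributes at most [eta / 4]. *)
pose eta1 := eta / (4 * (CW * ((Mw + 1) * (T + 1)))).
have Mw1 : 0 < Mw + 1 by rewrite ltr_wpDl.
have T1 : 0 < T + 1 by rewrite addr_gt0.
have eta1p : 0 < eta1 by rewrite divr_gt0 // !mulr_gt0.
have [d1 d1p Hd1] := cts2_unif (L + T) (st_p S) eta1p.
pose Kf : set (R * R * R) := (`[0, L] `*` `[0, T]) `*` `[- Mw, Mw].
have cKf : compact Kf by apply: compact_setX; [apply: compact_setX|]; exact: segment_compact.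
have [d2 d2p Hd2] := heine cKf (continuous_subspaceT (st_f S)) eta1p.
pose CX := 2 * l1 * expR (K * T); have CX0 : 0 < CX by rewrite !mulr_gt0 ?expR_gt0.
pose Cf := expR (K * T) / l0 * (1 + l1).
have Cf0 : 0 < Cf by rewrite mulr_gt0 ?divr_gt0 ?expR_gt0 ?(sf_l0 sf) // addr_gt0.
pose W := CW * (2 * G * Cf) + G.
have W0 : 0 < W.
  by apply: addr_gt0 => //; apply: mulr_gt0 => //; apply: mulr_gt0 => //; exact: mulr_gt0.
have CC : 0 < 2 * (CX * Cf) by apply: mulr_gt0 => //; exact: mulr_gt0.
have W4 : 0 < 4 * W by exact: mulr_gt0.
exists (Num.min (eta / (4 * W)) (Num.min (d1 / (2 * (CX * Cf))) (d2 / (2 * (CX * Cf))))).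
  by rewrite !lt_min !divr_gt0.
move=> e w v so HMw.
pose g s r := p (X r s) r * w (X r s) r + f (X r s) r (w (X r s) r).
have cw := so_w so.
have cg s : continuous (g s).
  apply: ctsD; first by apply: ctsM; apply: (along_cts S) => //; exact: (st_p S).
  apply: (@cts_app _ _ _ (fun r => (X r s, r, w (X r s) r)) (fun q => f q.1.1 q.1.2 q.2) (st_f S)).
  apply: cts_pair3; [|exact: cts_id|exact: (along_cts S)].
  exact: (cts2_l (X_cts2 sf)).
have inb s t r : Num.max s 0 <= r -> r <= t -> t <= T -> X t s <= L -> 0 <= X r s <= L /\ 0 <= r <= T.
  move=> sr rt tT XL; rewrite (X_ge0 sf) //= (le_trans (X_le sf s rt) XL); split => //.
  by rewrite (le_trans rt) // andbT (le_trans _ sr) // le_max lexx orbT.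
have gG s t r : Num.max s 0 <= r -> r <= t -> t <= T -> X t s <= L -> `|g s r| <= G.
  move=> sr rt tT XL; have [I1 I2] := inb s t r sr rt tT XL.
  apply: le_trans (ler_normD _ _) _; rewrite normrM; apply: lerD; last exact: (st_fC S).
  by apply: ler_pM => //; [exact: (st_pC S)|exact: HMw].
have lip s t t' : Num.max s 0 <= t -> t <= t' -> t' <= T -> X t' s <= L ->
    `|w (X t' s) t' - w (X t s) t| <= G * (t' - t).
  move=> st tt t'T XL.
  have XL' := le_trans (X_le sf s tt) XL.
  rewrite (so_wX so) ?(le_trans st tt) // (so_wX so (t := t)) ?(le_trans tt) //.
  rewrite -/(g s) opprD addrACA subrr add0r -(Int_chasles (g s) _ t t') addrC addKr.
  apply: Int_bound => // r /andP[tr rt']; apply: (gG s t') => //; exact: le_trans tr.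
have bdE s : w (X (Num.max s 0) s) (Num.max s 0) = bdv w s by rewrite (X_start sf).
have same t s s' : Num.max s 0 <= t -> Num.max s' 0 <= t -> t <= T -> X t s <= L -> X t s' <= L ->
    CX * `|s - s'| < d1 -> CX * `|s - s'| < d2 ->
    `|w (X t s) t - w (X t s') t| <= CW * (`|bdv w s - bdv w s'| + 2 * G * `|s - s'|) + eta / 4.
  move=> st s't tT XL XL' Hs1 Hs2.
  (* The two characteristics are compared from the later entry time on; up to then only one of them
     is inside, for a time at most [|s - s'|]. *)
  pose a := Num.max (Num.max s 0) (Num.max s' 0).
  have sa : Num.max s 0 <= a by rewrite le_max lexx.
  have s'a : Num.max s' 0 <= a by rewrite le_max lexx orbT.
  have at_ : a <= t by rewrite ge_max st.
  have a0 : 0 <= a by apply: le_trans sa; rewrite le_max lexx orbT.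
  have dXs r : a <= r <= t -> `|X r s - X r s'| <= CX * `|s - s'|.
    move=> /andP[ar_ rt]; apply: le_trans (X_lip_s sf r s s') _.
    rewrite /CX mulrAC; apply: ler_wpM2r => //; apply: ler_wpM2l; first by rewrite mulr_ge0 // ltW.
    rewrite ler_expR ler_wpM2l ?(ltW (sf_K0 sf)) // ger0_norm ?subr_ge0 ?(le_trans s'a) //.
    have : 0 <= Num.max s' 0 by rewrite le_max lexx orbT.
    by move: rt tT; flra.
  have H1 r : a <= r <= t -> w (X r s) r - w (X r s') r =
      (w (X a s) a - w (X a s') a) + Int (fun r => g s r - g s' r) a r.
    move=> /andP[ar_ rt]; have rT := le_trans rt tT.
    have P z : Num.max z 0 <= a -> X t z <= L -> w (X r z) r = w (X a z) a + Int (g z) a r.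
      move=> za Xz; rewrite (so_wX so (t := r)) ?(le_trans za ar_) // ?(le_trans (X_le sf z rt) Xz) //.
      rewrite (so_wX so (t := a)) ?(le_trans at_ tT) ?(le_trans (X_le sf z at_) Xz) //.
      by rewrite -/(g z) -addrA Int_chasles.
    by rewrite (P s) // (P s') // IntB //; ring.
  have H2 r : a <= r <= t -> `|g s r - g s' r| <= 2 * C * `|w (X r s) r - w (X r s') r| + (Mw + 1) * eta1.
    move=> /andP[ar_ rt]; rewrite /g.
    have [/andP[I1 I1'] /andP[I2 I2']] := inb s t r (le_trans sa ar_) rt tT XL.
    have [/andP[I3 I3'] _] := inb s' t r (le_trans s'a ar_) rt tT XL'.
    set x1 := X r s; set x2 := X r s'; set u1 := w x1 r; set u2 := w x2 r.
    have dx : `|x1 - x2| <= CX * `|s - s'| by apply: dXs; rewrite ar_.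
    have u1M : `|u1| <= Mw by apply: HMw; rewrite ?I1 ?I2.
    have -> : p x1 r * u1 + f x1 r u1 - (p x2 r * u2 + f x2 r u2) =
       (p x1 r - p x2 r) * u1 + p x2 r * (u1 - u2) + (f x1 r u1 - f x2 r u1) + (f x2 r u1 - f x2 r u2) by ring.
    have nx z : 0 <= z -> z <= L -> `|z| <= L + T by move=> z0 zL; rewrite ger0_norm //; move: zL T0; flra.
    have nr : `|r| <= L + T by rewrite ger0_norm //; move: I2' L0; flra.
    have E1 : `|(p x1 r - p x2 r) * u1| <= eta1 * Mw.
      rewrite normrM; apply: ler_pM => //; apply: ltW.
      by apply: (Hd1 x1 x2 r r (nx _ I1 I1') (nx _ I3 I3') nr nr (le_lt_trans dx Hs1)); rewrite subrr normr0.
    have E2 : `|p x2 r * (u1 - u2)| <= C * `|u1 - u2| by rewrite normrM ler_wpM2r // (st_pC S).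
    have E3 : `|f x1 r u1 - f x2 r u1| <= eta1.
      have Kin z : 0 <= z -> z <= L -> Kf (z, r, u1).
        by move=> z0 zL; split; [split; rewrite /= in_itv /= ?z0 ?I2|rewrite /= in_itv /= -ler_norml].
      apply: ltW; apply: (Hd2 (x1, r, u1) (x2, r, u1)); [exact: Kin|exact: Kin|].
      by rewrite !prod_normE /= !subrr normr0 !gt_max d2p !andbT; exact: le_lt_trans dx Hs2.
    have E4 : `|f x2 r u1 - f x2 r u2| <= C * `|u1 - u2| by exact: (st_fL S).
    apply: le_trans (ler_normD _ _) _.
    apply: le_trans (lerD (ler_normD _ _) (lexx _)) _.
    apply: le_trans (lerD (lerD (ler_normD _ _) (lexx _)) (lexx _)) _.
    by move: E1 E2 E3 E4; flra.
  have cDel : continuous (fun r => w (X r s) r - w (X r s') r) by apply: ctsB; exact: (along_cts S).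
  have C2 : 0 <= 2 * C by rewrite mulr_ge0 // ltW.
  have m0 : 0 <= (Mw + 1) * eta1 by rewrite mulr_ge0 // ltW.
  have := char_stab at_ cDel (ctsB (cg s) (cg s')) C2 m0 H1 H2; move=> /(_ t).
  rewrite lexx at_ => /(_ isT) /le_trans; apply.
  have Ha : `|w (X a s) a - w (X a s') a| <= `|bdv w s - bdv w s'| + 2 * G * `|s - s'|.
    have aT := le_trans at_ tT.
    have Q1 := lip s (Num.max s 0) a (lexx _) sa aT (le_trans (X_le sf s at_) XL).
    have Q2 := lip s' (Num.max s' 0) a (lexx _) s'a aT (le_trans (X_le sf s' at_) XL').
    rewrite !bdE in Q1 Q2.
    have aa z z' : Num.max z 0 <= a -> a <= Num.max (Num.max z 0) (Num.max z' 0) ->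
        a - Num.max z 0 <= `|z - z'|.
      move=> za; rewrite le_max => /orP[|] az'.
        by apply: le_trans (normr_ge0 _); rewrite subr_le0.
      apply: le_trans (_ : Num.max z' 0 - Num.max z 0 <= _); first by rewrite lerD2r.
      by rewrite distrC; apply: le_trans (ler_norm _) (max_lip _ _ _).
    have R1 : G * (a - Num.max s 0) <= G * `|s - s'|.
      by rewrite ler_pM2l //; apply: aa.
    have R2 : G * (a - Num.max s' 0) <= G * `|s - s'|.
      by rewrite ler_pM2l // distrC; apply: aa => //; rewrite maxC.
    have -> : w (X a s) a - w (X a s') a = (bdv w s - bdv w s') + (w (X a s) a - bdv w s) - (w (X a s') a - bdv w s') by ring.
    apply: le_trans (ler_normB _ _) _; apply: le_trans (lerD (ler_normD _ _) (lexx _)) _.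
    by move: Q1 Q2 R1 R2; flra.
  have e4 : CW * ((Mw + 1) * eta1 * (t - a)) <= eta / 4.
    have -> : eta / 4 = CW * ((Mw + 1) * eta1 * (T + 1)).
      rewrite /eta1; field; by rewrite !gt_eqF.
    rewrite ler_pM2l //; apply: ler_wpM2l => //; move: tT a0; flra.
  apply: le_trans (_ : CW * (`|w (X a s) a - w (X a s') a| + (Mw + 1) * eta1 * (t - a)) <= _).
    rewrite mulrC ler_wpM2r // ?CW_le //; by rewrite addr_ge0 // mulr_ge0 // subr_ge0.
  rewrite mulrDr; apply: lerD => //; by rewrite ler_pM2l.
have main x t x' t' : 0 <= x <= L -> 0 <= t <= T -> 0 <= x' <= L -> 0 <= t' <= T -> t <= t' ->
   `|x - x'| < Num.min (eta / (4 * W)) (Num.min (d1 / (2 * (CX * Cf))) (d2 / (2 * (CX * Cf)))) ->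
   `|t - t'| < Num.min (eta / (4 * W)) (Num.min (d1 / (2 * (CX * Cf))) (d2 / (2 * (CX * Cf)))) ->
   `|w x t - w x' t'| <= CW * `|bdv w (foot x t) - bdv w (foot x' t')| + eta.
  set dd := Num.min _ _ => xI tI x'I t'I tt xx tx.
  have [As st st0] := foot_in S xI tI; have [As' st' st0'] := foot_in S x'I t'I.
  set s := foot x t in As st st0 *; set s' := foot x' t' in As' st' st0' *.
  have Xs : X t s = x by exact: (X_foot sf).
  have Xs' : X t' s' = x' by exact: (X_foot sf).
  have /andP[x0 xL] := xI; have /andP[x'0 x'L] := x'I; have /andP[t0 tT] := tI; have /andP[t'0 t'T] := t'I.
  have ss : `|s - s'| <= Cf * dd.
    apply: le_trans (foot_lip sf tI t'I x0 x'0) _.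
    have -> : Cf * dd = expR (K * T) / l0 * ((1 + l1) * dd) by rewrite /Cf mulrA.
    apply: ler_wpM2l; first by rewrite divr_ge0 ?expR_ge0 // ltW // (sf_l0 sf).
    rewrite mulrDl mul1r; apply: lerD; first exact: ltW.
    by rewrite ler_pM2l // ltW.
  have ddp : 0 < dd by apply: le_lt_trans xx.
  have dd1 : dd <= eta / (4 * W) by rewrite /dd ge_min lexx.
  have dd2 : dd <= d1 / (2 * (CX * Cf)) by rewrite /dd !ge_min lexx !orbT.
  have dd3 : dd <= d2 / (2 * (CX * Cf)) by rewrite /dd !ge_min lexx !orbT.
  have Wd : W * dd <= eta / 4.
    apply: le_trans (ler_wpM2l (ltW W0) dd1) _.
    by rewrite le_eqVlt; apply/orP; left; apply/eqP; field; rewrite gt_eqF.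
  have CXs : CX * `|s - s'| <= CX * Cf * dd by rewrite -mulrA ler_pM2l.
  have Hs1 : CX * `|s - s'| < d1.
    by move: dd2 d1p CXs; rewrite ler_pdivlMr //; flra.
  have Hs2 : CX * `|s - s'| < d2.
    by move: dd3 d2p CXs; rewrite ler_pdivlMr //; flra.
  have GC : G * `|s - s'| <= G * Cf * dd by rewrite -mulrA ler_pM2l.
  have Gd : G * (t' - t) <= G * dd.
    by rewrite ler_pM2l // ltW //; apply: le_lt_trans tx; rewrite distrC ler_norm.
  have b0 := normr_ge0 (bdv w s - bdv w s').
  have WE : W * dd = CW * (2 * (G * Cf * dd)) + G * dd by rewrite /W mulrDl -mulrA; congr (CW * _ + _); rewrite -!mulrA.
  have GCd : 0 <= G * Cf * dd by apply: mulr_ge0 (ltW ddp); apply: mulr_ge0; exact: ltW.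
  (* If the second characteristic has entered by time [t], one passes from the first to it at time
     [t] and follows it up to [t']. Otherwise both points are close to their entry points, and the
     boundary values are compared directly. *)
  case: (leP (Num.max s' 0) t) => s't.
    have XL' : X t s' <= L by apply: le_trans (X_le sf s' tt) _; rewrite Xs'.
    have XL : X t s <= L by rewrite Xs.
    have Q1 := same t s s' st0 s't tT XL XL' Hs1 Hs2.
    have XLt : X t' s' <= L by rewrite Xs'.
    have Q2 := lip s' t t' s't tt t'T XLt.
    rewrite Xs in Q1; rewrite Xs' distrC in Q2.
    have Q3 := ler_distD (w (X t s') t) (w x t) (w x' t').
    have Q4 : CW * (2 * G * `|s - s'|) <= CW * (2 * (G * Cf * dd)).
      by rewrite ler_pM2l // -mulrA ler_pM2l.
    by move: Q1 Q2 Q3 Q4 Wd WE Gd eta0; rewrite mulrDr; flra.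
  have XLt : X t' s' <= L by rewrite Xs'.
  have XL : X t s <= L by rewrite Xs.
  have Q2 := lip s' _ t' (lexx _) st0' t'T XLt.
  have Q1 := lip s _ t (lexx _) st0 tT XL.
  rewrite !bdE Xs' Xs in Q1 Q2.
  have Q3 := ler_distD (bdv w s) (w x t) (w x' t').
  have Q4 := ler_distD (bdv w s') (bdv w s) (w x' t').
  rewrite (distrC (bdv w s') (w x' t')) in Q4.
  have Q5 : G * (t - Num.max s 0) <= G * `|s - s'|.
    rewrite ler_pM2l //; apply: le_trans (_ : Num.max s' 0 - Num.max s 0 <= _).
      by rewrite lerD2r ltW.
    by rewrite distrC; apply: le_trans (ler_norm _) (max_lip _ _ _).
  have Q6 : G * (t' - Num.max s' 0) <= G * (t' - t) by rewrite ler_pM2l // lerD2l lerN2 ltW.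
  have Q7 : `|bdv w s - bdv w s'| <= CW * `|bdv w s - bdv w s'| by rewrite ler_peMl.
  have Q8 : G * Cf * dd <= CW * (G * Cf * dd) by rewrite ler_peMl.
  by move: Q1 Q2 Q3 Q4 Q5 Q6 Q7 Q8 GC Gd Wd WE eta0 GCd; flra.
move=> x t x' t' xI tI x'I t'I xx tx.
case: (leP t t') => [tt|/ltW tt]; first exact: main.
rewrite distrC (distrC (bdv w _)); apply: main => //; by rewrite distrC.
Qed.

Section Convergence.
Hypothesis S : setup.
Let sf : speed_field h K l0 l1 := st_sf S.
Let C0 : 0 < C := st_C0 S.
Let C1 : 1 <= C := st_C1 S.
Let A0 : 0 < A := st_A S.
Let T0 : 0 < T := st_T S.
Let L0 : 0 < L := st_L S.
Opaque Int.

(** * A priori bounds *)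

(** The three ways in which a term of the boundary equations gains the factor [th] from the weight
    [expR (- G t)]: the delay of a reflection, integration over the travel time [x / l1], and the
    vanishing of [kappa] on its diagonal. *)
Record weight (G th : R) : Prop := Weight {
  wt_G : 0 < G;
  wt_th : 0 < th;
  wt_delay : expR (- (G * d0)) <= th;
  wt_int : Int (fun x => expR (- (G * (x / l1)))) 0 L <= th;
  wt_kappa : forall t s, 0 <= t <= T -> 0 <= s <= T ->
    `|kappa t s| * expR (G * s) <= th * expR (G * t) }.

Lemma expN_cts (G : R) (F : R -> R) : continuous F -> continuous (fun x => expR (- (G * F x))).
Proof. by move=> cF; apply: cts_exp; apply: ctsN; apply: ctsM => //; exact: cts_cst. Qed.

Lemma weight_exists (th : R) : 0 < th -> exists G, weight G th.
Proof.
move=> th0; have [G1 G1p H1] := exp_small (st_d0 S) th0.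
have [G2 G2p H2] := kappa_small S th0.
have l1p := st_l1 S.
(* The last entry serves [wt_int], whose integral is at most [l1 / G]. *)
pose G := Num.max G1 (Num.max G2 (l1 / th)).
have g1 : G1 <= G by rewrite le_max lexx.
have g2 : G2 <= G by rewrite !le_max lexx orbT.
have g3 : l1 / th <= G by rewrite !le_max lexx !orbT.
have Gp : 0 < G by exact: lt_le_trans g1.
exists G; split => //; [exact: H1| |by move=> t s; exact: H2].
have dF x : has_deriv (fun x => - (l1 / G) * expR (- (G * (x / l1)))) x (expR (- (G * (x / l1)))).
  have d1 : has_deriv (fun x => - (G * (x / l1))) x (- (G / l1)).
    rewrite (_ : (fun x => _) = (fun x => - (G / l1) * x)); last by apply/funext => y; field; rewrite gt_eqF.
    by apply: deriv_eq (derivZ (- (G / l1)) (deriv_id x)) _; rewrite mulr1.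
  apply: deriv_eq (derivZ _ (exp_deriv d1)) _; field; by rewrite !gt_eqF.
have c : continuous (fun x : R => expR (- (G * (x / l1)))).
  by apply: (expN_cts (F := fun x => x / l1)); apply: ctsM; [exact: cts_id|exact: cts_cst].
rewrite (Int_ftc _ _ c dF) mul0r mulr0 oppr0 expR0 mulr1 opprK addrC.
apply: le_trans (_ : l1 / G <= _).
  rewrite mulNr gerDl oppr_le0 mulr_ge0 ?expR_ge0 // divr_ge0 //; exact: ltW.
by rewrite ler_pdivrMr // mulrC -ler_pdivrMr.
Qed.

Lemma reg_abs s e a b (F : R -> R) (c : R) : (size s)%:R <= C -> 0 < e -> a <= b -> 0 <= c ->
  continuous F -> (forall x y, y \in s -> a <= x <= b -> `|x - y| <= e -> `|F x| <= c) ->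
  Int (fun x => `|reg s phi e x * F x|) a b <= C * C * c.
Proof.
move=> sC e0 ab c0 cF H.
apply: le_trans (reg_pullback_abs (G := id) (g := fun=> 1) (g0 := 1) (st_phi S) _ _ _ _ e0 ab c0 cF H) _.
all: cts; try by [].
  exact: (@deriv_id R).
rewrite divr1 -mulrA; apply: ler_pM => //; first by rewrite mulr_ge0 // (le_trans ler01 (mass_ge1 (st_phi S))).
by rewrite mulrC; apply: ler_wpM2r => //; exact: st_massC S.
Qed.

Lemma sz_xb : (size xb)%:R <= C. Proof. by have [] := st_szC S. Qed.
Lemma sz_tc : (size tc)%:R <= C. Proof. by have [] := st_szC S. Qed.
Lemma sz_xa : (size xa)%:R <= C. Proof. by have [] := st_szC S. Qed.

(** The exponential part of the bound on [D] costs only [th]: the support of [bs] lies in [x >= xm],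
    where [wt_delay] applies, and against the bounded [br] it is integrated as in [wt_int]. *)
Lemma bsbr_Int G th e (D : R -> R) (a b : R) : weight G th -> 0 < e < xm -> continuous D -> 0 <= a -> 0 <= b ->
  (forall x, 0 <= x <= L -> `|D x| <= a + b * expR (- (G * (x / l1)))) ->
  `|Int (fun x => (bs e x + br x) * D x) 0 L| <= 2 * (C * C) * (a + b * th).
Proof.
move=> W eI cD a0 b0 HD; have e0 : 0 < e by case/andP: eI.
have cb : continuous (fun x => bs e x * D x) by apply: ctsM => //; exact: (reg_cts (st_phi S)).
have cr' : continuous (fun x => br x * D x) by apply: ctsM => //; exact: (st_br S).
rewrite (_ : (fun x => _) = (fun x => bs e x * D x + br x * D x)); last by apply/funext => x; rewrite mulrDl.
rewrite IntD //; apply: le_trans (ler_normD _ _) _.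
have th0 := ltW (wt_th W).
have abt : 0 <= a + b * th by rewrite addr_ge0 // mulr_ge0.
have l1p := st_l1 S.
have H1 : `|Int (fun x => bs e x * D x) 0 L| <= C * C * (a + b * th).
  apply: le_trans (Int_norm (ltW L0) cb (cts_norm cb) (fun x _ => lexx _)) _.
  apply: reg_abs => //; [exact: sz_xb|exact: ltW|].
  move=> x y yb xI xy; apply: le_trans (HD x xI) _; rewrite lerD2l; apply: ler_wpM2l => //.
  apply: le_trans (wt_delay W); rewrite ler_expR lerN2 ler_pM2l ?(wt_G W) // ler_pM2r ?invr_gt0 //.
  have /andP[y1 y2] := st_xb S yb; have /andP[_ em] := eI; have := st_xm S.
  by move: xy; rewrite ler_norml => /andP[H _]; move: H y1 em; flra.
have H2 : `|Int (fun x => br x * D x) 0 L| <= C * C * (a + b * th).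
  have ce : continuous (fun x : R => expR (- (G * (x / l1)))).
    by apply: (expN_cts (F := fun x => x / l1)); apply: ctsM; [exact: cts_id|exact: cts_cst].
  have c1 : continuous (fun x : R => a + b * expR (- (G * (x / l1)))).
    by apply: ctsD; [exact: cts_cst|apply: ctsM => //; exact: cts_cst].
  apply: le_trans (_ : Int (fun x => C * (a + b * expR (- (G * (x / l1))))) 0 L <= _).
    apply: Int_norm => //; [exact: ltW|by apply: ctsM => //; exact: cts_cst|].
    by move=> x xI; rewrite normrM; apply: ler_pM => //; [exact: (st_brC S)|exact: HD].
  rewrite IntZ // -mulrA ler_pM2l // IntD //; [|exact: cts_cst|by apply: ctsM => //; exact: cts_cst].
  rewrite Int_cst subr0 IntZ //.
  rewrite [C * (a + _)]mulrDr; apply: lerD.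
    by rewrite mulrC ler_wpM2r // (st_LC S).
  apply: le_trans (ler_wpM2l b0 (wt_int W)) _.
  by rewrite ler_peMl // mulr_ge0.
by move: H1 H2; flra.
Qed.

Lemma kappa_weight G th t (b : R -> R) : weight G th -> 0 <= t <= T -> continuous b -> (forall r, 0 <= b r) ->
  Int (fun s => `|kappa t s| * b s) (- A) T <=
  C ^+ 3 * Int b (- A) 0 + th * expR (G * t) * Int (fun s => expR (- (G * s)) * b s) 0 T.
Proof.
move=> W tI cb b0; rewrite -(Int_chasles _ (- A) 0 T).
have ck : continuous (fun s => `|kappa t s| * b s).
  by apply: ctsM => //; apply: cts_norm; exact: (@cts2_r _ _ t (kappa_cts2 S)).
have NA : - A <= 0 by rewrite oppr_le0 ltW.
have cw : continuous (fun s : R => expR (- (G * s)) * b s).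
  by apply: ctsM => //; exact: (expN_cts (F := id) (@cts_id _)).
apply: lerD.
  rewrite -IntZ //; apply: Int_le => //; first by apply: ctsM => //; exact: cts_cst.
  move=> s /andP[As s0]; apply: ler_wpM2r => //.
  rewrite exprS expr2; apply: (kappa_bound S) => //; rewrite As (le_trans s0) //; exact: ltW.
rewrite -IntZ //; apply: Int_le => //; [exact: ltW|by apply: ctsM => //; exact: cts_cst|].
move=> s sI; rewrite mulrA; apply: ler_wpM2r => //.
have := wt_kappa W tI sI; rewrite -ler_pdivlMr ?expR_gt0 //.
by rewrite -expRN.
Qed.

(** After exchanging the integrals, a parameter [r >= 0] is seen by [bs] only at times
    [s >= r + xm / l1], which gives the factor [th]; for [r <= 0] the weight is bounded by 1. The
    five factors [C] bound the number of points, the two factors of [Y], [1 / l0] and the mass of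
    the profile. *)
Lemma Q_weight G th e (b : R -> R) : weight G th -> 0 < e < xm -> continuous b -> (forall r, 0 <= b r) ->
  Int (fun s => expR (- (G * s)) * Int (fun r => `|bs e (X s r) * Y s r| * b r) (- A) T) 0 T <=
  C ^+ 5 * (Int b (- A) 0 + th * Int (fun r => expR (- (G * r)) * b r) 0 T).
Proof.
move=> W eI cb b0; have e0 : 0 < e by case/andP: eI.
have NA : - A <= 0 by rewrite oppr_le0 ltW.
have NAT : - A <= T by apply: le_trans NA (ltW T0).
have cE : continuous (fun s : R => expR (- (G * s))) by exact: (expN_cts (F := id) (@cts_id _)).
have cbs := reg_cts (st_phi S) (s := xb) (e := e).
have cM : cts2 (fun s r => expR (- (G * s)) * (`|bs e (X s r) * Y s r| * b r)).
  apply: ctsM; first exact: (cts_app cE (@cts_fst R)).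
  apply: ctsM; last exact: (cts_app cb (@cts_snd R)).
  apply: cts_norm; apply: ctsM; last exact: (Y_cts2 S).
  exact: (cts_app cbs (X_cts2 sf)).
rewrite (_ : (fun s => _) = (fun s => Int (fun r => expR (- (G * s)) * (`|bs e (X s r) * Y s r| * b r)) (- A) T)); last first.
  apply/funext => s; rewrite IntZ //; apply: ctsM => //; apply: cts_norm; apply: ctsM.
    exact: (cts_app cbs (@cts2_r _ _ s (X_cts2 sf))).
  exact: (@cts2_r _ _ s (Y_cts2 S)).
rewrite Int_swap // -(Int_chasles _ (- A) 0 T) mulrDr.
have cI : continuous (fun r => Int (fun s => expR (- (G * s)) * (`|bs e (X s r) * Y s r| * b r)) 0 T).
  have := @Int_param_cts _ (fun r s => expR (- (G * s)) * (`|bs e (X s r) * Y s r| * b r)) 0 T.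
  by apply; exact: (cts2_flip cM).
have cU r : continuous (fun s => expR (- (G * s)) * Y s r).
  by apply: ctsM => //; exact: (cts2_l (Y_cts2 S)).
have cpos : 0 <= C ^+ 5 by apply: exprn_ge0; exact: ltW.
have key r c : 0 <= c -> (forall s y, y \in xb -> 0 <= s <= T -> `|X s r - y| <= e -> `|expR (- (G * s)) * Y s r| <= c * (C * C)) ->
   Int (fun s => expR (- (G * s)) * (`|bs e (X s r) * Y s r| * b r)) 0 T <= C ^+ 5 * c * b r.
  move=> c0 H.
  have cbX : continuous (fun s => `|bs e (X s r) * (expR (- (G * s)) * Y s r)|).
    by apply: cts_norm; apply: ctsM => //; exact: (cts_app cbs (cts2_l (X_cts2 sf))).
  rewrite (_ : (fun s => _) = (fun s => b r * `|bs e (X s r) * (expR (- (G * s)) * Y s r)|)); last first.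
    apply/funext => s; rewrite [in RHS]mulrCA [in RHS]normrM (ger0_norm (expR_ge0 _)); ring.
  rewrite IntZ // mulrC; apply: ler_wpM2r => //.
  have CC : 0 <= c * (C * C) by rewrite mulr_ge0 // mulr_ge0 // ltW.
  have hX s : l0 <= h (X s r) s by exact: (sf_ge sf).
  apply: le_trans (reg_pullback_abs (st_phi S) (@X_sol _ _ _ _ _ sf r) _ (sf_l0 sf) hX e0 (ltW T0) CC (cU r) H) _.
    exact: (cts_app (sf_cts sf) (cts_pair (cts2_l (X_cts2 sf)) (@cts_id _))).
  have -> : C ^+ 5 * c = C * (c * (C * C) * C * C) by ring.
  apply: ler_pM => //; [|exact: sz_xb|].
    by rewrite mulr_ge0 ?(le_trans ler01 (mass_ge1 (st_phi S))) // mulr_ge0 // invr_ge0 ltW // (sf_l0 sf).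
  apply: ler_pM; rewrite ?(le_trans ler01 (mass_ge1 (st_phi S))) ?(st_massC S) //.
    by rewrite mulr_ge0 // invr_ge0 ltW // (sf_l0 sf).
  by apply: ler_wpM2l => //; exact: (st_l0C S).
apply: lerD.
  rewrite -IntZ //; apply: Int_le => //; first by apply: ctsM => //; exact: cts_cst.
  move=> r /andP[Ar r0]; rewrite -[C ^+ 5]mulr1; apply: key => // s y yb sI sy.
  rewrite normrM (ger0_norm (expR_ge0 _)) (gtr0_norm (Y_gt0 S _ _)).
  apply: ler_pM; rewrite ?expR_ge0 ?(ltW (Y_gt0 S _ _)) //.
    rewrite -expR0 ler_expR oppr_le0 mulr_ge0 // ?(ltW (wt_G W)) //; by case/andP: sI.
  by apply: (Y_le S) => //; rewrite Ar (le_trans r0) // ltW.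
have cw : continuous (fun r : R => expR (- (G * r)) * b r) by apply: ctsM.
rewrite -!IntZ //; last by apply: ctsM => //; exact: cts_cst.
apply: Int_le => //; [exact: ltW|by apply: ctsM; [exact: cts_cst|apply: ctsM => //; exact: cts_cst]|].
move=> r rI; have /andP[r0 rT] := rI.
have -> : C ^+ 5 * (th * (expR (- (G * r)) * b r)) = C ^+ 5 * (th * expR (- (G * r))) * b r by ring.
apply: key; first by rewrite mulr_ge0 ?expR_ge0 // ltW // (wt_th W).
move=> s y yb sI sy; rewrite normrM (ger0_norm (expR_ge0 _)) (gtr0_norm (Y_gt0 S _ _)).
apply: ler_pM; rewrite ?expR_ge0 ?(ltW (Y_gt0 S _ _)) //; last first.
  by apply: (Y_le S) => //; rewrite rT andbT; exact: le_trans r0.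
have s0 : 0 <= s by case/andP: sI.
have := delay S eI yb sy s0; rewrite (foot_X sf) => /(_ r0) Hd.
apply: le_trans (_ : expR (- (G * d0)) * expR (- (G * r)) <= _).
  rewrite -expRD ler_expR -opprD lerN2 -mulrDr ler_pM2l ?(wt_G W) //.
  by move: Hd; flra.
by rewrite ler_wpM2r ?expR_ge0 // (wt_delay W).
Qed.

(** The factors [C] bound the number of points, the mass of the profile, and [1 / h 0 0], which
    comes from the scaling of the parameter on the initial line. *)
Lemma initial_mass e w v : wvsol e w v -> Int (fun s => `|bdv v s|) (- A) 0 <= C ^+ 3.
Proof.
move=> so; have e0 : 0 < e by case/andP: (so_e so).
have NA : - A <= 0 by rewrite oppr_le0 ltW.
have h0 := st_h0 S.
have ca : continuous (fun x => `|as_ e x|) by apply: cts_norm; exact: (reg_cts (st_phi S)).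
have cG : continuous (fun s => - h 0 0 * s) by apply: ctsM; [exact: cts_cst|exact: cts_id].
have cbv : continuous (fun s => `|bdv v s|) by apply: cts_norm; exact: (bdv_cts (so_v so)).
have caG : continuous (fun s => `|as_ e (- h 0 0 * s)|) by exact: (cts_app ca cG).
rewrite (@Int_ext _ _ (fun s => `|as_ e (- h 0 0 * s)|)) //; last first.
  by move=> s /andP[As s0]; rewrite (bdv_neg S so) ?(ltW As) ?(ltW s0).
have E1 : - h 0 0 * Int (fun s => `|as_ e (- h 0 0 * s)|) (- A) 0 = - Int (fun x => `|as_ e x|) 0 L.
  rewrite -IntZ // (@Int_subst _ (fun x => `|as_ e x|) (fun s => - h 0 0 * s) (fun=> - h 0 0)) //.
  - by rewrite mulrNN (st_hA S) mulr0 Int_opp.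
  - by apply: ctsM => //; exact: cts_cst.
  - by move=> x _; apply: deriv_eq (derivZ (- h 0 0) (deriv_id x)) _; rewrite mulr1.
  - by move=> x _; rewrite mulrC.
have E2 : Int (fun x => `|as_ e x|) 0 L <= C * C * 1.
  rewrite (_ : (fun x => _) = (fun x => `|as_ e x * 1|)); last by apply/funext => x; rewrite mulr1.
  apply: reg_abs => //; [exact: sz_xa|exact: ltW|exact: cts_cst|by move=> *; rewrite normr1].
have -> : Int (fun s => `|as_ e (- h 0 0 * s)|) (- A) 0 = Int (fun x => `|as_ e x|) 0 L / h 0 0.
  by apply: (mulfI (lt0r_neq0 h0)); rewrite mulrCA divff ?gt_eqF // mulr1; move: E1; rewrite mulNr => /oppr_inj.
have -> : C ^+ 3 = C * C * 1 * C by ring.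
apply: ler_pM => //; last first.
- apply: le_trans (st_l0C S); rewrite lef_pV2 ?posrE //; [exact: (sf_ge sf)|exact: (sf_l0 sf)].
- by rewrite invr_ge0 ltW.
by apply: Int_ge0 => //; exact: ltW.
Qed.

Lemma Bf_cts e w v : wvsol e w v -> continuous (Bf e w v).
Proof.
move=> so; apply: (@Int_param_cts _ (fun t x => (bs e x + br x) * w x t + br x * v x t) 0 L).
have cb := reg_cts (st_phi S) (s := xb) (e := e).
have c2 := @cts_snd R.
apply: ctsD; apply: ctsM; [apply: ctsD|exact: (cts2_flip (so_w so))| |exact: (cts2_flip (so_v so))].
- exact: (cts_app cb c2).
- exact: (cts_app (st_br S) c2).
- exact: (cts_app (st_br S) c2).
Qed.

Lemma Qf_cts e w v : wvsol e w v -> continuous (Qf e v).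
Proof.
move=> so; apply: (@Int_param_cts _ (fun t x => bs e x * v x t) 0 L).
apply: ctsM; last exact: (cts2_flip (so_v so)).
exact: (cts_app (reg_cts (st_phi S) (s := xb) (e := e)) (@cts_snd R)).
Qed.

Lemma bdv_zero e w v : wvsol e w v -> bdv v 0 = 0.
Proof.
move=> so; have /andP[e0 ex] := so_e so; have x0 := st_xm S.
rewrite (bdv_neg S so) ?lexx ?oppr_le0 ?(ltW A0) // mulr0.
apply: (reg_eq0 (st_phi S) e0) => y /(st_xa S)/andP[y1 _].
by rewrite sub0r normrN; apply: lt_le_trans (ler_norm _); move: ex y1 x0; flra.
Qed.

Lemma Bf_split e w v t : wvsol e w v -> 0 <= t <= T ->
  Bf e w v t = Int (fun x => (bs e x + br x) * w x t) 0 L + Int (fun s => kappa t s * bdv v s) (- A) T.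
Proof.
move=> so tI; rewrite -(v_pairing S so (st_br S) (st_br0 S) (st_brL S) tI) -IntD //.
- apply: ctsM; last exact: (cts2_l (so_w so)).
  by apply: ctsD; [exact: (reg_cts (st_phi S))|exact: (st_br S)].
- apply: ctsM; [exact: (st_br S)|exact: (cts2_l (so_v so))].
Qed.

Lemma Qf_abs e w v s : wvsol e w v -> 0 <= s <= T ->
  `|Qf e v s| <= Int (fun r => `|bs e (X s r) * Y s r| * `|bdv v r|) (- A) T.
Proof.
move=> so sI; rewrite (Q_pairing S so sI).
have cb := bdv_cts (so_v so).
have c : continuous (fun r => bs e (X s r) * Y s r).
  apply: ctsM; last exact: (@cts2_r _ _ s (Y_cts2 S)).
  exact: (cts_app (reg_cts (st_phi S) (s := xb) (e := e)) (@cts2_r _ _ s (X_cts2 sf))).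
apply: Int_norm.
- by move: A0 T0; flra.
- exact: ctsM.
- by apply: ctsM; exact: cts_norm.
- by move=> r _; rewrite normrM.
Qed.

(** The reflected part of the mass returns with the factor [C ^+ 6 * th <= 1 / 2] and is absorbed
    into the left side. What remains comes from [c_s B] and from the initial mass [C ^+ 3],
    multiplied by [C ^+ 6]. *)
Lemma v_mass G th e w v m : wvsol e w v -> weight G th -> C ^+ 6 * th <= 2^-1 -> 0 <= m ->
  (forall t, 0 <= t <= T -> `|Bf e w v t| <= m * expR (G * t)) ->
  Int (fun s => expR (- (G * s)) * `|bdv v s|) 0 T <= 2 * (C * C * m + C ^+ 9).
Proof.
move=> so W th6 m0 HB; have e0 : 0 < e by case/andP: (so_e so).
have cE : continuous (fun s : R => expR (- (G * s))) by exact: (expN_cts (F := id) (@cts_id _)).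
have cbv : continuous (fun s => `|bdv v s|) := cts_norm (bdv_cts (so_v so)).
have cB := Bf_cts so; have cQ := Qf_cts so.
have ccs := reg_cts (st_phi S) (s := tc) (e := e).
set V := Int _ 0 T.
have cEB : continuous (fun s => expR (- (G * s)) * Bf e w v s) by exact: ctsM.
pose q s := Int (fun r => `|bs e (X s r) * Y s r| * `|bdv v r|) (- A) T.
have cq : continuous q.
  apply: (@Int_param_cts _ (fun s r => `|bs e (X s r) * Y s r| * `|bdv v r|) (- A) T).
  apply: ctsM; last exact: (cts_app cbv (@cts_snd R)).
  apply: cts_norm; apply: ctsM; last exact: (Y_cts2 S).
  exact: (cts_app (reg_cts (st_phi S) (s := xb) (e := e)) (X_cts2 sf)).
have cEq : continuous (fun s => expR (- (G * s)) * q s) by exact: ctsM.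
have c1 : continuous (fun s => `|cs e s * (expR (- (G * s)) * Bf e w v s)|) by apply: cts_norm; exact: ctsM.
have c2 : continuous (fun s => C * (expR (- (G * s)) * q s)) by apply: ctsM => //; exact: cts_cst.
have H1 : V <= Int (fun s => `|cs e s * (expR (- (G * s)) * Bf e w v s)| + C * (expR (- (G * s)) * q s)) 0 T.
  apply: Int_le => //; [exact: ltW|exact: ctsM|exact: ctsD|].
  move=> s sI; have q0 : 0 <= q s by apply: le_trans (Qf_abs so sI).
  have p2 : 0 <= C * (expR (- (G * s)) * q s).
    by apply: mulr_ge0 (ltW C0) _; apply: mulr_ge0 q0; exact: expR_ge0.
  have /andP[s0' sT] := sI; case: (ltP 0 s) => [s0|s0]; last first.
    have E0 : bdv v s = 0 by rewrite (_ : s = 0) ?(bdv_zero so) //; apply/eqP; rewrite eq_le s0.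
    by rewrite E0 normr0 mulr0 addr_ge0.
  rewrite (bdv_pos so) ?s0 //.
  apply: le_trans (ler_wpM2l (expR_ge0 _) (ler_normD _ _)) _; rewrite mulrDr; apply: lerD.
    by rewrite [in leRHS]mulrCA [in leRHS]normrM (ger0_norm (expR_ge0 _)).
  rewrite [in leRHS]mulrCA; apply: ler_wpM2l; first exact: expR_ge0.
  rewrite normrM.
  by apply: ler_pM => //; [exact: (st_crC S)|exact: (Qf_abs so sI)].
have H2 : Int (fun s => `|cs e s * (expR (- (G * s)) * Bf e w v s)|) 0 T <= C * C * m.
  apply: reg_abs => //; [exact: sz_tc|exact: ltW|].
  move=> s y _ sI _; rewrite normrM (ger0_norm (expR_ge0 _)) expRN mulrC ler_pdivrMr ?expR_gt0 //.
  exact: HB.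
have H3 := Q_weight W (so_e so) cbv (fun r => normr_ge0 _).
rewrite -/V -/q in H3.
have V0 : 0 <= V.
  apply: Int_ge0 => //; [exact: ltW|exact: ctsM].
have H4 : C * Int (fun s => expR (- (G * s)) * q s) 0 T <= C ^+ 9 + 2^-1 * V.
  apply: le_trans (ler_wpM2l (ltW C0) H3) _.
  have -> : C * (C ^+ 5 * (Int (fun s => `|bdv v s|) (- A) 0 + th * V)) =
     C ^+ 6 * Int (fun s => `|bdv v s|) (- A) 0 + C ^+ 6 * th * V by ring.
  apply: lerD; last exact: ler_wpM2r.
  rewrite (_ : C ^+ 9 = C ^+ 6 * C ^+ 3); last by ring.
  by apply: ler_wpM2l (initial_mass so); apply: exprn_ge0; exact: ltW.
move: H1; rewrite IntD // IntZ // => H1.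
by move: H1 H2 H4; flra.
Qed.

Lemma foot_weight G x t : 0 < G -> 0 <= x <= L -> 0 <= t <= T -> 0 <= foot x t ->
  expR (G * foot x t) <= expR (G * t) * expR (- (G * (x / l1))).
Proof.
move=> G0 /andP[x0 _] /andP[t0 _] f0; rewrite -expRD ler_expR -mulrBr ler_pM2l //.
exact: (foot_travel sf).
Qed.

(** A characteristic through [(x, t)] carries either initial data bounded by [C] or boundary data of
    a time earlier by [x / l1]; the latter gives the decaying exponential. *)
Lemma w_weight G e w v m x t : wvsol e w v -> 0 < G -> 0 <= m ->
  (forall t, 0 <= t <= T -> `|Bf e w v t| <= m * expR (G * t)) ->
  0 <= x <= L -> 0 <= t <= T ->
  `|w x t| <= expR (G * t) * (CW * (C + C * T) + CW * (C * m) * expR (- (G * (x / l1)))).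
Proof.
move=> so G0 m0 HB xI tI; have [As st st0] := foot_in S xI tI.
have CW1 := CW_ge1 S; have CW0 : 0 < CW := lt_le_trans ltr01 CW1.
have /andP[x0 xL] := xI; have /andP[t0 tT] := tI.
have := w_bound S so st0 tT; rewrite (X_foot sf) => /(_ xL) /le_trans; apply.
have E1 : 1 <= expR (G * t) by apply: expR_ge1; apply: mulr_ge0 t0; exact: ltW.
have CT : 0 <= C * T by rewrite mulr_ge0 // ltW.
have Em : 0 <= expR (G * t) * (C * m * expR (- (G * (x / l1)))).
  by apply: mulr_ge0 (expR_ge0 _) _; apply: mulr_ge0 (expR_ge0 _); exact: mulr_ge0 (ltW C0) m0.
have H : `|bdv w (foot x t)| <= C + expR (G * t) * (C * m * expR (- (G * (x / l1)))).
  case: (leP (foot x t) 0) => [f0|f0].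
    by rewrite (bdw_neg S so) ?As // -[leLHS]addr0; apply: lerD => //; exact: (st_arC S).
  have fT := le_trans st tT.
  rewrite (bdw_pos so) ?f0 // normrM -[leLHS]add0r; apply: lerD; first exact: ltW.
  apply: le_trans (ler_pM (normr_ge0 _) (normr_ge0 _) (st_crC S _) (HB _ _)) _; first by rewrite (ltW f0).
  rewrite [leLHS]mulrA; have -> : expR (G * t) * (C * m * expR (- (G * (x / l1)))) = C * m * (expR (G * t) * expR (- (G * (x / l1)))) by ring.
  apply: ler_wpM2l; first exact: mulr_ge0 (ltW C0) m0.
  exact: foot_weight (ltW f0).
have CCT : 0 <= C + C * T by apply: addr_ge0 => //; exact: ltW.
have -> : expR (G * t) * (CW * (C + C * T) + CW * (C * m) * expR (- (G * (x / l1)))) =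
  CW * (expR (G * t) * (C + C * T) + expR (G * t) * (C * m * expR (- (G * (x / l1))))) by ring.
rewrite ler_pM2l //.
have H' : C + C * T <= expR (G * t) * (C + C * T) by rewrite ler_peMl.
by move: H H'; flra.
Qed.

(** All error terms have the form [k * C ^+ n * CW * th0], with or without [CW], where [n <= 6]. The
    number 64 leaves room for the numerical factors [k], the largest being 10, so that the sums stay
    below the fractions needed. *)
Definition th0 : R := (64 * (C ^+ 6 * CW))^-1.

Lemma th0_gt0 : 0 < th0.
Proof. by rewrite invr_gt0 mulr_gt0 // mulr_gt0 ?exprn_gt0 // (lt_le_trans ltr01 (CW_ge1 S)). Qed.

Lemma th0_le (n : nat) : (n <= 6)%N -> C ^+ n * CW * th0 <= 64^-1.
Proof.
move=> n6; rewrite /th0 invfM mulrA mulrAC ler_piMl ?invr_ge0 //.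
have CW0 := lt_le_trans ltr01 (CW_ge1 S).
have D : 0 < C ^+ 6 * CW by rewrite mulr_gt0 ?exprn_gt0.
rewrite ler_pdivrMr // mul1r ler_pM2r //; exact: ler_weXn2l.
Qed.

Lemma th0_le1 (n : nat) : (n <= 6)%N -> C ^+ n * th0 <= 64^-1.
Proof.
move=> n6; apply: le_trans (th0_le n6); rewrite -mulrA; apply: ler_wpM2l.
  by apply: exprn_ge0; exact: ltW.
by rewrite ler_peMl ?(CW_ge1 S) // ltW // th0_gt0.
Qed.

(** The boundary equation at the time where the weighted [B] is largest bounds its maximum [m] by a
    constant plus [m / 4]. The bounds on the mass of [bdv v] and on [w] then follow from the one on
    [B]. *)
Lemma apriori : exists2 M : R, 0 <= M & forall e w v, wvsol e w v ->
  [/\ forall t, 0 <= t <= T -> `|Bf e w v t| <= M,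
      Int (fun s => `|bdv v s|) (- A) T <= M &
      forall x t, 0 <= x <= L -> 0 <= t <= T -> `|w x t| <= M].
Proof.
have thp := th0_gt0; have [G W] := weight_exists thp.
have Gp := wt_G W.
have CW1 := CW_ge1 S; have CW0 : 0 < CW := lt_le_trans ltr01 CW1.
pose a := CW * (C + C * T).
have a0 : 0 < a by rewrite mulr_gt0 // addr_gt0 // mulr_gt0.
pose m1 := 2 * (2 * (C * C) * a + C ^+ 6 + th0 * (2 * C ^+ 9)).
have C9 : 0 <= C ^+ 9 by apply: exprn_ge0; exact: ltW.
have C6 : 0 <= C ^+ 6 by apply: exprn_ge0; exact: ltW.
have m1p : 0 <= m1.
  apply: mulr_ge0 => //; apply: addr_ge0; [apply: addr_ge0 => //|apply: mulr_ge0 (ltW thp) _; exact: mulr_ge0].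
  by apply: mulr_ge0 (ltW a0); apply: mulr_ge0 => //; apply: mulr_ge0; exact: ltW.
have EGT : 1 <= expR (G * T) by apply: expR_ge1; apply: mulr_ge0; exact: ltW.
pose MB := m1 * expR (G * T).
have MB0 : 0 <= MB by apply: mulr_ge0 m1p (expR_ge0 _).
pose MV := C ^+ 3 + expR (G * T) * (2 * (C * C * m1 + C ^+ 9)).
have C3 : 0 <= C ^+ 3 by apply: exprn_ge0; exact: ltW.
have MV0 : 0 <= MV.
  apply: addr_ge0 => //; apply: mulr_ge0 (expR_ge0 _) _; apply: mulr_ge0 => //; apply: addr_ge0 => //.
  by apply: mulr_ge0 m1p; apply: mulr_ge0; exact: ltW.
pose Mw := expR (G * T) * (a + CW * (C * m1)).
have Mw0 : 0 <= Mw.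
  apply: mulr_ge0 (expR_ge0 _) _; apply: addr_ge0 (ltW a0) _; apply: mulr_ge0 (ltW CW0) _.
  exact: mulr_ge0 (ltW C0) m1p.
exists (MB + MV + Mw); first by apply: addr_ge0 => //; exact: addr_ge0.
move=> e w v so.
have cE : continuous (fun s : R => expR (- (G * s))) by exact: (expN_cts (F := id) (@cts_id _)).
have cB := Bf_cts so.
have cF : continuous (fun s => expR (- (G * s)) * `|Bf e w v s|) by apply: ctsM => //; exact: cts_norm.
(* For fixed [e] the maximum is finite and attained, so it may be absorbed; the constant obtained
   does not depend on [e]. *)
have [tm tmI Hm] := EVT_max (ltW T0) (continuous_subspaceT cF).
set m := expR (- (G * tm)) * _ in Hm.
have m0 : 0 <= m by apply: mulr_ge0 (expR_ge0 _) (normr_ge0 _).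
have HB t : 0 <= t <= T -> `|Bf e w v t| <= m * expR (G * t).
  move=> tI; have := Hm t; rewrite in_itv /= tI => /(_ isT).
  by rewrite expRN mulrC ler_pdivrMr ?expR_gt0.
have {}tmI : 0 <= tm <= T by move: tmI; rewrite in_itv.
have V1 : Int (fun s => expR (- (G * s)) * `|bdv v s|) 0 T <= 2 * (C * C * m + C ^+ 9).
  apply: (v_mass so W _ m0 HB); apply: le_trans (th0_le1 (leqnn 6)) _; lra.
have NA : - A <= 0 by rewrite oppr_le0 ltW.
have cbv : continuous (fun s => `|bdv v s|) := cts_norm (bdv_cts (so_v so)).
have V0 := initial_mass so.
have mle : m <= m1.
  pose D x := expR (- (G * tm)) * w x tm.
  have cw : continuous (w^~ tm) := cts2_l (so_w so).
  have cD : continuous D by apply: ctsM => //; exact: cts_cst.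
  have b0 : 0 <= CW * (C * m) by apply: mulr_ge0 (ltW CW0) (mulr_ge0 (ltW C0) m0).
  have cbb : continuous (fun x => bs e x + br x) by apply: ctsD; [exact: (reg_cts (st_phi S))|exact: (st_br S)].
  have H1 : `|Int (fun x => (bs e x + br x) * D x) 0 L| <= 2 * (C * C) * (a + CW * (C * m) * th0).
    apply: (bsbr_Int W (so_e so) cD (ltW a0) b0) => x xI.
    rewrite normrM (ger0_norm (expR_ge0 _)) expRN mulrC ler_pdivrMr ?expR_gt0 // mulrC.
    exact: (w_weight so).
  have H2 : `|Int (fun s => kappa tm s * bdv v s) (- A) T| <= C ^+ 6 + th0 * expR (G * tm) * (2 * (C * C * m + C ^+ 9)).
    have ck : continuous (kappa tm) := @cts2_r _ _ tm (kappa_cts2 S).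
    apply: le_trans (_ : Int (fun s => `|kappa tm s| * `|bdv v s|) (- A) T <= _).
      apply: Int_norm; [by move: A0 T0; flra|by apply: ctsM => //; exact: bdv_cts (so_v so)|by apply: ctsM => //; exact: cts_norm|].
      by move=> s _; rewrite normrM.
    apply: le_trans (kappa_weight W tmI cbv (fun _ => normr_ge0 _)) _; apply: lerD.
      by rewrite (_ : C ^+ 6 = C ^+ 3 * C ^+ 3); [exact: ler_wpM2l|ring].
    by apply: ler_wpM2l V1; apply: mulr_ge0 (ltW thp) (expR_ge0 _).
  have Em : expR (- (G * tm)) <= 1.
    by rewrite -expR0 ler_expR oppr_le0 mulr_ge0 // ?(ltW Gp) //; case/andP: tmI.
  have E1 : expR (- (G * tm)) * expR (G * tm) = 1 by rewrite -expRD addNr expR0.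
  have H3 : m <= `|Int (fun x => (bs e x + br x) * D x) 0 L| +
      expR (- (G * tm)) * `|Int (fun s => kappa tm s * bdv v s) (- A) T|.
    have -> : Int (fun x => (bs e x + br x) * D x) 0 L = expR (- (G * tm)) * Int (fun x => (bs e x + br x) * w x tm) 0 L.
      rewrite -IntZ; last exact: ctsM.
      by congr (Int _ 0 L); apply/funext => x; rewrite /D; ring.
    rewrite /m (Bf_split so tmI) [in leRHS]normrM (ger0_norm (expR_ge0 _)) -mulrDr.
    apply: ler_wpM2l; [exact: expR_ge0|exact: ler_normD].
  have H4 := ler_wpM2l (expR_ge0 (- (G * tm))) H2.
  have H5 : expR (- (G * tm)) * (C ^+ 6 + th0 * expR (G * tm) * (2 * (C * C * m + C ^+ 9))) <=
      C ^+ 6 + th0 * (2 * (C * C * m + C ^+ 9)).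
    rewrite mulrDr; apply: lerD; first by rewrite ler_piMl.
    by rewrite [leLHS]mulrA (mulrCA _ th0) E1 mulr1.
  have T1 : 2 * (C * C) * (CW * (C * m) * th0) <= 8^-1 * m.
    rewrite (_ : _ * _ = 2 * (C ^+ 3 * CW * th0) * m); last by ring.
    apply: ler_wpM2r => //; have := th0_le (isT : 3 <= 6)%N; flra.
  have T2 : th0 * (2 * (C * C * m)) <= 8^-1 * m.
    rewrite (_ : _ * _ = 2 * (C ^+ 2 * th0) * m); last by ring.
    apply: ler_wpM2r => //; have := th0_le1 (isT : 2 <= 6)%N; flra.
  move: H1; rewrite [leRHS]mulrDr => H1; move: H4 H5; rewrite !mulrDr => H4 H5; rewrite /m1.
  by have := le_trans H4 H5; have := m1p; rewrite /m1; move: H1 H3 T1 T2; flra.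
have GTt t : 0 <= t <= T -> expR (G * t) <= expR (G * T).
  by move=> /andP[_ tT]; rewrite ler_expR ler_pM2l.
split.
- move=> t tI; apply: le_trans (HB t tI) _; apply: le_trans (_ : MB <= _); last by move: MV0 Mw0; flra.
  by apply: ler_pM => //; exact: GTt.
- apply: le_trans (_ : MV <= _); last by move: MB0 Mw0; flra.
  rewrite -(Int_chasles _ _ 0); apply: lerD => //.
  apply: le_trans (_ : expR (G * T) * Int (fun s => expR (- (G * s)) * `|bdv v s|) 0 T <= _).
    rewrite -IntZ; last exact: ctsM.
    apply: Int_le => //; [exact: ltW|by apply: ctsM; [exact: cts_cst|exact: ctsM]|].
    move=> s sI; rewrite mulrA ler_peMl // -expRD; apply: expR_ge1.
    by rewrite subr_ge0 ler_pM2l //; case/andP: sI.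
  apply: ler_wpM2l; first exact: expR_ge0.
  apply: le_trans V1 _; rewrite ler_pM2l // lerD2r; apply: ler_wpM2l mle.
  by apply: mulr_ge0; exact: ltW.
move=> x t xI tI; apply: le_trans (w_weight so Gp m0 HB xI tI) _.
apply: le_trans (_ : Mw <= _); last by move: MB0 MV0; flra.
apply: ler_pM; rewrite ?expR_ge0 ?GTt //.
  apply: addr_ge0 (ltW a0) _; apply: mulr_ge0 (expR_ge0 _); apply: mulr_ge0 (ltW CW0) (mulr_ge0 (ltW C0) m0).
rewrite lerD2l; apply: le_trans (_ : CW * (C * m) <= _).
  rewrite ler_piMr //; first by apply: mulr_ge0 (ltW CW0) (mulr_ge0 (ltW C0) m0).
  rewrite -expR0 ler_expR oppr_le0; apply: mulr_ge0 (ltW Gp) _; apply: divr_ge0; last exact: ltW (st_l1 S).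
  by case/andP: xI.
by rewrite ler_pM2l // ler_pM2l.
Qed.

(** * Convergence of the regular and singular parts *)

Definition Hk (k : R -> R) (v : R -> R -> R) : R := Int (fun s => k s * bdv v s) (- A) T.

(** Limit of the part of [Hk k] coming from [a_s]: a delta at [y] on the initial line is a delta of
    weight [1 / h 0 0] at the parameter [- (y / h 0 0)]. *)
Definition init_lim (k : R -> R) : R := \sum_(y <- xa) k (- (y / h 0 0)) / h 0 0.

(* [refl] transports a kernel backwards through one reflection
   (0, s) -> (x_i, tau x_i s) -> (0, tau x_i s) of the singularities. *)
Definition gain (s r : R) : R := cr (Num.max r 0) * Y r s / h (X r s) r.
Definition refl (k : R -> R) (s : R) : R :=
  \sum_(y <- xb) k (tau h y s) * gain s (tau h y s).

Lemma h_gt0 x t : 0 < h x t.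
Proof. exact: lt_le_trans (sf_l0 sf) (sf_ge sf x t). Qed.

Lemma gain_cts2 : cts2 gain.
Proof.
apply: ctsM; last first.
  apply: cts_inv => [|q]; last by rewrite gt_eqF // h_gt0.
  apply: (cts2_app (sf_cts sf)); [exact: (cts2_flip (X_cts2 sf))|exact: cts_snd].
apply: ctsM; last exact: (cts2_flip (Y_cts2 S)).
apply: (cts_app (st_cr S)); apply: cts_max; [exact: cts_snd|exact: cts_cst].
Qed.

Lemma refl_cts2 (k : R -> R -> R) : cts2 k -> cts2 (fun t s => refl (k t) s).
Proof.
move=> ck; apply: cts_sum => y.
have ct : continuous (fun q : R * R => tau h y q.2).
  apply: (cts2_app (tau_cts2 sf)); [exact: cts_cst|exact: cts_snd].
apply: ctsM; first exact: (cts2_app ck (@cts_fst R) ct).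
exact: (cts2_app gain_cts2 (@cts_snd R) ct).
Qed.

Lemma tau_delay y s : y \in xb -> 0 <= s -> s + d0 <= tau h y s.
Proof.
move=> /(st_xb S)/andP[y1 _] s0; have x0 := st_xm S.
have y0 : 0 <= y by lra.
apply: le_trans (tau_ge sf s0 y0); rewrite lerD2l ler_pM2r ?invr_gt0 ?(st_l1 S) //.
by lra.
Qed.

(** Each transport through a reflection shortens the support by one delay. After finitely many of
    them the kernel lives on the initial line only, which makes induction on the number of
    reflections possible. *)
Lemma refl_vanish (k : R -> R) (c s : R) : 0 <= c -> c <= s -> (forall r, c + d0 <= r -> k r = 0) ->
  refl k s = 0.
Proof.
move=> c0 cs' Hk'; rewrite /refl big_seq big1 // => y yb; rewrite Hk' ?mul0r //.
apply: le_trans (tau_delay yb (le_trans c0 cs')); by rewrite lerD2r.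
Qed.

(** [C ^+ 4] bounds [gain] and another [C] the number of points of [xb]; the factor [th] is the gain
    in weight over one delay. *)
Lemma refl_weight G th t M (k : R -> R) : weight G th -> 0 <= M ->
  (forall r, T <= r -> k r = 0) ->
  (forall s, 0 <= s <= T -> `|k s| * expR (G * s) <= M * expR (G * t)) ->
  forall s, 0 <= s <= T -> `|refl k s| * expR (G * s) <= C ^+ 5 * th * M * expR (G * t).
Proof.
move=> W M0 kT Hk' s /andP[s0 sT].
have C2 : 0 <= C * C by rewrite mulr_ge0 // ltW.
have EM : 0 <= th * M * expR (G * t).
  by apply: mulr_ge0 (expR_ge0 _); apply: mulr_ge0 M0; exact: ltW (wt_th W).
have H y : y \in xb -> `|k (tau h y s) * gain s (tau h y s)| * expR (G * s) <= C ^+ 4 * (th * M * expR (G * t)).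
  move=> yb; have td := tau_delay yb s0; set r := tau h y s in td *.
  have d0p := st_d0 S.
  have r0 : 0 <= r by move: td s0 d0p; flra.
  case: (leP T r) => [/kT ->|rT].
    by rewrite mul0r normr0 mul0r; apply: mulr_ge0 EM; apply: exprn_ge0; exact: ltW.
  have rI : 0 <= r <= T by rewrite r0 ltW.
  have g1 : `|gain s r| <= C ^+ 4.
    rewrite /gain -mulrA normrM (_ : C ^+ 4 = C * (C * C * C)); last by ring.
    apply: ler_pM => //; first exact: (st_crC S).
    rewrite normrM normfV (gtr0_norm (h_gt0 _ _)); apply: ler_pM => //; first by rewrite invr_ge0 ltW // h_gt0.
      rewrite (gtr0_norm (Y_gt0 S r s)); apply: (Y_le S) => //.
      by rewrite sT andbT; apply: le_trans s0; rewrite oppr_le0 ltW.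
    apply: le_trans (st_l0C S); rewrite lef_pV2 ?posrE ?h_gt0 //; [exact: (sf_ge sf)|exact: (sf_l0 sf)].
  have e1 : expR (G * s) <= th * expR (G * r).
    rewrite -ler_pdivrMr ?expR_gt0 // -expRN -expRD; apply: le_trans (wt_delay W).
    rewrite ler_expR -mulrBr -mulrN ler_pM2l ?(wt_G W) //; by move: td; flra.
  have := Hk' r rI => k1.
  rewrite normrM (_ : `|k r| * `|gain s r| * _ = `|gain s r| * (`|k r| * expR (G * s))); last by ring.
  apply: ler_pM => //.
  apply: le_trans (ler_wpM2l (normr_ge0 _) e1) _; rewrite mulrCA -mulrA.
  by apply: ler_wpM2l k1; exact: ltW (wt_th W).
have -> : C ^+ 5 * th * M * expR (G * t) = C * (C ^+ 4 * (th * M * expR (G * t))) by ring.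
apply: le_trans (_ : \sum_(y <- xb) (`|k (tau h y s) * gain s (tau h y s)| * expR (G * s)) <= _).
  by rewrite -mulr_suml ler_wpM2r ?expR_ge0 //; exact: ler_norm_sum.
apply: le_trans (sum_const_le H) _; apply: ler_wpM2r; last exact: (sz_xb).
by apply: mulr_ge0 EM; apply: exprn_ge0; exact: ltW.
Qed.

Lemma H_split e w v (k : R -> R) : wvsol e w v -> continuous k ->
  Hk k v = Int (fun s => k s * as_ e (- h 0 0 * s)) (- A) 0
         + Int (fun s => cs e s * (k s * Bf e w v s)) 0 T + Int (fun s => k s * cr s * Qf e v s) 0 T.
Proof.
move=> so ck; have cB := Bf_cts so; have cQ := Qf_cts so.
have cv : continuous (bdv v) := bdv_cts (so_v so).
have ccs := reg_cts (st_phi S) (s := tc) (e := e).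
have cG : continuous (fun s => - h 0 0 * s) by apply: ctsM; [exact: cts_cst|exact: cts_id].
have cas := cts_app (reg_cts (st_phi S) (s := xa) (e := e)) cG.
have ckv : continuous (fun s => k s * bdv v s) by exact: ctsM.
rewrite /Hk -(Int_chasles _ (- A) 0 T) -[RHS]addrA.
congr (_ + _).
  apply: Int_ext => //; [by rewrite oppr_le0 ltW|exact: ctsM|].
  by move=> s /andP[As s0]; rewrite (bdv_neg S so) // !ltW.
have c1 : continuous (fun s => cs e s * (k s * Bf e w v s)) by apply: ctsM => //; exact: ctsM.
have c2 : continuous (fun s => k s * cr s * Qf e v s) by apply: ctsM => //; apply: ctsM => //; exact: (st_cr S).
rewrite -IntD //; apply: Int_ext => //; [exact: ltW|exact: ctsD|].
by move=> s /andP[s0 sT]; rewrite (bdv_pos so) ?s0 ?ltW //; ring.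
Qed.

Lemma Q_kernel e w v (k : R -> R) : wvsol e w v -> continuous k ->
  Int (fun s => k s * cr s * Qf e v s) 0 T =
  Int (fun s => Int (fun r => bs e (X r s) * (k r * cr r * Y r s)) 0 T * bdv v s) (- A) T.
Proof.
move=> so ck; have cv : continuous (bdv v) := bdv_cts (so_v so).
have cQ := Qf_cts so.
have ckc : continuous (fun s => k s * cr s) by apply: ctsM => //; exact: (st_cr S).
have cbs := reg_cts (st_phi S) (s := xb) (e := e).
pose F r s := k r * cr r * (bs e (X r s) * Y r s * bdv v s).
have cF : cts2 F.
  apply: ctsM; first exact: (cts_app ckc (@cts_fst R)).
  apply: ctsM; last exact: (cts_app cv (@cts_snd R)).
  apply: ctsM; [exact: (cts_app cbs (X_cts2 sf))|exact: (Y_cts2 S)].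
have cFr r : continuous (fun s => bs e (X r s) * Y r s * bdv v s).
  apply: ctsM => //; apply: ctsM; last exact: (@cts2_r _ _ r (Y_cts2 S)).
  exact: (cts_app cbs (@cts2_r _ _ r (X_cts2 sf))).
have cI : continuous (fun r => Int (F r) (- A) T) by exact: Int_param_cts.
transitivity (Int (fun r => Int (F r) (- A) T) 0 T).
  apply: Int_ext => //; [exact: ltW|exact: ctsM|].
  by move=> r /andP[r0 rT]; rewrite (Q_pairing S so) ?(ltW r0) ?(ltW rT) // IntZ.
rewrite Int_swap //; congr (Int _ (- A) T); apply/funext => s.
rewrite mulrC -IntZ; first by congr (Int _ 0 T); apply/funext => r; rewrite /F; ring.
apply: ctsM; first exact: (cts_app cbs (cts2_l (X_cts2 sf))).
by apply: ctsM => //; exact: (cts2_l (Y_cts2 S)).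
Qed.

Lemma reg_lim sq e a b (V : R -> R) (eta : R) : (size sq)%:R <= C -> 0 < e -> a <= b -> continuous V -> 0 <= eta ->
  (forall y, y \in sq -> a <= y - e /\ y + e <= b) ->
  (forall r y, y \in sq -> a <= r <= b -> `|r - y| <= e -> `|V r - V y| <= eta) ->
  `|Int (fun r => reg sq phi e r * V r) a b - \sum_(y <- sq) V y| <= C * C * eta.
Proof.
move=> szC e0 ab cV eta0 Hs HV.
rewrite (_ : (fun r => _) = (fun r => reg sq phi e (id r) * (V r * (fun=> 1) r))); last first.
  by apply/funext => r; rewrite mulr1.
apply: le_trans (reg_pullback_lim (g0 := 1) (ty := id) (st_phi S) _ _ _ _ e0 ab cV eta0 Hs HV) _ => //.
- exact: (@deriv_id R).
- exact: cts_cst.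
rewrite -mulrA; apply: ler_pM => //; first by rewrite mulr_ge0 // (le_trans ler01 (mass_ge1 (st_phi S))).
by rewrite mulrC; apply: ler_wpM2r => //; exact: st_massC S.
Qed.

Lemma init_conv (k : R -> R -> R) (eta : R) : cts2 k -> 0 < eta -> exists2 e1 : R, 0 < e1 &
  forall e t, 0 < e < e1 -> 0 <= t <= T ->
  `|Int (fun s => k t s * as_ e (- h 0 0 * s)) (- A) 0 - init_lim (k t)| <= eta.
Proof.
move=> ck eta0; have h0 := st_h0 S; pose eta1 := eta / C ^+ 3.
have C3 : 0 < C ^+ 3 by exact: exprn_gt0.
have eta1p : 0 < eta1 by exact: divr_gt0.
have ck' : cts2 (fun t x => k t (- (x / h 0 0))).
  apply: (cts2_app ck); first exact: cts_fst.
  by apply: ctsN; apply: ctsM; [exact: cts_snd|exact: cts_cst].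
have [d dp Hd] := cts2_unif (T + L) ck' eta1p.
exists (Num.min xm d); first by rewrite lt_min (st_xm S).
move=> e t /andP[e0]; rewrite lt_min => /andP[exm ed] /andP[t0 tT].
pose V x := k t (- (x / h 0 0)).
have cV : continuous V := @cts2_r _ _ t ck'.
have cas := reg_cts (st_phi S) (s := xa) (e := e).
have cG : continuous (fun s => - h 0 0 * s) by apply: ctsM; [exact: cts_cst|exact: cts_id].
have ckt : continuous (k t) := @cts2_r _ _ t ck.
have ckas : continuous (fun s => k t s * as_ e (- h 0 0 * s)) by apply: ctsM => //; exact: (cts_app cas cG).
have NA : - A <= 0 by rewrite oppr_le0 ltW.
have E1 : - h 0 0 * Int (fun s => k t s * as_ e (- h 0 0 * s)) (- A) 0 = - Int (fun x => as_ e x * V x) 0 L.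
  rewrite -IntZ // (@Int_subst _ (fun x => as_ e x * V x) (fun s => - h 0 0 * s) (fun=> - h 0 0)) //.
  - by rewrite mulrNN (st_hA S) mulr0 Int_opp.
  - exact: ctsM.
  - by apply: ctsM => //; exact: cts_cst.
  - by move=> x _; apply: deriv_eq (derivZ (- h 0 0) (deriv_id x)) _; rewrite mulr1.
  - move=> x _; have xE : - (- h 0 0 * x / h 0 0) = x by field; rewrite gt_eqF.
    by rewrite /V xE; ring.
have {E1} -> : Int (fun s => k t s * as_ e (- h 0 0 * s)) (- A) 0 = Int (fun x => as_ e x * V x) 0 L / h 0 0.
  by apply: (mulfI (lt0r_neq0 h0)); rewrite mulrCA divff ?gt_eqF // mulr1; move: E1; rewrite mulNr => /oppr_inj.
rewrite /init_lim -mulr_suml -mulrBl normrM normfV (gtr0_norm h0).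
have H : `|Int (fun x => as_ e x * V x) 0 L - \sum_(y <- xa) V y| <= C * C * eta1.
  apply: reg_lim => //; [exact: (sz_xa)|exact: ltW|exact: ltW| |].
    by move=> y /(st_xa S); apply: gap_margin; rewrite !ltW.
  move=> r y ya /andP[r0 rL] ry; apply: ltW; have /andP[y1 y2] := st_xa S ya; have x0 := st_xm S.
  apply: Hd; rewrite ?subrr ?normr0 ?(le_lt_trans ry) //; rewrite ger0_norm //; lra.
have hC : (h 0 0)^-1 <= C.
  by apply: le_trans (st_l0C S); rewrite lef_pV2 ?posrE //; [exact: (sf_ge sf)|exact: (sf_l0 sf)].
apply: le_trans (ler_pM (normr_ge0 _) _ H hC) _; first by rewrite invr_ge0 ltW.
rewrite /eta1 (_ : C * C * (eta / C ^+ 3) * C = eta) //; field; by rewrite gt_eqF.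
Qed.

(** The times [- (L / l0)] and [(L + l1 * T) / l0] enclose the passage through [[0, L]] for all
    parameters at once, so every delta in [x] is crossed completely between them. *)
Lemma X_range s : - A <= s <= T -> X (- (L / l0)) s <= 0 /\ L <= X ((L + l1 * T) / l0) s.
Proof.
move=> /andP[As sT]; have l00 := sf_l0 sf; have l1p := st_l1 S.
have X0 : X 0 s <= L.
  apply: le_trans (_ : X 0 (- A) <= _); first by rewrite (X_leE sf).
  by rewrite (X_0 sf) ?oppr_le0 ?(ltW A0) // mulrNN (st_hA S).
have Xm : - (l1 * T) <= X 0 s.
  have /andP[_] := X_speed sf T (ltW T0); rewrite (X_diag sf) ?(ltW T0) // subr0 sub0r => H.
  by apply: le_trans (_ : X 0 T <= _); [lra|rewrite (X_leE sf)].
have LL : 0 <= L / l0 by rewrite divr_ge0 // ltW.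
have LT : 0 <= (L + l1 * T) / l0 by rewrite divr_ge0 ?ltW // addr_gt0 // mulr_gt0.
split.
  have N : - (L / l0) <= 0 by rewrite oppr_le0.
  have /andP[H _] := X_speed sf s N.
  by move: H; rewrite sub0r opprK mulrC divfK ?gt_eqF // => H; lra.
have /andP[H _] := X_speed sf s LT.
by move: H; rewrite subr0 mulrC divfK ?gt_eqF // => H; lra.
Qed.

(** The integration over [[0, T]] is extended to a range in which every point of [xb] is crossed.
    The added parts are zero: [gain] contains [cr (Num.max r 0)], which vanishes for [r <= 0] as
    [cr 0 = 0], and [k] vanishes beyond [T]. Thus crossings near time 0 cause no jump and the limit
    is uniform in [s]. *)
Lemma refl_conv (k : R -> R -> R) (eta : R) : cts2 k ->
  (forall t r, 0 <= t <= T -> T <= r -> k t r = 0) -> 0 < eta -> exists2 e1 : R, 0 < e1 &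
  forall e t s, 0 < e < e1 -> 0 <= t <= T -> - A <= s <= T ->
  `|Int (fun r => bs e (X r s) * (k t r * cr r * Y r s)) 0 T - refl (k t) s| <= eta.
Proof.
move=> ck kT eta0; have l00 := sf_l0 sf; have l1p := st_l1 S.
have T1 := T0; have A1 := A0; have L1 := L0.
set a := - (L / l0); set b := (L + l1 * T) / l0.
have LL : 0 <= L / l0 by rewrite divr_ge0 // ltW.
have b0 : T <= b.
  rewrite ler_pdivlMr //; have : l0 * T <= l1 * T.
    by rewrite ler_pM2r //; exact: le_trans (sf_ge sf 0 0) (sf_le sf 0 0).
  by have := L0; lra.
have a0 : a <= 0 by rewrite oppr_le0.
pose Mr := L / l0 + b + A + T.
have Mr0 : 0 <= Mr by rewrite /Mr; lra.
have aM r : a <= r <= b -> `|r| <= Mr.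
  by rewrite /a => /andP[r1 r2]; rewrite ler_norml; apply/andP; split; rewrite /Mr; lra.
have sM s : - A <= s <= T -> `|s| <= Mr.
  by move=> /andP[r1 r2]; rewrite ler_norml; apply/andP; split; rewrite /Mr; lra.
have [Bk Bk0 HBk] := cts2_bounded Mr ck.
have [Bg Bg0 HBg] := cts2_bounded Mr gain_cts2.
pose eta1 := eta / (C ^+ 2 * (Bk + Bg + 1) * C).
have BB : 0 < Bk + Bg + 1 by rewrite ltr_wpDl // addr_ge0.
have CC : 0 < C ^+ 2 * (Bk + Bg + 1) * C by rewrite !mulr_gt0 // exprn_gt0.
have eta1p : 0 < eta1 by exact: divr_gt0.
have [dk dkp Hdk] := cts2_unif Mr ck eta1p.
have [dg dgp Hdg] := cts2_unif Mr gain_cts2 eta1p.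
exists (Num.min xm (Num.min (l0 * dk) (l0 * dg))).
  by rewrite !lt_min (st_xm S) !mulr_gt0.
move=> e t s /andP[e0]; rewrite !lt_min => /and3P[exm edk edg] tI sI.
have /andP[t0 tT] := tI.
have [Xa Xb] := X_range sI.
have ckt : continuous (k t) := @cts2_r _ _ t ck.
pose V r := k t r * gain s r.
have cV : continuous V by apply: ctsM => //; exact: (@cts2_r _ _ s gain_cts2).
have hX r : l0 <= h (X r s) r by exact: (sf_ge sf).
have chX : continuous (fun r => h (X r s) r) := cts_app (sf_cts sf) (cts_pair (cts2_l (X_cts2 sf)) (@cts_id _)).
have cbX : continuous (fun r => bs e (X r s)) := cts_app (reg_cts (st_phi S) (s := xb) (e := e)) (cts2_l (X_cts2 sf)).
have cI : continuous (fun r => bs e (X r s) * (V r * h (X r s) r)) by apply: ctsM => //; exact: ctsM.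
have E1 : Int (fun r => bs e (X r s) * (k t r * cr r * Y r s)) 0 T =
    Int (fun r => bs e (X r s) * (V r * h (X r s) r)) a b.
  have z : continuous (fun _ : R => 0 : R) by exact: cts_cst.
  rewrite -(Int_chasles _ a 0 b) -(Int_chasles _ 0 T b).
  rewrite (@Int_ext _ (fun r => bs e (X r s) * (V r * h (X r s) r)) (fun=> 0) a 0) //; last first.
    by move=> r /andP[_ r0]; rewrite /V /gain (max_r (ltW r0)) (st_cr0 S) !mul0r mulr0 mul0r mulr0.
  rewrite (@Int_ext _ (fun r => bs e (X r s) * (V r * h (X r s) r)) (fun=> 0) T b) //; last first.
    by move=> r /andP[rT _]; rewrite /V kT ?(ltW rT) // !mul0r mulr0.
  rewrite !Int_cst !mul0r add0r addr0; apply: Int_ext => //; first exact: ltW.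
    apply: ctsM => //; apply: ctsM; [apply: ctsM => //; exact: (st_cr S)|exact: (cts2_l (Y_cts2 S))].
  move=> r /andP[r0 rT]; rewrite /V /gain (max_l (ltW r0)); congr (_ * _); field.
  by rewrite gt_eqF // h_gt0.
have tE y r : y \in xb -> a <= r <= b -> `|X r s - y| <= e ->
    `|r - tau h y s| < dk /\ `|r - tau h y s| < dg.
  move=> yb rI ry; have := tau_dist sf y s r; rewrite distrC (distrC y) => H.
  by have H2 := le_trans H ry; split; rewrite -(ltr_pM2l l00); apply: le_lt_trans H2 _.
have tI' y : y \in xb -> a <= tau h y s <= b.
  move=> yb; have /andP[y1 y2] := st_xb S yb; have x0 := st_xm S; have Xt := X_tau sf y s.
  by apply/andP; split; rewrite leNgt; apply/negP => /(X_strict sf s); rewrite Xt => H; move: H y1 y2 x0 Xa Xb; flra.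
rewrite E1 /refl -/V.
have H : `|Int (fun r => bs e (X r s) * (V r * h (X r s) r)) a b - \sum_(y <- xb) V (tau h y s)| <=
    (size xb)%:R * ((eta1 * (Bk + Bg + 1)) * mass phi).
  apply: (reg_pullback_lim (st_phi S) (@X_sol _ _ _ _ _ sf s) chX l00 hX e0) => //.
  - exact: le_trans (le_trans a0 (ltW T0)) b0.
  - by rewrite mulr_ge0 // ltW.
  - by move=> y yb; have /andP[y1 y2] := st_xb S yb; have x0 := st_xm S; split; move: y1 y2 x0 Xa Xb exm; flra.
  move=> r y yb rI ry; have [d1 d2] := tE y r yb rI ry; have tyI := tI' y yb.
  have tM : `|t| <= Mr by apply: sM; rewrite tT andbT; apply: le_trans t0; rewrite oppr_le0 ltW.
  have -> : V r - V (tau h y s) = (k t r - k t (tau h y s)) * gain s r + k t (tau h y s) * (gain s r - gain s (tau h y s)).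
    by rewrite /V; ring.
  apply: le_trans (ler_normD _ _) _; rewrite (normrM (k t r - _)) (normrM (k t (tau h y s))).
  have G1 : `|k t r - k t (tau h y s)| <= eta1.
    by apply: ltW; apply: Hdk => //; rewrite ?subrr ?normr0 //; exact: aM.
  have G2 : `|gain s r - gain s (tau h y s)| <= eta1.
    by apply: ltW; apply: Hdg => //; rewrite ?subrr ?normr0 //; [exact: sM|exact: sM|exact: aM|exact: aM].
  have G3 := HBk t (tau h y s) tM (aM _ tyI).
  have G4 := HBg s r (sM _ sI) (aM _ rI).
  apply: le_trans (lerD (ler_pM _ _ G1 G4) (ler_pM _ _ G3 G2)) _ => //.
  by have := ltW eta1p; flra.
apply: le_trans H _.
have -> : eta = C * (eta1 * (Bk + Bg + 1) * (C * C)).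
  by rewrite /eta1; field; rewrite !gt_eqF.
have m0 : 0 <= mass phi := le_trans ler01 (mass_ge1 (st_phi S)).
have e2 : 0 <= eta1 * (Bk + Bg + 1) by rewrite mulr_ge0 // ltW.
apply: ler_pM => //; [by rewrite mulr_ge0|exact: (sz_xb)|].
apply: ler_wpM2l => //; apply: le_trans (st_massC S) _; by rewrite ler_peMl // ltW.
Qed.

(* Asymptotic equicontinuity and Cauchy property of the boundary integrals in one. *)
Definition closeB (G m : R) : Prop := exists2 d : R, 0 < d &
  forall e e' w v w' v', wvsol e w v -> wvsol e' w' v' -> e < d -> e' < d ->
  forall t t', 0 <= t <= T -> 0 <= t' <= T -> `|t - t'| < d ->
  `|Bf e w v t - Bf e' w' v' t'| <= m * expR (G * Num.max t t').

Lemma Hk_bound e w v (k : R -> R) (c M : R) : wvsol e w v -> continuous k ->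
  (forall s, - A <= s <= T -> `|k s| <= c) -> 0 <= c -> Int (fun s => `|bdv v s|) (- A) T <= M ->
  `|Hk k v| <= c * M.
Proof.
move=> so ck Hk' c0 HM; have cv : continuous (bdv v) := bdv_cts (so_v so).
apply: le_trans (_ : Int (fun s => c * `|bdv v s|) (- A) T <= _).
  apply: Int_norm; [by have := A0; have := T0; lra|exact: ctsM| |].
    by apply: ctsM; [exact: cts_cst|exact: cts_norm].
  by move=> s sI; rewrite normrM; apply: ler_wpM2r => //; exact: Hk'.
by rewrite IntZ; [exact: ler_wpM2l|exact: cts_norm].
Qed.

Lemma HkB e w v (k k' : R -> R) : wvsol e w v -> continuous k -> continuous k' ->
  Hk k v - Hk k' v = Hk (fun s => k s - k' s) v.
Proof.
move=> so ck ck'; have cv : continuous (bdv v) := bdv_cts (so_v so).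
rewrite /Hk -IntB; [|exact: ctsM|exact: ctsM].
by congr (Int _ (- A) T); apply/funext => s; rewrite mulrBl.
Qed.

(* The regularized kernels are reduced to their limits, up to the values of B at the points of tc. *)
Lemma Hk_step (k : R -> R -> R) (eta : R) : cts2 k ->
  (forall t r, 0 <= t <= T -> T <= r -> k t r = 0) -> 0 < eta -> exists2 e1 : R, 0 < e1 &
  forall e w v t, wvsol e w v -> e < e1 -> 0 <= t <= T ->
  `|Hk (k t) v - (init_lim (k t) + Int (fun s => cs e s * (k t s * Bf e w v s)) 0 T + Hk (refl (k t)) v)| <= eta.
Proof.
move=> ck kT eta0; have [M M0 HM] := apriori.
have [e1 e1p H1] := init_conv ck (divr_gt0 eta0 (ltr0n _ 2)).
have M1 : 0 < 2 * (M + 1) by rewrite mulr_gt0 // ltr_wpDl.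
have [e2 e2p H2] := refl_conv ck kT (divr_gt0 eta0 M1).
exists (Num.min e1 e2); first by rewrite lt_min e1p.
move=> e w v t so; rewrite lt_min => /andP[ee1 ee2] tI.
have e0 : 0 < e by case/andP: (so_e so).
have ckt : continuous (k t) := @cts2_r _ _ t ck.
have crt : continuous (refl (k t)) := @cts2_r _ _ t (refl_cts2 ck).
rewrite (H_split so ckt) (Q_kernel so ckt) -/(Hk _ v).
set q := fun s => Int _ 0 T.
have cq : continuous q.
  apply: (@Int_param_cts _ (fun s r => bs e (X r s) * (k t r * cr r * Y r s)) 0 T).
  apply: ctsM; first exact: (cts_app (reg_cts (st_phi S) (s := xb) (e := e)) (cts2_flip (X_cts2 sf))).
  apply: ctsM; last exact: (cts2_flip (Y_cts2 S)).
  apply: ctsM; [exact: (cts_app ckt (@cts_snd R))|exact: (cts_app (st_cr S) (@cts_snd R))].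
set I0 := Int _ (- A) 0; set I1 := Int _ 0 T.
have -> : I0 + I1 + Hk q v - (init_lim (k t) + I1 + Hk (refl (k t)) v) =
  (I0 - init_lim (k t)) + (Hk q v - Hk (refl (k t)) v) by ring.
apply: le_trans (ler_normD _ _) _; rewrite [leRHS](_ : _ = eta / 2 + eta / 2); last by field.
apply: lerD; first by apply: H1; rewrite ?e0.
rewrite (HkB so cq crt); have [_ HMv _] := HM e w v so.
apply: le_trans (Hk_bound so (ctsB cq crt) _ _ HMv) _.
- by move=> s sI; apply: H2; rewrite ?e0.
- by rewrite divr_ge0 ?ltW.
rewrite invfM mulrA mulrAC ler_pdivrMr ?ltr_wpDl //; apply: ler_wpM2l; last by rewrite lerDl.
by rewrite divr_ge0 // ltW.
Qed.

Lemma exp_le2 (x : R) : x <= 2^-1 -> expR x <= 2.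
Proof.
move=> x2; have := expR_ge1Dx (- x); rewrite expRN => H.
have H2 : 2^-1 <= (expR x)^-1 by lra.
by rewrite -[2]invrK -[expR x]invrK lef_pV2 ?posrE ?invr_gt0 ?expR_gt0.
Qed.

(** Each integral is compared with the sum of the values at the points of [tc], and the two sums
    with each other. The defects are 2, 2 and 1 times [C * C * (M * m * expR (G * t))], hence the
    5. *)
Lemma cs_close G m M (k : R -> R -> R) (eta : R) : 0 < G -> 0 <= m -> closeB G m -> cts2 k -> 0 <= M ->
  (forall t s, 0 <= t <= T -> 0 <= s <= T -> `|k t s| * expR (G * s) <= M * expR (G * t)) -> 0 < eta ->
  exists2 e1 : R, 0 < e1 & forall e e' w v w' v' t, wvsol e w v -> wvsol e' w' v' -> e < e1 -> e' < e1 ->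
  0 <= t <= T ->
  `|Int (fun s => cs e s * (k t s * Bf e w v s)) 0 T - Int (fun s => cs e' s * (k t s * Bf e' w' v' s)) 0 T|
   <= eta + 5 * (C * C) * (M * m * expR (G * t)).
Proof.
move=> G0 m0 [d dp Hd] ck M0 kM eta0; have [Mb Mb0 HM] := apriori.
have CC0 : 0 < C * C by exact: mulr_gt0.
pose eta1 := eta / (2 * (C * C) * (Mb + 1)).
have Mb1 : 0 < Mb + 1 by rewrite ltr_wpDl.
have eta1p : 0 < eta1 by rewrite divr_gt0 // !mulr_gt0.
have [dk dkp Hdk] := cts2_unif T ck eta1p.
exists (Num.min d (Num.min dk (2^-1 / G))); first by rewrite !lt_min dp dkp divr_gt0.
move=> e e' w v w' v' t so so'; rewrite !lt_min => /and3P[ed ek eG] /and3P[ed' ek' eG'] tI.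
set Z := M * m * expR (G * t).
have Z0 : 0 <= Z by rewrite !mulr_ge0 ?expR_ge0.
have tT : `|t| <= T by case/andP: tI => t0 tT; rewrite ger0_norm.
have ckt : continuous (k t) := @cts2_r _ _ t ck.
have tcI y : y \in tc -> 0 <= y <= T by move=> /(st_tc S)/(gap_in S).
have one : forall e w v, wvsol e w v -> e < d -> e < dk -> e < 2^-1 / G ->
  `|Int (fun s => cs e s * (k t s * Bf e w v s)) 0 T - \sum_(y <- tc) k t y * Bf e w v y| <=
  C * C * (eta1 * Mb + 2 * Z).
  move=> {ed ek eG ed' ek' eG' so so'} {}e {}w {}v so ed ek eG; have /andP[e0 exm] := so_e so; have cB := Bf_cts so.
  have [HB _ _] := HM e w v so.
  apply: (reg_lim (V := fun s => k t s * Bf e w v s)) => //; [exact: (sz_tc)|exact: ltW|exact: ctsM| | |].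
  - by rewrite addr_ge0 // mulr_ge0 // ltW.
  - by move=> y /(st_tc S); apply: gap_margin; rewrite !ltW.
  move=> r y ytc rI ry; have yI := tcI y ytc.
  have rT : `|r| <= T by case/andP: rI => r0 rT; rewrite ger0_norm.
  have yT : `|y| <= T by case/andP: yI => r0 r1; rewrite ger0_norm.
  have -> : k t r * Bf e w v r - k t y * Bf e w v y =
    (k t r - k t y) * Bf e w v r + k t y * (Bf e w v r - Bf e w v y) by ring.
  apply: le_trans (ler_normD _ _) _; rewrite (normrM (k t r - _)) (normrM (k t y)); apply: lerD.
    apply: ler_pM => //; last exact: HB.
    by apply: ltW; apply: Hdk => //; rewrite ?subrr ?normr0 //; exact: le_lt_trans ek.
  have H1 := Hd e e w v w v so so ed ed r y rI yI (le_lt_trans ry ed).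
  apply: le_trans (ler_wpM2l (normr_ge0 _) H1) _.
  (* [closeB] carries the weight of the later time, at most [e] after [y]. The condition
     [e < 1 / (2 * G)] keeps the loss below a factor 2. *)
  have H2 : expR (G * Num.max r y) <= 2 * expR (G * y).
    rewrite -ler_pdivrMr ?expR_gt0 // -expRN -expRD; apply: exp_le2.
    rewrite -mulrBr; apply: le_trans (_ : G * e <= _).
      rewrite ler_pM2l // lerBlDl ge_max lerDl (ltW e0) andbT.
      by move: ry; rewrite ler_norml => /andP[]; flra.
    by move: eG; rewrite ltr_pdivlMr // mulrC; exact: ltW.
  have H3 := kM t y tI yI.
  apply: le_trans (ler_wpM2l (normr_ge0 _) (ler_wpM2l m0 H2)) _.
  have -> : `|k t y| * (m * (2 * expR (G * y))) = 2 * m * (`|k t y| * expR (G * y)) by ring.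
  apply: le_trans (ler_wpM2l _ H3) _; first by rewrite mulr_ge0.
  by rewrite /Z le_eqVlt; apply/orP; left; apply/eqP; ring.
have O1 := one e w v so ed ek eG; have O2 := one e' w' v' so' ed' ek' eG'.
have O3 : `|\sum_(y <- tc) k t y * Bf e w v y - \sum_(y <- tc) k t y * Bf e' w' v' y| <= C * C * Z.
  rewrite -sumrB; apply: le_trans (ler_norm_sum _ _ _) _.
  apply: le_trans (sum_const_le (C := Z) _) _.
    move=> y ytc; have yI := tcI y ytc; rewrite -mulrBr normrM.
    have := Hd e e' w v w' v' so so' ed ed' y y yI yI; rewrite subrr normr0 maxxx => /(_ dp) H1.
    apply: le_trans (ler_wpM2l (normr_ge0 _) H1) _; rewrite mulrCA /Z (mulrC M) -mulrA.
    by apply: ler_wpM2l => //; exact: kM.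
  apply: ler_wpM2r => //; apply: le_trans (sz_tc) _; by rewrite ler_peMl // ltW.
set I1 := Int _ 0 T in O1 *; set I2 := Int _ 0 T in O2 *.
set S1 := \sum_(y <- tc) _ in O1 O3; set S2 := \sum_(y <- tc) _ in O2 O3.
have -> : I1 - I2 = (I1 - S1) + (S1 - S2) - (I2 - S2) by ring.
apply: le_trans (ler_normB _ _) _; apply: le_trans (lerD (ler_normD _ _) (lexx _)) _.
have E1 : 2 * (C * C) * (eta1 * Mb) <= eta.
  rewrite (_ : eta = 2 * (C * C) * (eta1 * (Mb + 1))); last by rewrite /eta1; field; rewrite !gt_eqF.
  apply: ler_wpM2l; first by rewrite mulr_ge0 // ltW.
  by rewrite ler_pM2l // lerDl.
by move: O1 O2 O3 E1; flra.
Qed.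

(** Induction on the number [n] of delays after which the kernel vanishes. For [n = 0] only the
    initial data are seen. Otherwise [Hk_step] leaves a common limit, a [c_s] term with constant 5,
    and a reflected kernel of size [C ^+ 5 * th * M <= M / 2], whose constant 10 thus becomes 5; so
    10 is reproduced and does not depend on [n]. *)
Lemma Hk_cauchy G th m : weight G th -> C ^+ 5 * th <= 2^-1 -> 0 <= m -> closeB G m ->
  forall (n : nat) M (k : R -> R -> R), cts2 k -> 0 <= M ->
  (forall t r, 0 <= t <= T -> T <= r -> k t r = 0) ->
  (forall t r, 0 <= t <= T -> n%:R * d0 <= r -> k t r = 0) ->
  (forall t s, 0 <= t <= T -> 0 <= s <= T -> `|k t s| * expR (G * s) <= M * expR (G * t)) ->
  forall eta : R, 0 < eta -> exists2 e1 : R, 0 < e1 &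
  forall e e' w v w' v' t, wvsol e w v -> wvsol e' w' v' -> e < e1 -> e' < e1 -> 0 <= t <= T ->
  `|Hk (k t) v - Hk (k t) v'| <= eta + 10 * (C * C) * (M * m * expR (G * t)).
Proof.
move=> W th5 m0 cB; elim=> [|n IH] M k ck M0 kT kn kM eta eta0.
  have [e1 e1p H1] := init_conv ck (divr_gt0 eta0 (ltr0n _ 2)).
  exists e1 => // e e' w v w' v' t so so' ee1 ee1' tI.
  have ckt : continuous (k t) := @cts2_r _ _ t ck.
  have e0 : 0 < e by case/andP: (so_e so).
  have e0' : 0 < e' by case/andP: (so_e so').
  have red e2 w2 v2 : wvsol e2 w2 v2 -> Hk (k t) v2 = Int (fun s => k t s * as_ e2 (- h 0 0 * s)) (- A) 0.
    move=> so2; rewrite (H_split so2 ckt).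
    have z : continuous (fun _ : R => 0 : R) by exact: cts_cst.
    have cB2 := Bf_cts so2; have cQ2 := Qf_cts so2.
    have kz s : 0 < s -> k t s = 0 by move=> s0; apply: kn => //; rewrite mul0r ltW.
    rewrite (@Int_ext _ (fun s => cs e2 s * (k t s * Bf e2 w2 v2 s)) (fun=> 0) 0 T) ?(ltW T0) //; last 2 first.
    - by apply: ctsM; [exact: (reg_cts (st_phi S))|exact: ctsM].
    - by move=> s /andP[s0 _]; rewrite kz // mul0r mulr0.
    rewrite (@Int_ext _ (fun s => k t s * cr s * Qf e2 v2 s) (fun=> 0) 0 T) ?(ltW T0) //; last 2 first.
    - by apply: ctsM => //; apply: ctsM => //; exact: (st_cr S).
    - by move=> s /andP[s0 _]; rewrite kz // !mul0r.
    by rewrite !Int_cst !mul0r !addr0.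
  rewrite (red e w v so) (red e' w' v' so').
  have Q1 := H1 e t; rewrite e0 ee1 in Q1; have {}Q1 := Q1 isT tI.
  have Q2 := H1 e' t; rewrite e0' ee1' in Q2; have {}Q2 := Q2 isT tI.
  rewrite distrC in Q2.
  apply: le_trans (ler_distD (init_lim (k t)) _ _) _.
  apply: le_trans (lerD Q1 Q2) _; rewrite -splitr lerDl.
  by apply: mulr_ge0; apply: mulr_ge0; rewrite ?expR_ge0 ?mulr_ge0 ?(ltW C0).
have [e1 e1p H1] := Hk_step ck kT (divr_gt0 eta0 (ltr0n _ 4)).
have G0 := wt_G W.
have [e2 e2p H2] := cs_close G0 m0 cB ck M0 kM (divr_gt0 eta0 (ltr0n _ 4)).
have M'0 : 0 <= C ^+ 5 * th * M.
  by apply: mulr_ge0 M0; apply: mulr_ge0; [apply: exprn_ge0; exact: ltW|exact: ltW (wt_th W)].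
have d0p := st_d0 S.
have [||||e3 e3p H3] := IH (C ^+ 5 * th * M) (fun t => refl (k t)) (refl_cts2 ck) M'0 _ _ _ (eta / 4).
- move=> t r tI Tr; apply: (refl_vanish _ Tr); first exact: ltW.
  by move=> r' Tr'; apply: kT => //; apply: le_trans Tr'; rewrite lerDl ltW.
- move=> t r tI nr; apply: (refl_vanish _ nr); first by rewrite mulr_ge0 // ltW.
  by move=> r' nr'; apply: kn => //; rewrite -natr1 mulrDl mul1r.
- by move=> t s tI sI; apply: (refl_weight W M0 (fun r => kT t r tI) (fun s => kM t s tI)).
- by rewrite divr_gt0.
exists (Num.min e1 (Num.min e2 e3)); first by rewrite !lt_min e1p e2p.
move=> e e' w v w' v' t so so'; rewrite !lt_min => /and3P[f1 f2 f3] /and3P[g1 g2 g3] tI.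
have Q1 := H1 e w v t so f1 tI; have Q1' := H1 e' w' v' t so' g1 tI.
have Q2 := H2 e e' w v w' v' t so so' f2 g2 tI.
have Q3 := H3 e e' w v w' v' t so so' f3 g3 tI.
set Z := M * m * expR (G * t) in Q2 *.
have Z0 : 0 <= Z by rewrite !mulr_ge0 ?expR_ge0.
have E3 : 10 * (C * C) * (C ^+ 5 * th * M * m * expR (G * t)) <= 5 * (C * C) * Z.
  rewrite (_ : _ * _ = (10 * (C * C) * Z) * (C ^+ 5 * th)); last by rewrite /Z; ring.
  have CZ : 0 <= 10 * (C * C) * Z by rewrite !mulr_ge0 // ltW.
  by have := ler_wpM2l CZ th5; move: CZ; flra.
move: Q1 Q1' Q2 Q3 E3.
set a := Hk (k t) v; set a' := Hk (k t) v'; set b := Int _ 0 T; set b' := Int _ 0 T.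
set c := Hk (refl (k t)) v; set c' := Hk (refl (k t)) v'; set i := init_lim (k t).
move=> Q1 Q1' Q2 Q3 E3.
have -> : a - a' = (a - (i + b + c)) + (b - b') + (c - c') - (a' - (i + b' + c')) by ring.
apply: le_trans (ler_normB _ _) _; apply: le_trans (lerD (ler_normD _ _) (lexx _)) _.
apply: le_trans (lerD (lerD (ler_normD _ _) (lexx _)) (lexx _)) _.
by move: Q1 Q1' Q2 Q3 E3; flra.
Qed.

Lemma cts_unif (F : R -> R) (M eta : R) : continuous F -> 0 < eta -> exists2 d : R, 0 < d &
  forall x x' : R, `|x| <= M -> `|x'| <= M -> `|x - x'| < d -> `|F x - F x'| < eta.
Proof.
move=> cF eta0; have [|d dp Hd] := @cts2_unif R (fun x _ => F x) M eta _ eta0.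
  exact: (cts_app cF (@cts_fst R)).
exists d => // x x' xM x'M xx'; apply: (Hd x x' x x) => //; by rewrite subrr normr0.
Qed.

(** [Z] bounds the weights of positive parameters only, because initial values do not depend on [e].
    Near the corner the initial and the boundary values are both small by the compatibility
    conditions [ar 0 = 0] and [cr 0 = 0]. *)
Lemma bdw_close G m (eta : R) : 0 <= m -> closeB G m -> 0 < eta -> exists2 d : R, 0 < d &
  forall e e' w v w' v', wvsol e w v -> wvsol e' w' v' -> e < d -> e' < d ->
  forall s s' Z, - A <= s <= T -> - A <= s' <= T -> `|s - s'| < d -> 0 <= Z ->
  (0 < s -> expR (G * s) <= Z) -> (0 < s' -> expR (G * s') <= Z) ->
  `|bdv w s - bdv w' s'| <= eta + C * m * Z.
Proof.
move=> m0 [d1 d1p Hd] eta0; have [Mb Mb0 HM] := apriori.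
pose eta1 := eta / (Mb + 1).
have Mb1 : 0 < Mb + 1 by rewrite ltr_wpDl.
have eta1p : 0 < eta1 by rewrite divr_gt0.
have cab : continuous (fun s => ar (bstart h s)).
  apply: (cts_app (st_ar S)); rewrite /bstart; apply: ctsM; first exact: cts_cst.
  by apply: cts_min; [exact: cts_id|exact: cts_cst].
have [d2 d2p Hd2] := cts_unif (A + T) cab eta1p.
have [d3 d3p Hd3] := cts_unif (A + T) (st_cr S) eta1p.
exists (Num.min d1 (Num.min d2 d3)); first by rewrite !lt_min d1p d2p.
move=> e e' w v w' v' so so'; rewrite !lt_min => /and3P[f1 f2 f3] /and3P[g1 g2 g3].
move=> s s' Z sI s'I; rewrite !lt_min => /and3P[s1 s2 s3] Z0 sZ s'Z.
have [AT1 AT2] : - (A + T) <= - A /\ T <= A + T by split; move: A0 T0; flra.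
have nI r : - A <= r <= T -> `|r| <= A + T.
  by move=> /andP[r1 r2]; rewrite ler_norml (le_trans AT1 r1) (le_trans r2 AT2).
have nZ : `|0 : R| <= A + T by rewrite normr0; move: A0 T0; flra.
have CmZ : 0 <= C * m * Z by apply: mulr_ge0 => //; apply: mulr_ge0 => //; exact: ltW.
have [HB _ _] := HM e w v so; have [HB' _ _] := HM e' w' v' so'.
have neg e2 w2 v2 r : wvsol e2 w2 v2 -> - A <= r <= T -> r <= 0 -> `|r| < d2 -> `|bdv w2 r| <= eta1.
  move=> so2 rI r0 rd; have /andP[Ar _] := rI; rewrite (bdw_neg S so2) ?Ar //.
  have := Hd2 r 0 (nI _ rI) nZ; rewrite subr0 => /(_ rd) /ltW.
  by rewrite (bstart_pos (lexx 0)).1 (st_ar0 S) subr0.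
have pos e2 w2 v2 r : wvsol e2 w2 v2 -> - A <= r <= T -> 0 < r -> `|r| < d3 -> `|bdv w2 r| <= eta1 * Mb.
  move=> so2 rI r0 rd; have /andP[_ rT] := rI; rewrite (bdw_pos so2) ?r0 // normrM.
  have [HB2 _ _] := HM e2 w2 v2 so2; apply: ler_pM => //; last by apply: HB2; rewrite ltW.
  by have := Hd3 r 0 (nI _ rI) nZ; rewrite subr0 => /(_ rd) /ltW; rewrite (st_cr0 S) subr0.
have Eeta : eta1 + eta1 * Mb = eta by rewrite /eta1; field; rewrite gt_eqF.
have P0 : 0 <= eta1 * Mb by rewrite mulr_ge0 // ltW.
have e1p := ltW eta1p.
(* Parameters of opposite sign that are close to each other are both close to 0, so the two values
   are bounded separately by [neg] and [pos]. *)
case: (leP s 0) => [s0|s0]; case: (leP s' 0) => [s'0|s'0].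
- rewrite (bdw_neg S so) ?(bdw_neg S so') ?s0 ?s'0 ?andbT; try by [case/andP: sI|case/andP: s'I].
  by apply: ltW; apply: lt_le_trans (Hd2 s s' (nI _ sI) (nI _ s'I) s2) _; move: Eeta P0 CmZ; flra.
- apply: le_trans (ler_normB _ _) _; move: s2 s3; rewrite !ltr_norml => /andP[s2 _] /andP[s3 _].
  have N1 : `|s| < d2 by rewrite ler0_norm //; move: s2 s0 s'0; flra.
  have N2 : `|s'| < d3 by rewrite gtr0_norm //; move: s3 s0 s'0; flra.
  by have := neg _ _ _ _ so sI s0 N1; have := pos _ _ _ _ so' s'I s'0 N2; move: Eeta CmZ; flra.
- apply: le_trans (ler_normB _ _) _; move: s2 s3; rewrite !ltr_norml => /andP[_ s2] /andP[_ s3].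
  have N1 : `|s'| < d2 by rewrite ler0_norm //; move: s2 s0 s'0; flra.
  have N2 : `|s| < d3 by rewrite gtr0_norm //; move: s3 s0 s'0; flra.
  by have := neg _ _ _ _ so' s'I s'0 N1; have := pos _ _ _ _ so sI s0 N2; move: Eeta CmZ; flra.
have /andP[_ sT] := sI; have /andP[_ s'T] := s'I.
have sI' : 0 <= s <= T by rewrite ltW.
have s'I' : 0 <= s' <= T by rewrite ltW.
rewrite (bdw_pos so) ?s0 // (bdw_pos so') ?s'0 //.
have -> : cr s * Bf e w v s - cr s' * Bf e' w' v' s' =
  (cr s - cr s') * Bf e w v s + cr s' * (Bf e w v s - Bf e' w' v' s') by ring.
apply: le_trans (ler_normD _ _) _; rewrite (normrM (cr s - _)) (normrM (cr s')).
have Q1 := Hd e e' w v w' v' so so' f1 g1 s s' sI' s'I' s1.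
have Q2 : expR (G * Num.max s s') <= Z.
  by case: (leP s s') => _; [exact: s'Z|exact: sZ].
have Q3 := le_trans Q1 (ler_wpM2l m0 Q2).
have Q4 := ler_pM (normr_ge0 _) (normr_ge0 _) (st_crC S s') Q3.
have Q5 := ler_pM (normr_ge0 _) (normr_ge0 _) (ltW (Hd3 s s' (nI _ sI) (nI _ s'I) s3)) (HB s sI').
by rewrite -mulrA; move: Q4 Q5 Eeta e1p; flra.
Qed.

(** The point is moved with the solution kept, by [w_modulus], and then the solution is changed at
    the new point, by [w_diff]. Each of the two uses [bdw_close] once, hence the factor 2. *)
Lemma w_close G m (eta : R) : 0 <= m -> closeB G m -> 0 < eta -> exists2 d : R, 0 < d &
  forall e e' w v w' v', wvsol e w v -> wvsol e' w' v' -> e < d -> e' < d ->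
  forall x t x' t' Z, 0 <= x <= L -> 0 <= t <= T -> 0 <= x' <= L -> 0 <= t' <= T ->
  `|x - x'| < d -> `|t - t'| < d -> 0 <= Z ->
  (0 < foot x t -> expR (G * foot x t) <= Z) -> (0 < foot x' t' -> expR (G * foot x' t') <= Z) ->
  `|w x t - w' x' t'| <= eta + 2 * (CW * C) * (m * Z).
Proof.
move=> m0 cB eta0; have [Mb Mb0 HM] := apriori.
have CW1 := CW_ge1 S; have CW0 : 0 < CW := lt_le_trans ltr01 CW1.
have CW4 : 0 < 4 * CW by rewrite mulr_gt0.
have [d1 d1p H1] := w_modulus S (divr_gt0 eta0 (ltr0n _ 2)) Mb0.
have [d2 d2p H2] := bdw_close m0 cB (divr_gt0 eta0 CW4).
have l1p := st_l1 S; have l0p := sf_l0 sf.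
pose Cf := expR (K * T) / l0; have Cf0 : 0 < Cf by rewrite divr_gt0 ?expR_gt0.
pose d3 := d2 / (Cf * (1 + l1)).
have CL : 0 < Cf * (1 + l1) by rewrite mulr_gt0 // addr_gt0.
have d3p : 0 < d3 by rewrite divr_gt0.
exists (Num.min d1 (Num.min d2 d3)); first by rewrite !lt_min d1p d2p.
move=> e e' w v w' v' so so'; rewrite !lt_min => /and3P[f1 f2 f3] /and3P[g1 g2 g3].
move=> x t x' t' Z xI tI x'I t'I; rewrite !lt_min => /and3P[x1 x2 x3] /and3P[t1 t2 t3] Z0 sZ s'Z.
have [_ _ Hw] := HM e w v so.
have [As st st0] := foot_in S xI tI; have [As' st' st0'] := foot_in S x'I t'I.
have /andP[t0 tT] := tI; have /andP[t'0 t'T] := t'I.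
have /andP[x0 xL] := xI; have /andP[x'0 x'L] := x'I.
set s := foot x t in As st st0 sZ *; set s' := foot x' t' in As' st' st0' s'Z *.
have sI : - A <= s <= T by rewrite As (le_trans st).
have s'I : - A <= s' <= T by rewrite As' (le_trans st').
have ss' : `|s - s'| < d2.
  apply: le_lt_trans (foot_lip sf tI t'I x0 x'0) _.
  have -> : d2 = Cf * (d3 + l1 * d3) by rewrite /d3; field; rewrite !gt_eqF // addr_gt0.
  by rewrite ltr_pM2l //; apply: ltrD => //; rewrite ltr_pM2l.
have Q1 := H1 e w v so Hw x t x' t' xI tI x'I t'I x1 t1.
have Q2 := H2 e e w v w v so so f2 f2 s s' Z sI s'I ss' Z0 sZ s'Z.
have s's' : `|s' - s'| < d2 by rewrite subrr normr0.
have Q3 := H2 e e' w v w' v' so so' f2 g2 s' s' Z s'I s'I s's' Z0 s'Z s'Z.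
have Xs' : X t' s' = x' by exact: (X_foot sf).
have := w_diff S so so' st0' t'T; rewrite Xs' => /(_ x'L) Q4.
have Q5 := ler_distD (w x' t') (w x t) (w' x' t').
have Q6 := ler_wpM2l (ltW CW0) Q2; have Q7 := ler_wpM2l (ltW CW0) Q3.
have Q8 : CW * (eta / (4 * CW)) = eta / 4 by field; rewrite gt_eqF.
rewrite -/s -/s' in Q1.
move: Q6 Q7; rewrite !mulrDr Q8 => Q6 Q7.
have -> : 2 * (CW * C) * (m * Z) = CW * (C * m * Z) + CW * (C * m * Z) by ring.
by move: Q1 Q4 Q5 Q6 Q7; flra.
Qed.

(** The increment of [B] splits into a change of [w] under the kernel ([T1]), a change of the
    mollifier ([T2]), a change of time in [kappa] ([T3]) and a change of [v] ([T4]). In units of the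
    weight, the shares of [m] are 1/16, 1/16, 0 and 1/4, less than 1/2 in total. *)
Lemma closeB_step G m (eta : R) : weight G (th0) -> 0 <= m -> closeB G m -> 0 < eta -> closeB G (eta + m / 2).
Proof.
move=> W m0 cB eta0; have [Mb Mb0 HM] := apriori; have G0 := wt_G W.
have CW1 := CW_ge1 S; have CW0 : 0 < CW := lt_le_trans ltr01 CW1.
have thp : 0 < th0 := wt_th W; have l1p := st_l1 S; have d0p := st_d0 S.
have CC : 0 < 16 * (C * C) by rewrite !mulr_gt0.
have Mb1 : 0 < 4 * (Mb + 1) by rewrite mulr_gt0 // ltr_wpDl.
pose eta1 := eta / (16 * (C * C)); have eta1p : 0 < eta1 by rewrite divr_gt0.
pose eta2 := eta / (4 * (Mb + 1)); have eta2p : 0 < eta2 by rewrite divr_gt0.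
have [d1 d1p H1] := w_close m0 cB eta1p.
have ck := kappa_cts2 S.
have [d2 d2p H2] := cts2_unif (A + T) ck eta2p.
have [N N1] : exists n : nat, T <= n%:R * d0.
  exists (Num.bound (T / d0)); rewrite -ler_pdivrMr //; apply: ltW; apply: archi_boundP.
  by rewrite divr_ge0 // ltW.
have th5 : C ^+ 5 * th0 <= 2^-1 by apply: le_trans (th0_le1 (isT : 5 <= 6)%N) _; lra.
have kT t r : 0 <= t <= T -> T <= r -> kappa t r = 0.
  by move=> /andP[t0 tT] Tr; apply: (kappa_eq0 S) => //; exact: le_trans Tr.
have kN t r : 0 <= t <= T -> N%:R * d0 <= r -> kappa t r = 0.
  by move=> tI Nr; apply: kT => //; exact: le_trans Nr.
have [d3 d3p H3] := Hk_cauchy W th5 m0 cB ck (ltW thp) kT kN (wt_kappa W) (divr_gt0 eta0 (ltr0n _ 4)).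
exists (Num.min (Num.min d1 xm) (Num.min d2 d3)); first by rewrite !lt_min d1p d2p (st_xm S).
move=> e e' w v w' v' so so'; rewrite !lt_min => /andP[/andP[f1 f4] /andP[f2 f3]] /andP[/andP[g1 g4] /andP[g2 g3]].
move=> t t' tI t'I; rewrite !lt_min => /andP[/andP[t1 t4] /andP[t2 t3]].
have /andP[t0 tT] := tI; have /andP[t'0 t'T] := t'I.
set tm := Num.max t t'; pose Ex := expR (G * tm).
have Ex0 : 0 < Ex by exact: expR_gt0.
have tE : expR (G * t) <= Ex by rewrite ler_expR ler_pM2l // le_max lexx.
have t'E : expR (G * t') <= Ex by rewrite ler_expR ler_pM2l // le_max lexx orbT.
have Ex1 : 1 <= Ex by apply: expR_ge1; apply: mulr_ge0 (ltW G0) _; rewrite le_max t0.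
have cbb a : continuous (fun x => bs a x + br x) by apply: ctsD; [exact: (reg_cts (st_phi S))|exact: (st_br S)].
have cw : continuous (w^~ t) := cts2_l (so_w so).
have cw' : continuous (w'^~ t') := cts2_l (so_w so').
have cbs a : continuous (bs a) := reg_cts (st_phi S) (s := xb) (e := a).
rewrite (Bf_split so tI) (Bf_split so' t'I).
(* The solution is changed first under the kernel of [e], then the kernel with [w'] kept. In the
   second difference both integrals are compared with the sum of the values of [w'] at the points of
   [xb]. *)
have E1 : Int (fun x => (bs e x + br x) * w x t) 0 L - Int (fun x => (bs e' x + br x) * w' x t') 0 L =
    Int (fun x => (bs e x + br x) * (w x t - w' x t')) 0 L +
    (Int (fun x => bs e x * w' x t') 0 L - Int (fun x => bs e' x * w' x t') 0 L).
  have a1 : continuous (fun x => (bs e x + br x) * w x t) by exact: ctsM.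
  have a2 : continuous (fun x => (bs e' x + br x) * w' x t') by exact: ctsM.
  have a3 : continuous (fun x => (bs e x + br x) * (w x t - w' x t')) by apply: ctsM => //; exact: ctsB.
  have a4 a : continuous (fun x => bs a x * w' x t') by exact: ctsM.
  rewrite -!IntB // -IntD //; last exact: ctsB.
  by congr (Int _ 0 L); apply/funext => x; ring.
have T1 : `|Int (fun x => (bs e x + br x) * (w x t - w' x t')) 0 L| <=
    2 * (C * C) * (eta1 + 2 * (CW * C) * (m * Ex) * th0).
  apply: (bsbr_Int W (so_e so) (ctsB cw cw') (ltW eta1p)).
    by rewrite !mulr_ge0 // ltW.
  move=> x xI; rewrite -mulrA -(mulrA m).
  have xx : `|x - x| < d1 by rewrite subrr normr0.
  apply: (H1 e e' w v w' v' so so' f1 g1 x t x t' _ xI tI xI t'I xx t1).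
  - by rewrite mulr_ge0 ?expR_ge0.
  - move=> /ltW fx; apply: le_trans (foot_weight G0 xI tI fx) _.
    by rewrite ler_wpM2r // expR_ge0.
  - move=> /ltW fx; apply: le_trans (foot_weight G0 xI t'I fx) _.
    by rewrite ler_wpM2r // expR_ge0.
have one a : 0 < a < xm -> a < d1 -> `|Int (fun x => bs a x * w' x t') 0 L - \sum_(y <- xb) w' y t'| <=
    C * C * (eta1 + 2 * (CW * C) * (m * (Ex * th0))).
  move=> /andP[a0 axm] ad; apply: (reg_lim (V := w'^~ t')) => //; [exact: (sz_xb)|exact: ltW| | |].
  - by rewrite addr_ge0 ?(ltW eta1p) // !mulr_ge0 // ltW.
  - by move=> y /(st_xb S)/andP[y1 y2]; split; move: (st_xm S) y1 y2 axm; flra.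
  move=> r y yb rI ry; have := near_in S (_ : 0 < a < xm) yb; rewrite a0 axm => /(_ y isT).
  rewrite subrr normr0 => /(_ (ltW a0)) yI.
  have bigx z : xm <= z -> 0 <= z <= L -> 0 < foot z t' -> expR (G * foot z t') <= Ex * th0.
    move=> zm zI /ltW fz; apply: le_trans (foot_weight G0 zI t'I fz) _.
    apply: ler_pM; rewrite ?expR_ge0 //; apply: le_trans (wt_delay W).
    by rewrite ler_expR lerN2 ler_pM2l // ler_pM2r ?invr_gt0.
  have tt : `|t' - t'| < d1 by rewrite subrr normr0.
  have /andP[y1 y2] := st_xb S yb.
  have ym : xm <= y by move: y1 (st_xm S); flra.
  have rm : xm <= r by move: y1 axm ry; rewrite ler_norml => y1 axm /andP[ry _]; move: ry y1 axm; flra.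
  apply: (H1 e' e' w' v' w' v' so' so' g1 g1 r t' y t' _ rI t'I yI t'I (le_lt_trans ry ad) tt).
  - by rewrite mulr_ge0 // ltW.
  - exact: bigx.
  - exact: bigx.
have T2 : `|Int (fun x => bs e x * w' x t') 0 L - Int (fun x => bs e' x * w' x t') 0 L| <=
    2 * (C * C) * (eta1 + 2 * (CW * C) * (m * Ex) * th0).
  have O1 := one e (so_e so) f1; have := one e' (so_e so') g1; rewrite distrC => O2.
  apply: le_trans (ler_distD (\sum_(y <- xb) w' y t') _ _) _.
  apply: le_trans (lerD O1 O2) _; rewrite -(mulrA _ (m * Ex)) -(mulrA m).
  by rewrite le_eqVlt; apply/orP; left; apply/eqP; ring.
have kI s : - A <= s <= T -> `|s| <= A + T.
  by move=> /andP[s1 s2]; rewrite ler_norml; apply/andP; split; move: s1 s2 A0 T0; flra.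
have ckt r : continuous (kappa r) := @cts2_r _ _ r ck.
have [_ HMv _] := HM e w v so.
have T3 : `|Hk (kappa t) v - Hk (kappa t') v| <= eta2 * Mb.
  rewrite (HkB so (ckt t) (ckt t')); apply: (Hk_bound so (ctsB (ckt t) (ckt t')) _ (ltW eta2p) HMv).
  move=> s sI; apply: ltW; apply: H2; rewrite ?subrr ?normr0 ?kI //.
    by rewrite tT andbT; apply: le_trans t0; rewrite oppr_le0 ltW.
  by rewrite t'T andbT; apply: le_trans t'0; rewrite oppr_le0 ltW.
have T4 := H3 e e' w v w' v' t' so so' f3 g3 t'I.
rewrite -/(Hk (kappa t) v) -/(Hk (kappa t') v').
set I1 := Int _ 0 L in E1 *; set I2 := Int _ 0 L in E1 *.
set J1 := Int _ 0 L in E1 T1; set J2 := _ - _ in T2.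
have -> : I1 + Hk (kappa t) v - (I2 + Hk (kappa t') v') =
  (I1 - I2) + (Hk (kappa t) v - Hk (kappa t') v) + (Hk (kappa t') v - Hk (kappa t') v') by ring.
rewrite E1 -/J2.
apply: le_trans (ler_normD _ _) _; apply: le_trans (lerD (ler_normD _ _) (lexx _)) _.
apply: le_trans (lerD (lerD (ler_normD _ _) (lexx _)) (lexx _)) _.
have mE : 0 <= m * Ex by rewrite mulr_ge0 // ltW.
have F1 : 2 * (C * C) * (eta1 + 2 * (CW * C) * (m * Ex) * th0) <= eta / 8 + 16^-1 * (m * Ex).
  rewrite (_ : _ * _ = 2 * (C * C) * eta1 + 4 * (C ^+ 3 * CW * th0) * (m * Ex)); last by ring.
  apply: lerD; first by rewrite /eta1 le_eqVlt; apply/orP; left; apply/eqP; field; rewrite gt_eqF.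
  by apply: ler_wpM2r => //; move: (th0_le (isT : 3 <= 6)%N); flra.
have F3 : eta2 * Mb <= eta / 4.
  rewrite (_ : eta / 4 = eta2 * (Mb + 1)); last by rewrite /eta2; field; rewrite gt_eqF // ltr_wpDl.
  by rewrite ler_pM2l // lerDl.
have F4 : 10 * (C * C) * (th0 * m * expR (G * t')) <= 4^-1 * (m * Ex).
  apply: le_trans (_ : 10 * (C ^+ 2 * th0) * (m * Ex) <= _).
    rewrite (_ : 10 * (C ^+ 2 * th0) * (m * Ex) = 10 * (C * C) * (th0 * m * Ex)); last by ring.
    apply: ler_wpM2l; first by rewrite !mulr_ge0 // ltW.
    by apply: ler_wpM2l => //; rewrite mulr_ge0 // ltW.
  by apply: ler_wpM2r => //; move: (th0_le1 (isT : 2 <= 6)%N); flra.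
have F5 : eta <= eta * Ex by rewrite ler_peMr // ltW.
rewrite -/tm -/Ex mulrDl (mulrAC m).
have U1 := le_trans T1 F1; have U2 := le_trans T2 F1; have U3 := le_trans T3 F3.
have U4 := le_trans T4 (lerD (lexx _) F4).
apply: le_trans (lerD (lerD (lerD U1 U2) U3) U4) _.
by move: F5 mE eta0; flra.
Qed.

(** The a priori bound gives the defect [2 * Mb], and each application of [closeB_step] halves it up
    to an arbitrarily small error. The invariant therefore carries an arbitrary [eta]. *)
Lemma closeB_all : exists G, weight G (th0) /\ forall m : R, 0 < m -> closeB G m.
Proof.
have [G W] := weight_exists (th0_gt0); exists G; split => //.
have [Mb Mb0 HM] := apriori; have G0 := wt_G W.
have mono m m' : m <= m' -> closeB G m -> closeB G m'.
  move=> mm [d dp H]; exists d => // e e' w v w' v' so so' ed ed' t t' tI t'I tt.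
  by apply: le_trans (H e e' w v w' v' so so' ed ed' t t' tI t'I tt) _; rewrite ler_wpM2r ?expR_ge0.
have start : closeB G (2 * Mb).
  exists 1 => // e e' w v w' v' so so' _ _ t t' tI t'I _.
  have [HB _ _] := HM e w v so; have [HB' _ _] := HM e' w' v' so'.
  apply: le_trans (ler_normB _ _) _; apply: le_trans (_ : 2 * Mb <= _); first by have := HB t tI; have := HB' t' t'I; lra.
  rewrite ler_peMr ?mulr_ge0 //; apply: expR_ge1; apply: mulr_ge0 (ltW G0) _; rewrite le_max.
  by case/andP: tI => ->.
have iter n : forall eta : R, 0 < eta -> closeB G (2 * Mb / 2 ^+ n + eta).
  elim: n => [|n IH] eta eta0.
    by apply: mono start; rewrite expr0 divr1 lerDl ltW.
  have Mn : 0 <= 2 * Mb / 2 ^+ n by rewrite divr_ge0 ?mulr_ge0 ?exprn_ge0.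
  have H := IH (eta / 2) (divr_gt0 eta0 (ltr0n _ 2)).
  have [|p0] := boolP (0 <= 2 * Mb / 2 ^+ n + eta / 2); last first.
    by case/negP: p0; rewrite addr_ge0 // divr_ge0 // ltW.
  move=> p0; apply: mono (closeB_step W p0 H (divr_gt0 eta0 (ltr0n _ 4))).
  rewrite exprS invfM; set q := (2 ^+ n)^-1; rewrite -/q in Mn.
  by lra.
move=> m m0; have [n Hn] : exists n, 2 * Mb / 2 ^+ n <= m / 2.
  apply: contrapT => Hn; have : m / 2 <= 0; last by lra.
  apply: (@le0_geometric _ _ (2 * Mb)) => n; rewrite leNgt; apply/negP => H.
  by apply: Hn; exists n; exact: ltW.
by apply: mono (iter n _ (divr_gt0 m0 (ltr0n _ 2))); lra.
Qed.

Lemma delays_exhaust : exists N : nat, T <= N%:R * d0.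
Proof.
exists (Num.bound (T / d0)); rewrite -ler_pdivrMr ?(st_d0 S) //; apply: ltW; apply: archi_boundP.
by rewrite divr_ge0 ?ltW // (st_d0 S).
Qed.

Lemma w_cauchy (eta : R) : 0 < eta -> exists2 d : R, 0 < d &
  forall e e' w v w' v', wvsol e w v -> wvsol e' w' v' -> e < d -> e' < d ->
  forall x t, 0 <= x <= L -> 0 <= t <= T -> `|w x t - w' x t| <= eta.
Proof.
move=> eta0; have [G [W HB]] := closeB_all; have G0 := wt_G W.
have CW0 : 0 < CW := lt_le_trans ltr01 (CW_ge1 S).
have P0 : 0 < 4 * (CW * C) * expR (G * T) by rewrite !mulr_gt0 // expR_gt0.
pose m := eta / (4 * (CW * C) * expR (G * T)); have m0 : 0 < m by rewrite divr_gt0.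
have [d dp Hd] := w_close (ltW m0) (HB m m0) (divr_gt0 eta0 (ltr0n _ 2)).
exists d => // e e' w v w' v' so so' ed ed' x t xI tI.
have z0 (z : R) : `|z - z| < d by rewrite subrr normr0.
have Z : 0 < foot x t -> expR (G * foot x t) <= expR (G * T).
  move=> _; rewrite ler_expR ler_pM2l //; have [_ st _] := foot_in S xI tI.
  by apply: le_trans st _; case/andP: tI.
apply: le_trans (Hd e e' w v w' v' so so' ed ed' x t x t _ xI tI xI tI (z0 _) (z0 _) (expR_ge0 _) Z Z) _.
rewrite (_ : 2 * (CW * C) * (m * expR (G * T)) = eta / 2); first by rewrite -splitr.
by rewrite /m; field; rewrite !gt_eqF // expR_gt0.
Qed.

(** The number [N] of delays that exhaust [[0, T]] makes [Hk_cauchy] applicable to any kernel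
    vanishing beyond [T], and [m] is taken so small that its error term is at most [eta / 2]. *)
Lemma Hk_conv (k : R -> R) (eta : R) : continuous k -> (forall r, T <= r -> k r = 0) -> 0 < eta ->
  exists2 d : R, 0 < d & forall e e' w v w' v', wvsol e w v -> wvsol e' w' v' -> e < d -> e' < d ->
  `|Hk k v - Hk k v'| <= eta.
Proof.
move=> ck kT eta0; have [G [W HB]] := closeB_all; have G0 := wt_G W.
have [N HN] := delays_exhaust.
have ck2 : cts2 (fun _ s => k s) by exact: (cts_app ck (@cts_snd R)).
have [B B0 HkB] := cts2_bounded T ck2.
pose M := B * expR (G * T); have M0 : 0 <= M by rewrite mulr_ge0 ?expR_ge0.
have P0 : 0 < 20 * (C * C) * ((M + 1) * expR (G * T)) by rewrite !mulr_gt0 ?expR_gt0 // ltr_wpDl.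
pose m := eta / (20 * (C * C) * ((M + 1) * expR (G * T))); have m0 : 0 < m by rewrite divr_gt0.
have th5 : C ^+ 5 * th0 <= 2^-1 by apply: le_trans (th0_le1 (isT : 5 <= 6)%N) _; lra.
have kM t s : 0 <= t <= T -> 0 <= s <= T -> `|k s| * expR (G * s) <= M * expR (G * t).
  move=> /andP[t0 tT] /andP[s0 sT]; apply: le_trans (_ : M <= _); last first.
    by rewrite ler_peMr // expR_ge1 // mulr_ge0 // ltW.
  apply: ler_pM; rewrite ?expR_ge0 //; last by rewrite ler_expR ler_pM2l.
  by apply: (HkB 0 s); rewrite ?normr0 ?ger0_norm // ltW.
have kN t r : 0 <= t <= T -> N%:R * d0 <= r -> k r = 0.
  by move=> _ Hr; apply: kT; exact: le_trans Hr.
have [d dp Hd] := Hk_cauchy W th5 (ltW m0) (HB m m0) (n := N) ck2 M0 (fun t r _ => kT r) kN kM (divr_gt0 eta0 (ltr0n _ 2)).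
exists d => // e e' w v w' v' so so' ed ed'.
have TI : 0 <= T <= T by rewrite lexx ltW.
apply: le_trans (Hd e e' w v w' v' T so so' ed ed' TI) _.
rewrite [leRHS]splitr lerD2l.
have -> : eta / 2 = 10 * (C * C) * ((M + 1) * m * expR (G * T)).
  by rewrite /m; field; rewrite !gt_eqF ?expR_gt0 // ltr_wpDl.
apply: ler_wpM2l; first by rewrite !mulr_ge0 // ltW.
by apply: ler_wpM2r (expR_ge0 _) _ _ _; apply: ler_wpM2r (ltW m0) _ _ _; rewrite lerDl.
Qed.

(** * Concentration of the singular part *)

(** Limit positions of the singularities of the boundary values, after at most [n] reflections. A
    singularity starting to the right of [y] passes [y] at a negative time; such a crossing lies
    outside the domain and is filtered out. *)
Fixpoint sing (n : nat) : seq R :=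
  [seq - (y / h 0 0) | y <- xa] ++ tc ++
  (if n is n'.+1 then [seq r <- [seq tau h y s | y <- xb, s <- sing n'] | 0 <= r] else [::]).

Lemma sing_init n y : y \in xa -> - (y / h 0 0) \in sing n.
Proof. by move=> ya; case: n => [|n]; rewrite mem_cat (map_f (fun y => - (y / h 0 0))). Qed.

Lemma sing_tc n t : t \in tc -> t \in sing n.
Proof. by move=> tt; case: n => [|n]; rewrite !mem_cat tt ?orbT. Qed.

Lemma sing_tau n y s : y \in xb -> s \in sing n -> 0 <= tau h y s -> tau h y s \in sing n.+1.
Proof.
move=> yb sn t0; rewrite /= !mem_cat mem_filter t0 /=.
by rewrite (allpairs_f (fun y s => tau h y s)) ?orbT.
Qed.

Lemma seq_gap (l : seq R) : exists2 g : R, 0 < g & forall z, z \in l -> z != 0 -> g <= `|z|.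
Proof.
elim: l => [|a l [g g0 Hg]]; first by exists 1.
have [a0|a0] := eqVneq a 0.
  exists g => // z; rewrite inE => /orP[/eqP ->|zl]; first by rewrite a0 eqxx.
  exact: Hg.
exists (Num.min g `|a|); first by rewrite lt_min g0 normr_gt0.
move=> z; rewrite inE => /orP[/eqP ->|zl] z0; first by rewrite ge_min lexx orbT.
by rewrite ge_min Hg.
Qed.

Lemma reg_near s e x : 0 < e -> reg s phi e x != 0 -> exists2 y, y \in s & `|x - y| <= e.
Proof.
move=> e0; apply: contraNP => H; apply/eqP; apply: (reg_eq0 (st_phi S) e0) => y ys.
by rewrite ltNge; apply/negP => H2; apply: H; exists y.
Qed.

(** Otherwise the integrand in [Q_pairing] would vanish identically. The last alternative records
    that a source on the axis precedes its effect by one delay. *)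
Lemma Q_near e w v s : wvsol e w v -> 0 <= s <= T -> Qf e v s != 0 -> exists r y,
  [/\ y \in xb, `|X s r - y| <= e, - A <= r <= T, bdv v r != 0 & r <= 0 \/ r <= s - d0].
Proof.
move=> so sI; have e0 : 0 < e by case/andP: (so_e so).
rewrite (Q_pairing S so sI); apply: contraNP => H; apply/eqP.
have cv : continuous (bdv v) := bdv_cts (so_v so).
rewrite (@Int_ext _ _ (fun=> 0)) ?Int_cst ?mul0r //.
- by move: A0 T0; flra.
- apply: ctsM => //; apply: ctsM; last exact: (@cts2_r _ _ s (Y_cts2 S)).
  exact: (cts_app (reg_cts (st_phi S) (s := xb) (e := e)) (@cts2_r _ _ s (X_cts2 sf))).
- exact: cts_cst.
move=> r /andP[Ar rT]; apply/eqP; rewrite mulf_eq0 mulf_eq0 -orbA; apply/or3P.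
have [b0|b0] := eqVneq (bs e (X s r)) 0; first by apply: Or31; apply/eqP.
have [v0|v0] := eqVneq (bdv v r) 0; first by apply: Or33; apply/eqP.
have [y yb Xy] := reg_near e0 b0; case: H; exists r, y; split => //; first by rewrite !ltW.
case: (leP r 0) => [r0|r0]; [by left|right].
have /andP[s0 _] := sI; have := delay S (so_e so) yb Xy s0.
by rewrite (foot_X sf); apply; exact: ltW.
Qed.

(** For [s > 0] a nonzero value comes from [c_s], near a point of [tc], or from [Q]. In the latter
    case the source is earlier by one delay, so it is near some [q] in [sing n] by induction, and
    [s] is near [tau h y q] by continuity of [tau]. *)
Lemma bdv_near_sing n (rho : R) : 0 < rho -> exists2 d : R, 0 < d &
  forall e w v s, wvsol e w v -> e < d -> - A <= s <= T -> s <= n%:R * d0 -> bdv v s != 0 ->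
  exists2 q, q \in sing n & `|s - q| < rho.
Proof.
have h0 := st_h0 S; have l00 := sf_l0 sf.
have neg m (rh : R) : 0 < rh -> forall e w v s, wvsol e w v -> e < h 0 0 * rh -> - A <= s -> s <= 0 ->
    bdv v s != 0 -> exists2 q, q \in sing m & `|s - q| < rh.
  move=> rh0 e w v s so ed As s0; rewrite (bdv_neg S so) ?As // => H.
  have e0 : 0 < e by case/andP: (so_e so).
  have [y ya Xy] := reg_near e0 H; exists (- (y / h 0 0)); first exact: sing_init.
  rewrite -(ltr_pM2l h0) -[X in X * `|_|](gtr0_norm h0) -normrM.
  rewrite (_ : h 0 0 * (s - - (y / h 0 0)) = - (- h 0 0 * s - y)); last by field; rewrite gt_eqF.
  by rewrite normrN; exact: le_lt_trans ed.
elim: n rho => [|n IH] rho rho0.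
  exists (h 0 0 * rho); first by rewrite mulr_gt0.
  move=> e w v s so ed /andP[As _]; rewrite mul0r => s0; exact: (neg 0%N rho rho0 e w v).
(* The nonzero crossing times stay away from 0 by [g]. A crossing time close to some [s > 0] is then
   nonnegative and survives the filter in [sing]. *)
have [g g0 Hg] := seq_gap [seq tau h y s | y <- xb, s <- sing n].
pose rho1 := Num.min rho g; have r1p : 0 < rho1 by rewrite lt_min rho0.
pose M := A + T + 1 + L; have M0 : 0 <= M by move: A0 T0 L0; rewrite /M; flra.
have [d1 d1p H1] := cts2_unif M (tau_cts2 sf) (divr_gt0 r1p (ltr0n _ 2)).
have dd : 0 < Num.min d1 1 by rewrite lt_min d1p ltr01.
have [d2 d2p H2] := IH (Num.min d1 1) dd.
exists (Num.min (Num.min rho (h 0 0 * rho)) (Num.min d2 (l0 * (rho1 / 2)))).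
  by rewrite !lt_min rho0 d2p !mulr_gt0 ?invr_gt0.
move=> e w v s so; rewrite !lt_min => /andP[/andP[f4 f1] /andP[f2 f3]] sI sn vs.
  have /andP[As sT] := sI; have e0 : 0 < e by case/andP: (so_e so).
  case: (leP s 0) => [s0|s0]; first exact: (neg n.+1 rho rho0 e w v).
  move: vs; rewrite (bdv_pos so) ?s0 // => vs.
  have [cz|cnz] := eqVneq (cs e s) 0; last first.
    have [y yt sy] := reg_near e0 cnz; exists y; first exact: sing_tc.
    exact: le_lt_trans f4.
  have Qn : Qf e v s != 0 by apply: contra_neq vs => ->; rewrite cz mul0r mulr0 addr0.
  have sI' : 0 <= s <= T by rewrite ltW.
  have [r [y [yb Xy rI vr rs]]] := Q_near so sI' Qn.
  have rn : r <= n%:R * d0.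
    have nd : 0 <= n%:R * d0 by rewrite mulr_ge0 // ltW // (st_d0 S).
    case: rs => [r0|rs]; first exact: le_trans nd.
    by move: sn rs; rewrite -natr1 mulrDl mul1r; flra.
  have [q qn] := H2 e w v r so f2 rI rn vr; rewrite lt_min => /andP[rq1 rq2].
  have /andP[Ar rT] := rI; have /andP[y1 y2] := st_xb S yb; have x0 := st_xm S.
  have yM : `|y| <= M by rewrite ger0_norm /M; move: y1 y2 x0 A0 T0 L0; flra.
  have rM : `|r| <= M by rewrite ler_norml /M; apply/andP; split; move: Ar rT A0 T0 L0; flra.
  have qM : `|q| <= M.
    by move: rq2; rewrite ltr_norml ler_norml /M => /andP[u1 u2]; apply/andP; split; move: u1 u2 Ar rT A0 T0 L0; flra.
  have yy : `|y - y| < d1 by rewrite subrr normr0.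
  have Q1 := H1 y y r q yM yM rM qM yy rq1.
  have Q2 : `|tau h y r - s| < rho1 / 2.
    have := tau_dist sf y r s; rewrite distrC [X in _ <= X]distrC => Q.
    have Q' := le_lt_trans (le_trans Q Xy) f3.
    by move: Q'; rewrite ltr_pM2l.
  have Q3 : `|s - tau h y q| < rho1.
    apply: le_lt_trans (ler_distD (tau h y r) _ _) _; rewrite (distrC s) [ltRHS]splitr.
    exact: ltrD.
  exists (tau h y q); last by apply: lt_le_trans Q3 _; rewrite ge_min lexx.
  apply: sing_tau => //; rewrite leNgt; apply/negP => tn.
  have := Hg (tau h y q) (allpairs_f (fun y s => tau h y s) yb qn); rewrite lt_eqF // => /(_ isT).
  rewrite ltr0_norm // => gq; have : rho1 <= g by rewrite ge_min lexx orbT.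
  by move: Q3; rewrite ltr_norml => /andP[_ Q3]; move: Q3 s0 gq; flra.
Qed.

Lemma sing_exhaust : exists N : nat, forall rho : R, 0 < rho -> exists2 d : R, 0 < d &
  forall e w v s, wvsol e w v -> e < d -> - A <= s <= T -> bdv v s != 0 ->
  exists2 q, q \in sing N & `|s - q| < rho.
Proof.
have [N HN] := delays_exhaust; exists N => rho rho0.
have [d dp Hd] := bdv_near_sing N rho0; exists d => // e w v s so ed sI.
have /andP[_ sT] := sI; exact: (Hd e w v s so ed sI (le_trans sT HN)).
Qed.

Lemma clamp_le (a b x y : R) : x <= y -> clamp a b x <= clamp a b y.
Proof.
move=> xy; rewrite /clamp le_min !ge_min lexx !orbT andbT; apply/orP; left.
by rewrite ge_max !le_max xy lexx !orbT.
Qed.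

(** Cutting out the [rho]-neighbourhood of the first point leaves two intervals to which induction
    applies and a middle one of length at most [2 * rho]; hence the crude factor 3 for each
    point. *)
Lemma near_list_Int (l : seq R) (F : R -> R) (rho : R) : continuous F -> 0 <= rho ->
  (forall s, `|F s| <= 1) -> forall a b, a <= b ->
  (forall s, a < s < b -> F s != 0 -> exists2 q, q \in l & `|s - q| < rho) ->
  `|Int F a b| <= 3 ^+ size l * (2 * rho).
Proof.
move=> cF rho0 F1; elim: l => [|q l IH] a b ab H.
  rewrite (@Int_ext _ _ (fun=> 0)) //; [|exact: cts_cst|].
    by rewrite Int_cst mul0r normr0 mulr_ge0 // mulr_ge0.
  by move=> s sI; apply: contrapT => /eqP Fs; have [q] := H s sI Fs.
set a' := clamp a b (q - rho); set b' := clamp a b (q + rho).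
have /andP[aa' a'b] : a <= a' <= b by exact: clamp_itv.
have /andP[ab' b'b] : a <= b' <= b by exact: clamp_itv.
have a'b' : a' <= b' by apply: clamp_le; rewrite lerD2l; move: rho0; flra.
have I1 : `|Int F a a'| <= 3 ^+ size l * (2 * rho).
  apply: IH => // s /andP[as_' sa'] Fs.
  have sI : a < s < b by rewrite as_' (lt_le_trans sa').
  have [q' q'l q's] := H s sI Fs.
  move: q'l q's; rewrite inE => /orP[/eqP ->|q'l q's]; last by exists q'.
  rewrite ltr_norml => /andP[+ _].
  by move: sa'; rewrite /a' /clamp lt_min lt_max => /andP[/orP[|] + _]; move: as_'; flra.
have I2 : `|Int F b' b| <= 3 ^+ size l * (2 * rho).
  apply: IH => // s /andP[b's sb] Fs.
  have sI : a < s < b by rewrite sb (le_lt_trans ab').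
  have [q' q'l q's] := H s sI Fs.
  move: q'l q's; rewrite inE => /orP[/eqP ->|q'l q's]; last by exists q'.
  rewrite ltr_norml => /andP[_ +].
  by move: b's; rewrite /b' /clamp gt_min gt_max => /orP[/andP[+ _]|]; move: sb; flra.
have I3 : `|Int F a' b'| <= 2 * rho.
  apply: le_trans (Int_bound a'b' cF (fun s _ => F1 s)) _; rewrite mul1r.
  apply: le_trans (ler_norm _) _; apply: le_trans (clamp_dist _ _ _ _) _.
  by rewrite (_ : q + rho - (q - rho) = 2 * rho) ?ger0_norm ?mulr_ge0 //; ring.
rewrite -(Int_chasles F a a' b) -(Int_chasles F a' b' b) exprS.
apply: le_trans (ler_normD _ _) _; apply: le_trans (lerD (lexx _) (ler_normD _ _)) _.
have P : 2 * rho <= 3 ^+ size l * (2 * rho) by rewrite ler_peMl ?mulr_ge0 // exprn_ege1 // ler1n.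
by move: I1 I2 I3 P; flra.
Qed.

Definition Sing : set R := [set q | exists n, q \in sing n].

(** The mass of [bdv v] itself does not tend to 0. Truncated at height 1, it is bounded by the
    length of small neighbourhoods of finitely many points. *)
Lemma bdv_mass_small (eta : R) : 0 < eta -> exists2 d : R, 0 < d &
  forall e w v, wvsol e w v -> e < d -> Int (fun s => Num.min 1 `|bdv v s|) (- A) T <= eta.
Proof.
move=> eta0; have [N HN] := sing_exhaust.
have P : 0 < 3 ^+ size (sing N) * 2 :> R by rewrite mulr_gt0 // exprn_gt0.
pose rho := eta / (3 ^+ size (sing N) * 2); have rho0 : 0 < rho by rewrite divr_gt0.
have [d dp Hd] := HN rho rho0; exists d => // e w v so ed.
have cv : continuous (bdv v) := bdv_cts (so_v so).
have cF : continuous (fun s => Num.min 1 `|bdv v s|) by apply: cts_min; [exact: cts_cst|exact: cts_norm].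
have m0 s : 0 <= Num.min 1 `|bdv v s| by rewrite le_min ler01 normr_ge0.
apply: le_trans (ler_norm _) _; have -> : eta = 3 ^+ size (sing N) * (2 * rho).
  by rewrite mulrA mulrC divfK // gt_eqF.
apply: (near_list_Int cF (ltW rho0)).
- by move=> s; rewrite ger0_norm // ge_min lexx.
- by move: A0 T0; flra.
move=> s /andP[As sT] Fs; apply: (Hd e w v s so ed); first by rewrite !ltW.
by apply: contra_neq Fs => ->; rewrite normr0 min_r.
Qed.

Lemma bdv_vanish (q0 : R) : ~ Sing q0 -> exists2 d : R, 0 < d &
  forall e w v s, wvsol e w v -> e < d -> - A <= s <= T -> `|s - q0| < d -> bdv v s = 0.
Proof.
move=> nS; have [N HN] := sing_exhaust.
have [g g0 Hg] := seq_gap [seq q - q0 | q <- sing N].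
have [d dp Hd] := HN (g / 2) (divr_gt0 g0 (ltr0n _ 2)).
exists (Num.min d (g / 2)); first by rewrite lt_min dp divr_gt0.
move=> e w v s so; rewrite !lt_min => /andP[ed _] sI /andP[_ sq].
apply/eqP; apply: contraT => vs; have [q qN qs] := Hd e w v s so ed sI vs.
have qq : q - q0 != 0 by rewrite subr_eq0; apply: contra_notN nS => /eqP <-; exists N.
have := Hg _ (map_f (fun q => q - q0) qN) qq; rewrite leNgt => /negP; case.
have -> : q - q0 = (s - q0) - (s - q) by ring.
by apply: le_lt_trans (ler_normB _ _) _; rewrite [ltRHS]splitr ltrD.
Qed.

(** If both factors are nonzero at [t], then [t] is near some [tj], and a parameter near [Sing] has
    a characteristic passing near some [y] of [xb] at time [t]. Then [foot y tj] would be near the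
    finite set of singular parameters, from which it has positive distance. *)
Lemma cs_Q_vanish : (forall y t, y \in xb -> t \in tc -> ~ Sing (foot y t)) ->
  exists2 d : R, 0 < d & forall e w v t, wvsol e w v -> e < d -> 0 <= t <= T -> cs e t * Qf e v t = 0.
Proof.
move=> nS; have [N HN] := sing_exhaust; have l1p := st_l1 S.
have [g g0 Hg] := seq_gap [seq a - b | a <- [seq foot y t | y <- xb, t <- tc], b <- sing N].
have [d dp Hd] := HN (g / 2) (divr_gt0 g0 (ltr0n _ 2)).
pose Cf := expR (K * T) / l0 * (1 + l1).
have Cf0 : 0 < Cf by rewrite mulr_gt0 // ?addr_gt0 // divr_gt0 ?expR_gt0 // (sf_l0 sf).
exists (Num.min d (g / 2 / Cf)); first by rewrite lt_min dp !divr_gt0.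
move=> e w v t so; rewrite lt_min => /andP[ed eg] tI.
have e0 : 0 < e by case/andP: (so_e so).
have [->|Qn] := eqVneq (Qf e v t) 0; first by rewrite mulr0.
have [c0|cn] := eqVneq (cs e t) 0; first by rewrite c0 mul0r.
have [tj tjt ttj] := reg_near e0 cn.
have [r [y [yb Xy rI vr _]]] := Q_near so tI Qn.
have [q qN rq] := Hd e w v r so ed rI vr.
have nq : foot y tj - q != 0.
  by rewrite subr_eq0; apply/eqP => E; apply: (nS y tj yb tjt); rewrite E; exists N.
have H1 : g <= `|foot y tj - q|.
  by apply: Hg nq; apply: (allpairs_f (fun a b => a - b)) => //; exact: allpairs_f.
have /andP[y1 y2] := st_xb S yb; have x0 := st_xm S.
have y0 : 0 <= y by move: y1 x0; flra.
have tjI : 0 <= tj <= T by have /andP[u1 u2] := st_tc S tjt; apply/andP; split; move: u1 u2 x0; flra.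
have X0 : 0 <= X t r by have /andP[] := near_in S (so_e so) yb Xy.
have := foot_lip sf tI tjI X0 y0; rewrite (foot_X sf) => H2.
have H3 : `|r - foot y tj| < g / 2.
  apply: le_lt_trans H2 _; apply: le_lt_trans (_ : e * Cf < _); last by rewrite -ltr_pdivlMr.
  rewrite /Cf mulrCA; apply: ler_wpM2l; first by rewrite divr_ge0 ?expR_ge0 // ltW // (sf_l0 sf).
  by rewrite mulrDr mulr1 (mulrC e); apply: lerD => //; rewrite ler_pM2l.
have : `|foot y tj - q| < g.
  apply: le_lt_trans (ler_distD r _ _) _; rewrite (distrC _ r) [ltRHS]splitr; exact: ltrD.
by rewrite ltNge H1.
Qed.

(** * The remainder *)

Record usol (e : R) (u : R -> R -> R) : Prop := USol {
  so_u : cts2 u;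
  so_uX : forall t s, Num.max s 0 <= t -> t <= T -> X t s <= L ->
    u (X t s) t = bdv u s +
      Int (fun r => p (X r s) r * u (X r s) r + f (X r s) r (u (X r s) r)) (Num.max s 0) t;
  so_u0 : forall y, 0 <= y <= L -> u y 0 = as_ e y + ar y;
  so_ub : forall s, 0 < s <= T ->
    u 0 s = (cs e s + cr s) * Int (fun x => (bs e x + br x) * u x s) 0 L }.

Definition rem (u w v : R -> R -> R) (x t : R) : R := u x t - w x t - v x t.
(** Everything that drives the remainder along the characteristic of [s]: its own boundary value and
    the effect of [v] on the nonlinearity. *)
Definition load (u w v : R -> R -> R) (s : R) : R := `|bdv (rem u w v) s| + Num.min 1 `|bdv v s|.
Definition DD : R := 2 * C ^+ 3 * CW.

Lemma DD_gt0 : 0 < DD.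
Proof. by rewrite !mulr_gt0 ?exprn_gt0 // (lt_le_trans ltr01 (CW_ge1 S)). Qed.

Section Sol.
Variables (e : R) (u w v : R -> R -> R).
Hypotheses (uso : usol e u) (so : wvsol e w v).
Local Notation g := (rem u w v).
Local Notation beta := (load u w v).

Lemma rem_cts2 : cts2 g.
Proof. by apply: ctsB; [apply: ctsB; [exact: (so_u uso)|exact: (so_w so)]|exact: (so_v so)]. Qed.

Lemma load_cts : continuous beta.
Proof.
apply: ctsD; first by apply: cts_norm; apply: bdv_cts; exact: rem_cts2.
apply: cts_min; [exact: cts_cst|apply: cts_norm; apply: bdv_cts; exact: (so_v so)].
Qed.

Lemma load_ge0 s : 0 <= beta s.
Proof. by rewrite addr_ge0 // le_min ler01 normr_ge0. Qed.

Lemma rem_neg s : - A <= s <= 0 -> bdv g s = 0.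
Proof.
move=> sI; have [_ bI m0] := bstart_neg S sI; rewrite /bdv m0 /rem (so_u0 uso) // (so_w0 so) // (so_v0 so) //.
by ring.
Qed.

(** The product of [c_s] with the integral of [b_s v] is the only term of the boundary condition (U)
    for [w + v] that is missing in (W) and (V) together, and it vanishes by hypothesis. *)
Lemma rem_pos s : 0 < s <= T -> cs e s * Qf e v s = 0 ->
  bdv g s = (cs e s + cr s) * (Int (fun x => bs e x * g x s) 0 L + Int (fun x => br x * g x s) 0 L).
Proof.
move=> /andP[s0 sT] cQ; have [b0 m0] := bstart_pos (ltW s0).
rewrite /bdv b0 m0 {1}/rem (so_ub uso) ?s0 // (so_wb so) ?s0 // (so_vb so) ?s0 //.
have cb : continuous (bs e) := reg_cts (st_phi S) (s := xb) (e := e).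
have cbr := st_br S.
have cu : continuous (u^~ s) := cts2_l (so_u uso).
have cw : continuous (w^~ s) := cts2_l (so_w so).
have cv : continuous (v^~ s) := cts2_l (so_v so).
have cg : continuous (g^~ s) := cts2_l rem_cts2.
have c1 : continuous (fun x => bs e x * g x s) by exact: ctsM.
have c2 : continuous (fun x => br x * g x s) by exact: ctsM.
have c3 : continuous (fun x => bs e x * v x s) by exact: ctsM.
have c4 : continuous (fun x => (bs e x + br x) * w x s + br x * v x s).
  by apply: ctsD; apply: ctsM => //; exact: ctsD.
have -> : Int (fun x => (bs e x + br x) * u x s) 0 L =
   Int (fun x => bs e x * g x s) 0 L + Int (fun x => br x * g x s) 0 L + Bf e w v s + Qf e v s.
  rewrite -[Bf e w v s]/(Int _ 0 L) -[Qf e v s]/(Int _ 0 L) -!IntD //; try by do ?[exact: ctsD | apply: ctsD => //].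
  by congr (Int _ 0 L); apply/funext => x; rewrite /rem; ring.
set a := Int _ 0 L; set b := Int _ 0 L; move: cQ; set q := Qf _ _ _; set B := Bf _ _ _ _ => cQ.
have -> : (cs e s + cr s) * (a + b + B + q) - cr s * B - (cs e s * B + cr s * q) =
  (cs e s + cr s) * (a + b) + cs e s * q by ring.
by rewrite cQ addr0.
Qed.

Lemma E_bounds t s : 0 <= t <= T -> - A <= s <= T -> CW^-1 <= E t s /\ E t s <= CW.
Proof.
move=> /andP[t0 tT] /andP[As sT].
have cp : continuous (fun r => p (X r s) r) by apply: (along_cts S); exact: (st_p S).
have H : `|Int (fun r => p (X r s) r) (Num.max s 0) t| <= C * T.
  apply: le_trans (Int_bound_abs _ _ cp (fun r => st_pC S (X r s) r)) _; rewrite ler_pM2l //.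
  have m0 : 0 <= Num.max s 0 by rewrite le_max lexx orbT.
  have mT : Num.max s 0 <= T by rewrite ge_max sT ltW.
  by rewrite ler_norml; apply/andP; split; lra.
have CT : 0 <= C * T by rewrite mulr_ge0 // ltW.
move: H; rewrite ler_norml => /andP[H1 H2]; rewrite /E /CW -expRN !ler_expR.
by split; lra.
Qed.

(** Gronwall along the characteristic. In [f(u) - f(w)] the part [f(u) - f(w + v)] is Lipschitz in
    the remainder and [f(w + v) - f(w)] is a source term bounded by [m]. *)
Lemma rem_bound t s : Num.max s 0 <= t -> t <= T -> - A <= s -> X t s <= L ->
  `|g (X t s) t| <= DD * beta s.
Proof.
move=> st tT As XL; set a := Num.max s 0 in st *.
have a0 : 0 <= a by rewrite le_max lexx orbT.
have sa : s <= a by rewrite le_max lexx.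
have CW1 := CW_ge1 S; have CW0 : 0 < CW := lt_le_trans ltr01 CW1.
pose fz (z : R -> R -> R) r := f (X r s) r (z (X r s) r).
have cf z : cts2 z -> continuous (fz z).
  move=> cz; apply: (@cts_app _ _ _ (fun r => (X r s, r, z (X r s) r)) (fun q => f q.1.1 q.1.2 q.2) (st_f S)).
  apply: cts_pair3; [|exact: cts_id|exact: (along_cts S)].
  exact: (cts2_l (X_cts2 sf)).
have cp : continuous (fun r => p (X r s) r) by apply: (along_cts S); exact: (st_p S).
have cal z : cts2 z -> continuous (fun r => z (X r s) r) by move=> cz; exact: (along_cts S).
pose D r := p (X r s) r * g (X r s) r + (fz u r - fz w r).
have cD : continuous D.
  apply: ctsD; first by apply: ctsM => //; exact: (cal _ rem_cts2).
  by apply: ctsB; apply: cf; [exact: (so_u uso)|exact: (so_w so)].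
pose m := 2 * C ^+ 2 * Num.min 1 `|bdv v s|.
have m0 : 0 <= m by rewrite mulr_ge0 ?mulr_ge0 ?exprn_ge0 ?(ltW C0) // le_min ler01 normr_ge0.
have C2 : 0 <= 2 * C by rewrite mulr_ge0 // ltW.
have H1 r : a <= r <= t -> g (X r s) r = bdv g s + Int D a r.
  move=> /andP[ar_ rt]; have rT := le_trans rt tT.
  have XrL := le_trans (X_le sf s rt) XL.
  have b1 : continuous (fun r => p (X r s) r * u (X r s) r + fz u r).
    by apply: ctsD; [apply: ctsM => //; exact: (cal _ (so_u uso))|exact: cf (so_u uso)].
  have b2 : continuous (fun r => p (X r s) r * w (X r s) r + fz w r).
    by apply: ctsD; [apply: ctsM => //; exact: (cal _ (so_w so))|exact: cf (so_w so)].
  have b3 : continuous (fun r => p (X r s) r * v (X r s) r) by apply: ctsM => //; exact: (cal _ (so_v so)).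
  rewrite {1}/rem (so_uX uso) // (so_wX so) // (so_vX so) //.
  have -> : Int D a r = Int (fun r => p (X r s) r * u (X r s) r + fz u r) a r -
      Int (fun r => p (X r s) r * w (X r s) r + fz w r) a r - Int (fun r => p (X r s) r * v (X r s) r) a r.
    rewrite -!IntB //; last exact: ctsB.
    by congr (Int _ a r); apply/funext => q; rewrite /D /rem; ring.
  rewrite -/a -/(fz u) -/(fz w) (_ : bdv g s = bdv u s - bdv w s - bdv v s) //; by ring.
have H2 r : a <= r <= t -> `|D r| <= 2 * C * `|g (X r s) r| + m.
  move=> /andP[ar_ rt]; have rT := le_trans rt tT.
  have XrL := le_trans (X_le sf s rt) XL.
  rewrite /D; set uu := u (X r s) r; set ww := w (X r s) r; set vv := v (X r s) r.
  rewrite /fz -/uu -/ww; set gg := g _ _.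
  have gE : uu = (ww + vv) + gg by rewrite /gg /rem -/uu -/ww -/vv; ring.
  have L1 := st_fL S (X r s) r uu (ww + vv); have L2 := st_fL S (X r s) r (ww + vv) ww.
  have B1 := st_fC S (X r s) r (ww + vv); have B2 := st_fC S (X r s) r ww.
  have vE : vv = bdv v s * E r s by exact: (v_formula S so).
  (* Where the boundary value of [v] exceeds 1 the bound on [f] is used, elsewhere its Lipschitz
     constant together with [v_formula]. *)
  have LV : `|f (X r s) r (ww + vv) - f (X r s) r ww| <= m.
    rewrite /m; case: (leP 1 `|bdv v s|) => b1.
      rewrite mulr1; apply: le_trans (ler_normB _ _) _; apply: le_trans (lerD B1 B2) _.
      have : C <= C ^+ 2 by rewrite expr2 ler_peMl // ltW.
      by flra.
    apply: le_trans L2 _; rewrite addrC addKr vE normrM (gtr0_norm (E_gt0 _ _)).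
    have rI : 0 <= r <= T by rewrite rT (le_trans a0 ar_).
    have sI : - A <= s <= T by rewrite As (le_trans sa) // (le_trans ar_).
    have EC := st_EC S rI sI.
    apply: le_trans (_ : C * (`|bdv v s| * C) <= _).
      by rewrite ler_pM2l //; exact: ler_wpM2l.
    rewrite (_ : 2 * C ^+ 2 * `|bdv v s| = C * (`|bdv v s| * C) + C * (`|bdv v s| * C)); last by ring.
    by rewrite lerDl !mulr_ge0 // ltW.
  have L1' : `|f (X r s) r uu - f (X r s) r (ww + vv)| <= C * `|gg|.
    by apply: le_trans L1 _; rewrite gE addrC addKr.
  have Lp : `|p (X r s) r * gg| <= C * `|gg| by rewrite normrM ler_wpM2r // (st_pC S).
  apply: le_trans (ler_normD _ _) _.
  have := ler_distD (f (X r s) r (ww + vv)) (f (X r s) r uu) (f (X r s) r ww).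
  by move: LV L1' Lp; flra.
have := char_stab st (cal _ rem_cts2) cD C2 m0 H1 H2; move=> /(_ t); rewrite lexx st => /(_ isT) /le_trans; apply.
apply: le_trans (_ : (`|bdv g s| + m * (t - a)) * CW <= _).
  apply: ler_wpM2l; last exact: (CW_le S).
  by rewrite addr_ge0 // mulr_ge0 // subr_ge0.
rewrite /DD /load (_ : 2 * C ^+ 3 * CW * _ = (2 * C ^+ 3 * `|bdv g s| + 2 * C ^+ 3 * Num.min 1 `|bdv v s|) * CW); last by ring.
apply: ler_wpM2r; first exact: ltW.
apply: lerD.
  by rewrite ler_peMl // mulr_ege1 // ?ler1n // exprn_ege1.
rewrite (_ : 2 * C ^+ 3 * _ = m * C); last by rewrite /m; ring.
apply: ler_wpM2l => //; apply: le_trans (st_TC S); by move: tT a0; flra.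
Qed.

(** [J] is replaced by [CW * Y] so that the kernel becomes the one appearing for [v]; [kappa_weight]
    and [Q_weight] then apply to the remainder as well. *)
Lemma rem_pairing (F : R -> R) t : continuous F -> (forall x, x <= 0 -> F x = 0) ->
  (forall x, L <= x -> F x = 0) -> 0 <= t <= T ->
  `|Int (fun x => F x * g x t) 0 L| <= DD * CW * Int (fun s => `|F (X t s) * Y t s| * beta s) (- A) T.
Proof.
move=> cF F0 FL tI; have /andP[t0 tT] := tI.
have CW1 := CW_ge1 S; have CW0 : 0 < CW := lt_le_trans ltr01 CW1.
have cg : continuous (g^~ t) := cts2_l rem_cts2.
rewrite (flow_pairing S cF cg F0 FL tI).
have cX : continuous (X t) by exact: (@cts2_r _ _ t (X_cts2 sf)).
have cFX : continuous (fun s => F (X t s)) := cts_app cF cX.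
have cY : continuous (Y t) := @cts2_r _ _ t (Y_cts2 S).
have cb : continuous (fun s => `|F (X t s) * Y t s| * beta s).
  by apply: ctsM; [apply: cts_norm; exact: ctsM|exact: load_cts].
rewrite -IntZ //; apply: Int_norm.
- by have := A0; have := T0; lra.
- apply: ctsM; last exact: (@cts2_r _ _ t (Jac_cts2 (st_cf S))).
  by apply: ctsM => //; exact: (cts_app cg cX).
- by apply: ctsM => //; exact: cts_cst.
move=> s sI; have DD0 := DD_gt0.
have [/F0 ->|X0] := leP (X t s) 0.
  by rewrite !mul0r normr0 !mul0r mulr0.
have [/FL ->|XL] := leP L (X t s).
  by rewrite !mul0r normr0 !mul0r mulr0.
have st : Num.max s 0 <= t.
  by rewrite ge_max t0 andbT ltW // -(X_ltE sf t) (X_diag sf).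
have As : - A <= s by case/andP: sI.
have gb := rem_bound st tT As (ltW XL).
have [E1 _] := E_bounds tI sI.
have JY : J t s <= CW * Y t s.
  rewrite /Y mulrCA ler_peMr ?(ltW (J_gt0 S _ _)) // mulrC -ler_pdivrMr //.
  by rewrite div1r.
rewrite -[in leLHS]mulrA (normrM (F _)) (normrM (F _) (Y _ _)) (gtr0_norm (Y_gt0 S _ _)).
rewrite (normrM (g _ _)) (gtr0_norm (J_gt0 S _ _)).
have -> : DD * CW * (`|F (X t s)| * Y t s * beta s) = `|F (X t s)| * ((DD * beta s) * (CW * Y t s)) by ring.
apply: ler_wpM2l => //; apply: ler_pM => //; exact: (ltW (J_gt0 S _ _)).
Qed.

End Sol.

(** The part of [load] on the initial line enters with full weight but contains only the truncated
    [v]. The part on the axis, which contains the remainder, enters with the small factor [th]. *)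
Definition ysum (u w v : R -> R -> R) (G th : R) : R :=
  Int (fun s => Num.min 1 `|bdv v s|) (- A) T +
  th * (Int (fun s => expR (- (G * s)) * `|bdv (rem u w v) s|) 0 T +
        Int (fun s => Num.min 1 `|bdv v s|) (- A) T).

Section Weighted.
Variables (G th : R) (W : weight G th).
Let G0 : 0 < G := wt_G W.
Let thp : 0 < th := wt_th W.
Let DD0 : 0 < DD := DD_gt0.
Let CW0 : 0 < CW := lt_le_trans ltr01 (CW_ge1 S).

Lemma min1_cts v : cts2 v -> continuous (fun s => Num.min 1 `|bdv v s|).
Proof. by move=> cv; apply: cts_min; [exact: cts_cst|apply: cts_norm; exact: bdv_cts]. Qed.

Lemma min1_ge0 v s : 0 <= Num.min 1 `|bdv v s|.
Proof. by rewrite le_min ler01 normr_ge0. Qed.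

Lemma rem_mass_ge0 e u w v : usol e u -> wvsol e w v ->
  0 <= Int (fun s => expR (- (G * s)) * `|bdv (rem u w v) s|) 0 T.
Proof.
move=> uso so; apply: Int_ge0; [exact: ltW| |by move=> s _; rewrite mulr_ge0 // expR_ge0].
apply: ctsM; first exact: (@expN_cts G id (@cts_id _)).
by apply: cts_norm; apply: bdv_cts; exact: rem_cts2 uso so.
Qed.

Lemma eta_ge0 e w v : wvsol e w v -> 0 <= Int (fun s => Num.min 1 `|bdv v s|) (- A) T.
Proof.
move=> so; apply: Int_ge0; [by have := A0; have := T0; lra|exact: min1_cts (so_v so)|].
by move=> s _; exact: min1_ge0.
Qed.

Lemma ysum_ge0 e u w v : usol e u -> wvsol e w v -> 0 <= ysum u w v G th.
Proof.
move=> uso so; rewrite addr_ge0 ?(eta_ge0 so) // mulr_ge0 ?(ltW thp) //.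
by rewrite addr_ge0 ?(eta_ge0 so) ?(rem_mass_ge0 uso so).
Qed.

Lemma load_parts e u w v : usol e u -> wvsol e w v ->
  Int (load u w v) (- A) 0 <= Int (fun s => Num.min 1 `|bdv v s|) (- A) T /\
  Int (fun s => expR (- (G * s)) * load u w v s) 0 T <=
    Int (fun s => expR (- (G * s)) * `|bdv (rem u w v) s|) 0 T + Int (fun s => Num.min 1 `|bdv v s|) (- A) T.
Proof.
move=> uso so; have NA : - A <= 0 by rewrite oppr_le0 ltW.
have cm := min1_cts (so_v so).
have cE : continuous (fun s : R => expR (- (G * s))) by exact: (@expN_cts G id (@cts_id _)).
have cg : continuous (fun s => `|bdv (rem u w v) s|).
  by apply: cts_norm; apply: bdv_cts; exact: rem_cts2 uso so.
have cl := load_cts uso so.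
have m1 : 0 <= Int (fun s => Num.min 1 `|bdv v s|) (- A) 0.
  by apply: Int_ge0 => // s _; exact: min1_ge0.
have m2 : 0 <= Int (fun s => Num.min 1 `|bdv v s|) 0 T.
  by apply: Int_ge0 => //; exact: ltW.
rewrite -(Int_chasles (fun s => Num.min 1 _) (- A) 0 T); split.
  rewrite -[leLHS]addr0; apply: lerD => //; apply: Int_le => // s sI.
  by rewrite /load (rem_neg uso so) // normr0 add0r.
apply: le_trans (_ : Int (fun s => expR (- (G * s)) * `|bdv (rem u w v) s|) 0 T + Int (fun s => Num.min 1 `|bdv v s|) 0 T <= _); last first.
  by rewrite lerD2l lerDr.
rewrite -IntD //; last exact: ctsM.
apply: Int_le; [exact: ltW|exact: ctsM|by apply: ctsD => //; exact: ctsM|].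
move=> s /andP[s0 sT]; rewrite mulrDr lerD2l ler_piMl ?min1_ge0 //.
by rewrite -expR0 ler_expR oppr_le0 mulr_ge0 // ltW.
Qed.

Lemma br_part e u w v t : usol e u -> wvsol e w v -> 0 <= t <= T ->
  `|Int (fun x => br x * rem u w v x t) 0 L| <= DD * CW * C ^+ 3 * expR (G * t) * ysum u w v G th.
Proof.
move=> uso so tI; have [L1 L2] := load_parts uso so.
apply: le_trans (rem_pairing uso so (st_br S) (st_br0 S) (st_brL S) tI) _.
rewrite -!(mulrA (DD * CW)); apply: ler_wpM2l; first by rewrite mulr_ge0 // ltW.
have := kappa_weight W tI (load_cts uso so) (load_ge0 u w v).
move/le_trans; apply; have := eta_ge0 so; have := rem_mass_ge0 uso so; rewrite /ysum.
set N := Int (fun s => expR (- (G * s)) * `|bdv (rem u w v) s|) 0 T in L2 *; set H := Int _ (- A) T in L1 L2 * => N0 H0.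
have Et : 1 <= expR (G * t).
  by apply: expR_ge1; apply: mulr_ge0 (ltW G0) _; case/andP: tI.
have C3 : 1 <= C ^+ 3 by exact: exprn_ege1.
have e0 : 0 <= expR (G * t) by exact: expR_ge0.
have N1 : 0 <= th * (N + H) by apply: mulr_ge0; [exact: ltW|exact: addr_ge0].
rewrite [leRHS]mulrDr; apply: lerD.
  apply: le_trans (_ : C ^+ 3 * H <= _); first by apply: ler_wpM2l => //; exact: exprn_ge0 (ltW C0).
  apply: ler_wpM2r => //; rewrite ler_peMr //; exact: exprn_ge0 (ltW C0).
apply: le_trans (_ : expR (G * t) * (th * (N + H)) <= _).
  by rewrite mulrA (mulrC (expR _)); apply: ler_wpM2l => //; rewrite mulr_ge0 // ltW.
rewrite ler_wpM2r // ler_peMl //.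
Qed.

(* Away from the singular times the remainder is controlled by its total mass: the singular kernel bs
   only sees earlier non-singular times. *)
Lemma rem_regular_times (M1 : R) : 2 * DD * CW * C ^+ 4 <= M1 -> 2 * C ^+ 3 * DD * th <= 1 ->
  forall (n : nat) q0, q0 < n%:R * d0 -> ~ Sing q0 -> exists2 d : R, 0 < d &
  forall e u w v s, usol e u -> wvsol e w v -> (forall t, 0 <= t <= T -> cs e t * Qf e v t = 0) -> e < d ->
  - A <= s <= T -> `|s - q0| < d ->
  `|bdv (rem u w v) s| <= M1 * expR (G * s) * ysum u w v G th.
Proof.
move=> HM1 Hth; have M10 : 0 <= M1.
  by apply: le_trans HM1; rewrite !mulr_ge0 ?exprn_ge0 // ltW.
have triv e u w v s : usol e u -> wvsol e w v -> - A <= s -> s <= 0 ->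
    `|bdv (rem u w v) s| <= M1 * expR (G * s) * ysum u w v G th.
  move=> uso so As s0; rewrite (rem_neg uso so) ?As // normr0 !mulr_ge0 ?expR_ge0 //.
  exact: ysum_ge0 uso so.
elim=> [|n IH] q0 qn nS.
  rewrite mul0r in qn; exists (- q0); first by rewrite oppr_gt0.
  move=> e u w v s uso so _ _ /andP[As _]; rewrite ltr_norml => /andP[_ sq].
  by apply: (triv e) => //; lra.
have d0p := st_d0 S; have xm0 := st_xm S; have l00 := sf_l0 sf; have l1p := st_l1 S.
case: (ltP q0 0) => [q00|q00].
  exists (- q0); first by rewrite oppr_gt0.
  move=> e u w v s uso so _ _ /andP[As _]; rewrite ltr_norml => /andP[_ sq].
  by apply: (triv e) => //; lra.
(* The foot of [(y, q0)] is nonsingular, for otherwise [q0] would be one of its reflections, and it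
   lies one delay earlier or on the initial side. So the induction hypothesis and [bdv_vanish] apply
   near it, with one [d] for the finite list [xb]. *)
have step : exists2 d : R, 0 < d & forall e u w v s y, usol e u -> wvsol e w v -> (forall t, 0 <= t <= T -> cs e t * Qf e v t = 0) -> e < d ->
    y \in xb -> - A <= s <= T -> `|s - foot y q0| < d ->
    `|bdv (rem u w v) s| <= M1 * expR (G * s) * ysum u w v G th /\ bdv v s = 0.
  have : forall l : seq R, {subset l <= xb} -> exists2 d : R, 0 < d & forall e u w v s y, usol e u -> wvsol e w v -> (forall t, 0 <= t <= T -> cs e t * Qf e v t = 0) -> e < d ->
    y \in l -> - A <= s <= T -> `|s - foot y q0| < d ->
    `|bdv (rem u w v) s| <= M1 * expR (G * s) * ysum u w v G th /\ bdv v s = 0.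
    elim=> [_|y l IHl sub]; first by exists 1.
    have [|d1 d1p H1] := IHl; first by move=> z zl; apply: sub; rewrite inE zl orbT.
    have yb : y \in xb by apply: sub; rewrite inE eqxx.
    have /andP[y1 y2] := st_xb S yb.
    have /andP[y0 _] := gap_in S (st_xb S yb).
    have nSr : ~ Sing (foot y q0).
      move=> [m Hm]; apply: nS; exists m.+1; have := sing_tau yb Hm.
      by have := tau_X sf q0 (foot y q0); rewrite (X_foot sf) => ->; apply.
    have rn : foot y q0 < n%:R * d0.
      case: (ltP (foot y q0) 0) => [r0|r0]; first by apply: lt_le_trans r0 _; rewrite mulr_ge0 // ltW.
      have := foot_travel sf y0 q00 r0; have : d0 <= y / l1 by rewrite ler_pM2r ?invr_gt0 //; move: xm0 y1; flra.
      by move: qn; rewrite -natr1 mulrDl mul1r; flra.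
    have [d2 d2p H2] := IH _ rn nSr.
    have [d3 d3p H3] := bdv_vanish nSr.
    exists (Num.min d1 (Num.min d2 d3)); first by rewrite !lt_min d1p d2p.
    move=> e u w v s z uso so cQ; rewrite !lt_min => /and3P[f1 f2 f3] + sI /and3P[s1 s2 s3].
    rewrite inE => /orP[/eqP zy|zl]; last exact: (H1 e u w v s z).
    rewrite zy in s1 s2 s3; split; first exact: (H2 e u w v s uso so cQ).
    exact: (H3 e w v s so).
  by move=> /(_ xb (fun z => id)).
have [d1 d1p H1] := step.
have [N HN] := sing_exhaust.
have [gap gap0 Hgap] := seq_gap [seq q - q0 | q <- tc].
pose Cf := expR (K * T) / l0 * (1 + l1).
have Cf0 : 0 < Cf by rewrite mulr_gt0 // ?addr_gt0 // divr_gt0 ?expR_gt0.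
case: (ltP T q0) => [Tq|qT].
  exists (q0 - T); first by rewrite subr_gt0.
  move=> e u w v s uso so _ _ /andP[_ sT]; rewrite ltr_norml => /andP[sq _]; move: sT sq; flra.
have q0I : 0 <= q0 <= T by rewrite q00.
exists (Num.min (Num.min d1 (d1 / Cf)) (Num.min (gap / 2) 1)).
  by rewrite !lt_min d1p ltr01 !divr_gt0.
move=> e u w v s uso so cQ; rewrite !lt_min => /andP[/andP[f1 f2] /andP[f3 _]] sI /andP[/andP[s1 s2] /andP[s3 _]].
have /andP[As sT] := sI.
case: (leP s 0) => [s0|s0]; first exact: (triv e).
have sI' : 0 <= s <= T by rewrite ltW.
have e0 : 0 < e by case/andP: (so_e so).
(* A nonsingular [q0] has positive distance from [tc], so the delta in time is absent near it. *)
have cz : cs e s = 0.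
  apply: (reg_eq0 (st_phi S) e0) => y yt; rewrite ltNge; apply/negP => sy.
  have ny : y - q0 != 0 by rewrite subr_eq0; apply: contra_notN nS => /eqP <-; exists 0%N; exact: sing_tc.
  have := Hgap _ (map_f (fun q => q - q0) yt) ny; rewrite leNgt => /negP; apply.
  have -> : y - q0 = (s - q0) - (s - y) by ring.
  by apply: le_lt_trans (ler_normB _ _) _; move: s3 f3 sy; flra.
rewrite (rem_pos uso so) ?s0 ?cQ // cz add0r normrM.
have Y0 := ysum_ge0 uso so; set Z := ysum u w v G th in Y0 *.
have EZ : 0 <= expR (G * s) * Z by rewrite mulr_ge0 ?expR_ge0.
have B1 := br_part uso so sI'; rewrite -/Z in B1.
have B2 : `|Int (fun x => bs e x * rem u w v x s) 0 L| <= C * C * (DD * (M1 * (th * expR (G * s)) * Z)).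
  have cgs : continuous ((rem u w v)^~ s) := cts2_l (rem_cts2 uso so).
  have cbg : continuous (fun x => bs e x * rem u w v x s) by apply: ctsM => //; exact: (reg_cts (st_phi S)).
  apply: le_trans (Int_norm (ltW L0) cbg (cts_norm cbg) (fun x _ => lexx _)) _.
  apply: (reg_abs) => //; [exact: (sz_xb)|exact: ltW| |].
    by rewrite !mulr_ge0 ?expR_ge0 // ltW.
  move=> x y yb xI xy; have [Af fs fs0] := foot_in S xI sI'.
  have Xf := X_foot sf x s; have /andP[x0 xL] := xI.
  have fI : - A <= foot x s <= T by rewrite Af (le_trans fs).
  have := rem_bound uso so fs0 sT Af; rewrite Xf => /(_ xL) /le_trans; apply.
  apply: ler_wpM2l; first exact: ltW.
  have /andP[y1 y2] := st_xb S yb.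
  have y0 : 0 <= y by move: y1 xm0; flra.
  have fd : `|foot x s - foot y q0| < d1.
    apply: le_lt_trans (foot_lip sf sI' q0I x0 y0) _.
    have -> : d1 = expR (K * T) / l0 * (d1 / Cf + l1 * (d1 / Cf)).
      rewrite /Cf; field; rewrite !gt_eqF ?expR_gt0 // addr_gt0 //.
    rewrite ltr_pM2l ?divr_gt0 ?expR_gt0 //; apply: ltrD; first exact: le_lt_trans f2.
    by rewrite ltr_pM2l.
  have [R1 R2] := H1 e u w v _ y uso so cQ f1 yb fI fd.
  rewrite /load R2 normr0 (min_r ler01) addr0.
  case: (leP (foot x s) 0) => [f0|f0].
    by rewrite (rem_neg uso so) ?Af // normr0 !mulr_ge0 ?expR_ge0 // ltW.
  apply: le_trans R1 _; apply: ler_wpM2r => //; apply: ler_wpM2l => //.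
  have dl := delay S (so_e so) yb xy (ltW s0) (ltW f0).
  rewrite -ler_pdivrMr ?expR_gt0 // -expRN -expRD; apply: le_trans (wt_delay W).
  by rewrite ler_expR -mulrBr -mulrN ler_pM2l //; move: dl; flra.
have B3 : `|Int (fun x => bs e x * rem u w v x s) 0 L + Int (fun x => br x * rem u w v x s) 0 L| <=
   C * C * (DD * (M1 * (th * expR (G * s)) * Z)) + DD * CW * C ^+ 3 * expR (G * s) * Z.
  exact: le_trans (ler_normD _ _) (lerD B2 B1).
apply: le_trans (ler_pM (normr_ge0 _) (normr_ge0 _) (st_crC S s) B3) _.
have P1 := ler_wpM2r EZ HM1.
have P2 : 2 * C ^+ 3 * DD * th * (M1 * (expR (G * s) * Z)) <= M1 * (expR (G * s) * Z).
  by rewrite ler_piMl // mulr_ge0.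
rewrite -[leRHS]mulrA.
(* The two halves use the two conditions on the constants: [th] small makes the reflected part at
   most half of the bound, and [M1] large does the same for the part from [br]. *)
have -> : C * (C * C * (DD * (M1 * (th * expR (G * s)) * Z)) + DD * CW * C ^+ 3 * expR (G * s) * Z) =
  2^-1 * (2 * C ^+ 3 * DD * th * (M1 * (expR (G * s) * Z))) + 2^-1 * (2 * DD * CW * C ^+ 4 * (expR (G * s) * Z)) by field.
by move: P1 P2; flra.
Qed.

End Weighted.

Lemma seq_unif (U : eqType) (l : seq U) (P : U -> R -> Prop) :
  (forall x d d', d <= d' -> P x d' -> P x d) ->
  (forall x, x \in l -> exists2 d : R, 0 < d & P x d) ->
  exists2 d : R, 0 < d & forall x, x \in l -> P x d.
Proof.
move=> mono; elim: l => [_|x l IH H]; first by exists 1.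
have [|d1 d1p H1] := IH; first by move=> y yl; apply: H; rewrite inE yl orbT.
have [d2 d2p H2] := H x (mem_head _ _).
exists (Num.min d1 d2); first by rewrite lt_min d1p.
move=> y; rewrite inE => /orP[/eqP ->|yl]; [apply: mono H2|apply: mono (H1 y yl)].
  by rewrite ge_min lexx orbT.
by rewrite ge_min lexx.
Qed.

(** With [Nm] the weighted mass of the remainder and [H] that of the truncated [v], one gets
    [Nm <= M2 * (H + th * (Nm + H))]. Since [M2 * th <= 1 / 2], the mass [Nm] is absorbed and
    [(2 * M2 + 1) * H] remains. *)
Lemma rem_mass : (forall y t, y \in xb -> t \in tc -> ~ Sing (foot y t)) ->
  exists M G : R, 0 <= M /\ exists2 d : R, 0 < d & forall e u w v, usol e u -> wvsol e w v -> e < d ->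
  Int (fun s => expR (- (G * s)) * `|bdv (rem u w v) s|) 0 T <= M * Int (fun s => Num.min 1 `|bdv v s|) (- A) T.
Proof.
move=> nS; have DD0 := DD_gt0; have CW0 : 0 < CW := lt_le_trans ltr01 (CW_ge1 S).
have C3 : 0 < C ^+ 3 by exact: exprn_gt0. have C4 : 0 < C ^+ 4 by exact: exprn_gt0.
have C5 : 0 < C ^+ 5 by exact: exprn_gt0.
have DC : 0 < DD * CW by exact: mulr_gt0.
pose M1 := 2 * DD * CW * C ^+ 4; have M10 : 0 < M1 by rewrite !mulr_gt0.
pose b := DD * CW * C ^+ 3; have b0 : 0 < b by exact: mulr_gt0.
pose a := C ^+ 2 * DD * M1; have a0 : 0 < a by rewrite !mulr_gt0 // exprn_gt0.
pose M2 := C * C * (a + b) + C * (DD * CW * C ^+ 5 + b * T).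
have M20 : 0 < M2.
  by apply: addr_gt0; apply: mulr_gt0 => //; [exact: mulr_gt0|exact: addr_gt0|apply: addr_gt0; exact: mulr_gt0].
have C3D : 0 < 2 * C ^+ 3 * DD by rewrite !mulr_gt0.
have MM : 0 < 2 * M2 + 2 * C ^+ 3 * DD by rewrite addr_gt0 // mulr_gt0.
(* The two summands serve the absorption of [Nm] and the condition of [rem_regular_times]. No
   circularity arises, since [M2] does not depend on the weight. *)
pose th := (2 * M2 + 2 * C ^+ 3 * DD)^-1; have thp : 0 < th by rewrite invr_gt0.
have th1 : 2 * C ^+ 3 * DD * th <= 1.
  by rewrite /th ler_pdivrMr // mul1r lerDr mulr_ge0 // ltW.
have th2 : M2 * th <= 2^-1.
  by rewrite /th ler_pdivrMr // mulrDr mulrA mulVf // mul1r lerDl mulr_ge0 // ltW.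
have [G W] := weight_exists thp; have G0 := wt_G W.
exists (2 * M2 + 1), G; split; first by rewrite addr_ge0 // mulr_ge0 // ltW.
have [N HN] := delays_exhaust; have d0p := st_d0 S.
have [d1 d1p H1] := cs_Q_vanish nS.
pose P (z : R * R) (d : R) := forall e u w v s, usol e u -> wvsol e w v ->
  (forall t, 0 <= t <= T -> cs e t * Qf e v t = 0) -> e < d -> - A <= s <= T -> `|s - foot z.1 z.2| < d ->
  `|bdv (rem u w v) s| <= M1 * expR (G * s) * ysum u w v G th /\ bdv v s = 0.
have tcI y : y \in tc -> 0 <= y <= T by move=> /(st_tc S)/(gap_in S).
have xb0 y : y \in xb -> 0 <= y by move=> /(st_xb S)/(gap_in S)/andP[].
have [d2 d2p H2] : exists2 d : R, 0 < d & forall z, z \in [seq (y, t) | y <- xb, t <- tc] -> P z d.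
  apply: seq_unif => [z d d' dd' H e u w v s uso so cQ ed sI sz|z /allpairsP[[y t] /= [yb tt ->]]].
    by apply: (H e) => //; exact: lt_le_trans dd'.
  have nSz := nS y t yb tt.
  have fN : foot y t < N.+1%:R * d0.
    have /andP[t0 tT] := tcI t tt; apply: le_lt_trans (foot_le sf (xb0 y yb) t0) _.
    apply: le_lt_trans tT _; apply: le_lt_trans HN _; rewrite ltr_pM2r // ltr_nat //.
  have [d3 d3p H3] := rem_regular_times W (lexx M1) th1 fN nSz.
  have [d4 d4p H4] := bdv_vanish nSz.
  exists (Num.min d3 d4); first by rewrite lt_min d3p.
  move=> e u w v s uso so cQ; rewrite !lt_min => /andP[f1 f2] sI /andP[s1 s2].
  by split; [exact: (H3 e u w v s uso so cQ)|exact: (H4 e w v s so)].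
have l1p := st_l1 S; have l00 := sf_l0 sf.
pose Cf := expR (K * T) / l0 * (1 + l1).
have Cf0 : 0 < Cf by rewrite mulr_gt0 // ?addr_gt0 // divr_gt0 ?expR_gt0.
exists (Num.min d1 (Num.min d2 (d2 / Cf))); first by rewrite !lt_min d1p d2p divr_gt0.
move=> e u w v uso so; rewrite !lt_min => /and3P[f1 f2 f3].
have e0 : 0 < e by case/andP: (so_e so).
have cQ t : 0 <= t <= T -> cs e t * Qf e v t = 0 by exact: (H1 e w v t so f1).
set H := Int _ (- A) T; set Nm := Int _ 0 T.
have Y0 := ysum_ge0 W uso so; set Z := ysum u w v G th in Y0.
have ZE : Z = H + th * (Nm + H) by [].
have H0 : 0 <= H by exact: eta_ge0 so.
have N0 : 0 <= Nm by exact: rem_mass_ge0 uso so.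
pose Gb t := Int (fun x => bs e x * rem u w v x t) 0 L.
pose Br t := Int (fun x => br x * rem u w v x t) 0 L.
have cg2 := cts2_flip (rem_cts2 uso so).
have cGb : continuous Gb.
  apply: (@Int_param_cts _ (fun t x => bs e x * rem u w v x t) 0 L); apply: ctsM => //.
  exact: (cts_app (reg_cts (st_phi S) (s := xb) (e := e)) (@cts_snd R)).
have cBr : continuous Br.
  apply: (@Int_param_cts _ (fun t x => br x * rem u w v x t) 0 L); apply: ctsM => //.
  exact: (cts_app (st_br S) (@cts_snd R)).
have cE : continuous (fun s : R => expR (- (G * s))) by exact: (@expN_cts G id (@cts_id _)).
have EE s : expR (- (G * s)) * expR (G * s) = 1 by rewrite -expRD addNr expR0.
have Brb t : 0 <= t <= T -> expR (- (G * t)) * `|Br t| <= b * Z.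
  move=> tI; have B1 := br_part W uso so tI.
  apply: le_trans (ler_wpM2l (expR_ge0 _) B1) _.
  rewrite -/Z -/b [leLHS]mulrA (mulrCA _ b) EE mulr1.
  exact: lexx.
(* Here two kernels of size [1 / eps] meet. For [t] near a point of [tc], the kernel [bs] sees only
   parameters near the feet treated in [H2], where the load has no contribution from [v] and is
   bounded pointwise. *)
have Gbb t y : y \in tc -> 0 <= t <= T -> `|t - y| <= e -> expR (- (G * t)) * `|Gb t| <= a * Z.
  move=> yt tI ty; have /andP[t0 tT] := tI.
  have cgs : continuous ((rem u w v)^~ t) := cts2_l (rem_cts2 uso so).
  have cbg : continuous (fun x => bs e x * rem u w v x t) by apply: ctsM => //; exact: (reg_cts (st_phi S)).
  have B2 : `|Gb t| <= C * C * (DD * (M1 * expR (G * t) * Z)).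
    apply: le_trans (Int_norm (ltW L0) cbg (cts_norm cbg) (fun x _ => lexx _)) _.
    apply: (reg_abs) => //; [exact: (sz_xb)|exact: ltW| |].
      apply: mulr_ge0; first exact: ltW.
      by apply: mulr_ge0 Y0; apply: mulr_ge0 (expR_ge0 _); exact: ltW.
    move=> x y' yb xI xy; have [Af fs fs0] := foot_in S xI tI.
    have Xf := X_foot sf x t; have /andP[x0 xL] := xI.
    have fI : - A <= foot x t <= T by rewrite Af (le_trans fs).
    have := rem_bound uso so fs0 tT Af; rewrite Xf => /(_ xL) /le_trans; apply.
    apply: ler_wpM2l; first exact: ltW.
    have fd : `|foot x t - foot y' y| < d2.
      apply: le_lt_trans (foot_lip sf tI (tcI y yt) x0 (xb0 y' yb)) _.
      have -> : d2 = expR (K * T) / l0 * (d2 / Cf + l1 * (d2 / Cf)).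
        by rewrite /Cf; field; rewrite !gt_eqF ?expR_gt0 // addr_gt0.
      rewrite ltr_pM2l ?divr_gt0 ?expR_gt0 //; apply: ltrD; first exact: le_lt_trans f3.
      by rewrite ltr_pM2l //; exact: le_lt_trans f3.
    have zin : (y', y) \in [seq (y, t) | y <- xb, t <- tc] by exact: (allpairs_f (fun y t => (y, t))).
    have [R1 R2] := H2 (y', y) zin e u w v _ uso so cQ f2 fI fd.
    rewrite /load R2 normr0 (min_r ler01) addr0; apply: le_trans R1 _; apply: ler_wpM2r => //.
    by apply: ler_wpM2l; [exact: ltW|rewrite ler_expR ler_pM2l].
  apply: le_trans (ler_wpM2l (expR_ge0 _) B2) _.
  have -> : C * C * (DD * (M1 * expR (G * t) * Z)) = expR (G * t) * (a * Z) by rewrite /a; ring.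
  by rewrite [leLHS]mulrA EE mul1r.
have GbI : Int (fun t => expR (- (G * t)) * `|Gb t|) 0 T <= DD * CW * C ^+ 5 * Z.
  have [L1 L2] := load_parts W uso so.
  have cl := load_cts uso so.
  have Q := Q_weight W (so_e so) cl (load_ge0 u w v).
  have cq : continuous (fun s => Int (fun r => `|bs e (X s r) * Y s r| * load u w v r) (- A) T).
    apply: (@Int_param_cts _ (fun s r => `|bs e (X s r) * Y s r| * load u w v r) (- A) T).
    apply: ctsM; last exact: (cts_app cl (@cts_snd R)).
    apply: cts_norm; apply: ctsM; last exact: (Y_cts2 S).
    exact: (cts_app (reg_cts (st_phi S) (s := xb) (e := e)) (X_cts2 sf)).
  apply: le_trans (_ : DD * CW * Int (fun s => expR (- (G * s)) *
     Int (fun r => `|bs e (X s r) * Y s r| * load u w v r) (- A) T) 0 T <= _).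
    rewrite -IntZ; last exact: ctsM.
    apply: Int_le; [exact: ltW|by apply: ctsM => //; exact: cts_norm|by apply: ctsM; [exact: cts_cst|exact: ctsM]|].
    move=> s sI; rewrite mulrCA; apply: ler_wpM2l; first exact: expR_ge0.
    have xm0 := st_xm S.
    apply: (rem_pairing uso so (reg_cts (st_phi S) (s := xb) (e := e))) => //.
      by move=> x x0; apply: (bs_supp S (so_e so)); rewrite (le_trans x0 (ltW xm0)).
    by move=> x x0; apply: (bs_supp S (so_e so)); apply/orP; right; move: x0 xm0; flra.
  rewrite -(mulrA (DD * CW) (C ^+ 5)); apply: ler_wpM2l; first exact: ltW.
  apply: le_trans Q _; apply: ler_wpM2l; first exact: ltW.
  rewrite ZE; apply: lerD => //; by apply: ler_wpM2l; [exact: ltW|].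
have c1 : continuous (fun t => expR (- (G * t)) * `|Gb t|) by apply: ctsM => //; exact: cts_norm.
have c2 : continuous (fun t => expR (- (G * t)) * `|Br t|) by apply: ctsM => //; exact: cts_norm.
have c3 : continuous (fun t => expR (- (G * t)) * `|Gb t| + expR (- (G * t)) * `|Br t|) by exact: ctsD.
have ccs := reg_cts (st_phi S) (s := tc) (e := e).
have c4 : continuous (fun t => `|cs e t * (expR (- (G * t)) * `|Gb t| + expR (- (G * t)) * `|Br t|)|).
  by apply: cts_norm; exact: ctsM.
have c5 : continuous (fun t => C * (expR (- (G * t)) * `|Gb t| + expR (- (G * t)) * `|Br t|)).
  by apply: ctsM => //; exact: cts_cst.
have p1 t : 0 <= expR (- (G * t)) * `|Gb t| + expR (- (G * t)) * `|Br t|.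
  by apply: addr_ge0; apply: mulr_ge0 (expR_ge0 _) (normr_ge0 _).
have S1 : Nm <= Int (fun t => `|cs e t * (expR (- (G * t)) * `|Gb t| + expR (- (G * t)) * `|Br t|)| +
     C * (expR (- (G * t)) * `|Gb t| + expR (- (G * t)) * `|Br t|)) 0 T.
  apply: Int_le; [exact: ltW| |exact: ctsD|].
    by apply: ctsM => //; apply: cts_norm; apply: bdv_cts; exact: rem_cts2 uso so.
  move=> s sI; have /andP[s0' sT] := sI; case: (leP s 0) => [s0|s0].
    rewrite (rem_neg uso so) ?s0 ?andbT; last by apply: le_trans s0'; rewrite oppr_le0 ltW.
    by rewrite normr0 mulr0; apply: addr_ge0 => //; apply: mulr_ge0 (p1 s); exact: ltW.
  rewrite (rem_pos uso so) ?s0 ?cQ // -/(Gb s) -/(Br s) normrM mulrCA.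
  rewrite (normrM (cs e s)) (ger0_norm (p1 s)) -mulrDl -mulrDr mulrA.
  apply: le_trans (_ : (`|cs e s| + C) * (expR (- (G * s)) * `|Gb s + Br s|) <= _).
    rewrite -mulrA; apply: ler_wpM2r; first exact: mulr_ge0 (expR_ge0 _) (normr_ge0 _).
    by apply: le_trans (ler_normD _ _) _; rewrite lerD2l; exact: (st_crC S).
  apply: ler_wpM2l; first by apply: addr_ge0 => //; exact: ltW.
  by apply: ler_wpM2l; [exact: expR_ge0|exact: ler_normD].
have S2 : Int (fun t => `|cs e t * (expR (- (G * t)) * `|Gb t| + expR (- (G * t)) * `|Br t|)|) 0 T <= C * C * ((a + b) * Z).
  apply: (reg_abs) => //; [exact: (sz_tc)|exact: ltW| |].
    by apply: mulr_ge0 Y0; apply: addr_ge0; exact: ltW.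
  move=> t y yt tI ty; rewrite ger0_norm // mulrDl; apply: lerD; [exact: (Gbb t y)|exact: Brb].
have S3 : Int (fun t => expR (- (G * t)) * `|Br t|) 0 T <= b * Z * T.
  apply: le_trans (_ : Int (fun=> b * Z) 0 T <= _); last by rewrite Int_cst subr0.
  by apply: Int_le; [exact: ltW|exact: c2|exact: cts_cst|exact: Brb].
rewrite IntD // IntZ // IntD // in S1.
have S4 : Nm <= M2 * Z.
  have -> : M2 * Z = C * C * ((a + b) * Z) + C * (DD * CW * C ^+ 5 * Z + b * Z * T) by rewrite /M2; ring.
  apply: le_trans S1 _; apply: lerD => //; apply: ler_wpM2l; first exact: ltW.
  exact: lerD.
have S5 := ler_wpM2r (addr_ge0 N0 H0) th2.
rewrite ZE in S4.
move: S4 S5 N0 H0; rewrite mulrDr (mulrA M2 th).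
by flra.
Qed.

Lemma rem_small (eta : R) : (forall y t, y \in xb -> t \in tc -> ~ Sing (foot y t)) -> 0 < eta ->
  exists2 d : R, 0 < d & forall e u w v, usol e u -> wvsol e w v -> e < d ->
  forall (F : R -> R) (c t : R), continuous F -> (forall x, x <= 0 -> F x = 0) -> (forall x, L <= x -> F x = 0) ->
  0 <= c -> (forall x, `|F x| <= c) -> 0 <= t <= T ->
  `|Int (fun x => F x * rem u w v x t) 0 L| <= c * eta.
Proof.
move=> nS eta0; have [M [G [M0 [d1 d1p H1]]]] := rem_mass nS.
have DD0 := DD_gt0; have CW0 : 0 < CW := lt_le_trans ltr01 (CW_ge1 S).
(* Removing the weight costs [expR] of [|G| * T]; the absolute value appears because [rem_mass] does
   not record the sign of [G]. *)
pose Q := DD * CW * (C * C) * (1 + expR (`|G| * T) * (M + 1)).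
have Q0 : 0 < Q.
  apply: mulr_gt0; first by rewrite !mulr_gt0.
  by rewrite addr_gt0 // mulr_gt0 ?expR_gt0 // ltr_wpDl.
have [d2 d2p H2] := bdv_mass_small (divr_gt0 eta0 Q0).
exists (Num.min d1 d2); first by rewrite lt_min d1p.
move=> e u w v uso so; rewrite lt_min => /andP[f1 f2] F c t cF F0 FL c0 Fc tI.
have HN := H1 e u w v uso so f1; have HH := H2 e w v so f2.
apply: le_trans (rem_pairing uso so cF F0 FL tI) _.
set H := Int _ (- A) T in HN HH.
have cl := load_cts uso so.
have H0 : 0 <= H by exact: eta_ge0 so.
have cm := min1_cts (so_v so).
have cg : continuous (fun s => `|bdv (rem u w v) s|).
  by apply: cts_norm; apply: bdv_cts; exact: rem_cts2 uso so.
have cE : continuous (fun s : R => expR (- (G * s))) by exact: (@expN_cts G id (@cts_id _)).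
have AT : - A <= T by have := A0; have := T0; lra.
have I1 : Int (fun s => `|F (X t s) * Y t s| * load u w v s) (- A) T <= c * (C * C) * Int (load u w v) (- A) T.
  rewrite -IntZ //; apply: Int_le => //.
  - apply: ctsM => //; apply: cts_norm; apply: ctsM; last exact: (@cts2_r _ _ t (Y_cts2 S)).
    exact: (cts_app cF (@cts2_r _ _ t (X_cts2 sf))).
  - by apply: ctsM => //; exact: cts_cst.
  move=> s sI; apply: ler_wpM2r; first exact: load_ge0.
  rewrite normrM (gtr0_norm (Y_gt0 S _ _)); apply: ler_pM => //; [exact: (ltW (Y_gt0 S _ _))|exact: (Y_le S)].
have I2 : Int (load u w v) (- A) T <= (1 + expR (`|G| * T) * (M + 1)) * H.
  rewrite /load IntD // -/H mulrDl mul1r addrC lerD2l.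
  rewrite -(Int_chasles _ (- A) 0 T) (@Int_ext _ _ (fun=> 0) (- A) 0) //; first last.
  - by move=> s /andP[As s0]; rewrite (rem_neg uso so) ?normr0 // !ltW.
  - exact: cts_cst.
  - by rewrite oppr_le0 ltW.
  rewrite Int_cst mul0r add0r.
  apply: le_trans (_ : expR (`|G| * T) * Int (fun s => expR (- (G * s)) * `|bdv (rem u w v) s|) 0 T <= _).
    rewrite -IntZ; last exact: ctsM.
    apply: Int_le; [exact: ltW|exact: cg|by apply: ctsM; [exact: cts_cst|exact: ctsM]|].
    move=> s /andP[s0 sT]; rewrite mulrA ler_peMl // -expRD; apply: expR_ge1.
    rewrite subr_ge0; apply: le_trans (_ : `|G| * s <= _); first by apply: ler_wpM2r => //; exact: ler_norm.
    by apply: ler_wpM2l.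
  rewrite -mulrA; apply: ler_wpM2l; first exact: expR_ge0.
  by apply: le_trans HN _; rewrite mulrDl lerDl mul1r.
have -> : c * eta = DD * CW * (c * (C * C) * ((1 + expR (`|G| * T) * (M + 1)) * (eta / Q))).
  have -> : DD * CW * (c * (C * C) * ((1 + expR (`|G| * T) * (M + 1)) * (eta / Q))) = c * (Q * (eta / Q)) by rewrite /Q; ring.
  by congr (c * _); rewrite mulrC divfK // gt_eqF.
apply: ler_wpM2l; first by rewrite mulr_ge0 // ltW.
apply: le_trans I1 _; apply: ler_wpM2l; first by rewrite !mulr_ge0 // ltW.
apply: le_trans I2 _; apply: ler_wpM2l HH.
by rewrite addr_ge0 // mulr_ge0 ?expR_ge0 // addr_ge0.
Qed.

(** * Pairing with test functions *)

Lemma oo_cc (a b t : R) : a < t < b -> a <= t <= b.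
Proof. by case/andP => /ltW -> /ltW. Qed.

(** A test function pulled back to the entry parameters: by [v_pairing] and an exchange of
    integrals, the pairing of [v] with [psi] on the plane equals that of [bdv v] with this
    continuous kernel. *)
Definition kern (psi : R -> R -> R) (s : R) : R := Int (fun t => psi (X t s) t * Y t s) 0 T.

Section TestFunction.
Variable psi : R -> R -> R.
Hypotheses (cpsi : cts2 psi) (psi0 : forall x t, x <= 0 -> psi x t = 0)
  (psiL : forall x t, L <= x -> psi x t = 0).

Lemma kern_cts2 : cts2 (fun t s => psi (X t s) t * Y t s).
Proof.
apply: ctsM; last exact: (Y_cts2 S).
exact: (@cts_app _ _ _ (fun q : R * R => (X q.1 q.2, q.1)) _ cpsi (cts_pair (X_cts2 sf) (@cts_fst R))).
Qed.

Lemma kern_cts : continuous (kern psi).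
Proof. exact: (@Int_param_cts _ (fun s t => psi (X t s) t * Y t s) 0 T (cts2_flip kern_cts2)). Qed.

Lemma kern_late r : T <= r -> kern psi r = 0.
Proof.
move=> Tr; transitivity (Int (fun _ : R => 0 : R) 0 T); last by rewrite Int_cst mul0r.
apply: Int_ext; [exact: ltW|exact: (cts2_l kern_cts2)|exact: cts_cst|].
move=> t /oo_cc/andP[t0 tT]; rewrite psi0 ?mul0r //.
by have r0 : 0 <= r; [exact: le_trans (le_trans t0 tT) Tr|rewrite -(X_diag sf r0); apply: (X_le sf); exact: le_trans Tr].
Qed.

Lemma kern_abs (c s : R) : 0 <= c -> (forall x t, `|psi x t| <= c) -> - A <= s <= T ->
  `|kern psi s| <= T * (C * C) * c.
Proof.
move=> c0 Hc sI.
have H : `|Int (fun t => psi (X t s) t * Y t s) 0 T| <= c * (C * C) * (T - 0).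
  apply: Int_bound; [exact: ltW|exact: (cts2_l kern_cts2)|].
  move=> t tI; rewrite normrM; apply: ler_pM => //.
  by rewrite ger0_norm ?(Y_le S) // ltW // (Y_gt0 S).
by apply: le_trans H _; rewrite subr0 le_eqVlt; apply/orP; left; apply/eqP; ring.
Qed.

Lemma v_test e w v : wvsol e w v ->
  Int (fun t => Int (fun x => psi x t * v x t) 0 L) 0 T = Hk (kern psi) v.
Proof.
move=> so; have cb : continuous (bdv v) := bdv_cts (so_v so).
transitivity (Int (fun t => Int (fun s => psi (X t s) t * Y t s * bdv v s) (- A) T) 0 T).
  apply: Int_ext; first exact: ltW.
  - by apply: (@Int_param_cts _ (fun t x => psi x t * v x t)); apply: cts2_flip; apply: ctsM => //; exact: (so_v so).
  - apply: (@Int_param_cts _ (fun t s => psi (X t s) t * Y t s * bdv v s)); apply: ctsM; first exact: kern_cts2.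
    exact: (cts_app cb (@cts_snd R)).
  by move=> t /oo_cc tI; apply: (v_pairing S so) => //; [exact: (cts2_l cpsi)|move=> x; exact: psi0|move=> x; exact: psiL].
rewrite (@Int_swap _ (fun t s => psi (X t s) t * Y t s * bdv v s)); last first.
  by apply: ctsM; [exact: kern_cts2|exact: (cts_app cb (@cts_snd R))].
congr (Int _ (- A) T); apply/funext => s; rewrite /kern mulrC -IntZ.
  by congr (Int _ 0 T); apply/funext => t; rewrite mulrC.
exact: (cts2_l kern_cts2).
Qed.

(** Wherever [bdv v] is nonzero, the parameter is near some [q] of [sing N]. Its characteristic then
    stays within [g] of that of [q], hence off the set where [psi] is nonzero, and [kern psi]
    vanishes there. *)
Lemma v_test_vanish (g : R) N : (forall rho : R, 0 < rho -> exists2 d : R, 0 < d &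
    forall e w v s, wvsol e w v -> e < d -> - A <= s <= T -> bdv v s != 0 ->
    exists2 q, q \in sing N & `|s - q| < rho) ->
  0 < g -> (forall q x t, q \in sing N -> 0 <= t <= T -> psi x t != 0 -> g <= `|x - X t q|) ->
  exists2 d : R, 0 < d & forall e w v, wvsol e w v -> e < d ->
    Int (fun t => Int (fun x => psi x t * v x t) 0 L) 0 T = 0.
Proof.
move=> HN g0 Hg; have [r r0 Hr] := cts2_unif (A + T + 1) (X_cts2 sf) g0.
have m0 : 0 < Num.min r 1 by rewrite lt_min r0 ltr01.
have [d dp Hd] := HN _ m0; exists d => // e w v so ed.
have cb : continuous (bdv v) := bdv_cts (so_v so).
rewrite (v_test so); transitivity (Int (fun _ : R => 0 : R) (- A) T); last by rewrite Int_cst mul0r.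
apply: Int_ext; [by have := A0; have := T0; lra|by apply: ctsM => //; exact: kern_cts|exact: cts_cst|].
move=> s /oo_cc sI; have [->|bs0] := eqVneq (bdv v s) 0; first by rewrite mulr0.
have [q qN] := Hd e w v s so ed sI bs0; rewrite lt_min => /andP[sq sq1].
rewrite (_ : kern psi s = 0) ?mul0r //.
transitivity (Int (fun _ : R => 0 : R) 0 T); last by rewrite Int_cst mul0r.
apply: Int_ext; [exact: ltW|exact: (cts2_l kern_cts2)|exact: cts_cst|].
move=> t /oo_cc tI; have [->|pn] := eqVneq (psi (X t s) t) 0; first by rewrite mul0r.
have := Hg q _ t qN tI pn; have : `|X t s - X t q| < g.
  have AT := A0; have TT := T0; case/andP: sI tI => As sT /andP[t0 tT].
  have tM : `|t| <= A + T + 1 by rewrite ger0_norm //; move: AT TT tT; flra.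
  apply: Hr => //; rewrite ?subrr ?normr0 //.
    by rewrite ler_norml; apply/andP; split; move: AT TT sT As; flra.
  move: sq1; rewrite ltr_distl ler_norml => /andP[s1 s2].
  by apply/andP; split; move: AT TT sT As s1 s2; flra.
by move=> /lt_le_trans H /H; rewrite ltxx.
Qed.

Lemma v_test_cauchy (eta : R) : 0 < eta -> exists2 d : R, 0 < d &
  forall e e' w v w' v', wvsol e w v -> wvsol e' w' v' -> e < d -> e' < d ->
  `|Int (fun t => Int (fun x => psi x t * v x t) 0 L) 0 T -
    Int (fun t => Int (fun x => psi x t * v' x t) 0 L) 0 T| <= eta.
Proof.
move=> eta0; have [d dp Hd] := Hk_conv kern_cts kern_late eta0.
by exists d => // e e' w v w' v' so so' ed ed'; rewrite (v_test so) (v_test so'); exact: Hd so so' ed ed'.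
Qed.

End TestFunction.

(** The bounded mass of [bdv v] controls the pairing by the supremum of [psi] alone, uniformly in
    [e]; the limit is therefore a distribution of order 0. *)
Lemma v_test_bound : exists2 B : R, 0 <= B & forall psi c e w v, cts2 psi ->
  (forall x t, x <= 0 -> psi x t = 0) -> (forall x t, L <= x -> psi x t = 0) ->
  0 <= c -> (forall x t, `|psi x t| <= c) -> wvsol e w v ->
  `|Int (fun t => Int (fun x => psi x t * v x t) 0 L) 0 T| <= B * c.
Proof.
have [M M0 HM] := apriori.
have P : 0 <= T * (C * C) by rewrite !mulr_ge0 // ltW.
exists (T * (C * C) * M); first exact: mulr_ge0.
move=> psi c e w v cpsi psi0 psiL c0 Hc so; rewrite (v_test cpsi psi0 psiL so).
rewrite mulrAC; apply: (Hk_bound so (kern_cts cpsi)).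
- by move=> s sI; exact: kern_abs.
- exact: mulr_ge0.
by have [] := HM e w v so.
Qed.

Lemma rem_test psi (c eta : R) : (forall y t, y \in xb -> t \in tc -> ~ Sing (foot y t)) ->
  cts2 psi -> (forall x t, x <= 0 -> psi x t = 0) -> (forall x t, L <= x -> psi x t = 0) ->
  0 <= c -> (forall x t, `|psi x t| <= c) -> 0 < eta ->
  exists2 d : R, 0 < d & forall e u w v, usol e u -> wvsol e w v -> e < d ->
  `|Int (fun t => Int (fun x => psi x t * rem u w v x t) 0 L) 0 T| <= eta.
Proof.
move=> nS cpsi psi0 psiL c0 Hc eta0.
have P : 0 < T * (c + 1) by rewrite mulr_gt0 // ltr_wpDl.
have [d dp Hd] := rem_small nS (divr_gt0 eta0 P); exists d => // e u w v uso so ed.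
have H : `|Int (fun t => Int (fun x => psi x t * rem u w v x t) 0 L) 0 T| <= c * (eta / (T * (c + 1))) * (T - 0).
  apply: Int_bound; first exact: ltW.
    apply: (@Int_param_cts _ (fun t x => psi x t * rem u w v x t)); apply: cts2_flip; apply: ctsM => //.
    exact: (rem_cts2 uso so).
  move=> t tI; apply: (Hd e u w v uso so ed (psi^~ t) c t (cts2_l cpsi)) => // x; [exact: psi0|exact: psiL].
apply: le_trans H _; rewrite subr0.
have -> : c * (eta / (T * (c + 1))) * T = c / (c + 1) * eta.
  by field; rewrite !gt_eqF // ltr_wpDl.
by apply: ler_piMl; [exact: ltW|rewrite ler_pdivrMr ?ltr_wpDl // mul1r lerDl].
Qed.

End Convergence.
End Setup.

(** * Passage to distributions *)

Section PlaneIntegral.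
Variable R : realType.
Local Notation mu := (@lebesgue_measure R).
Implicit Types (F : R -> R -> R).

Lemma between_ratr (x e : R) : 0 < e -> exists a : rat, `|ratr a - x| < e.
Proof.
move=> e0; have /rat_in_itvoo[a] : x - e < x + e by lra.
by rewrite in_itv /= => /andP[a1 a2]; exists a; rewrite ltr_norml; apply/andP; split; lra.
Qed.

(** Measurable sets of the product are generated by rectangles. An open superlevel set is the
    countable union of the squares with rational centres and radii [1 / n] that it contains. *)
Lemma cts2_measurable F : cts2 F -> measurable_fun setT (fun q : R * R => F q.1 q.2).
Proof.
move=> cF; apply: (measurability _ (measurable_realfun.RGenOInfty.measurableE R)) => _ [_ [r ->] <-].
pose sq (a b : rat) (n : nat) : set (R * R) :=
  [set x | `|ratr a - x| < n.+1%:R^-1] `*` [set t | `|ratr b - t| < n.+1%:R^-1].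
pose G (a b : rat) (n : nat) : set (R * R) :=
  if `[< sq a b n `<=` [set q | r < F q.1 q.2] >] then sq a b n else set0.
rewrite setTI (_ : _ @^-1` _ = \bigcup_a \bigcup_b \bigcup_n G a b n).
  have mball (a : rat) (n : nat) : measurable [set x : R | `|ratr a - x| < n.+1%:R^-1].
    rewrite (_ : [set _ | _] = `]ratr a - n.+1%:R^-1, ratr a + n.+1%:R^-1[%classic); first exact: measurable_itv.
    move: (n.+1%:R^-1) => e.
    by apply/seteqP; split => x /=; rewrite in_itv /= ltr_norml => /andP[? ?]; apply/andP; split; lra.
  do 2!apply: bigcupT_measurable_rat => ?; apply: bigcupT_measurable => n.
  rewrite /G; case: ifP => _; last exact: measurable0.
  by apply: measurableX.
apply/seteqP; split => [[x t] /=|[x t] [a _ [b _ [n _]]]].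
  rewrite in_itv /= andbT => rF.
  have rF' : 0 < F x t - r by rewrite subr_gt0.
  have [d d0 Hd] := cts2_dist x t cF rF'.
  have d20 : 0 < d / 2 by rewrite divr_gt0.
  have [n Hn] : exists n : nat, n.+1%:R^-1 < d / 2.
    by have [n] := ltr_add_invr d20; rewrite add0r; exists n.
  have n0 : 0 < n.+1%:R^-1 :> R by rewrite invr_gt0.
  have [a Ha] := between_ratr x n0; have [b Hb] := between_ratr t n0.
  exists a => //; exists b => //; exists n => //; rewrite /G ifT //.
  apply/asboolP => -[x' t'] [/= x1 t1].
  have := Hd x' t'; have -> : x' - x = (ratr a - x) - (ratr a - x') by ring.
  have -> : t' - t = (ratr b - t) - (ratr b - t') by ring.
  have X1 : `|(ratr a - x) - (ratr a - x')| < d by apply: le_lt_trans (ler_normB _ _) _; rewrite [d]splitr; apply: ltrD; exact: lt_trans Hn.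
  have T1 : `|(ratr b - t) - (ratr b - t')| < d by apply: le_lt_trans (ler_normB _ _) _; rewrite [d]splitr; apply: ltrD; exact: lt_trans Hn.
  by move=> /(_ X1 T1); rewrite ltr_norml => /andP[H _]; move: H; flra.
by rewrite /G; case: ifP => // /asboolP sub /sub /=; rewrite in_itv /= andbT.
Qed.

Lemma integral_cts_zero (F : R -> R) a b : a <= b -> continuous F -> (forall x, ~~ (a <= x <= b) -> F x = 0) ->
  (\int[mu]_x (F x)%:E = (Int F a b)%:E)%E.
Proof.
move=> ab cF F0; rewrite -(Int_Rintegral ab cF (fun x _ => erefl)) /Rintegral.
rewrite fineK; last exact: integrable_fin_num (cts_integrable a b cF).
rewrite [RHS]integral_mkcond; apply: eq_integral => x _; rewrite patchE.
case: ifPn => //; rewrite notin_setE /= in_itv /= => /negP H; by rewrite F0.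
Qed.

Lemma plane_integral F (a b c d : R) : a <= b -> c <= d -> cts2 F ->
  (forall x t, ~~ ((a <= x <= b) && (c <= t <= d)) -> F x t = 0) ->
  \int[(mu \x mu)%E]_(q in setT) F q.1 q.2 = Int (fun t => Int (F^~ t) a b) c d.
Proof.
move=> ab cd cF F0.
have mF := cts2_measurable cF.
have cFt t : continuous (F^~ t) := cts2_l cF.
have inner (H : R -> R -> R) : cts2 H -> (forall x t, ~~ ((a <= x <= b) && (c <= t <= d)) -> H x t = 0) ->
    (\int[mu]_t \int[mu]_x (H x t)%:E = (Int (fun t => Int (H^~ t) a b) c d)%:E)%E.
  move=> cH H0; under eq_integral => t _.
    rewrite (integral_cts_zero ab (cts2_l cH)); last by move=> x xI; apply: H0; rewrite negb_and xI.
    over.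
  apply: integral_cts_zero => //.
    exact: (@Int_param_cts _ (fun t x => H x t) a b (cts2_flip cH)).
  move=> t tI; rewrite (_ : H^~ t = fun=> 0) ?Int_cst ?mul0r //.
  by apply/funext => x; apply: H0; rewrite negb_and tI orbT.
have iF : (mu \x mu)%E.-integrable setT (fun q : R * R => (F q.1 q.2)%:E).
  apply/integrable21ltyP; first exact/measurable_realfun.measurable_EFinP.
  under eq_integral do under eq_integral do rewrite /=.
  rewrite (inner (fun x t => `|F x t|)) ?ltry //; first exact: cts_norm.
  by move=> x t /F0 ->; rewrite normr0.
by rewrite /Rintegral -(integral21_prod_meas1 iF) /= (inner F).
Qed.

End PlaneIntegral.

(** * The data of the theorem as an instance of the setup *)

Section Instantiation.
Variables (R : realType) (L : R) (p lam : R * R -> R) (f : R * R * R -> R)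
  (ar br cr : R -> R) (xa xb tc : seq R) (phi : R -> R).

Definition extf (T x t y : R) : R := f (cbox L T x t, y).
Definition exts (a : R) (z : R -> R) (x : R) : R := z (clamp 0 a x).

Local Notation fsetup T hx K l0 l1 C xm := (setup L T (ext L T lam) hx (ext L T p) (extf T)
  (exts L ar) (exts L br) (exts T cr) xa xb tc phi K l0 l1 C xm).

Lemma path_bounds (s : seq R) (a b : R) : path <%R a (rcons s b) -> forall y, y \in s -> a < y < b.
Proof.
elim: s a => // x s IH a /= /andP[ax px] y; rewrite inE => /orP[/eqP ->|ys].
  by rewrite ax; have /allP := order_path_min lt_trans px; apply; rewrite mem_rcons mem_head.
by have /andP[xy ->] := IH x px y ys; rewrite (lt_trans ax xy).
Qed.

Lemma exts_cts (a : R) (z : R -> R) : 0 < a -> {within `[0, a], continuous z} -> continuous (exts a z).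
Proof.
move=> a0 cz; apply: (@within_comp _ _ _ `[0, a]%classic z (clamp 0 a)) => //; first exact: clamp_cts.
by move=> u; rewrite /= in_itv /= clamp_itv // ltW.
Qed.

Lemma exts_bounded (a : R) (z : R -> R) : 0 < a -> {within `[0, a], continuous z} ->
  exists2 B : R, 0 <= B & forall x, `|exts a z x| <= B.
Proof.
move=> a0 cz; have [B B0 HB] := within_bounded (@segment_compact R 0 a) cz.
exists B => // x; apply: HB; by rewrite /= in_itv /= clamp_itv // ltW.
Qed.

Hypotheses (L0 : 0 < L) (cp : {within Pibar L, continuous p})
  (cf : {within Pibar L `*` [set: R], continuous f})
  (car : {within `[0, L], continuous ar}) (cbr : {within `[0, L], continuous br})
  (ccr : {within `[0, +oo[, continuous cr})
  (clam : C1_Pibar L lam) (f1 : C1_in_u L f) (lamp : forall q, Pibar L q -> 0 < lam q)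
  (pxa : path <%R 0 (rcons xa L)) (pxb : path <%R 0 (rcons xb L)) (ptc : path <%R 0 tc)
  (mphi : mollifier phi) (br0 : br 0 = 0) (brL : br L = 0) (ar0 : ar 0 = 0) (cr0 : cr 0 = 0)
  (bf : bounded_on_compacts L f).

Lemma within_itv_sub (T : R) : {within `[0, T], continuous cr}.
Proof.
apply: continuous_subspaceW ccr => x /=; rewrite !in_itv /= => /andP[-> _]; by [].
Qed.

Lemma extf_cts T : 0 < T -> continuous (fun q : R * R * R => extf T q.1.1 q.1.2 q.2).
Proof.
move=> T0; apply: (@within_comp _ _ _ (Pibar L `*` [set: R]) f (fun q : R * R * R => (cbox L T q.1.1 q.1.2, q.2))) => //.
  have c1 : continuous (fun q : R * R * R => q.1) by move=> q; exact: cvg_fst.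
  have c2 : continuous (fun q : R * R * R => q.2) by move=> q; exact: cvg_snd.
  apply: (@cts_pair3 R _ (fun q : R * R * R => clamp 0 L q.1.1) (fun q => clamp 0 T q.1.2) (fun q => q.2)) => //.
    by apply: (cts_app (@clamp_cts _ 0 L)); exact: (cts_app (@cts_fst R) c1).
  by apply: (cts_app (@clamp_cts _ 0 T)); exact: (cts_app (@cts_snd R) c1).
by move=> q; split => //=; exact: cbox_Pibar.
Qed.

(** Assumption (iii) on the compact box gives the bound on [f], and the bound on its derivative in
    [u] gives a Lipschitz constant by the mean value theorem. *)
Lemma extf_bounds T : 0 < T -> exists2 M : R, 0 <= M &
  (forall x t y, `|extf T x t y| <= M) /\
  (forall x t y y', `|extf T x t y - extf T x t y'| <= M * `|y - y'|).
Proof.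
move=> T0; pose Kb : set (R * R) := `[0, L] `*` `[0, T].
have cK : compact Kb by apply: compact_setX; exact: segment_compact.
have sub : Kb `<=` Pibar L.
  by move=> [x t] [] /=; rewrite !in_itv /= => xI /andP[t0 _]; split.
have [M HM] := bf cK sub.
have Kx x t : Kb (cbox L T x t).
  by split; rewrite /= in_itv /= clamp_itv // ltW.
have M0 : 0 <= M by apply: le_trans (normr_ge0 _) (HM _ 0 (Kx 0 0)).1.
exists M => //; split; first by move=> x t y; exact: (HM _ y (Kx x t)).1.
have key x t y y' : y <= y' -> `|extf T x t y' - extf T x t y| <= M * (y' - y).
  move=> yy; pose F z := extf T x t z; have [dF _] := f1 (sub _ (Kx x t)).
  have hd z : has_deriv F z (derive1 F z) by rewrite derive1E; apply: DeriveDef => //; exact: dF.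
  have [z _ ->] := derive_mvt yy (derive_cts hd) (fun z _ => hd z).
  rewrite normrM (ger0_norm (x := y' - y)) ?subr_ge0 // ler_wpM2r ?subr_ge0 //.
  exact: (HM _ z (Kx x t)).2.
move=> x t y y'; case: (leP y y') => [yy|/ltW yy].
  by rewrite distrC (distrC y) (ger0_norm (x := y' - y)) ?subr_ge0 //; exact: key.
by rewrite (ger0_norm (x := y - y')) ?subr_ge0 //; exact: key.
Qed.

Lemma setup_exists T : 0 < T -> (forall y, y \in tc -> y < T) ->
  exists hx K l0 l1 C xm, fsetup T hx K l0 l1 C xm.
Proof.
move=> T0 tcT.
have [hx [K [l0 [l1 cfd]]]] := C1_Pibar_speed_field L0 T0 clam lamp.
have sf := cf_sf cfd; have cph := mollifier_profile mphi.
(* [g] is a lower bound for all distances of support points to the ends of their intervals; [xm]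
   will be [g / 2]. *)
have [g g0 Hg] := seq_gap (xa ++ [seq L - y | y <- xa] ++ xb ++ [seq L - y | y <- xb] ++ tc ++ [seq T - y | y <- tc]).
have gap0 z : 0 < z -> z \in (xa ++ [seq L - y | y <- xa] ++ xb ++ [seq L - y | y <- xb] ++ tc ++ [seq T - y | y <- tc]) -> g <= z.
  by move=> z0 zin; have := Hg z zin; rewrite gtr0_norm // gt_eqF // => /(_ isT).
have xaB := path_bounds pxa; have xbB := path_bounds pxb.
have tcB y : y \in tc -> 0 < y.
  by move: ptc; rewrite (path_sortedE lt_trans) => /andP[/allP H _]; exact: H.
have [Mp Mp0 HMp] := ext_bounded L0 T0 cp.
have [Mf Mf0 [HMf HLf]] := extf_bounds T0.
have [Ma Ma0 HMa] := exts_bounded L0 car.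
have [Mb Mb0 HMb] := exts_bounded L0 cbr.
have [Mc Mc0 HMc] := exts_bounded T0 (@within_itv_sub T).
pose h := ext L T lam; pose A := A L h.
have cJ : cts2 (Jac h hx) by exact: (Jac_cts2 cfd).
have cE : cts2 (E h (ext L T p)).
  by apply: cts_exp; exact: (along_Int_cts2 cfd (ext_cts2 L0 T0 cp)).
have [MJ MJ0 HMJ] := cts2_bounded (A + T) cJ.
have [ME ME0 HME] := cts2_bounded (A + T) cE.
have m1 := mass_ge1 cph.
have l00 := sf_l0 sf; have l10 : 0 < l1 := lt_le_trans l00 (le_trans (sf_ge sf 0 0) (sf_le sf 0 0)).
have li0 : 0 < l0^-1 by rewrite invr_gt0.
have A0 : 0 < A by rewrite divr_gt0 // (lt_le_trans l00 (sf_ge sf 0 0)).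
have n1 : 0 <= (size xa)%:R :> R by []. have n2 : 0 <= (size xb)%:R :> R by []. have n3 : 0 <= (size tc)%:R :> R by [].
move: n1 n2 n3; set s1 := (size xa)%:R; set s2 := (size xb)%:R; set s3 := (size tc)%:R => n1 n2 n3.
set ms := mass phi in m1.
pose C1 := 1 + Mp + Mf + Ma + Mb + Mc; pose C2 := MJ + ME + ms + s1 + s2 + s3 + l0^-1 + l1 + L + T.
have C10 : [/\ 1 <= C1, Mp <= C1, Mf <= C1 & [/\ Ma <= C1, Mb <= C1 & Mc <= C1]].
  by rewrite /C1; split; [| | |split]; move: Mp0 Mf0 Ma0 Mb0 Mc0; flra.
have C20 : [/\ 0 <= C2, MJ <= C2, ME <= C2 & [/\ ms <= C2, s1 <= C2, s2 <= C2 & [/\ s3 <= C2, l0^-1 <= C2, l1 <= C2 & [/\ L <= C2 & T <= C2]]]].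
  by rewrite /C2; split; [| | |split; [| | |split; [| | |split]]]; move: MJ0 ME0 m1 n1 n2 n3 li0 l10 L0 T0; flra.
have [c1 c2 c3 [c4 c5 c6]] := C10; have [d1 d2 d3 [d4 d5 d6 [d7 d8 d9 [d10 d11]]]] := C20.
have up1 z : z <= C1 -> z <= C1 + C2 by move=> zC; rewrite (le_trans zC) // lerDl.
have up2 z : z <= C2 -> z <= C1 + C2 by move=> zC; rewrite (le_trans zC) // lerDr (le_trans ler01).
exists hx, K, l0, l1, (C1 + C2), (g / 2); split => //.
- exact: ext_cts2.
- exact: extf_cts.
- exact: exts_cts.
- exact: exts_cts.
- exact: exts_cts (@within_itv_sub T).
- by rewrite /exts clamp_id // lexx ltW.
- by move=> x x0; rewrite /exts /clamp max_r // min_l // ltW.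
- by move=> x xL; rewrite /exts /clamp max_l ?(le_trans (ltW L0)) // min_r.
- by rewrite /exts clamp_id // lexx ltW.
- by rewrite divr_gt0.
- move=> y yin; have /andP[y0 yL] := xaB y yin.
  have := gap0 y y0; rewrite !mem_cat yin => /(_ isT) g1.
  have := gap0 (L - y); rewrite subr_gt0 !mem_cat (map_f (fun y => L - y) yin) !orbT => /(_ yL isT) g2.
  by apply/andP; split; move: g1 g2; flra.
- move=> y yin; have /andP[y0 yL] := xbB y yin.
  have := gap0 y y0; rewrite !mem_cat yin !orbT => /(_ isT) g1.
  have := gap0 (L - y); rewrite subr_gt0 !mem_cat (map_f (fun y => L - y) yin) !orbT => /(_ yL isT) g2.
  by apply/andP; split; move: g1 g2; flra.
- move=> y yin; have y0 := tcB y yin; have yL := tcT y yin.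
  have := gap0 y y0; rewrite !mem_cat yin !orbT => /(_ isT) g1.
  have := gap0 (T - y); rewrite subr_gt0 !mem_cat (map_f (fun y => T - y) yin) !orbT => /(_ yL isT) g2.
  by apply/andP; split; move: g1 g2; flra.
- exact: up1.
- by move=> x t; apply: le_trans (HMp x t) (up1 _ c2).
- by move=> x t u; apply: le_trans (HMf x t u) (up1 _ c3).
- by move=> x t u u'; apply: le_trans (HLf x t u u') _; apply: ler_wpM2r => //; exact: up1.
- by move=> x; apply: le_trans (HMa x) (up1 _ c4).
- by move=> x; apply: le_trans (HMb x) (up1 _ c5).
- by move=> x; apply: le_trans (HMc x) (up1 _ c6).
- move=> t s /andP[t0 tT] /andP[As sT]; apply: le_trans (ler_norm _) (le_trans (HMJ t s _ _) (up2 _ d2)).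
    by rewrite ger0_norm // (le_trans tT) // lerDr ltW.
  by rewrite ler_norml; apply/andP; split; move: As sT A0 T0; rewrite -/h -/A; flra.
- move=> t s /andP[t0 tT] /andP[As sT]; apply: le_trans (ler_norm _) (le_trans (HME t s _ _) (up2 _ d3)).
    by rewrite ger0_norm // (le_trans tT) // lerDr ltW.
  by rewrite ler_norml; apply/andP; split; move: As sT A0 T0; rewrite -/h -/A; flra.
- exact: up2.
- by split; exact: up2.
- exact: up2.
- exact: up2.
- exact: up2.
- exact: up2.
Qed.

Section Along.
Variables (T : R) (K l0 l1 : R) (T0 : 0 < T).
Local Notation h := (ext L T lam).
Hypothesis sf : speed_field h K l0 l1.
Local Notation X := (flow h).
Local Notation ext := (ext L T).

Lemma sol_along (g : R * R * R -> R) (g' : R -> R -> R -> R) z0 hb z :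
  is_solution L lam g z0 hb z -> continuous (fun q : R * R * R => g' q.1.1 q.1.2 q.2) ->
  (forall x t y, 0 <= x <= L -> 0 <= t <= T -> g' x t y = g (x, t, y)) ->
  forall t s, Num.max s 0 <= t -> t <= T -> X t s <= L ->
  ext z (X t s) t = bdv h (ext z) s + Int (fun r => g' (X r s) r (ext z (X r s) r)) (Num.max s 0) t.
Proof.
move=> sol cg gE t s st tT XL; have cz := ext_cts2 L0 T0 sol.1.
have m0 : 0 <= Num.max s 0 by rewrite le_max lexx orbT.
pose G r := g' (X r s) r (ext z (X r s) r).
have cG : continuous G.
  apply: (@cts_app _ _ _ (fun r => (X r s, r, ext z (X r s) r)) (fun q => g' q.1.1 q.1.2 q.2) cg).
  apply: cts_pair3; [exact: (cts2_l (X_cts2 sf))|exact: cts_id|].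
  by apply: (cts2_app cz); [exact: (cts2_l (X_cts2 sf))|exact: cts_id].
have GE r : Num.max s 0 <= r <= t -> G r = g (X r s, r, z (X r s, r)).
  move=> /andP[sr rt].
  have XI : 0 <= X r s <= L by rewrite (X_ge0 sf sr) (le_trans (X_le sf s rt) XL).
  have rI : 0 <= r <= T by rewrite (le_trans m0 sr) (le_trans rt tT).
  by rewrite /G gE // ext_id.
rewrite (solution_flow sf sol cG GE st tT XL); congr (_ + _).
have GE0 r : Num.max s 0 <= r <= Num.max s 0 -> G r = g (X r s, r, z (X r s, r)).
  by move=> /andP[r1 r2]; apply: GE; rewrite r1 (le_trans r2).
have := solution_flow sf sol cG GE0 (lexx _) (le_trans st tT) (le_trans (X_le sf s st) XL).
by rewrite Int_refl addr0 (X_start sf) /bdv => <-.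
Qed.

End Along.

Section Solutions.
Variables (T : R) (hx : R -> R -> R) (K l0 l1 C xm : R).
Hypotheses (T0 : 0 < T) (S : fsetup T hx K l0 l1 C xm).
Local Notation h := (ext L T lam).
Local Notation ext := (ext L T).
Local Notation fwvsol := (wvsol L T h (ext p) (extf T) (exts L ar) (exts L br) (exts T cr) xa xb tc phi xm).
Local Notation fusol := (usol L T h (ext p) (extf T) (exts L ar) (exts L br) (exts T cr) xa xb tc phi).

Lemma pf_cts : continuous (fun q : R * R * R => ext p q.1.1 q.1.2 * q.2 + extf T q.1.1 q.1.2 q.2).
Proof.
have c1 : continuous (fun q : R * R * R => q.1) by move=> q; exact: cvg_fst.
have c2 : continuous (fun q : R * R * R => q.2) by move=> q; exact: cvg_snd.
apply: ctsD; last exact: extf_cts.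
by apply: ctsM => //; exact: (cts_app (ext_cts2 L0 T0 cp) c1).
Qed.

Lemma p_cts : continuous (fun q : R * R * R => ext p q.1.1 q.1.2 * q.2).
Proof.
have c1 : continuous (fun q : R * R * R => q.1) by move=> q; exact: cvg_fst.
have c2 : continuous (fun q : R * R * R => q.2) by move=> q; exact: cvg_snd.
by apply: ctsM => //; exact: (cts_app (ext_cts2 L0 T0 cp) c1).
Qed.

Lemma pf_E x t y : 0 <= x <= L -> 0 <= t <= T ->
  ext p x t * y + extf T x t y = p (x, t, y).1 * (x, t, y).2 + f (x, t, y).
Proof. by move=> xI tI; rewrite ext_id // /extf /cbox !clamp_id. Qed.

Lemma solves_wvsol e w v : 0 < e < xm ->
  solves_W L lam p f ar br cr (reg xb phi e) w v ->
  solves_V L lam p br cr (reg xa phi e) (reg xb phi e) (reg tc phi e) w v ->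
  fwvsol e (ext w) (ext v).
Proof.
move=> eI sW sV; have sf := st_sf S.
have cbs := reg_cts (st_phi S) (s := xb) (e := e).
have TI : 0 <= (0 : R) <= T by rewrite lexx ltW.
have cw := ext_cts2 L0 T0 sW.1; have cv := ext_cts2 L0 T0 sV.1.
have LI s : 0 < s <= T -> 0 <= (0 : R) <= L /\ 0 <= s <= T by move=> /andP[s0 ->]; rewrite lexx !ltW.
have BE s : 0 < s <= T -> \int[lebesgue_measure]_(x in `[0, L]) ((reg xb phi e x + br x) * w (x, s) + br x * v (x, s)) =
   Bf L (exts L br) xb phi e (ext w) (ext v) s.
  move=> sI; have [_ sI'] := LI s sI; apply: Int_Rintegral; first exact: ltW.
    apply: ctsD; apply: ctsM; [apply: ctsD => //|exact: (cts2_l cw)| |exact: (cts2_l cv)]; exact: (st_br S).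
  by move=> x xI; rewrite !ext_id // /exts clamp_id.
have QE s : 0 < s <= T -> \int[lebesgue_measure]_(x in `[0, L]) (reg xb phi e x * v (x, s)) =
   Qf L xb phi e (ext v) s.
  move=> sI; have [_ sI'] := LI s sI; apply: Int_Rintegral; first exact: ltW.
    by apply: ctsM => //; exact: (cts2_l cv).
  by move=> x xI; rewrite !ext_id.
split => //.
- move=> t s; apply: (sol_along T0 sf (g' := fun x t y => ext p x t * y + extf T x t y) sW); first exact: pf_cts.
  exact: pf_E.
- move=> y yI; rewrite (ext_id _ yI TI) (solution_initial T0 sf sW) // /exts clamp_id //.
- move=> s sI; have [zI sI'] := LI s sI.
  by rewrite ext_id // (solution_boundary L0 sf sW) // BE // /exts clamp_id.
- move=> t s; apply: (sol_along T0 sf (g' := fun x t y => ext p x t * y) sV); first exact: p_cts.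
  by move=> x t' y xI tI; rewrite ext_id.
- by move=> y yI; rewrite (ext_id _ yI TI) (solution_initial T0 sf sV).
- move=> s sI; have [zI sI'] := LI s sI.
  by rewrite ext_id // (solution_boundary L0 sf sV) // BE // QE // /exts clamp_id.
Qed.

Lemma solves_usol e u :
  solves_U L lam p f ar br cr (reg xa phi e) (reg xb phi e) (reg tc phi e) u -> fusol e (ext u).
Proof.
move=> sU; have sf := st_sf S; have cu := ext_cts2 L0 T0 sU.1.
have TI : 0 <= (0 : R) <= T by rewrite lexx ltW.
have cbs := reg_cts (st_phi S) (s := xb) (e := e).
split => //.
- move=> t s; apply: (sol_along T0 sf (g' := fun x t y => ext p x t * y + extf T x t y) sU); first exact: pf_cts.
  exact: pf_E.
- by move=> y yI; rewrite (ext_id _ yI TI) (solution_initial T0 sf sU) // /exts clamp_id.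
move=> s sI; have /andP[s0 sT] := sI.
have sI' : 0 <= s <= T by rewrite ltW.
have LI : 0 <= (0 : R) <= L by rewrite lexx ltW.
rewrite (ext_id _ LI sI') (solution_boundary L0 sf sU) // /exts (clamp_id sI'); congr (_ * _).
apply: Int_Rintegral; first exact: ltW.
  by apply: ctsM; [apply: ctsD => //; exact: (st_br S)|exact: (cts2_l cu)].
by move=> x xI; rewrite ext_id // clamp_id.
Qed.

End Solutions.
End Instantiation.

(** * Singular parameters and the set [I_+] *)

Section SingularSupport.
Variables (R : realType) (L : R) (lam : R * R -> R) (xa xb tc : seq R).
Hypotheses (L0 : 0 < L) (clam : C1_Pibar L lam) (lamp : forall q, Pibar L q -> 0 < lam q).
Local Notation oc := (on_char L lam).
Local Notation gen := (Iplus_gen L lam xa xb tc).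

Lemma char_speed_field (T : R) : 0 < T -> exists K l0 l1, speed_field (ext L T lam) K l0 l1.
Proof.
move=> T0; have [hx [K [l0 [l1 cf]]]] := C1_Pibar_speed_field L0 T0 clam lamp.
by exists K, l0, l1; exact: cf_sf cf.
Qed.

(** Like symmetry and transitivity below, this concerns finitely many points, so it can be read off
    from the feet in the flow of a box that reaches beyond their times. *)
Lemma on_char_refl q : Pibar L q -> oc q q.
Proof.
move=> Pq; have T0 : 0 < Num.max 1 q.2 by rewrite lt_max ltr01.
have [K [l0 [l1 sf]]] := char_speed_field T0.
by apply/(on_char_foot sf); rewrite ?le_max ?lexx ?orbT.
Qed.

Lemma on_char_sym q q' : oc q q' -> oc q' q.
Proof.
have T0 : 0 < Num.max 1 (Num.max q.2 q'.2) by rewrite lt_max ltr01.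
have [K [l0 [l1 sf]]] := char_speed_field T0.
have qT : q.2 <= Num.max 1 (Num.max q.2 q'.2) by rewrite !le_max lexx !orbT.
have qT' : q'.2 <= Num.max 1 (Num.max q.2 q'.2) by rewrite !le_max lexx !orbT.
by move=> /(on_char_foot sf qT qT')[P P' E]; apply/(on_char_foot sf qT' qT).
Qed.

Lemma on_char_trans q q' q'' : oc q q' -> oc q' q'' -> oc q q''.
Proof.
pose T := Num.max 1 (Num.max q.2 (Num.max q'.2 q''.2)).
have T0 : 0 < T by rewrite lt_max ltr01.
have [K [l0 [l1 sf]]] := char_speed_field T0.
have [t1 t2 t3] : [/\ q.2 <= T, q'.2 <= T & q''.2 <= T].
  by split; rewrite !le_max lexx ?orbT.
move=> /(on_char_foot sf t1 t2)[P1 P2 E1] /(on_char_foot sf t2 t3)[_ P3 E2].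
by apply/(on_char_foot sf t1 t3); rewrite E1.
Qed.

Lemma Iplus_gen_char n q q' : gen n q -> oc q q' -> gen n q'.
Proof.
case: n => [|n] /=.
  by move=> [[x xI o]|[t tI o]] o'; [left; exists x|right; exists t] => //; exact: on_char_trans o o'.
by move=> [x [t [xI H o]]] o'; exists x, t; split => //; exact: on_char_trans o o'.
Qed.

Section Box.
Variables (T K l0 l1 : R).
Hypotheses (T0 : 0 < T) (sf : speed_field (ext L T lam) K l0 l1).
Local Notation h := (ext L T lam).
Hypotheses (xaI : forall y, y \in xa -> 0 < y < L) (xbI : forall y, y \in xb -> 0 < y < L)
  (tcI : forall y, y \in tc -> 0 < y < T).

Lemma h00_gt0 : 0 < h 0 0.
Proof. exact: lt_le_trans (sf_l0 sf) (sf_ge sf 0 0). Qed.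

Lemma boundary_Pibar s : - (L / h 0 0) <= s -> Pibar L (bstart h s, Num.max s 0).
Proof.
have h0 := h00_gt0; move=> As; split => /=; last by rewrite le_max lexx orbT.
rewrite /bstart; case: (leP s 0) => s0; last by rewrite mulr0 lexx ltW.
rewrite mulNr -mulrN mulr_ge0 ?oppr_ge0 ?(ltW h0) //=.
by rewrite mulrC -ler_pdivlMr // lerNl.
Qed.

Lemma on_char_boundary s x t : - (L / h 0 0) <= s -> s <= T -> 0 <= x <= L -> 0 <= t <= T ->
  oc (bstart h s, Num.max s 0) (x, t) <-> foot h x t = s.
Proof.
move=> As sT xI /andP[t0 tT].
have mT : (bstart h s, Num.max s 0).2 <= T by rewrite /= ge_max sT ltW.
have tT' : (x, t).2 <= T by [].
have E : foot h (bstart h s) (Num.max s 0) = s by rewrite -(X_start sf s) (foot_X sf).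
split; first by move=> /(on_char_foot sf mT tT')[_ _] /=; rewrite E.
by move=> H; apply/(on_char_foot sf mT tT'); rewrite /= E H; split => //; exact: boundary_Pibar.
Qed.

(** Induction along the generations: if the characteristic of [s] belongs to [I_+], it passes
    [(y, tau h y s)], so the characteristic through [(0, tau h y s)] belongs to the next
    generation. *)
Lemma sing_Iplus n q : q \in sing h xa xb tc n -> q <= T ->
  - (L / h 0 0) <= q /\ Iplus L lam xa xb tc (bstart h q, Num.max q 0).
Proof.
have h0 := h00_gt0; have A0 : 0 < L / h 0 0 by rewrite divr_gt0.
elim: n q => [|n IH] q; rewrite /= !mem_cat.
  rewrite orbF => qI qT.
  have As : - (L / h 0 0) <= q.
    case/orP: qI => [/mapP[y ya ->]|/tcI/andP[q0 _]]; last by apply: le_trans (ltW q0); rewrite oppr_le0 ltW.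
    by rewrite lerN2 ler_pM2r ?invr_gt0 // ltW //; have /andP[] := xaI ya.
  split => //; exists 0%N => //=.
  have Pq := boundary_Pibar As.
  case/orP: qI => [/mapP[y ya qE]|qt]; [left; exists y => //|right; exists q => //].
    have y0 : 0 < y by have /andP[] := xaI ya.
    have q0 : q <= 0 by rewrite qE oppr_le0 divr_ge0 // ltW.
    move: Pq; rewrite /bstart; case: (leP q 0) => [_|]; last by rewrite ltNge q0.
    have -> : - h 0 0 * q = y by rewrite qE mulrNN mulrC divfK // gt_eqF.
    exact: on_char_refl.
  have /andP[q0 _] := tcI qt.
  move: Pq; rewrite /bstart; case: (leP q 0) => [|_]; first by rewrite leNgt q0.
  by rewrite mulr0; exact: on_char_refl.
rewrite orbA => /orP[qI qT|].
  by have := IH q; case: n {IH} => [|n] /=; rewrite !mem_cat orbA qI /= => /(_ isT qT).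
rewrite mem_filter => /andP[q0 /allpairsP[[y s] /= [yb sn qE]]] qT.
have /andP[y0 yL] := xbI yb.
(* A reflection takes place after its source, so bounding the reflected parameter by [T] bounds the
   source and the induction hypothesis applies. *)
have sT : s <= T.
  case: (leP 0 s) => [s0|s0]; last by rewrite (le_trans (ltW s0)) // ltW.
  have l10 : 0 < l1 by apply: lt_le_trans (sf_l0 sf) _; exact: le_trans (sf_ge sf 0 0) (sf_le sf 0 0).
  have := tau_ge sf s0 (ltW y0); rewrite -qE => H.
  by apply: le_trans qT; apply: le_trans H; rewrite lerDl divr_ge0 // ltW.
have [As [m _ Hm]] := IH s sn sT.
have Aq : - (L / h 0 0) <= q by apply: le_trans q0; rewrite oppr_le0 ltW.
split => //; exists m.+1 => //=; exists y, q; split => //.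
  apply: Iplus_gen_char Hm _; apply/on_char_boundary => //; rewrite ?q0 ?(ltW y0) ?(ltW yL) //.
  by rewrite qE -{1}(X_tau sf y s) (foot_X sf).
have -> : bstart h q = 0 by rewrite /bstart; case: (leP q 0) => q0'; rewrite ?mulr0 // (@le_anti _ _ q 0) ?q0' // mulr0.
have -> : Num.max q 0 = q by apply/max_idPl.
by apply: on_char_refl; split; rewrite //= lexx ltW.
Qed.

(** A singular foot of [(y, t)] would lie in [I_+]. If it is on the axis, it is one of the numbers
    [t_s^*] and contradicts the first half of assumption (iv); if it is on the initial line, it is a
    point of [xa] and contradicts the second half. *)
Lemma noncharacteristic_foot : (forall xi tj, xi \in xb -> tj \in tc ->
    (forall ts, tstar L lam xa xb tc ts -> ts < last 0 tc ->
       ~ (omegat_def L lam 0 (xi, tj) /\ omegat L lam 0 (xi, tj) = ts)) /\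
    (forall xq, xq \in xa ->
       ~ (omega_def L lam 0 (xi, tj) /\ omega L lam 0 (xi, tj) = xq))) ->
  path <%R 0 tc ->
  forall y t, y \in xb -> t \in tc -> ~ Sing h xa xb tc (foot h y t).
Proof.
move=> nc ptc y t yb tt [n sn]; have h0 := h00_gt0.
have /andP[y0 yL] := xbI yb; have /andP[t0 tT] := tcI tt.
have yI : 0 <= y <= L by rewrite !ltW. have tI : 0 <= t <= T by rewrite !ltW.
have [nc1 nc2] := nc y t yb tt; move: sn; set s := foot h y t => sn.
have st : s <= t := foot_le sf (ltW y0) (ltW t0).
have sT : s <= T by rewrite (le_trans st) // ltW.
have [As Is] := sing_Iplus sn sT.
have o : oc (bstart h s, Num.max s 0) (y, t) by apply/on_char_boundary.
case: (leP 0 s) => s0.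
  have E1 : bstart h s = 0 by rewrite /bstart; case: (leP s 0) => s0'; rewrite ?mulr0 // (@le_anti _ _ s 0) ?s0' // mulr0.
  have E2 : Num.max s 0 = s by apply/max_idPl.
  rewrite E1 E2 in Is o.
  have l10 : 0 < l1 by apply: lt_le_trans (sf_l0 sf) _; exact: le_trans (sf_ge sf 0 0) (sf_le sf 0 0).
  have slt : s < t.
    apply: le_lt_trans (foot_travel sf (ltW y0) (ltW t0) s0) _.
    by rewrite gtrBl divr_gt0.
  (* Assumption (iv) covers only [t_s^* < t_l]. This holds here since the foot is strictly earlier
     than [t] and [t] is one of the [t_j]. *)
  have tl : t <= last 0 tc.
    have [i il <-] := nthP 0 tt; rewrite -nth_last.
    have stc : sorted <%R tc by case: (tc) ptc => //= a l /andP[].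
    rewrite (lt_sorted_leq_nth 0 stc) ?inE //; last by case: (tc) il.
    by move: il; case: (size tc).
  apply: (nc1 s Is (lt_le_trans slt tl)).
  have od : oc (y, t) (0, s) by exact: on_char_sym.
  split; first by exists s.
  rewrite /omegat; set s' := get _.
  have /= : oc (y, t) (0, s') by rewrite /s'; apply: (@getPex _ [set tau | oc (y, t) (0, tau)]); exists s.
  move=> o'; have oo := on_char_trans o o'.
  pose M := Num.max 1 (Num.max s s').
  have M0 : 0 < M by rewrite lt_max ltr01.
  have [K' [l0' [l1' sf']]] := char_speed_field M0.
  have sM : (0 : R, s).2 <= M by rewrite /= !le_max lexx !orbT.
  have sM' : (0 : R, s').2 <= M by rewrite /= !le_max lexx !orbT.
  have /(on_char_foot sf' sM sM')[_ [/= _ s'0]] := oo.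
  by rewrite (foot_0 sf' s0) (foot_0 sf' s'0).
have E1 : bstart h s = - h 0 0 * s by rewrite /bstart; case: (leP s 0) => //; rewrite ltNge ltW.
have E2 : Num.max s 0 = 0 by apply/max_idPr/ltW.
rewrite E2 in Is o; have x0 : 0 < bstart h s by rewrite E1 mulNr -mulrN mulr_gt0 // oppr_gt0.
have od : oc (y, t) (bstart h s, 0) by exact: on_char_sym.
have T00 : 0 <= T := ltW T0.
have feet x1 t1 x2 t2 : t1 <= T -> t2 <= T -> oc (x1, t1) (x2, t2) -> foot h x1 t1 = foot h x2 t2.
  by move=> H1 H2 /(@on_char_foot _ _ _ _ _ _ _ sf (x1, t1) (x2, t2) H1 H2)[].
have fb : foot h (bstart h s) 0 = s by rewrite -(feet _ _ _ _ _ _ od) // ltW.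
have main x : x \in xa -> ~ oc (x, 0) (bstart h s, 0).
  move=> xa' o'; apply: (nc2 x xa'); split; first by exists (bstart h s).
  have u x' : oc (y, t) (x', 0) -> x' = x.
    move=> o2; have := feet _ _ _ _ (ltW tT) T00 o2; rewrite -/s /= => E.
    have := feet _ _ _ _ T00 T00 o'; rewrite /= fb E => E'.
    by rewrite -(X_foot sf x' 0) -E' (X_foot sf).
  apply: u; rewrite /omega.
  by apply: (@getPex _ [set xi | oc (y, t) (xi, 0)]); exists (bstart h s).
(* A characteristic entering through the axis has a nonnegative parameter, so it contains no point
   of the initial line with negative parameter. Only a point of [xa] can account for such a foot. *)
have tpos t' : 0 <= t' -> t' <= T -> ~ oc (0, t') (bstart h s, 0).
  move=> t'0 t'T o'; have := feet _ _ _ _ t'T T00 o'; rewrite /= fb (foot_0 sf t'0) => E.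
  by move: s0; rewrite -E ltNge t'0.
have oT t' : oc (0, t') (bstart h s, 0) -> 0 <= t' /\ t' <= T.
  move=> o'; pose M := Num.max 1 t'.
  have M0 : 0 < M by rewrite lt_max ltr01.
  have [K' [l0' [l1' sf']]] := char_speed_field M0.
  have tM : (0 : R, t').2 <= M by rewrite /= le_max lexx orbT.
  have /(on_char_foot sf' tM (ltW M0 : (bstart h s, 0 : R).2 <= M))[[_ /= t'0] _ E] := o'.
  split => //; have := foot_le sf' (ltW x0) (lexx 0); rewrite -E (foot_0 sf' t'0) => H.
  exact: le_trans H (ltW T0).
case: Is => m _; case: m => [|m] /=.
  move=> [[x xI o']|[t' tI' o']]; first exact: main xI o'.
  by have [H1 H2] := oT _ o'; exact: (tpos _ H1 H2 o').
by move=> [x' [t' [_ _ o']]]; have [H1 H2] := oT _ o'; exact: (tpos _ H1 H2 o').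
Qed.

End Box.
End SingularSupport.

(** * Limits from the right at 0 *)

Section RightLimits.
Variable R : realType.
Implicit Types F : R -> R.

Lemma right_cvgP F (l : R) : (F e @[e --> 0^'+] --> l) <->
  (forall eta : R, 0 < eta -> exists2 d : R, 0 < d & forall e, 0 < e < d -> `|F e - l| <= eta).
Proof.
split=> [/cvgrPdist_le H eta eta0|H].
  by have [d d0 Hd] := near0_ex (H eta eta0); exists d => // e ed; rewrite distrC; exact: Hd.
apply/cvgrPdist_le => eta eta0; have [d d0 Hd] := H eta eta0.
by apply: (near0_of d0) => e ed; rewrite distrC; exact: Hd.
Qed.

Lemma right_cauchy F : (forall eta : R, 0 < eta -> exists2 d : R, 0 < d &
    forall e e', 0 < e < d -> 0 < e' < d -> `|F e - F e'| <= eta) ->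
  F e @[e --> 0^'+] --> lim (F e @[e --> 0^'+]).
Proof.
move=> H; apply: cauchy_cvg; apply: cauchy_exP => eta eta0.
have [d d0 Hd] := H (eta / 2) (divr_gt0 eta0 (ltr0n _ 2)).
exists (F (d / 2)); apply: (near0_of d0) => e ed; rewrite -ball_normE /ball_ /=.
have d2 : 0 < d / 2 < d by apply/andP; split; lra.
by apply: le_lt_trans (Hd _ _ d2 ed) _; lra.
Qed.

Lemma below_both (a b : R) : 0 < a -> 0 < b -> exists e, [/\ 0 < e, e < a & e < b].
Proof.
move=> a0 b0; have [|] := leP a b => ab; [exists (a / 2)|exists (b / 2)]; by split; lra.
Qed.

Lemma right_lim_bound F (l b d : R) : F e @[e --> 0^'+] --> l -> 0 < d ->
  (forall e, 0 < e < d -> `|F e| <= b) -> `|l| <= b.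
Proof.
move=> /right_cvgP H d0 Hb; apply/ler_addgt0Pr => eta eta0.
have [d' d'0 Hd'] := H eta eta0; have [e [e0 ed ed']] := below_both d0 d'0.
have -> : l = F e - (F e - l) by ring.
apply: le_trans (ler_normB _ _) (lerD _ _); first by apply: Hb; rewrite e0.
by apply: Hd'; rewrite e0.
Qed.

Lemma right_cvg_eq F G (l d : R) : 0 < d -> (forall e, 0 < e < d -> F e = G e) ->
  G e @[e --> 0^'+] --> l -> F e @[e --> 0^'+] --> l.
Proof.
move=> d0 E /right_cvgP H; apply/right_cvgP => eta eta0.
have [d' d'0 Hd'] := H eta eta0; exists (Num.min d d'); first by rewrite lt_min d0.
by move=> e; rewrite lt_min => /and3P[e0 ed ed']; rewrite E ?e0 //; apply: Hd'; rewrite e0.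
Qed.

Lemma seq_ubound (l : seq R) (b : R) : exists2 B : R, b < B & forall y, y \in l -> y < B.
Proof.
elim: l => [|x l [B bB HB]]; first by exists (b + 1) => //; lra.
have h1 : B <= Num.max B (x + 1) by rewrite le_max lexx.
have h2 : x + 1 <= Num.max B (x + 1) by rewrite le_max lexx orbT.
exists (Num.max B (x + 1)); first exact: lt_le_trans h1.
move=> y; rewrite inE => /orP[/eqP ->|/HB yB]; first by move: h2; flra.
exact: lt_le_trans h1.
Qed.

Lemma seq_lower_bound (U : Type) (l : seq R) (P : U -> Prop) (F : R -> U -> R) :
  (forall q, q \in l -> exists2 g : R, 0 < g & forall u, P u -> g <= F q u) ->
  exists2 g : R, 0 < g & forall q u, q \in l -> P u -> g <= F q u.
Proof.
elim: l => [_|x l IH H]; first by exists 1.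
have [g g0 Hg] := IH (fun q ql => H q (mem_behead (s := x :: l) ql)).
have [g' g'0 Hg'] := H x (mem_head x l).
exists (Num.min g g'); first by rewrite lt_min g0.
move=> q u; rewrite inE => /orP[/eqP ->|ql] Pu; first by rewrite ge_min Hg' // orbT.
by rewrite ge_min Hg.
Qed.

End RightLimits.

Section TestFunctions.
Variables (R : realType) (L : R).
Hypothesis L0 : 0 < L.

Record time_test (T : R) (psi : R * R -> R) : Prop := TimeTest {
  tt_cts : cts2 (fun x t => psi (x, t));
  tt_x0 : forall x t, x <= 0 -> psi (x, t) = 0;
  tt_xL : forall x t, L <= x -> psi (x, t) = 0;
  tt_t0 : forall x t, t <= 0 -> psi (x, t) = 0;
  tt_T : forall x t, T <= t -> psi (x, t) = 0 }.

Lemma supp_out (psi : R * R -> R) q : ~ supp psi q -> psi q = 0.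
Proof. by move=> H; apply/eqP; apply: contra_notT H => H; exact: subset_closure. Qed.

Lemma time_test_of (psi : R * R -> R) (T : R) : test_function (Pidom L) psi ->
  (forall q, supp psi q -> q.2 < T) -> time_test T psi.
Proof.
move=> [sm cK sub] HT; have /= [c0 _] := sm [::].
have out q : ~ Pidom L q -> psi q = 0 by move=> H; apply: supp_out => /sub.
split.
- rewrite /cts2 (_ : (fun q : R * R => _) = psi) //.
  by apply/funext => -[].
- by move=> x t x0; apply: out => -[/= /andP[H _] _]; move: H; rewrite ltNge x0.
- by move=> x t xL; apply: out => -[/= /andP[_ H] _]; move: H; rewrite ltNge xL.
- by move=> x t t0; apply: out => -[/= _ H]; move: H; rewrite ltNge t0.
by move=> x t Tt; apply: supp_out => /HT /=; rewrite ltNge Tt.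
Qed.

Lemma compact_time (K : set (R * R)) : compact K -> exists2 B : R, 0 <= B & forall q, K q -> q.2 <= B.
Proof.
move=> cK; have [B B0 HB] := within_bounded cK (continuous_subspaceT (@cts_snd R)).
by exists B => // q Kq; apply: le_trans (ler_norm _) (HB q Kq).
Qed.

Lemma test_bounded (psi : R * R -> R) : test_function (Pidom L) psi ->
  exists2 c : R, 0 <= c & forall q, `|psi q| <= c.
Proof.
move=> [sm cK _]; have /= [c0 _] := sm [::].
have [c c0' Hc] := within_bounded cK (continuous_subspaceT c0).
exists c => // q; have [/Hc//|/supp_out ->] := pselect (supp psi q); by rewrite normr0.
Qed.

Lemma regular_Int (T : R) (z psi : R * R -> R) : 0 < T -> cts2 (ext L T z) -> time_test T psi ->
  regular_distr L z psi = Int (fun t => Int (fun x => psi (x, t) * ext L T z x t) 0 L) 0 T.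
Proof.
move=> T0 cz tt; pose F x t := psi (x, t) * ext L T z x t.
have cF : cts2 F by apply: ctsM => //; exact: (tt_cts tt).
rewrite -(@plane_integral _ F 0 L 0 T) ?ltW //; last first.
  move=> x t; rewrite /F; case: (leP 0 x) => [x0|/ltW/(tt_x0 tt) -> _]; last by rewrite mul0r.
  case: (leP x L) => [xL|/ltW/(tt_xL tt) -> _]; last by rewrite mul0r.
  case: (leP 0 t) => [t0|/ltW/(tt_t0 tt) -> _]; last by rewrite mul0r.
  by case: (leP t T) => [tT //|/ltW/(tt_T tt) -> _]; rewrite mul0r.
rewrite /regular_distr Rintegral_mkcond; congr (Rintegral _ _ _); apply/funext => -[x t].
rewrite patchE /F /=; case: ifPn => [|H].
  rewrite inE => -[/= /andP[x0 xL] t0]; rewrite mulrC; case: (ltP t T) => [tT|/(tt_T tt) ->]; last by rewrite !mul0r.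
  by rewrite ext_id // !ltW.
case: (leP x 0) => [/(tt_x0 tt) ->|x0]; first by rewrite mul0r.
case: (leP L x) => [/(tt_xL tt) ->|xL]; first by rewrite mul0r.
case: (leP t 0) => [/(tt_t0 tt) ->|t0]; first by rewrite mul0r.
by move: H; rewrite notin_setE; case; split => //=; rewrite x0.
Qed.

End TestFunctions.

(** * The limits [w] and [v] and their properties *)

Section Limit.
Variables (R : realType) (L : R) (p lam : R * R -> R) (f : R * R * R -> R)
  (ar br cr : R -> R) (xa xb tc : seq R) (phi : R -> R) (eps0 : R) (u_ w_ v_ : R -> R * R -> R).
Hypotheses (L0 : 0 < L) (cp : {within Pibar L, continuous p})
  (cf : {within Pibar L `*` [set: R], continuous f})
  (car : {within `[0, L], continuous ar}) (cbr : {within `[0, L], continuous br})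
  (ccr : {within `[0, +oo[, continuous cr})
  (clam : C1_Pibar L lam) (f1 : C1_in_u L f) (lamp : forall q, Pibar L q -> 0 < lam q)
  (pxa : path <%R 0 (rcons xa L)) (pxb : path <%R 0 (rcons xb L)) (ptc : path <%R 0 tc)
  (mphi : mollifier phi) (br0 : br 0 = 0) (brL : br L = 0) (ar0 : ar 0 = 0) (cr0 : cr 0 = 0)
  (bf : bounded_on_compacts L f) (eps00 : 0 < eps0).
Hypothesis nonchar : forall xi tj, xi \in xb -> tj \in tc ->
    (forall ts, tstar L lam xa xb tc ts -> ts < last 0 tc ->
       ~ (omegat_def L lam 0 (xi, tj) /\ omegat L lam 0 (xi, tj) = ts)) /\
    (forall xq, xq \in xa ->
       ~ (omega_def L lam 0 (xi, tj) /\ omega L lam 0 (xi, tj) = xq)).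
Hypothesis sols : forall eps, 0 < eps <= eps0 ->
    [/\ solves_U L lam p f ar br cr
          (reg xa phi eps) (reg xb phi eps) (reg tc phi eps) (u_ eps),
        solves_W L lam p f ar br cr (reg xb phi eps) (w_ eps) (v_ eps) &
        solves_V L lam p br cr
          (reg xa phi eps) (reg xb phi eps) (reg tc phi eps)
          (w_ eps) (v_ eps)].

Local Notation fsetup T hx K l0 l1 C xm := (setup L T (ext L T lam) hx (ext L T p) (extf L f T)
  (exts L ar) (exts L br) (exts T cr) xa xb tc phi K l0 l1 C xm).
Local Notation fwvsol T xm := (wvsol L T (ext L T lam) (ext L T p) (extf L f T)
  (exts L ar) (exts L br) (exts T cr) xa xb tc phi xm).
Local Notation fusol T := (usol L T (ext L T lam) (ext L T p) (extf L f T)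
  (exts L ar) (exts L br) (exts T cr) xa xb tc phi).

(** Each statement involves bounded times only, so it can be proved in a box whose height exceeds
    the given time; the [t_j] are kept inside as well, since [setup] asks for it. *)
Lemma setup_beyond (T1 : R) : exists T, [/\ 0 < T, T1 < T, forall y, y \in tc -> 0 < y < T &
  exists hx K l0 l1 C xm, fsetup T hx K l0 l1 C xm].
Proof.
have [T hT HT] := seq_ubound tc (Num.max 0 T1); exists T.
have T0 : 0 < T by apply: le_lt_trans hT; rewrite le_max lexx.
have TT : T1 < T by apply: le_lt_trans hT; rewrite le_max lexx orbT.
have tc0 y : y \in tc -> 0 < y.
  by move: ptc; rewrite (path_sortedE lt_trans) => /andP[/allP H _]; exact: H.
split => //; first by move=> y yt; rewrite tc0 // HT.
exact: (setup_exists L0 cp cf car cbr ccr clam f1 lamp pxa pxb ptc mphi br0 brL ar0 cr0 bf T0 HT).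
Qed.

Lemma sols_clamped T hx K l0 l1 C xm (S : fsetup T hx K l0 l1 C xm) : exists2 d : R, 0 < d &
  forall e, 0 < e < d -> [/\ fusol T e (ext L T (u_ e)), fwvsol T xm e (ext L T (w_ e)) (ext L T (v_ e)) & e < xm].
Proof.
exists (Num.min xm eps0); first by rewrite lt_min (st_xm S).
move=> e; rewrite lt_min => /and3P[e0 ex ee].
have eI : 0 < e <= eps0 by rewrite e0 ltW.
have [sU sW sV] := sols eI.
have ex' : 0 < e < xm by rewrite e0.
by split => //; [exact: (solves_usol L0 cp cf (st_T S) S sU)|exact: (solves_wvsol L0 cp cf (st_T S) S ex' sW sV)].
Qed.

Definition w_lim (q : R * R) : R := lim (w_ e q @[e --> 0^'+]).
Definition v_lim (psi : R * R -> R) : R := lim (regular_distr L (v_ e) psi @[e --> 0^'+]).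

Lemma w_cauchy_box (T1 eta : R) : 0 < eta -> exists2 d : R, 0 < d &
  forall e e', 0 < e < d -> 0 < e' < d -> forall x t, 0 <= x <= L -> 0 <= t <= T1 ->
  `|w_ e (x, t) - w_ e' (x, t)| <= eta.
Proof.
move=> eta0; have [T [T0 TT tcT [hx [K [l0 [l1 [C [xm S]]]]]]]] := setup_beyond T1.
have [d dp Hd] := w_cauchy S eta0; have [d' dp' Hd'] := sols_clamped S.
exists (Num.min d d'); first by rewrite lt_min dp.
move=> e e'; rewrite !lt_min => /and3P[e0 ed ed'] /and3P[e'0 e'd e'd'] x t xI /andP[t0 t1].
have tI : 0 <= t <= T by rewrite t0 (le_trans t1) // ltW.
have eI : 0 < e < d' by rewrite e0.
have [_ s1 _] := Hd' e eI.
have e'I : 0 < e' < d' by rewrite e'0.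
have [_ s2 _] := Hd' e' e'I.
by have := Hd e e' _ _ _ _ s1 s2 ed e'd x t xI tI; rewrite !ext_id.
Qed.

Lemma w_lim_unif (T1 eta : R) : 0 < eta -> exists2 d : R, 0 < d &
  forall e, 0 < e < d -> forall x t, 0 <= x <= L -> 0 <= t <= T1 ->
  `|w_ e (x, t) - w_lim (x, t)| <= eta.
Proof.
move=> eta0; have [d dp Hd] := w_cauchy_box T1 eta0; exists d => // e ed x t xI tI.
have cw : w_ e' (x, t) @[e' --> 0^'+] --> w_lim (x, t).
  apply: right_cauchy => eta' eta'0; have [d' dp' Hd'] := w_cauchy_box T1 eta'0.
  by exists d' => // e1 e2 I1 I2; exact: Hd'.
apply: (@right_lim_bound _ (fun e' => w_ e (x, t) - w_ e' (x, t)) _ _ d) => //.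
  by apply: cvgB => //; exact: cvg_cst.
by move=> e' ed'; exact: Hd.
Qed.

Lemma w_lim_cts2 (T : R) : 0 < T -> cts2 (ext L T w_lim).
Proof.
move=> T0; apply: cts2_distP => x y eta eta0.
have e30 : 0 < eta / 3 by rewrite divr_gt0.
have [d dp Hd] := w_lim_unif T e30.
have [e [ep ed ee]] := below_both dp eps00.
have cw : cts2 (ext L T (w_ e)).
  have eI : 0 < e <= eps0 by rewrite ep ltW.
have [_ sW _] := sols eI.
  exact: (ext_cts2 L0 T0 sW.1).
have [r r0 Hr] := cts2_dist x y cw e30; exists r => // x' y' xx yy.
have H a b : `|ext L T (w_ e) a b - ext L T w_lim a b| <= eta / 3.
  by apply: Hd; rewrite ?ep // clamp_itv // ltW.
have H1 := H x y; have H2 := H x' y'; have H3 := Hr x' y' xx yy.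
move: H1 H2 H3; rewrite !ler_norml !ltr_norml => /andP[? ?] /andP[? ?] /andP[? ?].
by apply/andP; split; lra.
Qed.

Lemma w_regular_cvg psi : test_function (Pidom L) psi ->
  regular_distr L (w_ e) psi @[e --> 0^'+] --> regular_distr L w_lim psi.
Proof.
move=> tp; have [_ cK _] := tp; have [B B0 HB] := compact_time cK.
have [c c0 Hc] := test_bounded tp.
have [T [T0 TT _ [hx [K [l0 [l1 [C [xm S]]]]]]]] := setup_beyond B.
have tt : time_test L T psi by apply: time_test_of => // q /HB H; exact: le_lt_trans H TT.
have [d' dp' Hd'] := sols_clamped S.
have cwl := w_lim_cts2 T0.
apply/right_cvgP => eta eta0.
have P : 0 < T * (L * (c + 1)) by rewrite !mulr_gt0 // ltr_wpDl.
have [d dp Hd] := w_lim_unif T (divr_gt0 eta0 P).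
exists (Num.min d d'); first by rewrite lt_min dp.
move=> e; rewrite lt_min => /and3P[e0 ed ed'].
have eI : 0 < e < d' by rewrite e0.
have [_ so _] := Hd' e eI.
have cw := so_w so.
rewrite !(regular_Int L0 T0 _ tt) //.
have cA z : cts2 z -> cts2 (fun x t => psi (x, t) * z x t) by move=> cz; apply: ctsM => //; exact: (tt_cts tt).
have cI z : cts2 z -> continuous (fun t => Int (fun x => psi (x, t) * z x t) 0 L).
  by move=> cz; apply: (@Int_param_cts _ (fun t x => psi (x, t) * z x t)); apply: cts2_flip; exact: cA.
rewrite -IntB; [|exact: cI|exact: cI].
have -> : eta = (c + 1) * (eta / (T * (L * (c + 1)))) * (L - 0) * (T - 0).
  by field; rewrite !gt_eqF // ltr_wpDl.
apply: Int_bound; [exact: ltW|by apply: ctsB; exact: cI|].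
move=> t tI; rewrite -IntB; [|exact: (cts2_l (cA _ cw))|exact: (cts2_l (cA _ cwl))].
apply: Int_bound; [exact: ltW|by apply: ctsB; [exact: (cts2_l (cA _ cw))|exact: (cts2_l (cA _ cwl))]|].
move=> x xI; rewrite -mulrBr normrM; apply: ler_pM => //.
  by apply: le_trans (Hc _) _; rewrite lerDl.
by rewrite !ext_id //; apply: Hd => //; rewrite e0.
Qed.

Lemma v_cvg psi : test_function (Pidom L) psi ->
  regular_distr L (v_ e) psi @[e --> 0^'+] --> v_lim psi.
Proof.
move=> tp; have [_ cK _] := tp; have [B B0 HB] := compact_time cK.
have [T [T0 TT _ [hx [K [l0 [l1 [C [xm S]]]]]]]] := setup_beyond B.
have tt : time_test L T psi by apply: time_test_of => // q /HB H; exact: le_lt_trans H TT.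
have [d' dp' Hd'] := sols_clamped S.
apply: right_cauchy => eta eta0.
have [d dp Hd] := v_test_cauchy S (tt_cts tt) (tt_x0 tt) (tt_xL tt) eta0.
exists (Num.min d d'); first by rewrite lt_min dp.
move=> e e'; rewrite !lt_min => /and3P[e0 ed ed'] /and3P[e'0 e'd e'd'].
have eI : 0 < e < d' by rewrite e0.
have [_ s1 _] := Hd' e eI.
have e'I : 0 < e' < d' by rewrite e'0.
have [_ s2 _] := Hd' e' e'I.
rewrite !(regular_Int L0 T0 _ tt); [|exact: (so_v s2)|exact: (so_v s1)].
exact: Hd s1 s2 ed e'd.
Qed.

Lemma v_limE psi l : regular_distr L (v_ e) psi @[e --> 0^'+] --> l -> v_lim psi = l.
Proof. exact: cvg_lim. Qed.

Lemma v_lim_distribution : is_distribution (Pidom L) v_lim.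
Proof.
split.
- move=> psi1 psi2 tp1 tp2; apply: v_limE.
  have [_ cK1 _] := tp1; have [B1 _ HB1] := compact_time cK1.
  have [_ cK2 _] := tp2; have [B2 _ HB2] := compact_time cK2.
  have [T [T0 TT _ [hx [K [l0 [l1 [C [xm S]]]]]]]] := setup_beyond (Num.max B1 B2).
  move: TT; rewrite gt_max => /andP[T1 T2].
  have tt1 : time_test L T psi1 by apply: time_test_of => // q /HB1 H; exact: le_lt_trans H T1.
  have tt2 : time_test L T psi2 by apply: time_test_of => // q /HB2 H; exact: le_lt_trans H T2.
  have tt : time_test L T (psi1 \+ psi2).
    split; first by apply: ctsD; [exact: (tt_cts tt1)|exact: (tt_cts tt2)].
    - by move=> x t x0 /=; rewrite (tt_x0 tt1) // (tt_x0 tt2) // addr0.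
    - by move=> x t x0 /=; rewrite (tt_xL tt1) // (tt_xL tt2) // addr0.
    - by move=> x t x0 /=; rewrite (tt_t0 tt1) // (tt_t0 tt2) // addr0.
    by move=> x t x0 /=; rewrite (tt_T tt1) // (tt_T tt2) // addr0.
  have [d dp Hd] := sols_clamped S.
  apply: (right_cvg_eq dp _ (cvgD (v_cvg tp1) (v_cvg tp2))) => e ed.
  have [_ so _] := Hd e ed; have cv := so_v so.
  rewrite !(regular_Int L0 T0 cv) //.
  have cA psi : time_test L T psi -> cts2 (fun x t => psi (x, t) * ext L T (v_ e) x t).
    by move=> H; apply: ctsM => //; exact: (tt_cts H).
  rewrite -IntD; last 2 first.
  - by apply: (@Int_param_cts _ (fun t x => psi1 (x, t) * ext L T (v_ e) x t)); apply: cts2_flip; exact: cA.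
  - by apply: (@Int_param_cts _ (fun t x => psi2 (x, t) * ext L T (v_ e) x t)); apply: cts2_flip; exact: cA.
  congr (Int _ 0 T); apply/funext => t; rewrite -IntD; [|exact: (cts2_l (cA _ tt1))|exact: (cts2_l (cA _ tt2))].
  by congr (Int _ 0 L); apply/funext => x; rewrite /= mulrDl.
- move=> a psi tp; apply: v_limE.
  have [_ cK _] := tp; have [B _ HB] := compact_time cK.
  have [T [T0 TT _ [hx [K [l0 [l1 [C [xm S]]]]]]]] := setup_beyond B.
  have tt : time_test L T psi by apply: time_test_of => // q /HB H; exact: le_lt_trans H TT.
  have [d dp Hd] := sols_clamped S.
  apply: (right_cvg_eq dp _ (cvgM (cvg_cst a) (v_cvg tp))) => e ed.
  have [_ so _] := Hd e ed; have cv := so_v so.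
  have tta : time_test L T (fun x => a * psi x).
    split; first by apply: ctsM; [exact: cts_cst|exact: (tt_cts tt)].
    - by move=> x t x0 /=; rewrite (tt_x0 tt) // mulr0.
    - by move=> x t x0 /=; rewrite (tt_xL tt) // mulr0.
    - by move=> x t x0 /=; rewrite (tt_t0 tt) // mulr0.
    by move=> x t x0 /=; rewrite (tt_T tt) // mulr0.
  rewrite !(regular_Int L0 T0 cv) //.
  have cA : cts2 (fun x t => psi (x, t) * ext L T (v_ e) x t) by apply: ctsM => //; exact: (tt_cts tt).
  rewrite -IntZ; last first.
    by apply: (@Int_param_cts _ (fun t x => psi (x, t) * ext L T (v_ e) x t)); apply: cts2_flip.
  congr (Int _ 0 T); apply/funext => t; rewrite -IntZ; last exact: (cts2_l cA).
  by congr (Int _ 0 L); apply/funext => x; rewrite /= mulrA.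
move=> K cK KP; have [B _ HB] := compact_time cK.
have [T [T0 TT _ [hx [k [l0 [l1 [C [xm S]]]]]]]] := setup_beyond B.
(* The single seminorm is the supremum of the test function itself: the empty list of directions
   stands for no differentiation. *)
have [M M0 HM] := v_test_bound S; exists M, [:: [::]] => psi c tp sK c0 Hc.
have tt : time_test L T psi by apply: time_test_of => // q /sK/HB H; exact: le_lt_trans H TT.
have [d dp Hd] := sols_clamped S.
apply: (right_lim_bound (v_cvg tp) dp) => e ed; have [_ so _] := Hd e ed.
rewrite (regular_Int L0 T0 (so_v so) tt).
apply: (HM (fun x t => psi (x, t)) c e _ _ (tt_cts tt) (tt_x0 tt) (tt_xL tt) c0 _ so) => x t.
by apply: (Hc [::]); rewrite mem_head.
Qed.

Lemma xaI y : y \in xa -> 0 < y < L. Proof. exact: path_bounds. Qed.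
Lemma xbI y : y \in xb -> 0 < y < L. Proof. exact: path_bounds. Qed.

(** The compact support of [psi] avoids [I_+], so it has positive distance from the finitely many
    singular characteristics in the box; [v_test_vanish] then gives pairing 0 for all small
    [eps]. *)
Lemma v_lim_support : vanishes_on (Pidom L `\` Iplus L lam xa xb tc) v_lim.
Proof.
move=> psi [sm cK sub].
have tp : test_function (Pidom L) psi by split => // q /sub[].
have [B B0 HB] := compact_time cK.
have [T [T0 TT tcT [hx [K [l0 [l1 [C [xm S]]]]]]]] := setup_beyond B.
have tt : time_test L T psi by apply: time_test_of => // q /HB H; exact: le_lt_trans H TT.
have sf := st_sf S; have [N HN] := sing_exhaust S.
pose F q (u : R * R) := `|u.1 - flow (ext L T lam) u.2 q|.
have cF q : continuous (F q).
  apply: cts_norm; apply: ctsB; first exact: cts_fst.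
  exact: (cts_app (cts2_l (X_cts2 sf)) (@cts_snd R)).
have [g g0 Hg] : exists2 g : R, 0 < g & forall q u, q \in sing (ext L T lam) xa xb tc N -> supp psi u -> g <= F q u.
  apply: seq_lower_bound => q qN.
  have [[u0 Ku0]|K0] := pselect (exists u0, supp psi u0); last by exists 1 => // u Ku; case: K0; exists u.
  (* The minimum of the distance over the support is attained. If it were 0, that point would lie on
     the characteristic of [q], hence in [I_+]. *)
  have [u Ku Hu] := compact_EVT_min (ex_intro _ u0 Ku0) cK (continuous_subspaceT (cF q)).
  exists (F q u); last by move=> u1 Ku1; apply: Hu; rewrite inE.
  rewrite normr_gt0 subr_eq0; apply/eqP => E.
  move: Ku; rewrite inE => Ku; have [[/andP[x0 xL] t0] nI] := sub _ Ku; apply: nI.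
  have tT : u.2 <= T by apply: le_trans (HB _ Ku) (ltW TT).
  have fq : foot (ext L T lam) u.1 u.2 = q by rewrite E (foot_X sf).
  have qT : q <= T by rewrite -fq (le_trans (foot_le sf (ltW x0) (ltW t0))).
  have [Aq [n _ Iq]] := sing_Iplus L0 clam lamp T0 sf xaI xbI tcT qN qT.
  exists n => //; rewrite (surjective_pairing u); apply: (Iplus_gen_char L0 clam lamp Iq).
  by apply/(on_char_boundary L0 T0 sf) => //; rewrite ?(ltW x0) ?(ltW xL) ?(ltW t0).
have away q x t : q \in sing (ext L T lam) xa xb tc N -> 0 <= t <= T -> psi (x, t) != 0 ->
    g <= `|x - flow (ext L T lam) t q|.
  move=> qN _ pn; apply: (Hg q (x, t) qN); exact: (@subset_closure _ [set u | psi u != 0] (x, t) pn).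
have [d dp Hd] := v_test_vanish S (tt_cts tt) (tt_x0 tt) (tt_xL tt) HN g0 away.
have [d' dp' Hd'] := sols_clamped S.
apply: v_limE; apply: (@right_cvg_eq _ _ (fun=> 0) _ (Num.min d d')); last exact: cvg_cst.
  by rewrite lt_min dp.
move=> e; rewrite lt_min => /and3P[e0 ed ed'].
have eI : 0 < e < d' by rewrite e0.
have [_ so _] := Hd' e eI.
by rewrite (regular_Int L0 T0 (so_v so) tt) (Hd _ _ _ so ed).
Qed.

(** On the box [u] is the sum of [w], [v] and the remainder, and the pairing of the remainder with
    [psi] tends to 0; assumption (iv) enters through [noncharacteristic_foot]. *)
Lemma u_cvg psi : test_function (Pidom L) psi ->
  regular_distr L (u_ e) psi @[e --> 0^'+] --> regular_distr L w_lim psi + v_lim psi.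
Proof.
move=> tp; have [_ cK _] := tp; have [B B0 HB] := compact_time cK.
have [c c0 Hc] := test_bounded tp.
have [T [T0 TT tcT [hx [K [l0 [l1 [C [xm S]]]]]]]] := setup_beyond B.
have tt : time_test L T psi by apply: time_test_of => // q /HB H; exact: le_lt_trans H TT.
have sf := st_sf S; have [d' dp' Hd'] := sols_clamped S.
have nS := noncharacteristic_foot L0 clam lamp T0 sf xaI xbI tcT nonchar ptc.
pose r e := Int (fun t => Int (fun x => psi (x, t) * rem (ext L T (u_ e)) (ext L T (w_ e)) (ext L T (v_ e)) x t) 0 L) 0 T.
have r0 : r e @[e --> 0^'+] --> (0 : R).
  apply/right_cvgP => eta eta0.
  have [d dp Hd] := rem_test S nS (tt_cts tt) (tt_x0 tt) (tt_xL tt) c0 (fun x t => Hc (x, t)) eta0.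
  exists (Num.min d d'); first by rewrite lt_min dp.
  move=> e; rewrite lt_min => /and3P[e0 ed ed'].
  have eI : 0 < e < d' by rewrite e0.
have [s1 s2 _] := Hd' e eI.
  by rewrite subr0; exact: Hd s1 s2 ed.
rewrite -[X in _ --> X]add0r.
apply: (right_cvg_eq dp' _ (cvgD r0 (cvgD (w_regular_cvg tp) (v_cvg tp)))) => e ed.
have [s1 s2 _] := Hd' e ed; have cw := so_w s2; have cv := so_v s2; have cu := so_u s1.
have cA z : cts2 z -> cts2 (fun x t => psi (x, t) * z x t) by move=> cz; apply: ctsM => //; exact: (tt_cts tt).
have cI z : cts2 z -> continuous (fun t => Int (fun x => psi (x, t) * z x t) 0 L).
  by move=> cz; apply: (@Int_param_cts _ (fun t x => psi (x, t) * z x t)); apply: cts2_flip; exact: cA.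
have cr' := rem_cts2 s1 s2.
change (regular_distr L (u_ e) psi = r e + (regular_distr L (w_ e) psi + regular_distr L (v_ e) psi)).
rewrite !(regular_Int L0 T0 _ tt) // -IntD; [|exact: cI|exact: cI]; rewrite /r -IntD; [|exact: cI|by apply: ctsD; exact: cI].
congr (Int _ 0 T); apply/funext => t.
have cl z : cts2 z -> continuous (fun x => psi (x, t) * z x t) by move=> cz; exact: (cts2_l (cA z cz)).
rewrite -IntD; [|exact: cl|exact: cl]; rewrite -IntD; [|exact: cl|by apply: ctsD; exact: cl].
by congr (Int _ 0 L); apply/funext => x; rewrite /rem; ring.
Qed.

Lemma w_lim_uniform (T : R) : 0 < T -> {uniform PiT L T, w_ eps @[eps --> 0^'+] --> w_lim}.
Proof.
move=> T0 P /uniform_nbhs[E [+ sub]]; rewrite -entourage_ballE => -[r /= r0 Hr].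
have [d dp Hd] := w_lim_unif T (divr_gt0 r0 (ltr0n _ 2)).
apply: (near0_of dp) => e ed; apply: sub => -[x t] [[/= /andP[x0 xL] t0] tT]; apply: Hr.
rewrite /= -ball_normE /ball_ /= distrC; apply: le_lt_trans (Hd e ed x t _ _) _; rewrite ?(ltW x0) ?(ltW xL) ?(ltW t0) ?(ltW tT) //.
lra.
Qed.

End Limit.

Theorem theorem1 (R : realType) (L : R)
  (p lam : R * R -> R) (f : R * R * R -> R) (ar br cr : R -> R)
  (xa xb tc : seq R) (phi : R -> R) (eps0 : R)
  (u_ w_ v_ : R -> R * R -> R) :
  0 < L ->
  {within Pibar L, continuous p} ->
  {within Pibar L `*` [set: R], continuous f} ->
  {within `[0, L], continuous ar} ->
  {within `[0, L], continuous br} ->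
  {within `[0, +oo[, continuous cr} ->
  C1_Pibar L lam ->
  C1_in_u L f ->
  (forall q, Pibar L q -> 0 < lam q) ->
  path <%R 0 (rcons xa L) ->
  path <%R 0 (rcons xb L) ->
  path <%R 0 tc ->
  mollifier phi ->
  admissible_eps0 L lam xa xb tc eps0 ->
  br 0 = 0 -> br L = 0 ->
  ar 0 = 0 -> cr 0 = 0 ->
  bounded_on_compacts L f ->
  (forall xi tj, xi \in xb -> tj \in tc ->
    (forall ts, tstar L lam xa xb tc ts -> ts < last 0 tc ->
       ~ (omegat_def L lam 0 (xi, tj) /\ omegat L lam 0 (xi, tj) = ts)) /\
    (forall xq, xq \in xa ->
       ~ (omega_def L lam 0 (xi, tj) /\ omega L lam 0 (xi, tj) = xq))) ->
  ~ Iminus L lam xb tc (0, 0) ->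
  (forall eps, 0 < eps <= eps0 ->
    [/\ solves_U L lam p f ar br cr
          (reg xa phi eps) (reg xb phi eps) (reg tc phi eps) (u_ eps),
        solves_W L lam p f ar br cr (reg xb phi eps) (w_ eps) (v_ eps) &
        solves_V L lam p br cr
          (reg xa phi eps) (reg xb phi eps) (reg tc phi eps)
          (w_ eps) (v_ eps)]) ->
  exists (w : R * R -> R) (v : (R * R -> R) -> R),
    [/\ is_distribution (Pidom L) v,
        distr_cvg (Pidom L) (fun eps => regular_distr L (u_ eps))
          (fun psi => regular_distr L w psi + v psi),
        forall T : R, 0 < T -> {uniform PiT L T, w_ eps @[eps --> 0^'+] --> w},
        distr_cvg (Pidom L) (fun eps => regular_distr L (v_ eps)) v &
        vanishes_on (Pidom L `\` Iplus L lam xa xb tc) v].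
Proof.
move=> L0 cp cf car cbr ccr clam f1 lamp pxa pxb ptc mphi [eps00 _ _ _ _] br0 brL ar0 cr0 bf nonchar _ sols.
exists (w_lim w_), (v_lim L v_); split.
- exact: (v_lim_distribution L0 cp cf car cbr ccr clam f1 lamp pxa pxb ptc mphi br0 brL ar0 cr0 bf eps00 sols).
- exact: (u_cvg L0 cp cf car cbr ccr clam f1 lamp pxa pxb ptc mphi br0 brL ar0 cr0 bf eps00 nonchar sols).
- exact: (w_lim_uniform L0 cp cf car cbr ccr clam f1 lamp pxa pxb ptc mphi br0 brL ar0 cr0 bf eps00 sols).
- exact: (v_cvg L0 cp cf car cbr ccr clam f1 lamp pxa pxb ptc mphi br0 brL ar0 cr0 bf eps00 sols).
exact: (v_lim_support L0 cp cf car cbr ccr clam f1 lamp pxa pxb ptc mphi br0 brL ar0 cr0 bf eps00 sols).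
Qed.
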